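(* Let $d\ge2$, $r\in(0,1)$, $s=d/2+r$. Let $\mu_0$ be a probability measure on $\mathbb{R}^d$ having finite $r'$-exponential moments for all $r'<1$, with $\int v\,d\mu_0(v)=0$, and let $k=\frac12\int|v|^2d\mu_0(v)$. Choose some $k_1>k$ and define $$\kappa=1-\frac{\Gamma(d-1)}{2^{d-3}\,\Gamma((d-1)/2)^2}\int_0^\pi\sin(\theta/2)^r\sin(\theta)^{d-2}\,d\theta,\quad \omega=(2^{1-r}-1)\,2^{1+2r}\,C_r^2\,k_1^r,\quad \sigma^2=\int_{\mathbb{R}^d}\|\delta_v-\mu_0\|_{\dot H^{-s}}^2\,d\mu_0(v).$$ For each $N\ge2$ let $\hat\mu^N_t$ be the empirical measure at time $t$ of the $N$-particle collision Markov process of the ``Kac'' model started from $N$ i.i.d. velocities with law $\mu_0$, and let $(\mu_t)_{t\ge0}$ be the solution of the Boltzmann equation $\frac{d}{dt}\mu_t=Q(\mu_t,\mu_t)$ for the same model with initial value $\mu_0$. Then for any $T>0$ and any $x\ge0$, $$\limsup_{N\to\infty}\mathbb{P}\big(\|\hat\mu^N_T-\mu_T\|_{\dot H^{-s}}\ge xN^{-1/2}\big)\le2\exp\left(\frac{-x^2}{2\big[e^{2|\kappa|T}\sigma^2+e_1(2|\kappa|T)\,\omega T\big]}\right).$$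
   Context: Sobolev space: with $\hat f(\xi)=(2\pi)^{-d/2}\int f(x)e^{-i\xi\cdot x}dx$, $\dot H^{-s}(\mathbb{R}^d)$ is the Hilbert completion of the Schwartz functions $f$ with $\|f\|_{\dot H^{-s}}^2=\int|\hat f(\xi)|^2|\xi|^{-2s}d\xi<\infty$; a signed measure belongs to it when its Fourier transform is in $L^2(|\xi|^{-2s}d\xi)$, which is the case (for $d\ge 2$, $r\in(0,1)$) for zero-mass signed measures with finite $r$-th absolute moment. $C_r$ is the $\dot H^{-s}$ norm of $\delta_x-\delta_y$ for any $x,y$ with $|x-y|=1$. $e_1(t)=(e^t-1)/t$, $e_1(0)=1$. A measure $\mu$ has a finite $r'$-exponential moment if $\int e^{b|v|^{r'}}d\mu(v)<\infty$ for some $b>0$. ``Kac'' model: for $v,w\in\mathbb{R}^d$, $\gamma_{v,w}$ is the law of $(v',w')$ where $v'=\frac{v+w}2+\frac{|v-w|}2\sigma$, $w'=\frac{v+w}2-\frac{|v-w|}2\sigma$ and $\sigma$ is uniform on the unit sphere of $\mathbb{R}^d$ (total mass $1$). The $N$-particle process is the Markov process on $(\mathbb{R}^d)^N$ with generator $$\mathcal{L}f(v_0,\dots,v_{N-1})=\frac1{2N}\sum_{0\le i,j<N}\int\big(f(\dots,v_i',\dots,v_j',\dots)-f(v_0,\dots,v_{N-1})\big)\,d\gamma_{v_i,v_j}(v_i',v_j'),$$ where velocities $i,j$ are replaced by $v_i',v_j'$ (terms $i=j$ vanish). Its empirical measure at time $t$ is $\hat\mu^N_t=N^{-1}\sum_i\delta_{v_i(t)}$.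 The Boltzmann collision kernel is $Q(\mu,\nu)=\frac12\int\big(\int(-\delta_v-\delta_w+\delta_{v'}+\delta_{w'})\,d\gamma_{v,w}(v',w')\big)d\mu(v)\,d\nu(w)$. *)

(* Defs.v *)
From HB Require Import structures.
From mathcomp Require Import all_boot all_order all_algebra.
From mathcomp Require Import all_classical all_reals all_analysis.
From mathcomp Require Import measurable_realfun complex.

Set Implicit Arguments.
Unset Strict Implicit.
Unset Printing Implicit Defensive.
Import Order.TTheory GRing.Theory Num.Theory.
Import numFieldNormedType.Exports.

Local Open Scope classical_set_scope.
Local Open Scope ring_scope.

(* R^d is [d.-tuple R], whose measurable structure in the library is the
   product of the Borel sigma-algebras. *)
Section euclidean.
Context {R : realType} {d : nat}.
Implicit Types v w : d.-tuple R.

Definition origin : d.-tuple R := [tuple 0 | i < d].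

Definition vsub v w : d.-tuple R := [tuple tnth v i - tnth w i | i < d].

Definition dotp v w : R := \sum_(i < d) tnth v i * tnth w i.

Definition enorm v : R := Num.sqrt (dotp v v).

(* The junk value at the origin is the origin. *)
Definition direction v : d.-tuple R := [tuple tnth v i / enorm v | i < d].

Definition unit_ball : set (d.-tuple R) := [set v | enorm v <= 1].

Lemma measurable_mktuple d' (T : measurableType d') n (f : 'I_n -> T -> R) :
  (forall i, measurable_fun setT (f i)) ->
  measurable_fun setT (fun x : T => [tuple f i x | i < n]).
Proof.
move=> mf; apply/measurable_fun_tnthP => i.
rewrite (_ : _ \o _ = f i)//; apply/funext => x /=.
by rewrite tnth_mktuple.
Qed.

Lemma measurable_enorm : measurable_fun setT enorm.
Proof.
apply: (@measurableT_comp _ _ _ _ _ _ (@Num.sqrt R)).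
  by apply: continuous_measurable_fun => x; exact: sqrt_continuous.
apply: measurable_sum => i.
by apply: measurable_funM; exact: measurable_tnth.
Qed.

Lemma measurable_direction : measurable_fun setT direction.
Proof.
apply: measurable_mktuple => i; apply: measurable_funM.
  exact: measurable_tnth.
rewrite (_ : (fun _ => _) = (fun v => enorm v `^ (-1))); last first.
  by apply/funext => v; rewrite powR_inv1// sqrtr_ge0.
apply: (@measurableT_comp _ _ _ _ _ _ (@powR R ^~ (-1))).
  exact: measurable_powR.
exact: measurable_enorm.
Qed.

HB.instance Definition _ :=
  isMeasurableFun.Build _ _ _ _ direction measurable_direction.

Lemma measurable_unit_ball : measurable unit_ball.
Proof.
rewrite (_ : unit_ball = setT `&` enorm @^-1` `]-oo, 1]).
  exact: measurable_enorm.
by rewrite setTI; apply/seteqP; split => x; rewrite /unit_ball/= in_itv.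
Qed.

End euclidean.

Section lebesgue_step.
Context {R : realType} {n : nat}.
Variable m : {sigma_finite_measure set (n.-tuple R) -> \bar R}.

Definition cons_pair (xv : measurableTypeR R * n.-tuple R) : n.+1.-tuple R :=
  [tuple of xv.1 :: xv.2].

Lemma measurable_cons_pair : measurable_fun setT cons_pair.
Proof. exact: (@measurable_cons _ _ _ R fst n snd). Qed.

Definition lebesgue_cons : set (n.+1.-tuple R) -> \bar R :=
  pushforward (@lebesgue_measure R \x m)%E cons_pair.

Let lebesgue_cons_mp A : measurable A -> measurable (cons_pair @^-1` A).
Proof. by move=> mA; rewrite -[X in measurable X]setTI; exact: measurable_cons_pair. Qed.

Let lebesgue_cons0 : lebesgue_cons set0 = 0%E.
Proof. by rewrite /lebesgue_cons /pushforward preimage_set0 measure0. Qed.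

Let lebesgue_cons_ge0 A : (0 <= lebesgue_cons A)%E.
Proof. by rewrite /lebesgue_cons /pushforward. Qed.

Let lebesgue_cons_sigma_additive : semi_sigma_additive lebesgue_cons.
Proof.
move=> F mF tF mUF; rewrite /lebesgue_cons /pushforward preimage_bigcup.
apply: measure_semi_sigma_additive.
- by move=> i; exact: lebesgue_cons_mp.
- apply/trivIsetP => /= i j _ _ ij; rewrite -preimage_setI.
  by move/trivIsetP : tF => /(_ _ _ _ _ ij) ->//; rewrite preimage_set0.
- by rewrite -preimage_bigcup; exact: lebesgue_cons_mp.
Qed.

HB.instance Definition _ := isMeasure.Build _ _ _ lebesgue_cons
  lebesgue_cons0 lebesgue_cons_ge0 lebesgue_cons_sigma_additive.

Definition uncons_pair (v : n.+1.-tuple R) : measurableTypeR R * n.-tuple R :=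
  (thead v, [tuple of behead v]).

Lemma measurable_uncons_pair : measurable_fun setT uncons_pair.
Proof.
apply/measurable_fun_pair; last exact: measurable_behead.
exact: measurable_tnth.
Qed.

Let lebesgue_cons_sigma_finite : sigma_finite setT lebesgue_cons.
Proof.
have /sigma_finiteP[F [TF ndF Foo]] := sigma_finiteT (@lebesgue_measure R).
have /sigma_finiteP[G [TG ndG Goo]] := sigma_finiteT m.
exists (fun k => uncons_pair @^-1` (F k `*` G k)).
  rewrite -preimage_bigcup (_ : \bigcup_k (F k `*` G k) = setT)//.
  rewrite -subTset -setXTT TF TG => -[x y] /= [[i _ Fix] [j _ Gjy]].
  exists (maxn i j) => //; split.
  - by move: x Fix; exact/subsetPset/ndF/leq_maxl.
  - by move: y Gjy; exact/subsetPset/ndG/leq_maxr.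
move=> k; have [mF Fk] := Foo k; have [mG Gk] := Goo k; split.
  rewrite -[X in measurable X]setTI; apply: measurable_uncons_pair => //.
  exact: measurableX.
rewrite /lebesgue_cons /pushforward -comp_preimage.
rewrite (_ : uncons_pair \o cons_pair = id); last first.
  apply/funext => -[x v] /=; rewrite /uncons_pair/= theadE; congr (_, _).
  exact/val_inj.
rewrite preimage_id product_measure1E//.
by rewrite lte_mul_pinfty// ge0_fin_numE.
Qed.

HB.instance Definition _ := Measure_isSigmaFinite.Build _ _ _ lebesgue_cons
  lebesgue_cons_sigma_finite.

End lebesgue_step.

(* Lebesgue measure on R^d as an iterated product. *)
Fixpoint lebesgue_tuple (R : realType) (d : nat) :
    {sigma_finite_measure set (d.-tuple R) -> \bar R} :=
  match d with
  | 0 => @dirac _ (0.-tuple R) [tuple] R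
  | n.+1 => lebesgue_cons (lebesgue_tuple R n)
  end.

Section sphere.
Context {R : realType} {d : nat}.

(* The default (last) argument of [mnormalize] is irrelevant: the Lebesgue
   measure of the ball is positive and finite. *)
Definition uniform_ball : probability (d.-tuple R) R :=
  mnormalize (mrestr (lebesgue_tuple R d) measurable_unit_ball)
    (dirac (origin : d.-tuple R)).

(* Law of x / |x| for x uniform in the unit ball (cone measure), which for the
   Euclidean norm is the normalized surface measure. *)
Definition uniform_sphere : probability (d.-tuple R) R :=
  distribution uniform_ball direction.

End sphere.

Section kac.
Context {R : realType} {d : nat}.
Implicit Types v w s : d.-tuple R.

Definition kac_post v w s : d.-tuple R * d.-tuple R :=
  ([tuple (tnth v i + tnth w i) / 2 + enorm (vsub v w) / 2 * tnth s i | i < d],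
   [tuple (tnth v i + tnth w i) / 2 - enorm (vsub v w) / 2 * tnth s i | i < d]).

Lemma measurable_kac_post v w : measurable_fun setT (kac_post v w).
Proof.
apply/measurable_fun_pair; apply: measurable_mktuple => i.
- apply: measurable_funD => //; apply: measurable_funM => //.
  exact: measurable_tnth.
- apply: measurable_funB => //; apply: measurable_funM => //.
  exact: measurable_tnth.
Qed.

HB.instance Definition _ v w :=
  isMeasurableFun.Build _ _ _ _ (kac_post v w) (@measurable_kac_post v w).

(* gamma_{v,w} *)
Definition kac_law v w : probability (d.-tuple R * d.-tuple R)%type R :=
  distribution uniform_sphere (kac_post v w).

(* For i = j the first alternative wins; this is harmless in the generator, as
   kac_law v v is the Dirac mass at (v, v). *)
Definition replace2 N (V : N.-tuple (d.-tuple R)) (i j : 'I_N) (a b : d.-tuple R)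
    : N.-tuple (d.-tuple R) :=
  [tuple if l == i then a else if l == j then b else tnth V l | l < N].

Definition kac_generator N (f : N.-tuple (d.-tuple R) -> R)
    (V : N.-tuple (d.-tuple R)) : R :=
  (2 * N%:R)^-1 * \sum_(i < N) \sum_(j < N)
    \int[kac_law (tnth V i) (tnth V j)]_z (f (replace2 V i j z.1 z.2) - f V).

(* The signed measure Q(mu, nu), evaluated on a measurable set. *)
Definition kac_Q (mu nu : probability (d.-tuple R) R) (A : set (d.-tuple R)) : R :=
  2^-1 * \int[mu]_v \int[nu]_w \int[kac_law v w]_z
    (- \1_A v - \1_A w + \1_A z.1 + \1_A z.2).

(* [mu] is indexed by all reals; only its values at times t >= 0 matter, and the
   time derivative at 0 is one-sided.  The equation is an equality of signed
   measures, tested on every measurable set. *)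
Definition boltzmann_solution (mu0 : probability (d.-tuple R) R)
    (mu : R -> probability (d.-tuple R) R) : Prop :=
  (forall A, measurable A -> mu 0 A = mu0 A) /\
  forall A, measurable A -> forall t, 0 <= t ->
    (fine (mu h A) - fine (mu t A)) / (h - t)
      @[h --> within [set h | 0 <= h] t^'] --> kac_Q (mu t) (mu t) A.

(* N^-1 sum_i delta_{V_i} *)
Definition empirical N (V : N.-tuple (d.-tuple R)) :
    {measure set (d.-tuple R) -> \bar R} :=
  mscale (N%:R^-1)%:nng (msum (fun i : nat => \d_(nth origin V i)) N).

End kac.

Section markov.
Context {R : realType} {dX : measure_display} {X : measurableType dX}.

Definition markov_semigroup (p : R -> R.-pker X ~> X) : Prop :=
  (forall x A, measurable A -> p 0 x A = \d_x A) /\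
  forall s t, 0 <= s -> 0 <= t -> forall x A, measurable A ->
    p (s + t) x A = (\int[p s x]_y p t y A)%E.

(* L is the generator of p on bounded measurable functions:
   (p_t f - f) / t -> L f uniformly as t -> 0+. *)
Definition has_generator (p : R -> R.-pker X ~> X)
    (L : (X -> R) -> X -> R) : Prop :=
  forall f : X -> R, measurable_fun setT f -> (exists M, forall x, `|f x| <= M) ->
  forall e, 0 < e -> \forall t \near 0^'+, forall x,
    `| (\int[p t x]_y f y - f x) / t - L f x | <= e.

(* The sigma-algebra generated by (V_u)_{0 <= u <= s}. *)
Definition history (dO : measure_display) (O : measurableType dO)
    (V : R -> O -> X) (s : R) : set (set O) :=
  <<s [set A | exists u, [/\ 0 <= u, u <= s &
         exists2 B, measurable B & A = V u @^-1` B]] >>.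

Definition markov_process (L : (X -> R) -> X -> R) (dO : measure_display)
    (O : measurableType dO) (P : probability O R) (V : R -> O -> X) : Prop :=
  (forall t, 0 <= t -> measurable_fun setT (V t)) /\
  exists p : R -> R.-pker X ~> X,
    [/\ markov_semigroup p, has_generator p L &
      forall s t, 0 <= s -> 0 <= t ->
      forall A B, history V s A -> measurable B ->
        P (A `&` V (s + t) @^-1` B) = (\int[P]_(w in A) p t (V s w) B)%E].

End markov.

(* The components of V are independent with common law mu. *)
Definition iid (R : realType) (dE dO : measure_display) (E : measurableType dE)
    (O : measurableType dO) (P : probability O R) (mu : probability E R)
    (N : nat) (V : O -> N.-tuple E) : Prop :=
  forall B : 'I_N -> set E, (forall i, measurable (B i)) ->
    P [set w | forall i, B i (tnth (V w) i)] = (\prod_(i < N) mu (B i))%E.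

Section sobolev.
Context {R : realType} {d : nat}.
Implicit Types mu nu : {measure set (d.-tuple R) -> \bar R}.

Definition fourier mu (xi : d.-tuple R) : R[i] :=
  ((2 * pi) `^ (- (d%:R / 2)))%:C%C *
  ((\int[mu]_x cos (dotp xi x)) +i* (- \int[mu]_x sin (dotp xi x)))%C.

(* The homogeneous Sobolev norm of exponent -s of the signed measure mu - nu,
   for finite mu and nu; it is +oo when mu - nu is not in the space. *)
Definition hsobolev (s : R) mu nu : \bar R :=
  ((\int[lebesgue_tuple R d]_xi
      ((ComplexField.Normc.normc (fourier mu xi - fourier nu xi)) ^+ 2
       * enorm xi `^ (- (2 * s)))%:E) `^ 2^-1)%E.

End sobolev.

Section constants.
Context {R : realType}.

Definition Gamma (x : R) : R :=
  \int[lebesgue_measure]_(t in `]0, +oo[) (t `^ (x - 1) * expR (- t)).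

Definition kappa (d : nat) (r : R) : R :=
  1 - Gamma (d%:R - 1) / (2 `^ (d%:R - 3) * Gamma ((d%:R - 1) / 2) ^+ 2) *
    \int[lebesgue_measure]_(theta in `[0, pi])
      (sin (theta / 2) `^ r * sin theta ^+ (d - 2)).

Definition omega (r C k1 : R) : R :=
  (2 `^ (1 - r) - 1) * 2 `^ (1 + 2 * r) * C ^+ 2 * k1 `^ r.

Definition e1 (t : R) : R := if t == 0 then 1 else (expR t - 1) / t.

Definition kinetic d (mu : probability (d.-tuple R) R) : R :=
  2^-1 * \int[mu]_v (enorm v ^+ 2).

Definition exp_moment d (mu : probability (d.-tuple R) R) (r : R) : Prop :=
  exists2 b : R, 0 < b & (\int[mu]_v (expR (b * enorm v `^ r))%:E < +oo)%E.

Definition sobolev_variance d (s : R) (mu : probability (d.-tuple R) R) : R :=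
  fine (\int[mu]_v (hsobolev s \d_v mu ^+ 2))%E.

End constants.

(* Main.v *)
(* Let X_t be the difference between the empirical measure and mu_t, as an
   element of the Hilbert space of exponent -s, and let Q denote the collision
   operator.

   Contraction: <m - m', Q(m, m) - Q(m', m')> <= - kappa |m - m'|^2.  By
   Bobylev's identity the Fourier transform of the gain term is an average of
   products m^(xi+) m^(xi-); Young's inequality separates the factors, and the
   change of variables xi |-> xi+ produces the constant.

   Pinelis' inequality: cosh |x + y| <= cosh |x| + (sinh |x| / |x|) <x, y> +
   cosh |x| (e^|y| - 1 - |y|).  Applied to the jumps of X_t, whose squared norm
   is at most a constant times N^-2 |v_i - v_j|^(2r), it bounds the growth of
   cosh (c |X_t|); on the set G where sum |v_i|^2 <= 2 N k1, which is invariant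
   since collisions preserve the energy, Jensen's inequality bounds the average
   of |v_i - v_j|^(2r) by (4 k1)^r.

   Hence, for a suitable increasing B, exp (- B t) cosh (lambda e^(-|kappa| t)
   |X_t|) 1_G is a supermartingale up to an error O(h^2) per time step h, and
   letting h tend to 0 bounds the expectation of the hyperbolic cosine at time T
   by its value at time 0.  At time 0, X is a sum of N independent centered
   terms, to which Pinelis' inequality applies once more.  Markov's inequality
   with the optimal lambda, proportional to sqrt N, gives the Gaussian bound,
   and the complement of G has small probability by Chebyshev's inequality. *)

Require Import Defs.
From HB Require Import structures.
From mathcomp Require Import all_boot all_order all_algebra.
From mathcomp Require Import all_classical all_reals all_analysis.
From mathcomp Require Import measurable_realfun complex ring lra.
Import Order.TTheory GRing.Theory Num.Theory.
Import numFieldNormedType.Exports.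

Set Implicit Arguments.
Unset Strict Implicit.
Unset Printing Implicit Defensive.

Local Open Scope classical_set_scope.
Local Open Scope ring_scope.

(** The time derivatives at hand are weak: the equation is tested on measurable sets, the generator
    on bounded functions. Hence finite steps with explicit quadratic remainders; the factor 1_G
    makes the test function bounded. A step goes from t to u = t + h with the drift frozen at time
    u: as y -> cosh (sqrt y) is convex, cosh at the displaced point is at least its first-order
    expansion, and the drift is absorbed without remainder.

    Elements of the Hilbert space are represented by the real and imaginary parts of their Fourier
    transforms, dominated by a multiple of min(1, |xi|). This bound is square integrable for the
    weight |xi|^(-d-2r) because 0 < r < 1, holds for differences of probability measures with a
    first moment, and justifies the exchanges of integrals.

    Young's inequality produces two constants, a mean of cos(theta/2)^r and one coming from the
    Jacobian of xi |-> xi+; the weight (|xi+|/|xi|)^r makes them equal. The factor e^(-|kappa| t)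
    compensates the growth of the norm, and the integral of its square is the origin of e_1. *)

(** * Densities and substitution on the line *)

Section density.
Context d (T : measurableType d) (R : realType) (mu : {measure set T -> \bar R}).
Variables (f : T -> R) (mf : measurable_fun setT f) (f0 : forall x, 0 <= f x).

(** The two proofs are arguments, so that the term itself carries what its measure structure
    requires. *)
Definition density of measurable_fun setT f & (forall x, 0 <= f x) :
  set T -> \bar R := fun A => (\int[mu]_(x in A) (f x)%:E)%E.

Local Notation dens := (density mf f0).

Let density0 : dens set0 = 0%E.
Proof. by rewrite /density integral_set0. Qed.

Let density_ge0 A : (0 <= dens A)%E.
Proof. by apply: integral_ge0 => x _; rewrite lee_fin. Qed.

Let density_sigma_additive : semi_sigma_additive dens.
Proof.
move=> F mF tF mUF; rewrite /density ge0_integral_bigcup//; last 2 first.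
- by apply: measurable_funTS; exact/measurable_EFinP.
- by move=> x _; rewrite lee_fin.
apply: is_cvg_ereal_nneg_natsum_cond => n _ _; apply: integral_ge0 => x _.
by rewrite lee_fin.
Qed.

HB.instance Definition _ := isMeasure.Build _ _ _ dens
  density0 density_ge0 density_sigma_additive.

Import HBNNSimple.

(** On indicators this is the definition of [density]; simple functions and monotone convergence
    give the rest. *)
Lemma ge0_integral_density (h : T -> \bar R) :
  measurable_fun setT h -> (forall x, (0 <= h x)%E) ->
  (\int[dens]_x h x = \int[mu]_x (h x * (f x)%:E))%E.
Proof.
move=> mh h0.
pose g := nnsfun_approx measurableT mh.
have gh x : (EFin \o g ^~ x) @ \oo --> h x by exact: cvg_nnsfun_approx.
have ndg x a b : (a <= b)%N -> ((g a x)%:E <= (g b x)%:E)%E.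
  by move=> ab; rewrite lee_fin; exact/lefP/nd_nnsfun_approx.
have Ef0 x : (0 <= (f x)%:E)%E by rewrite lee_fin.
have mEf : measurable_fun setT (EFin \o f) by exact/measurable_EFinP.
transitivity (limn (fun n => \int[dens]_x (g n x)%:E)%E).
  rewrite -monotone_convergence//.
  - by apply: eq_integral => x _; apply/esym/cvg_lim => //; exact: gh.
  - by move=> n; exact/measurable_EFinP.
  - by move=> n x _; rewrite lee_fin.
  - by move=> x _ a b; exact: ndg.
transitivity (limn (fun n => \int[mu]_x ((g n x)%:E * (f x)%:E))%E).
  apply: congr_lim; apply/funext => n.
  rewrite integralT_nnsfun sintegralE.
  under [RHS]eq_integral => x _.
    rewrite (fimfunE (g n) x) -fsumEFin// ge0_mule_fsuml; last first.
      by move=> r; rewrite lee_fin; exact: nnfun_muleindic_ge0.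
    over.
  rewrite ge0_integral_fsum//.
  - apply: eq_fsbigr => r _.
    have [r0|r0] := ltP r 0.
      rewrite preimage_nnfun0// measure0 mule0 integral0_eq// => x _.
      by rewrite indic0 mulr0 mul0e.
    under eq_integral do rewrite EFinM -muleA.
    rewrite ge0_integralZl//; last 2 first.
    - by apply: emeasurable_funM => //; exact/measurable_EFinP.
    - by move=> x _; rewrite mule_ge0// lee_fin.
    congr (_ * _)%E; rewrite /= /density integral_mkcond; apply: eq_integral => x _.
    rewrite patchE indicE; case: ifPn => _; [by rewrite mul1e|by rewrite mul0e].
  - move=> r; apply: emeasurable_funM => //; apply/measurable_EFinP.
    exact: measurable_funM.
  - by move=> r x _; rewrite mule_ge0// lee_fin; exact: nnfun_muleindic_ge0.
rewrite -monotone_convergence//.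
- by apply: eq_integral => x _; apply/cvg_lim => //; apply: cvgeZr => //; exact: gh.
- by move=> n; apply: emeasurable_funM => //; exact/measurable_EFinP.
- by move=> n x _; rewrite mule_ge0// lee_fin.
- by move=> x _ a b ab; apply: lee_wpmul2r => //; exact: ndg.
Qed.
End density.

Lemma ge0_integral_mrestr d (T : measurableType d) (R : realType)
  (mu : {measure set T -> \bar R}) (D : set T) (mD : measurable D) (h : T -> \bar R) :
  measurable_fun setT h -> (forall x, (0 <= h x)%E) ->
  (\int[mrestr mu mD]_x h x = \int[mu]_(x in D) h x)%E.
Proof.
move=> mh h0.
have m1 : measurable_fun setT (\1_D : T -> R) by exact: measurable_indic.
have p1 x : 0 <= \1_D x :> R by rewrite indicE ler0n.
rewrite [LHS](eq_measure_integral (density mu m1 p1)); last first.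
  by move=> A mA _ /=; rewrite /density integral_indic// /mrestr setIC.
rewrite ge0_integral_density// [RHS]integral_mkcond; apply: eq_integral => x _.
rewrite patchE indicE; case: ifPn => _; [by rewrite mule1|by rewrite mule0].
Qed.

(** Measurability of [phi] is an explicit argument here, so that plain functions can be pushed
    forward without being bundled first. *)
Definition pushforward_measure d1 d2 (X : measurableType d1) (Y : measurableType d2)
  (R : realType) (mu : {measure set X -> \bar R}) (phi : X -> Y)
  (mphi : measurable_fun setT phi) : {measure set Y -> \bar R}.
Proof. by unshelve refine (pushforward mu phi : {measure set Y -> \bar R}). Defined.

Lemma pushforward_measureE d1 d2 (X : measurableType d1) (Y : measurableType d2)
  (R : realType) (mu : {measure set X -> \bar R}) (phi : X -> Y)
  (mphi : measurable_fun setT phi) A :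
  pushforward_measure mu mphi A = mu (phi @^-1` A).
Proof. by []. Qed.

Lemma ge0_integral_pushforward_measure d1 d2 (X : measurableType d1)
  (Y : measurableType d2) (R : realType) (mu : {measure set X -> \bar R}) (phi : X -> Y)
  (mphi : measurable_fun setT phi) (f : Y -> \bar R) :
  measurable_fun setT f -> (forall y, (0 <= f y)%E) ->
  (\int[pushforward_measure mu mphi]_y f y = \int[mu]_x f (phi x))%E.
Proof. by move=> mf f0; rewrite ge0_integral_pushforward. Qed.

Section substitution.
Context (R : realType).
Notation leb := (@lebesgue_measure R).
Variables (phi g : R -> R).
Hypothesis dphi : forall x : R, is_derive x 1 phi (g x).
Hypothesis cg : continuous g.
Hypothesis g0 : forall x, 0 < g x.

Let phi_cont : continuous phi.
Proof. by move=> x; apply/differentiable_continuous/derivable1_diffP. Qed.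

Let phi_incr x y : x < y -> phi x < phi y.
Proof.
move=> xy; apply: (@gtr0_derive1_incr R phi x y) => //.
- by move=> z _; rewrite derive1E (@derive_val _ _ _ _ _ _ _ (dphi z)).
- exact: continuous_subspaceT.
Qed.

Let phi_le x y : (phi x <= phi y) = (x <= y).
Proof.
have [xy|yx] := leP x y.
  by move: xy; rewrite le_eqVlt => /predU1P[->|/phi_incr/ltW->//]; rewrite lexx.
by apply/negbTE; rewrite -ltNge phi_incr.
Qed.

Let phi_lt x y : (phi x < phi y) = (x < y).
Proof. by rewrite !ltNge phi_le. Qed.

Let mphi : measurable_fun setT phi.
Proof. exact: continuous_measurable_fun. Qed.

Let mg : measurable_fun setT g.
Proof. exact: continuous_measurable_fun. Qed.

Let g_ge0 x : 0 <= g x. Proof. exact: ltW. Qed.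

Let integral_g a b : a <= b ->
  (\int[leb]_(x in `]a, b]) (g x)%:E = (phi b - phi a)%:E)%E.
Proof.
rewrite le_eqVlt => /predU1P[->|ab].
  by rewrite set_itvoc0 integral_set0 subrr.
rewrite integral_itv_obnd_cbnd; last first.
  by apply/measurable_EFinP; exact: measurable_funTS.
rewrite EFinB; apply: continuous_FTC2 => //.
- exact: continuous_subspaceT.
- split; first by move=> *.
  + by apply: cvg_at_right_filter; exact: phi_cont.
  + by apply: cvg_at_left_filter; exact: phi_cont.
- by move=> z _; rewrite derive1E (@derive_val _ _ _ _ _ _ _ (dphi z)).
Qed.

Let IVTphi a b y : a <= b -> phi a <= y <= phi b -> exists2 x, a <= x <= b & phi x = y.
Proof.
move=> ab yab.
have [||x] := @IVT _ phi a b y ab; first exact: continuous_subspaceT.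
  by rewrite min_l ?phi_le// max_r ?phi_le.
by rewrite in_itv/= => xab <-; exists x.
Qed.

(** Exhaustion by bounded intervals: the fundamental theorem of calculus acts on compact intervals,
    and [phi] may fail to be onto, so that an endpoint has a preimage only after it is clipped to
    the image of a piece. *)
Let piece n := `]- n%:R : R, n%:R]%classic.
Let ipiece n := `]phi (- n%:R), phi n%:R]%classic.

Let nd_piece : nondecreasing_seq piece.
Proof.
move=> a b ab; apply/subsetPset => x; rewrite /piece/= !in_itv/= => /andP[h1 h2].
by rewrite (le_lt_trans _ h1) ?(le_trans h2)// ?lerN2 ler_nat.
Qed.

Let nd_ipiece : nondecreasing_seq ipiece.
Proof.
move=> a b ab; apply/subsetPset => x; rewrite /ipiece/= !in_itv/= => /andP[h1 h2].
rewrite (le_lt_trans _ h1) ?(le_trans h2)// ?phi_le ?lerN2 ler_nat//.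
Qed.

Let bigcup_piece : \bigcup_n piece n = setT.
Proof.
apply/seteqP; split=> // x _; exists (Num.bound x) => //=.
have : `|x| < (Num.bound x)%:R by exact: unstable.ltr_norm_bound.
by rewrite /piece/= in_itv/= ltr_norml => /andP[-> /ltW->].
Qed.

Let bigcup_ipiece : \bigcup_n ipiece n = range phi.
Proof.
apply/seteqP; split=> [x [n _]|_ [x _ <-]].
  rewrite /ipiece/= in_itv/= => /andP[h1 h2].
  have [||y _ <-] := IVTphi (a := - n%:R) (b := n%:R) (y := x); last by exists y.
  - by rewrite (@le_trans _ _ 0)// ?oppr_le0 ler0n.
  - by rewrite (ltW h1).
have : (\bigcup_n piece n) x by rewrite bigcup_piece.
move=> [n _]; rewrite /piece/= in_itv/= => /andP[h1 h2]; exists n => //.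
by rewrite /ipiece/= in_itv/= phi_lt phi_le h1.
Qed.

Let measurable_range : measurable (range phi).
Proof. by rewrite -bigcup_ipiece; apply: bigcup_measurable => n _; exact: measurable_itv. Qed.

Let on_piece n a b :
  density leb mg g_ge0 (phi @^-1` `]a, b] `&` piece n) = leb (`]a, b]%classic `&` ipiece n).
Proof.
pose a' := Num.max a (phi (- n%:R)); pose b' := Num.min b (phi n%:R).
have -> : `]a, b]%classic `&` ipiece n = `]a', b']%classic.
  apply/seteqP; split => x; rewrite /ipiece/= !in_itv/= gt_max le_min.
    by move=> [/andP[-> ->] /andP[-> ->]].
  by move=> /andP[/andP[-> ->] /andP[-> ->]].
have -> : phi @^-1` `]a, b] `&` piece n = phi @^-1` `]a', b'].
  apply/seteqP; split => x; rewrite /piece/= !in_itv/= gt_max le_min !phi_le !phi_lt.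
    by move=> [/andP[-> ->] /andP[-> ->]].
  by move=> /andP[/andP[-> ->] /andP[-> ->]].
have [ab|ba] := ltP a' b'; last first.
  rewrite set_itv_ge ?bnd_simp -?leNgt//= preimage_set0.
  by rewrite !measure0.
have nn : - n%:R <= n%:R :> R by rewrite (@le_trans _ _ 0)// ?oppr_le0 ler0n.
have [|al alP alE] := IVTphi (a := - n%:R) (b := n%:R) (y := a') nn.
  by rewrite le_max lexx orbT (le_trans (ltW ab))// ge_min lexx orbT.
have [|be beP beE] := IVTphi (a := - n%:R) (b := n%:R) (y := b') nn.
  by rewrite (le_trans _ (ltW ab)) ?le_max ?lexx ?orbT// ge_min lexx orbT.
have -> : phi @^-1` `]a', b'] = `]al, be]%classic.
  by apply/seteqP; split => x /=; rewrite !in_itv/= -alE -beE phi_le phi_lt.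
rewrite /density integral_g; last by rewrite -phi_le alE beE ltW.
by rewrite alE beE lebesgue_measure_itv/= lte_fin ab.
Qed.

Let mphi_preimage A : measurable A -> measurable (phi @^-1` A).
Proof. by move=> mA; rewrite -[X in measurable X]setTI; exact: mphi. Qed.

Let on_itv a b :
  density leb mg g_ge0 (phi @^-1` `]a, b]) = leb (`]a, b]%classic `&` range phi).
Proof.
have mp n : measurable (piece n) by exact: measurable_itv.
have mi n : measurable (ipiece n) by exact: measurable_itv.
have mab : measurable (`]a, b] : set R) by exact: measurable_itv.
have mpab : measurable (phi @^-1` `]a, b]) by exact: mphi_preimage.
rewrite -bigcup_ipiece setI_bigcupr -[X in density _ _ _ X]setIT -bigcup_piece.
rewrite [X in density _ _ _ X]setI_bigcupr.
have mF n : measurable (phi @^-1` `]a, b] `&` piece n) by exact: measurableI.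
have mG n : measurable (`]a, b]%classic `&` ipiece n) by exact: measurableI.
have c1 := @nondecreasing_cvg_mu _ _ _ (density leb mg g_ge0)
  (fun n => phi @^-1` `]a, b] `&` piece n) mF (bigcupT_measurable _ mF).
have c2 := @nondecreasing_cvg_mu _ _ _ leb (fun n => `]a, b]%classic `&` ipiece n)
  mG (bigcupT_measurable _ mG).
apply: cvg_unique (c1 _) _ => //.
  by move=> m n mn; apply/subsetPset; apply: setIS; exact/subsetPset/nd_piece.
rewrite (_ : _ \o _ = leb \o (fun n => `]a, b]%classic `&` ipiece n)); last first.
  by apply/funext => n /=; exact: on_piece.
apply: c2.
by move=> m n mn; apply/subsetPset; apply: setIS; exact/subsetPset/nd_ipiece.
Qed.

Let pm := @pushforward_measure _ _ (measurableTypeR R) (measurableTypeR R) _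
  (density leb mg g_ge0) phi mphi.

Let pushforward_density A : measurable A -> pm A = leb (A `&` range phi).
Proof.
move=> mA.
(* Lebesgue measure is characterized on the whole line, so the pushforward is completed by the
   Lebesgue measure of the complement of the range; this addition vanishes on subsets of the
   range. *)
pose m2 : {measure set (measurableTypeR R) -> \bar R} :=
  mrestr leb (measurableC measurable_range).
have E : leb (A `&` range phi) = (pm (A `&` range phi) + m2 (A `&` range phi))%E.
  rewrite -measure_addE; apply: lebesgue_measure_unique; last exact: measurableI.
  move=> _ [[a b]] _ <-.
  transitivity (pm `]a, b]%classic + m2 `]a, b]%classic)%E; last by rewrite -measure_addE.
  transitivity (leb (`]a, b]%classic `&` range phi)
    + leb (`]a, b]%classic `&` ~` range phi))%E; last first.
    by congr (_ + _)%E; exact/esym/on_itv.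
  rewrite -measureU//.
  - by rewrite -setIUr setUv setIT.
  - by apply: measurableI => //; exact: measurable_itv.
  - by apply: measurableI; exact: measurable_itv || exact: measurableC.
  - by rewrite setIACA setICr setI0.
have m20 : m2 (A `&` range phi) = 0%E.
  transitivity (leb (A `&` range phi `&` ~` range phi)) => //.
  by rewrite -setIA setICr setI0 measure0.
rewrite E m20 adde0.
by rewrite !pushforward_measureE preimage_setI preimage_range setIT.
Qed.

(** The range stays in the formula because several substitutions below map the line onto (0, +oo) or
    (0, pi). *)
Lemma ge0_integral_substitution (h : R -> \bar R) :
  measurable_fun setT h -> (forall x, (0 <= h x)%E) ->
  (\int[leb]_x (h (phi x) * (g x)%:E) = \int[leb]_(y in range phi) h y)%E.
Proof.
move=> mh h0.
have mhphi : measurable_fun setT (h \o phi) by exact: measurableT_comp.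
have hphi0 x : (0 <= (h \o phi) x)%E by exact: h0.
rewrite -(ge0_integral_density leb mg g_ge0 mhphi hphi0).
rewrite -(@ge0_integral_pushforward_measure _ _ (measurableTypeR R)
  (measurableTypeR R) _ (density leb mg g_ge0) phi mphi)//.
pose m2 : {measure set (measurableTypeR R) -> \bar R} := mrestr leb measurable_range.
rewrite (eq_measure_integral m2); last first.
  by move=> A mA _; exact: pushforward_density.
exact: ge0_integral_mrestr.
Qed.
End substitution.

(** * Lebesgue measure and the uniform law on the sphere *)

Section real_line.
Context (R : realType).
Notation leb := (@lebesgue_measure R).

Lemma ge0_integral_translation (a : R) (h : R -> \bar R) :
  measurable_fun setT h -> (forall x, (0 <= h x)%E) ->
  (\int[leb]_x h (x + a)%R = \int[leb]_x h x)%E.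
Proof.
move=> mh h0.
have d (x : R) : is_derive x 1 (fun x : R => x + a) 1.
  by apply: is_derive_eq; rewrite addr0.
have := @ge0_integral_substitution R (fun x => x + a) (cst 1) d _ _ h mh h0.
rewrite (_ : [set (i + a)%R | i in setT] = setT); last first.
  by apply/seteqP; split => // x _; exists (x - a) => //; rewrite subrK.
move=> <-//; last by move=> ?; exact: cvg_cst.
by apply: eq_integral => x _; rewrite mule1.
Qed.

Lemma ge0_integral_dilation (c : R) (h : R -> \bar R) : 0 < c ->
  measurable_fun setT h -> (forall x, (0 <= h x)%E) ->
  (\int[leb]_x (h (c * x)%R * c%:E) = \int[leb]_x h x)%E.
Proof.
move=> c0 mh h0.
have d (x : R) : is_derive x 1 (fun x : R => c * x) c.
  rewrite (_ : (fun x : R => c * x) = (cst c * id)%R)//.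
  by apply: is_derive_eq; rewrite /GRing.scale/= mulr1 mulr0 addr0.
have := @ge0_integral_substitution R (fun x => c * x) (cst c) d _ _ h mh h0.
rewrite (_ : [set c * x | x in setT] = setT); last first.
  by apply/seteqP; split => // x _; exists (c^-1 * x) => //; rewrite mulVKf// gt_eqF.
by move=> ->//; move=> ?; exact: cvg_cst.
Qed.
End real_line.

Section tuple_vectors.
Context {R : realType} {d : nat}.
Implicit Types v w : d.-tuple R.

Definition vadd v w : d.-tuple R := [tuple tnth v i + tnth w i | i < d].
Definition vscale (c : R) v : d.-tuple R := [tuple c * tnth v i | i < d].

Lemma tnth_vadd v w i : tnth (vadd v w) i = tnth v i + tnth w i.
Proof. by rewrite tnth_mktuple. Qed.
Lemma tnth_vsub v w i : tnth (vsub v w) i = tnth v i - tnth w i.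
Proof. by rewrite tnth_mktuple. Qed.
Lemma tnth_vscale c v i : tnth (vscale c v) i = c * tnth v i.
Proof. by rewrite tnth_mktuple. Qed.
Lemma tnth_origin i : tnth (origin : d.-tuple R) i = 0.
Proof. by rewrite tnth_mktuple. Qed.

Definition vtnthE := (tnth_vadd, tnth_vsub, tnth_vscale, tnth_origin).

Lemma dotpC v w : dotp v w = dotp w v.
Proof. by apply: eq_bigr => i _; rewrite mulrC. Qed.
Lemma dotpDl u v w : dotp (vadd u v) w = dotp u w + dotp v w.
Proof. by rewrite -big_split; apply: eq_bigr => i _; rewrite !vtnthE mulrDl. Qed.
Lemma dotpBl u v w : dotp (vsub u v) w = dotp u w - dotp v w.
Proof.
by rewrite /dotp -sumrB; apply: eq_bigr => i _; rewrite !vtnthE mulrBl.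
Qed.
Lemma dotpZl c v w : dotp (vscale c v) w = c * dotp v w.
Proof.
by rewrite /dotp mulr_sumr; apply: eq_bigr => i _; rewrite !vtnthE mulrA.
Qed.
Lemma dotpDr u v w : dotp w (vadd u v) = dotp w u + dotp w v.
Proof. by rewrite !(dotpC w) dotpDl. Qed.
Lemma dotpBr u v w : dotp w (vsub u v) = dotp w u - dotp w v.
Proof. by rewrite !(dotpC w) dotpBl. Qed.
Lemma dotpZr c v w : dotp w (vscale c v) = c * dotp w v.
Proof. by rewrite !(dotpC w) dotpZl. Qed.

Definition dotpE := (dotpDl, dotpDr, dotpBl, dotpBr, dotpZl, dotpZr).

Lemma dotp_ge0 v : 0 <= dotp v v.
Proof. by apply: sumr_ge0 => i _; rewrite -expr2 sqr_ge0. Qed.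
Lemma sqr_enorm v : enorm v ^+ 2 = dotp v v.
Proof. by rewrite sqr_sqrtr// dotp_ge0. Qed.
Lemma enorm_ge0 v : 0 <= enorm v.
Proof. exact: sqrtr_ge0. Qed.
Lemma dotp_eq0 v : dotp v v = 0 -> v = origin.
Proof.
move=> /eqP; rewrite psumr_eq0; last by move=> i _; rewrite -expr2 sqr_ge0.
move=> /allP h; apply: eq_from_tnth => i; rewrite vtnthE.
by have := h i (mem_index_enum i); rewrite /= mulf_eq0 orbb => /eqP.
Qed.
Lemma enorm_eq0 v : enorm v = 0 -> v = origin.
Proof. by move=> v0; apply: dotp_eq0; rewrite -sqr_enorm v0 expr0n. Qed.
Lemma enorm_origin : enorm (origin : d.-tuple R) = 0.
Proof.
by rewrite /enorm /dotp big1 ?sqrtr0// => i _; rewrite vtnthE mul0r.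
Qed.
Lemma eq_enorm v w : dotp v v = dotp w w -> enorm v = enorm w.
Proof. by rewrite /enorm => ->. Qed.
Lemma enormZ c v : enorm (vscale c v) = `|c| * enorm v.
Proof. by rewrite /enorm !dotpE mulrA -expr2 sqrtrM ?sqr_ge0// sqrtr_sqr. Qed.

Lemma dotp_le v w : `|dotp v w| <= enorm v * enorm w.
Proof.
have [v0|v0] := eqVneq (enorm v) 0.
  rewrite v0 mul0r (enorm_eq0 v0) /dotp big1 ?normr0// => i _.
  by rewrite vtnthE mul0r.
have vv : 0 < dotp v v by rewrite -sqr_enorm exprn_gt0// lt_neqAle eq_sym v0 enorm_ge0.
rewrite -(@ler_pXn2r _ 2)// ?nnegrE ?mulr_ge0 ?enorm_ge0//.
rewrite real_normK ?num_real// exprMn !sqr_enorm.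
(* The square of this vector is |v|^2 (|v|^2 |w|^2 - <v, w>^2). *)
have := dotp_ge0 (vsub (vscale (dotp v v) w) (vscale (dotp v w) v)).
rewrite !dotpE (dotpC w v) => H.
rewrite -(ler_pM2l vv) -subr_ge0; apply: le_trans H _.
by rewrite le_eqVlt; apply/orP; left; apply/eqP; ring.
Qed.

Lemma enorm_triangle v w : enorm (vadd v w) <= enorm v + enorm w.
Proof.
rewrite -(@ler_pXn2r _ 2)// ?nnegrE ?addr_ge0 ?enorm_ge0//.
rewrite sqrrD !sqr_enorm !dotpE (dotpC w v).
have := le_trans (ler_norm _) (dotp_le v w); lra.
Qed.
Lemma enormB v w : enorm (vsub v w) <= enorm v + enorm w.
Proof.
rewrite -(@ler_pXn2r _ 2)// ?nnegrE ?addr_ge0 ?enorm_ge0//.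
rewrite sqrrD !sqr_enorm !dotpE (dotpC w v).
have := dotp_le v w; rewrite ler_norml => /andP[]; lra.
Qed.
Lemma enorm_direction v : enorm v != 0 -> enorm (direction v) = 1.
Proof.
move=> v0; rewrite (_ : direction v = vscale (enorm v)^-1 v); last first.
  by apply: eq_from_tnth => i; rewrite vtnthE tnth_mktuple mulrC.
by rewrite enormZ ger0_norm ?invr_ge0 ?enorm_ge0// mulVf.
Qed.
End tuple_vectors.

Section tuple_measurable.
Context {R : realType} {d : nat} {dT : measure_display} {T : measurableType dT}.
Implicit Types f g : T -> d.-tuple R.

Lemma measurable_tnth_comp f i : measurable_fun setT f ->
  measurable_fun setT (fun x => tnth (f x) i).
Proof. by move=> mf; exact: (measurableT_comp (measurable_tnth i) mf). Qed.

Lemma measurable_vadd f g : measurable_fun setT f -> measurable_fun setT g ->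
  measurable_fun setT (fun x => vadd (f x) (g x)).
Proof.
by move=> mf mg; apply: measurable_mktuple => i; apply: measurable_funD;
  exact: measurable_tnth_comp.
Qed.
Lemma measurable_vsub f g : measurable_fun setT f -> measurable_fun setT g ->
  measurable_fun setT (fun x => vsub (f x) (g x)).
Proof.
by move=> mf mg; apply: measurable_mktuple => i; apply: measurable_funB;
  exact: measurable_tnth_comp.
Qed.
Lemma measurable_vscale (c : T -> R) f : measurable_fun setT c -> measurable_fun setT f ->
  measurable_fun setT (fun x => vscale (c x) (f x)).
Proof.
by move=> mc mf; apply: measurable_mktuple => i; apply: measurable_funM => //;
  exact: measurable_tnth_comp.
Qed.
Lemma measurable_dotp f g : measurable_fun setT f -> measurable_fun setT g ->
  measurable_fun setT (fun x => dotp (f x) (g x)).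
Proof.
by move=> mf mg; apply: measurable_sum => i; apply: measurable_funM;
  exact: measurable_tnth_comp.
Qed.
Lemma measurable_enorm_comp f : measurable_fun setT f ->
  measurable_fun setT (fun x => enorm (f x)).
Proof. by move=> mf; exact: (measurableT_comp measurable_enorm mf). Qed.
End tuple_measurable.

Section indicator.
Context d (T : measurableType d) (R : realType).
Lemma measurable_EFin_indic (A : set T) : measurable A ->
  measurable_fun setT (fun x => (\1_A x)%:E : \bar R).
Proof. by move=> mA; apply/measurable_EFinP; exact: measurable_indic. Qed.
Lemma EFin_indic_ge0 (A : set T) x : (0 <= (\1_A x)%:E :> \bar R)%E.
Proof. by rewrite lee_fin indicE ler0n. Qed.
Lemma eq_indic (T' : Type) (A : set T) (B : set T') x y : (A x <-> B y) ->
  \1_A x = \1_B y :> R.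
Proof.
move=> AB; rewrite !indicE; congr (_%:R); congr nat_of_bool.
by apply/idP/idP; rewrite !inE => /AB.
Qed.
Lemma ge0_integral_indicr (mu : {measure set T -> \bar R}) (D : set T)
  (h : T -> \bar R) :
  (\int[mu]_(x in D) h x = \int[mu]_x (h x * (\1_D x)%:E))%E.
Proof.
rewrite integral_mkcond; apply: eq_integral => x _.
by rewrite patchE indicE; case: ifPn => _; rewrite ?mule1 ?mule0.
Qed.
End indicator.

Section lebesgue_tuple_theory.
Context {R : realType}.
Notation leb := (@lebesgue_measure R).
Notation lam := (lebesgue_tuple R).

Lemma ge0_integral_lebesgue_tupleS n (f : n.+1.-tuple R -> \bar R) :
  measurable_fun setT f -> (forall v, (0 <= f v)%E) ->
  (\int[lam n.+1]_v f v = \int[leb]_x \int[lam n]_y f (cons_pair (x, y)))%E.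
Proof.
move=> mf f0.
rewrite /= /lebesgue_cons ge0_integral_pushforward//; last exact: measurable_cons_pair.
rewrite preimage_setT fubini_tonelli1//; last by move=> ?; exact: f0.
by apply: measurableT_comp => //; exact: measurable_cons_pair.
Qed.

Lemma ge0_integral_lebesgue_tupleS_swap n (f : n.+1.-tuple R -> \bar R) :
  measurable_fun setT f -> (forall v, (0 <= f v)%E) ->
  (\int[lam n.+1]_v f v = \int[lam n]_y \int[leb]_x f (cons_pair (x, y)))%E.
Proof.
move=> mf f0.
rewrite /= /lebesgue_cons ge0_integral_pushforward//; last exact: measurable_cons_pair.
rewrite preimage_setT fubini_tonelli2//; last by move=> ?; exact: f0.
by apply: measurableT_comp => //; exact: measurable_cons_pair.
Qed.

Lemma measurable_cons_pairr n (x : R) :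
  measurable_fun setT (fun y : n.-tuple R => cons_pair (x, y)).
Proof.
apply: (measurableT_comp (measurable_cons_pair (R := R) (n := n))).
exact: measurable_pair1.
Qed.

Lemma tnth_cons_pair0 n (x : R) (y : n.-tuple R) : tnth (cons_pair (x, y)) ord0 = x.
Proof. by rewrite tnth0. Qed.

Lemma tnth_cons_pairS n (x : R) (y : n.-tuple R) i :
  tnth (cons_pair (x, y)) (lift ord0 i) = tnth y i.
Proof. by rewrite tnthS. Qed.

Lemma cons_pairE n (v : n.+1.-tuple R) :
  v = cons_pair (thead v, [tuple of behead v]).
Proof. by rewrite [LHS]tuple_eta. Qed.

Lemma vadd_cons n (x : R) (y : n.-tuple R) a b :
  vadd (cons_pair (x, y)) (cons_pair (a, b)) = cons_pair (x + a, vadd y b).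
Proof.
apply: eq_from_tnth => i; rewrite vtnthE.
by case: (unliftP ord0 i) => [j ->|->]; rewrite ?tnth_cons_pair0 ?tnth_cons_pairS ?vtnthE.
Qed.

Lemma vscale_cons n c (x : R) (y : n.-tuple R) :
  vscale c (cons_pair (x, y)) = cons_pair (c * x, vscale c y).
Proof.
apply: eq_from_tnth => i; rewrite vtnthE.
by case: (unliftP ord0 i) => [j ->|->]; rewrite ?tnth_cons_pair0 ?tnth_cons_pairS ?vtnthE.
Qed.

Lemma dotp_cons n (x : R) (y : n.-tuple R) a b :
  dotp (cons_pair (x, y)) (cons_pair (a, b)) = x * a + dotp y b.
Proof.
rewrite /dotp big_ord_recl !tnth_cons_pair0; congr (_ + _).
by apply: eq_bigr => i _; rewrite !tnth_cons_pairS.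
Qed.

Lemma ge0_integral_vadd n (a : n.-tuple R) (f : n.-tuple R -> \bar R) :
  measurable_fun setT f -> (forall v, (0 <= f v)%E) ->
  (\int[lam n]_v f (vadd v a) = \int[lam n]_v f v)%E.
Proof.
elim: n a f => [|n IH] a f mf f0.
  by congr (integral _ _ _); apply/funext => v; congr f; rewrite [RHS]tuple0 tuple0.
have ma : measurable_fun setT (fun v : n.+1.-tuple R => f (vadd v a)).
  by apply: (measurableT_comp mf); exact: measurable_vadd.
rewrite ge0_integral_lebesgue_tupleS// [in RHS]ge0_integral_lebesgue_tupleS//.
rewrite [in LHS](cons_pairE a).
transitivity (\int[leb]_x \int[lam n]_y f (cons_pair ((x + thead a)%R, y)))%E.
  apply: eq_integral => x _.
  under eq_integral do rewrite vadd_cons.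
  apply: (IH _ (fun y => f (cons_pair ((x + thead a)%R, y)))) => //.
  by apply: (measurableT_comp mf); exact: measurable_cons_pairr.
apply: (@ge0_integral_translation R _ (fun x => \int[lam n]_y f (cons_pair (x, y)))%E).
  apply: (@measurable_fun_fubini_tonelli_F _ _ _ _ _ (lam n) (f \o @cons_pair R n)) => //.
    by apply: measurableT_comp => //; exact: measurable_cons_pair.
  by move=> ?; exact: f0.
by move=> x; exact: integral_ge0.
Qed.

Lemma ge0_integral_vscale n (c : R) (f : n.-tuple R -> \bar R) : 0 < c ->
  measurable_fun setT f -> (forall v, (0 <= f v)%E) ->
  (\int[lam n]_v (f (vscale c v) * (c ^+ n)%:E) = \int[lam n]_v f v)%E.
Proof.
move=> c0; elim: n f => [|n IH] f mf f0.
  congr (integral _ _ _); apply/funext => v; rewrite expr0 mule1.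
  by congr f; rewrite [RHS]tuple0 tuple0.
have ma : measurable_fun setT (fun v : n.+1.-tuple R => f (vscale c v) * (c ^+ n.+1)%:E)%E.
  apply: emeasurable_funM => //; apply: (measurableT_comp mf).
  exact: measurable_vscale.
rewrite ge0_integral_lebesgue_tupleS//; last first.
  by move=> v; rewrite mule_ge0// lee_fin exprn_ge0// ltW.
rewrite [in RHS]ge0_integral_lebesgue_tupleS//.
pose F x := (\int[lam n]_y f (cons_pair (x, y)))%E.
transitivity (\int[leb]_x (F (c * x)%R * c%:E))%E.
  apply: eq_integral => x _; rewrite /F -(IH (fun y => f (cons_pair ((c * x)%R, y))))//; last first.
    by apply: (measurableT_comp mf); exact: measurable_cons_pairr.
  rewrite -ge0_integralZr//.
  - by apply: eq_integral => y _; rewrite vscale_cons -muleA -EFinM exprSr.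
  - apply: emeasurable_funM => //; apply: (measurableT_comp mf).
    apply: (measurableT_comp (measurable_cons_pairr _)); exact: measurable_vscale.
  - by move=> y _; rewrite mule_ge0// lee_fin exprn_ge0// ltW.
  - by rewrite lee_fin ltW.
apply: ge0_integral_dilation => //.
  apply: (@measurable_fun_fubini_tonelli_F _ _ _ _ _ (lam n) (f \o @cons_pair R n)) => //.
    by apply: measurableT_comp => //; exact: measurable_cons_pair.
  by move=> ?; exact: f0.
by move=> x; exact: integral_ge0.
Qed.

Definition cube {n} (c : R) : set (n.-tuple R) := [set v | forall i, `|tnth v i| <= c].

Lemma measurable_cube n c : measurable (cube c : set (n.-tuple R)).
Proof.
rewrite (_ : cube c = \bigcap_(i in [set: 'I_n]) ((fun v => tnth v i) @^-1` `[- c, c])).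
  apply: fin_bigcap_measurable => // i _; rewrite -[X in measurable X]setTI.
  by apply: measurable_tnth => //; exact: measurable_itv.
apply/seteqP; split => v h i; first by move=> _ /=; rewrite in_itv/= -ler_norml; exact: h.
by have := h i I; rewrite /= in_itv/= -ler_norml.
Qed.

(** A cube outside and a cube inside the unit ball will show that the measure of the ball is finite
    and positive. *)
Lemma lebesgue_cube n (c : R) : 0 <= c -> lam n (cube c) = ((2 * c) ^+ n)%:E.
Proof.
move=> c0; elim: n => [|n IH].
  by rewrite /= diracE expr0 mem_set// => -[].
rewrite -[X in lam _ X]setIT -integral_indic//; last exact: measurable_cube.
have mC m := @measurable_EFin_indic _ _ R _ (@measurable_cube m c).
rewrite (ge0_integral_lebesgue_tupleS (mC _)); last by move=> v; exact: EFin_indic_ge0.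
transitivity (\int[leb]_x ((\1_`[- c, c] x)%:E * ((2 * c) ^+ n)%:E))%E.
  apply: eq_integral => x _; rewrite -IH -[X in lam _ X]setIT -integral_indic//; last exact: measurable_cube.
  rewrite -ge0_integralZl ?EFin_indic_ge0//.
  apply: eq_integral => y _; rewrite -EFinM !indicE; congr (_%:E).
  rewrite -natrM mulnb; congr (_%:R); congr nat_of_bool.
  apply/idP/andP; rewrite !inE/= in_itv/= -ler_norml.
    move=> h; split; first by have := h ord0; rewrite tnth_cons_pair0.
    by move=> i; have := h (lift ord0 i); rewrite tnth_cons_pairS.
  move=> [hx hy] i; case: (unliftP ord0 i) => [j ->|->].
    by rewrite tnth_cons_pairS; exact: hy.
  by rewrite tnth_cons_pair0.
have mI : measurable (`[- c, c] : set R) by exact: measurable_itv.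
rewrite ge0_integralZr ?lee_fin ?exprn_ge0 ?mulr_ge0//; last first.
  exact: measurable_EFin_indic.
rewrite integral_indic//= setIT lebesgue_measure_itv/= lte_fin.
case: ltP => h; rewrite -?EFinB -?EFinM ?exprS; first by congr (_%:E); lra.
have -> : c = 0 by lra.
by rewrite mulr0 !mul0r.
Qed.

Lemma tnth_le_enorm n (v : n.-tuple R) i : `|tnth v i| <= enorm v.
Proof.
rewrite -sqrtr_sqr ler_sqrt ?dotp_ge0// /dotp (bigD1 i)//= -expr2 lerDl.
by apply: sumr_ge0 => j _; rewrite -expr2 sqr_ge0.
Qed.

Lemma lebesgue_unit_ball_lty n : (lam n unit_ball < +oo)%E.
Proof.
apply: (@le_lt_trans _ _ (lam n (cube 1))).
  apply: le_measure; rewrite ?inE; [exact: measurable_unit_ball|exact: measurable_cube|].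
  by move=> v vB i; exact: le_trans (tnth_le_enorm _ _) _.
by rewrite lebesgue_cube// ltry.
Qed.

Lemma lebesgue_unit_ball_gt0 n : (0 < lam n unit_ball)%E.
Proof.
(* Half-side 1/(n+1): then n c^2 <= (n+1) c^2 = c <= 1, also for n = 0. *)
pose c : R := n.+1%:R^-1.
have c0 : 0 < c by rewrite invr_gt0.
apply: (@lt_le_trans _ _ (lam n (cube c))).
  by rewrite lebesgue_cube ?ltW// lte_fin exprn_gt0// mulr_gt0.
apply: le_measure; rewrite ?inE; [exact: measurable_cube|exact: measurable_unit_ball|].
move=> v vB; rewrite /unit_ball/= -[leRHS]sqrtr1 ler_sqrt//.
apply: (@le_trans _ _ (\sum_(i < n) c ^+ 2)).
  apply: ler_sum => i _; rewrite -expr2 -real_normK ?num_real//.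
  by rewrite ler_pXn2r// ?nnegrE// ?ltW//; exact: vB.
rewrite sumr_const card_ord -mulr_natl.
apply: (@le_trans _ _ (n.+1%:R * c ^+ 2)); first by rewrite ler_wpM2r ?sqr_ge0 ?ler_nat.
by rewrite expr2 mulrA divff ?mul1r ?invf_le1 ?ler1n ?pnatr_eq0.
Qed.

End lebesgue_tuple_theory.

Section isometries.
Context {R : realType} {d : nat}.
Notation E := (d.-tuple R).
Notation lam := (lebesgue_tuple R d).

Record linear_isometry (U : E -> E) : Prop := LinearIsometry {
  isom_measurable : measurable_fun setT U;
  isomD : forall v w, U (vadd v w) = vadd (U v) (U w);
  isomZ : forall c v, U (vscale c v) = vscale c (U v);
  isom_dotp : forall v w, dotp (U v) (U w) = dotp v w;
  isom_surj : forall v, exists w, U w = v }.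

Lemma isom_enorm U v : linear_isometry U -> enorm (U v) = enorm v.
Proof. by move=> uU; apply: eq_enorm; rewrite isom_dotp. Qed.

Let B : set E := unit_ball.
Let b (v : E) : \bar R := (\1_B v)%:E.

Let mb : measurable_fun setT b.
Proof. by apply/measurable_EFinP; apply: measurable_indic; exact: measurable_unit_ball. Qed.

Let b0 v : (0 <= b v)%E.
Proof. by rewrite lee_fin indicE ler0n. Qed.

Let intb : (\int[lam]_v b v = lam B)%E.
Proof. by rewrite integral_indic ?setIT//; exact: measurable_unit_ball. Qed.

(** Only Tonelli and translations enter: y becomes y + U x, then x becomes x - z where U z = y, then
    y becomes y + U x again. With [g] the indicator of the ball, invariant under [U], the right side
    no longer depends on [U]. *)
Let exchange U (f g : E -> \bar R) : linear_isometry U ->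
  measurable_fun setT f -> (forall v, (0 <= f v)%E) ->
  measurable_fun setT g -> (forall v, (0 <= g v)%E) ->
  ((\int[lam]_x f (U x)) * (\int[lam]_y g y) =
   (\int[lam]_x g (U x)) * (\int[lam]_y f (vsub origin y)))%E.
Proof.
move=> uU mf f0 mg g0; have mU := isom_measurable uU.
have mfU : measurable_fun setT (f \o U) by exact: measurableT_comp.
have mgU : measurable_fun setT (g \o U) by exact: measurableT_comp.
have mfN : measurable_fun setT (fun y => f (vsub origin y)).
  by apply: (measurableT_comp mf); exact: measurable_vsub.
transitivity (\int[lam]_x \int[lam]_y (f (U x) * g (vadd y (U x))))%E.
  rewrite -ge0_integralZr//; last by exact: integral_ge0.
  apply: eq_integral => x _; rewrite ge0_integralZl//; last first.
    by apply: (measurableT_comp mg); exact: measurable_vadd.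
  by rewrite ge0_integral_vadd.
rewrite (fubini_tonelli (fun z : E * E => f (U z.1) * g (vadd z.2 (U z.1))))%E//; last 2 first.
- apply: emeasurable_funM.
    by apply: (measurableT_comp mfU); exact: measurable_fst.
  apply: (measurableT_comp mg); apply: measurable_vadd; first exact: measurable_snd.
  by apply: (measurableT_comp mU); exact: measurable_fst.
- by move=> x; rewrite mule_ge0.
transitivity (\int[lam]_y \int[lam]_x (f (vsub (U x) y) * g (U x)))%E.
  apply: eq_integral => y _ /=; have [z Uz] := isom_surj uU y.
  rewrite -(ge0_integral_vadd z (f := fun x => f (vsub (U x) y) * g (U x)))%E//; last 2 first.
  - apply: emeasurable_funM => //; apply: (measurableT_comp mf).
    exact: measurable_vsub.
  - by move=> x; rewrite mule_ge0.
  apply: eq_integral => x _; rewrite isomD// Uz; congr (f _ * g _)%E.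
    by apply: eq_from_tnth => i; rewrite !vtnthE addrK.
  by apply: eq_from_tnth => i; rewrite !vtnthE addrC.
rewrite -(fubini_tonelli (fun z : E * E => f (vsub (U z.1) z.2) * g (U z.1)))%E//; last 2 first.
- apply: emeasurable_funM.
    apply: (measurableT_comp mf); apply: measurable_vsub; last exact: measurable_snd.
    by apply: (measurableT_comp mU); exact: measurable_fst.
  by apply: (measurableT_comp mgU); exact: measurable_fst.
- by move=> x; rewrite mule_ge0.
rewrite -ge0_integralZr//; last exact: integral_ge0.
apply: eq_integral => x _ /=.
rewrite -(ge0_integral_vadd (U x) (f := fun y => f (vsub (U x) y) * g (U x)))%E//; last 2 first.
- apply: emeasurable_funM => //; apply: (measurableT_comp mf).
  exact: measurable_vsub.
- by move=> y; rewrite mule_ge0.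
rewrite [LHS]ge0_integralZr//; last first.
  apply: (measurableT_comp mf); apply: measurable_vsub => //.
  exact: measurable_vadd.
rewrite muleC; congr (_ * _)%E; apply: eq_integral => y _; congr f.
by apply: eq_from_tnth => i; rewrite !vtnthE; ring.
Qed.

(* Uniqueness of translation invariant measures: both sides are proportional
   to the Lebesgue measure, and they agree on the unit ball. *)
Lemma ge0_integral_isometry U (f : E -> \bar R) : linear_isometry U ->
  measurable_fun setT f -> (forall v, (0 <= f v)%E) ->
  (\int[lam]_x f (U x) = \int[lam]_x f x)%E.
Proof.
move=> uU mf f0.
have id_isom : linear_isometry id.
  by split => // v; exists v.
have := exchange id_isom mf f0 mb b0; have := exchange uU mf f0 mb b0.
have -> : (\int[lam]_x b (U x) = \int[lam]_x b x)%E.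
  apply: eq_integral => x _; rewrite /b !indicE; congr (_%:R%:E); congr nat_of_bool.
  by apply/idP/idP; rewrite !inE /B /unit_ball/= isom_enorm.
move=> <- /esym; rewrite intb.
have bB : (lam B \is a fin_num) by rewrite ge0_fin_numE//; exact: lebesgue_unit_ball_lty.
move=> H; have : (lam B * \int[lam]_x f (U x) = lam B * \int[lam]_x f x)%E.
  by rewrite muleC H muleC.
have r0 : fine (lam B) != 0 by rewrite gt_eqF// fine_gt0// lebesgue_unit_ball_gt0 lebesgue_unit_ball_lty.
rewrite -(fineK bB) => /(congr1 (fun z => ((fine (lam B))^-1)%:E * z)%E).
by rewrite !muleA -!EFinM mulVf// !mul1e.
Qed.

(** Reflections provide all the rotation invariance used below, since they carry any vector to any
    other of the same norm ([householder_swap]). For n = 0 the division by zero makes this the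
    identity, as the swap of a vector with itself should be. *)
Definition householder (n v : E) : E :=
  vsub v (vscale (2 * dotp v n / dotp n n) n).

Lemma householder_isometry n : linear_isometry (householder n).
Proof.
have [n0|n0] := eqVneq (dotp n n) 0.
  have -> : householder n = id.
    apply/funext => v; rewrite /householder n0 invr0 mulr0.
    by apply: eq_from_tnth => i; rewrite !vtnthE mul0r subr0.
  by split => // v; exists v.
have invol v : householder n (householder n v) = v.
  by apply: eq_from_tnth => i; rewrite /householder !vtnthE !dotpE; field.
split.
- apply: measurable_vsub => //; apply: measurable_vscale => //.
  apply: measurable_funM => //; apply: measurable_funM => //.
  exact: measurable_dotp.
- by move=> v w; apply: eq_from_tnth => i; rewrite /householder !vtnthE !dotpE; field.
- by move=> c v; apply: eq_from_tnth => i; rewrite /householder !vtnthE !dotpE; field.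
- by move=> v w; rewrite /householder !dotpE (dotpC n w); field.
- by move=> v; exists (householder n v).
Qed.

Lemma householder_swap v w : enorm v = enorm w -> householder (vsub v w) v = w.
Proof.
move=> vw; have {}vw : dotp v v = dotp w w by rewrite -!sqr_enorm vw.
have [n0|n0] := eqVneq (dotp (vsub v w) (vsub v w)) 0.
  rewrite /householder n0 invr0 mulr0; have n1 := dotp_eq0 n0.
  apply: eq_from_tnth => i; rewrite !vtnthE mul0r subr0.
  by have := congr1 (fun t => tnth t i) n1; rewrite /= !vtnthE => /eqP; rewrite subr_eq0 => /eqP.
apply: eq_from_tnth => i; rewrite /householder !vtnthE.
move: n0; rewrite !dotpE vw (dotpC w v) => n0.
by field.
Qed.

Lemma neg_isometry : linear_isometry (vscale (-1)).
Proof.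
split.
- exact: measurable_vscale.
- by move=> v w; apply: eq_from_tnth => i; rewrite !vtnthE; ring.
- by move=> c v; apply: eq_from_tnth => i; rewrite !vtnthE; ring.
- by move=> v w; rewrite !dotpE; ring.
- by move=> v; exists (vscale (-1) v); apply: eq_from_tnth => i; rewrite !vtnthE; ring.
Qed.

End isometries.

Section uniform_sphere_theory.
Context {R : realType} {d : nat}.
Notation E := (d.-tuple R).
Notation lam := (lebesgue_tuple R d).
Notation S := (@uniform_sphere R d).
Notation invB := (fine (lam unit_ball))^-1.

Let mB := @measurable_unit_ball R d.

Lemma ge0_integral_uniform_sphere (h : E -> \bar R) :
  measurable_fun setT h -> (forall v, (0 <= h v)%E) ->
  (\int[S]_s h s =
   invB%:E * \int[lam]_v (h (direction v) * (\1_unit_ball v)%:E))%E.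
Proof.
move=> mh h0.
rewrite ge0_integral_distribution//.
have mhd : measurable_fun setT (h \o (@direction R d)).
  by apply: measurableT_comp => //; exact: measurable_direction.
have B1 : mrestr lam mB setT = lam unit_ball by rewrite /mrestr setTI.
have BN0 : (mrestr lam mB setT != 0)%E.
  by rewrite B1 gt_eqF//; exact: lebesgue_unit_ball_gt0.
have BNy : (mrestr lam mB setT == +oo)%E = false.
  by rewrite B1 lt_eqF//; exact: lebesgue_unit_ball_lty.
have c0 : 0 <= invB by rewrite invr_ge0 fine_ge0.
rewrite (eq_measure_integral (mscale (NngNum c0) (mrestr lam mB))); last first.
  move=> A mA _; rewrite /uniform_ball /= /mnormalize (negbTE BN0) BNy /=.
  by rewrite muleC /mscale/= B1.
rewrite -ge0_integral_indicr.
transitivity (invB%:E * \int[mrestr lam mB]_v h (direction v))%E.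
  by apply: ge0_integral_mscale => // v _; exact: h0.
by congr (_ * _)%E; apply: ge0_integral_mrestr => // v; exact: h0.
Qed.

Lemma direction_vscale (v : E) : direction v = vscale (enorm v)^-1 v.
Proof. by apply: eq_from_tnth => j; rewrite vtnthE tnth_mktuple mulrC. Qed.

Lemma integral_sphere_isometry U (h : E -> \bar R) : linear_isometry U ->
  measurable_fun setT h -> (forall v, (0 <= h v)%E) ->
  (\int[S]_s h (U s) = \int[S]_s h s)%E.
Proof.
move=> uU mh h0; have mU := isom_measurable uU.
rewrite ge0_integral_uniform_sphere//; last exact: (measurableT_comp mh mU).
rewrite ge0_integral_uniform_sphere//; congr (_ * _)%E.
rewrite -[RHS](ge0_integral_isometry uU); last 2 first.
- apply: emeasurable_funM; last exact: measurable_EFin_indic.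
  by apply: (measurableT_comp mh); exact: measurable_direction.
- by move=> v; rewrite mule_ge0// EFin_indic_ge0.
apply: eq_integral => v _; congr (h _ * _%:E)%E.
  by rewrite !direction_vscale isomZ// isom_enorm.
by apply: eq_indic; rewrite /unit_ball/= isom_enorm.
Qed.

(** The reflection that exchanges [e] and [f] preserves the law on the sphere. *)
Lemma ge0_sphere_zonal (e f : E) (h : R -> \bar R) : enorm e = enorm f ->
  measurable_fun setT h -> (forall x, (0 <= h x)%E) ->
  (\int[S]_s h (dotp s e) = \int[S]_s h (dotp s f))%E.
Proof.
move=> ef mh h0.
have iH := householder_isometry (vsub e f).
rewrite -[RHS](integral_sphere_isometry iH (h := fun s => h (dotp s f)))//; last first.
  by apply: (measurableT_comp mh); exact: measurable_dotp.
by apply: eq_integral => s _; rewrite -{2}(householder_swap ef) (isom_dotp iH).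
Qed.

Hypothesis d0 : (0 < d)%N.

(** The dilation by 2 fixes the origin and multiplies volumes by 2^d > 1, so the finite measure of
    that point must be 0. *)
Lemma lebesgue_origin : (\int[lam]_v (\1_[set w : E | enorm w = 0%R] v)%:E = 0)%E.
Proof.
pose f (v : E) : \bar R := (\1_[set w : E | enorm w = 0%R] v)%:E.
have m0 : measurable [set w : E | enorm w = 0%R].
  rewrite (_ : [set _ | _] = (@enorm R d) @^-1` [set 0]); last by apply/seteqP; split.
  by rewrite -[X in measurable X]setTI; exact: measurable_enorm.
have mf : measurable_fun setT f.
  by apply/measurable_EFinP; exact: measurable_indic.
have f0 v : (0 <= f v)%E by rewrite lee_fin indicE ler0n.
have fin : (\int[lam]_v f v)%E \is a fin_num.
  rewrite ge0_fin_numE; last exact: integral_ge0.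
  rewrite /f integral_indic// setIT (le_lt_trans _ (lebesgue_unit_ball_lty d))//.
  apply: le_measure; [by rewrite inE|by rewrite inE; exact: measurable_unit_ball|].
  by move=> v /= v0; rewrite /unit_ball/= v0.
have two0 : 0 < 2 :> R by [].
have := ge0_integral_vscale two0 mf f0.
rewrite ge0_integralZr ?lee_fin ?exprn_ge0//; last first.
  by apply: (measurableT_comp mf); exact: measurable_vscale.
have -> : (\int[lam]_x f (vscale 2 x) = \int[lam]_x f x)%E.
  apply: eq_integral => v _; rewrite /f !indicE; congr (_%:R%:E); congr nat_of_bool.
  by apply/idP/idP; rewrite !inE/= enormZ; [move/eqP; rewrite mulf_eq0 normr_eq0 pnatr_eq0/= => /eqP|move=> ->; rewrite mulr0].
move: fin; rewrite -/f => /fineK <-; rewrite -EFinM => -[] H.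
have : 1 < 2 ^+ d :> R by rewrite exprn_egt1// ?ltr1n// -lt0n.
move=> d1; congr (_%:E); apply/eqP.
move/eqP: H; rewrite -subr_eq0 -[X in _ - X]mulr1 -mulrBr mulf_eq0 => /orP[//|].
by rewrite subr_eq0 gt_eqF.
Qed.

(** The only exception is the junk direction of the origin, a null set of the ball. *)
Lemma ae_sphere : {ae S, forall s : E, enorm s = 1}.
Proof.
have m1 : measurable [set w : E | enorm w = 1].
  rewrite (_ : [set _ | _] = (@enorm R d) @^-1` [set 1]); last by apply/seteqP; split.
  by rewrite -[X in measurable X]setTI; exact: measurable_enorm.
have mN : measurable (~` [set w : E | enorm w = 1]) by exact: measurableC.
have mI := measurable_EFin_indic mN.
exists (~` [set w : E | enorm w = 1]); split => //.
rewrite -[X in S X]setIT -integral_indic//.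
rewrite ge0_integral_uniform_sphere//.
suff -> : (\int[lam]_v ((\1_(~` [set w : E | enorm w = 1%R]) (direction v))%:E *
    (\1_unit_ball v)%:E) = 0)%E by rewrite mule0.
apply/eqP; rewrite eq_le integral_ge0 ?andbT; last first.
  by move=> v _; rewrite mule_ge0// EFin_indic_ge0.
rewrite -lebesgue_origin; apply: ge0_le_integral => //.
- apply: emeasurable_funM; last exact: measurable_EFin_indic.
  exact: (measurableT_comp (mI R) measurable_direction).
- apply: measurable_EFin_indic.
  rewrite (_ : [set _ | _] = (@enorm R d) @^-1` [set 0]); last by apply/seteqP; split.
  by rewrite -[X in measurable X]setTI; exact: measurable_enorm.
- move=> v _; rewrite lee_fin.
  case: (eqVneq (enorm v) 0) => [v0|v0].
    by rewrite [leRHS]indicE mem_set// !indicE -natrM ler_nat mulnb leq_b1.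
  by rewrite [X in X * _]indicE memNset ?mul0r// /setC/= => h; apply: h; rewrite enorm_direction.
Qed.
End uniform_sphere_theory.

(** * Zonal integrals on the sphere *)

Section hypotenuse.
Context {R : realType}.
Implicit Types x t rho : R.

(** The norm of a vector with first coordinate [x] whose other coordinates have norm [rho]. *)
Definition hyp (rho x : R) : R := Num.sqrt (x ^+ 2 + rho ^+ 2).

Lemma hyp_gt0 rho x : 0 < rho -> 0 < hyp rho x.
Proof. by move=> r0; rewrite sqrtr_gt0 ltr_wpDl ?sqr_ge0// exprn_gt0. Qed.

Lemma sqr_hyp rho x : hyp rho x ^+ 2 = x ^+ 2 + rho ^+ 2.
Proof. by rewrite sqr_sqrtr// addr_ge0 ?sqr_ge0. Qed.

Lemma hyp_gt_norm rho x : 0 < rho -> `|x| < hyp rho x.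
Proof.
move=> r0; rewrite -(@ltr_pXn2r _ 2)// ?nnegrE ?sqrtr_ge0//.
by rewrite sqr_hyp real_normK ?num_real// ltrDl exprn_gt0.
Qed.

Lemma hypD_gt0 rho x : 0 < rho -> 0 < hyp rho x + x.
Proof.
move=> /(hyp_gt_norm x) h; rewrite -ltrBlDr sub0r (le_lt_trans _ h)//.
by rewrite -normrN ler_norm.
Qed.

Lemma hyp_scale rho t : 0 <= rho -> hyp rho (rho * t) = rho * hyp 1 t.
Proof.
move=> r0; rewrite /hyp -[X in _ = X * _](ger0_norm r0) -sqrtr_sqr -sqrtrM ?sqr_ge0//.
by congr Num.sqrt; ring.
Qed.

Lemma is_derive_hyp rho x : 0 < rho -> is_derive x 1 (hyp rho) (x / hyp rho x).
Proof.
move=> r0.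
have h0 : 0 < x ^+ 2 + rho ^+ 2 by rewrite -sqr_hyp exprn_gt0// hyp_gt0.
have d1 : is_derive x 1 (fun x : R => x ^+ 2 + rho ^+ 2) (2 * x).
  have : is_derive x 1 ((@id R) ^+ 2 + cst (rho ^+ 2))%R (2 * x).
    by apply: is_derive_eq; rewrite /GRing.scale/= addr0 mulr1 expr1 mulr_natl.
  by [].
have := @is_derive1_comp R Num.sqrt (fun x : R => x ^+ 2 + rho ^+ 2) x _ _ (is_derive1_sqrt h0) d1.
rewrite (_ : _ * _ = x / hyp rho x)//.
rewrite -/(hyp rho x); field; rewrite /= gt_eqF ?hyp_gt0//.
Qed.

Lemma continuous_hyp rho : continuous (hyp rho).
Proof.
move=> x; apply: (@continuous_comp _ _ _ (fun x : R => x ^+ 2 + rho ^+ 2) Num.sqrt).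
  by apply: cvgD; [exact: exprn_continuous|exact: cvg_cst].
exact: sqrt_continuous.
Qed.

Lemma measurable_hyp_comp d (T : measurableType d) (f g : T -> R) :
  measurable_fun setT f -> measurable_fun setT g ->
  measurable_fun setT (fun z : T => hyp (f z) (g z)).
Proof.
move=> mf mg; apply: (@measurableT_comp _ _ _ _ _ _ (@Num.sqrt R)).
  by apply: continuous_measurable_fun => x; exact: sqrt_continuous.
by apply: measurable_funD; apply: measurable_funX.
Qed.

(* The first coordinate of x |-> (x + |x| e_1) / 2 when the other coordinates
   have norm rho. *)
Definition halfway (rho x : R) : R := (hyp rho x + x) / 2.

Lemma is_derive_halfway rho x : 0 < rho ->
  is_derive x 1 (halfway rho) ((hyp rho x + x) / (2 * hyp rho x)).
Proof.
move=> r0.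
have d1 := is_derive_hyp x r0.
have : is_derive x 1 (2^-1 *: (hyp rho + @id R))%R ((hyp rho x + x) / (2 * hyp rho x)).
  apply: is_derive_eq; rewrite /GRing.scale/=; field.
  by rewrite gt_eqF ?hyp_gt0.
rewrite (_ : (2^-1 *: (hyp rho + id))%R = halfway rho)//.
by apply/funext => y; rewrite /halfway /GRing.scale/= mulrC.
Qed.

Lemma range_halfway rho : 0 < rho -> range (halfway rho) = `]0, +oo[%classic.
Proof.
move=> r0; apply/seteqP; split => [_ [x _ <-]|y].
  by rewrite /= in_itv/= andbT /halfway divr_gt0// hypD_gt0.
(* The solution x of sqrt (x^2 + rho^2) = 2 y - x. *)
rewrite /= in_itv/= andbT => y0; exists (y - rho ^+ 2 / (4 * y)) => //.
rewrite /halfway /hyp.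
have -> : (y - rho ^+ 2 / (4 * y)) ^+ 2 + rho ^+ 2 = (y + rho ^+ 2 / (4 * y)) ^+ 2.
  by field; rewrite gt_eqF.
rewrite sqrtr_sqr ger0_norm; last first.
  by rewrite addr_ge0 ?divr_ge0 ?sqr_ge0 ?mulr_ge0// ltW.
by field; rewrite gt_eqF.
Qed.

Notation leb := (@lebesgue_measure R).

Lemma ge0_integral_halfway rho (h : R -> \bar R) : 0 < rho ->
  measurable_fun setT h -> (forall x, (0 <= h x)%E) ->
  (\int[leb]_x (h (halfway rho x) * ((hyp rho x + x) / (2 * hyp rho x))%:E)
   = \int[leb]_x (h x * (\1_`]0%R, +oo[ x)%:E))%E.
Proof.
move=> r0 mh h0.
have d1 x := is_derive_halfway x r0.
rewrite -ge0_integral_indicr -(range_halfway r0).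
apply: (ge0_integral_substitution d1) => //.
- move=> x; apply: cvgM.
    by apply: cvgD; [exact: continuous_hyp|exact: cvg_id].
  apply: cvgV; first by rewrite mulf_neq0// gt_eqF ?hyp_gt0.
  by apply: cvgM; [exact: cvg_cst|exact: continuous_hyp].
- by move=> x; rewrite divr_gt0 ?hypD_gt0// mulr_gt0// hyp_gt0.
Qed.

(** If t is the cotangent of the angle theta to the axis, this is sin theta, and t * hcos t is cos
    theta. *)
Definition hcos t : R := (hyp 1 t)^-1.

Lemma hcos_gt0 t : 0 < hcos t.
Proof. by rewrite invr_gt0 hyp_gt0. Qed.

Lemma hcos_atan t : cos (atan t) = hcos t.
Proof. by rewrite cos_atan /hcos /hyp expr1n addrC. Qed.

Lemma sin_atan t : sin (atan t) = t * hcos t.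
Proof.
have := atanK t; rewrite /tan hcos_atan => {2}<-.
by rewrite mulfVK// gt_eqF// hcos_gt0.
Qed.

Lemma measurable_hcos : measurable_fun setT hcos.
Proof.
apply: continuous_measurable_fun => x; apply: cvgV; last exact: continuous_hyp.
by rewrite gt_eqF ?hyp_gt0.
Qed.

(** With t = cot theta this is the integral of sin(theta)^(n-2) over (0, pi): the total mass of the
    zonal density on the sphere of R^n. *)
Definition sphere_mass (n : nat) : \bar R := (\int[leb]_t (hcos t ^+ n)%:E)%E.

Lemma hcos_le1 t : hcos t <= 1.
Proof. by rewrite -hcos_atan cos_le1. Qed.

Lemma sqr_hcos t : hcos t ^+ 2 = (1 + t ^+ 2)^-1.
Proof. by rewrite /hcos exprVn sqr_hyp expr1n addrC. Qed.

Lemma atan_pi2_range : range (fun t : R => atan t + pi / 2) = `]0, pi[%classic.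
Proof.
apply/seteqP; split => [_ [t _ <-]|y].
  rewrite /= in_itv/=; have := atan_gtNpi2 t; have := atan_ltpi2 t => h1 h2.
  by apply/andP; split; lra.
rewrite /= in_itv/= => /andP[y0 ypi]; exists (tan (y - pi / 2)) => //.
by rewrite tanK ?subrK// in_itv/=; apply/andP; split; lra.
Qed.

Lemma ge0_integral_atan (h : R -> \bar R) :
  measurable_fun setT h -> (forall x, (0 <= h x)%E) ->
  (\int[leb]_t (h (atan t + pi / 2)%R * (hcos t ^+ 2)%:E)
   = \int[leb]_(x in `]0%R, pi[) h x)%E.
Proof.
move=> mh h0; rewrite -atan_pi2_range.
have d1 x : is_derive x 1 (fun t : R => atan t + pi / 2) (hcos x ^+ 2).
  have : is_derive x 1 (@atan R + cst (pi / 2))%R (hcos x ^+ 2).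
    by apply: is_derive_eq; rewrite addr0 sqr_hcos.
  by [].
apply: (ge0_integral_substitution d1) => //.
- move=> x; apply: (@cvgM _ _ _ _ hcos hcos); (apply: cvgV; [by rewrite gt_eqF ?hyp_gt0|exact: continuous_hyp]).
- by move=> x; rewrite exprn_gt0// hcos_gt0.
Qed.

Lemma sphere_mass_lty n : (2 <= n)%N -> (sphere_mass n < +oo)%E.
Proof.
move=> n2; have H := @ge0_integral_atan (cst 1%E) (measurable_cst _) (fun=> lee01).
have Hp : (\int[leb]_(x in `]0%R, pi[) cst 1%E x = pi%:E)%E.
  rewrite integral_cst; last exact: measurable_itv.
  have := @lebesgue_measure_itv R `]0, pi[; rewrite /= lte_fin pi_gt0 sube0 mul1e.
  exact.
apply: (@le_lt_trans _ _ (\int[leb]_t (1 * (hcos t ^+ 2)%:E))%E); last first.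
  by rewrite H Hp ltry.
apply: ge0_le_integral => //.
- by move=> t _; rewrite lee_fin exprn_ge0// ltW// hcos_gt0.
- by apply/measurable_EFinP; apply: measurable_funX; exact: measurable_hcos.
- apply: emeasurable_funM => //.
  by apply/measurable_EFinP; apply: measurable_funX; exact: measurable_hcos.
- move=> t _; rewrite mul1e lee_fin.
  by apply: ler_wiXn2l => //; [exact/ltW/hcos_gt0|exact: hcos_le1].
Qed.
End hypotenuse.

Section zonal.
Context {R : realType}.
Notation leb := (@lebesgue_measure R).
Notation lam := (lebesgue_tuple R).
Notation S n := (@uniform_sphere R n).

Definition axis1 n : n.+1.-tuple R := cons_pair (1, origin).

Lemma dotp_origin n (v : n.-tuple R) : dotp v origin = 0.
Proof. by rewrite /dotp big1// => i _; rewrite tnth_origin mulr0. Qed.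

Lemma dotp_axis1 n (x : R) (y : n.-tuple R) : dotp (cons_pair (x, y)) (axis1 n) = x.
Proof. by rewrite dotp_cons dotp_origin mulr1 addr0. Qed.

Lemma enorm_axis1 n : enorm (axis1 n) = 1.
Proof. by rewrite /enorm dotp_axis1 sqrtr1. Qed.

Lemma enorm_cons n (x : R) (y : n.-tuple R) : enorm (cons_pair (x, y)) = hyp (enorm y) x.
Proof. by rewrite /enorm dotp_cons /hyp sqr_enorm -expr2. Qed.

Lemma ae_enorm_gt0 n : (0 < n)%N -> {ae lam n, forall y : n.-tuple R, 0 < enorm y}.
Proof.
move=> n0.
have m0 : measurable [set w : n.-tuple R | enorm w = 0].
  rewrite (_ : [set _ | _] = (@enorm R n) @^-1` [set 0]); last by apply/seteqP; split.
  by rewrite -[X in measurable X]setTI; exact: measurable_enorm.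
exists [set w : n.-tuple R | enorm w = 0]; split => //.
  by rewrite -[X in lam n X]setIT -integral_indic// lebesgue_origin.
move=> y /= h; apply/eqP; apply: contra_notT h => y0.
by rewrite lt_neqAle eq_sym y0 enorm_ge0.
Qed.

Let C n : \bar R := ((fine (lam n.+1 unit_ball))^-1%:E *
  \int[lam n]_y (enorm y * \1_unit_ball y)%:E)%E.

(** Let y be the last n coordinates of a point of the ball and |y| t the first one. Rescaling y by
    hcos t separates the variables; the exponent n + 1 of hcos t comes from the volume (n) and from
    the factor |y| (one). *)
Let zonal_axis n (h : R -> \bar R) : (0 < n)%N ->
  measurable_fun setT h -> (forall x, (0 <= h x)%E) ->
  (\int[S n.+1]_s h (dotp s (axis1 n)) =
   C n * \int[leb]_t (h (t * hcos t)%R * (hcos t ^+ n.+1)%:E))%E.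
Proof.
move=> n0 mh h0.
have mB := @measurable_unit_ball R.
have mind m : measurable_fun setT (\1_unit_ball : m.-tuple R -> R).
  by apply: measurable_indic; exact: mB.
have mhc := @measurable_hcos R.
rewrite ge0_integral_uniform_sphere//; last first.
  by apply: (measurableT_comp mh); exact: measurable_dotp.
rewrite /C -muleA; congr (_ * _)%E.
pose G (v : n.+1.-tuple R) := (h (dotp (direction v) (axis1 n)) * (\1_unit_ball v)%:E)%E.
have mG : measurable_fun setT G.
  apply: emeasurable_funM; last by apply/measurable_EFinP; exact: mind.
  by apply: (measurableT_comp mh); apply: measurable_dotp => //; exact: measurable_direction.
have G0 v : (0 <= G v)%E by rewrite mule_ge0// EFin_indic_ge0.
rewrite -/(integral _ _ G) ge0_integral_lebesgue_tupleS_swap//.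
pose K (z : n.-tuple R * R) : \bar R :=
  (h (z.2 * hcos z.2)%R * (enorm z.1 * \1_unit_ball (vscale (hyp 1 z.2) z.1))%:E)%E.
have K0 z : (0 <= K z)%E.
  by rewrite mule_ge0// lee_fin mulr_ge0 ?enorm_ge0// indicE.
have mK : measurable_fun setT K.
  apply: emeasurable_funM.
    apply: (measurableT_comp mh); apply: measurable_funM; first exact: measurable_snd.
    by apply: (measurableT_comp mhc); exact: measurable_snd.
  apply/measurable_EFinP; apply: measurable_funM.
    by apply: measurable_enorm_comp; exact: measurable_fst.
  apply: (measurableT_comp (mind n)); apply: measurable_vscale; last exact: measurable_fst.
  by apply: measurable_hyp_comp => //; exact: measurable_snd.
transitivity (\int[lam n]_y \int[leb]_t K (y, t))%E.
  have mF : measurable_fun setT (fun y => \int[leb]_x G (cons_pair (x, y)))%E.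
    apply: (@measurable_fun_fubini_tonelli_G _ _ _ _ _ leb (G \o @cons_pair R n)) => //.
      by apply: measurableT_comp => //; exact: measurable_cons_pair.
    by move=> ?; exact: G0.
  apply: ge0_ae_eq_integral => //.
  - exact: (measurable_fun_fubini_tonelli_F (m2 := leb) K).
  - by move=> y _; apply: integral_ge0 => x _; exact: G0.
  - by move=> y _; exact: integral_ge0.
  apply: filterS (ae_enorm_gt0 n0) => y y0 _.
  have mGy : measurable_fun setT (fun x : R => G (cons_pair (x, y))).
    apply: (measurableT_comp mG); apply: (measurableT_comp (measurable_cons_pair (R := R) (n := n))).
    exact: measurable_pair2.
  rewrite -(ge0_integral_dilation y0 mGy)//.
  apply: eq_integral => t _; rewrite /G /K/= direction_vscale dotpZl dotp_axis1 enorm_cons.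
  rewrite hyp_scale ?ltW//.
  rewrite (_ : (_^-1 * _)%R = (t * hcos t)%R); last first.
    by rewrite /hcos; field; rewrite !gt_eqF ?hyp_gt0.
  rewrite -muleA -EFinM; congr (_ * _%:E)%E; rewrite mulrC; congr (_ * _).
  apply: eq_indic; rewrite /unit_ball/= enorm_cons hyp_scale ?(ltW y0)// enormZ.
  by rewrite ger0_norm ?(ltW (hyp_gt0 _ _))// mulrC.
rewrite (@fubini_tonelli _ _ _ (measurableTypeR R) _ (lam n) leb K mK K0).
pose c1 : \bar R := (\int[lam n]_y (enorm y * \1_unit_ball y)%:E)%E.
rewrite -/c1 muleC -ge0_integralZr//; last 3 first.
- apply: emeasurable_funM.
    by apply: (measurableT_comp mh); exact: measurable_funM.
  by apply/measurable_EFinP; exact: measurable_funX.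
- by move=> t _; rewrite mule_ge0// lee_fin exprn_ge0// ltW// hcos_gt0.
- by apply: integral_ge0 => y _; rewrite lee_fin mulr_ge0 ?enorm_ge0// indicE.
apply: eq_integral => t _; rewrite /K/= ge0_integralZl//; last 2 first.
- apply/measurable_EFinP; apply: measurable_funM; first exact: measurable_enorm.
  by apply: (measurableT_comp (mind n)); exact: measurable_vscale.
- by move=> y _; rewrite lee_fin mulr_ge0 ?enorm_ge0// indicE.
rewrite -muleA; congr (_ * _)%E.
rewrite -(ge0_integral_vscale (hcos_gt0 t)); last 2 first.
- apply/measurable_EFinP; apply: measurable_funM; first exact: measurable_enorm.
  by apply: (measurableT_comp (mind n)); exact: measurable_vscale.
- by move=> y; rewrite lee_fin mulr_ge0 ?enorm_ge0// indicE.
rewrite /c1 -ge0_integralZl ?lee_fin ?exprn_ge0 ?(ltW (hcos_gt0 t))//; last 2 first.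
- apply/measurable_EFinP; apply: measurable_funM; first exact: measurable_enorm.
  exact: mind.
- by move=> y _; rewrite lee_fin mulr_ge0 ?enorm_ge0// indicE.
apply: eq_integral => y _; rewrite -!EFinM; congr (_%:E).
rewrite enormZ ger0_norm ?(ltW (hcos_gt0 t))// exprS.
rewrite (_ : \1_unit_ball (vscale (hyp 1 t) _) = \1_unit_ball y :> R); first ring.
congr (\1_unit_ball _); apply: eq_from_tnth => i; rewrite !vtnthE mulrA /hcos.
by rewrite divff ?mul1r// gt_eqF// hyp_gt0.
Qed.

Lemma ge0_zonal n (e : n.-tuple R) (h : R -> \bar R) : (2 <= n)%N -> enorm e = 1 ->
  measurable_fun setT h -> (forall x, (0 <= h x)%E) ->
  (\int[S n]_s h (dotp s e) = (fine (sphere_mass n))^-1%:E *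
    \int[leb]_t (h (t * hcos t)%R * (hcos t ^+ n)%:E))%E.
Proof.
case: n e => [//|n] e n2 e1 mh h0; have n0 : (0 < n)%N by [].
rewrite (@ge0_sphere_zonal _ _ e (axis1 n)) ?enorm_axis1// zonal_axis//.
congr (_ * _)%E.
(* The constant [C n] is identified by taking h = 1, instead of being computed. *)
have S1 : (\int[S n.+1]_s (cst 1%E (dotp s (axis1 n))) = 1)%E.
  by rewrite -[RHS](probability_setT (S n.+1)) -[RHS]mul1e -integral_cst.
have := zonal_axis n0 (measurable_cst (1%E : \bar R)) (fun=> lee01).
rewrite S1.
under eq_integral do rewrite mul1e.
rewrite -/(sphere_mass n.+1) => H.
have mfin : sphere_mass n.+1 \is a @fin_num R.
  rewrite ge0_fin_numE ?sphere_mass_lty//; apply: integral_ge0 => t _.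
  by rewrite lee_fin exprn_ge0// ltW// hcos_gt0.
have m0 : fine (sphere_mass n.+1) != 0 :> R.
  apply/eqP => m0; move: H; rewrite -(fineK mfin) m0 mule0 => /eqP.
  by rewrite eqe oner_eq0.
have : (C n * (fine (sphere_mass n.+1))%:E * (fine (sphere_mass n.+1))^-1%:E =
   1%:E * (fine (sphere_mass n.+1))^-1%:E)%E by rewrite fineK// -H.
by rewrite -muleA -EFinM mulfV// mule1 mul1e.
Qed.

Lemma sphere_mass_gt0 n : (2 <= n)%N -> 0 < fine (sphere_mass n : \bar R).
Proof.
move=> n2.
have e : {e : n.-tuple R | enorm e = 1}.
  by case: n n2 => // n _; exists (axis1 n); exact: enorm_axis1.
have S1 : (\int[S n]_s (cst 1%E (dotp s (sval e))) = 1)%E.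
  by rewrite -[RHS](probability_setT (S n)) -[RHS]mul1e -integral_cst.
have := ge0_zonal n2 (svalP e) (measurable_cst (1%E : \bar R)) (fun=> lee01).
rewrite S1 => H.
rewrite lt_neqAle fine_ge0 ?andbT; last first.
  by apply: integral_ge0 => t _; rewrite lee_fin exprn_ge0// ltW// hcos_gt0.
apply/eqP => h; move: H; rewrite -h invr0 mul0e => /eqP.
by rewrite eqe oner_eq0.
Qed.
End zonal.

(** * The constant kappa *)

Section zonal_constants.
Context {R : realType}.
Notation leb := (@lebesgue_measure R).
Notation lam := (lebesgue_tuple R).
Notation S n := (@uniform_sphere R n).

Lemma one_hcos (t : R) : (1 + t * hcos t) / 2 = (hyp 1 t + t) / (2 * hyp 1 t).
Proof. by rewrite /hcos; field; rewrite gt_eqF// hyp_gt0. Qed.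

Lemma one_hcos_gt0 (t : R) : 0 < (1 + t * hcos t) / 2.
Proof. by rewrite one_hcos divr_gt0 ?hypD_gt0// mulr_gt0// hyp_gt0. Qed.

(* The mean of cos(theta/2)^r on the sphere, theta being the angle to a fixed axis. *)
Definition half_angle_mean (n : nat) (r : R) : \bar R :=
  ((fine (sphere_mass n))^-1%:E *
   \int[leb]_t ((((1 + t * hcos t) / 2) `^ (r / 2))%:E * (hcos t ^+ n)%:E))%E.

Lemma half_angle_mean_ge0 n r : (0 <= half_angle_mean n r)%E.
Proof.
apply: mule_ge0.
  rewrite lee_fin invr_ge0 fine_ge0//; apply: integral_ge0 => t _.
  by rewrite lee_fin exprn_ge0// ltW// hcos_gt0.
by apply: integral_ge0 => t _; rewrite -EFinM lee_fin mulr_ge0 ?powR_ge0// exprn_ge0// ltW// hcos_gt0.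
Qed.

Lemma sphere_half_angle n (e : n.-tuple R) r : (2 <= n)%N -> enorm e = 1 ->
  (\int[S n]_s (((1 + dotp s e) / 2) `^ (r / 2))%:E = half_angle_mean n r)%E.
Proof.
move=> n2 e1.
rewrite (ge0_zonal n2 e1 (h := fun u => (((1 + u) / 2) `^ (r / 2))%:E))//; last first.
  by move=> u; rewrite lee_fin powR_ge0.
apply/measurable_EFinP; apply: (measurableT_comp (measurable_powR _)).
by apply: measurable_funM => //; exact: measurable_funD.
Qed.

(** A doubling of the angle: if t = cot theta then 2 * halfway 1 t = cot (theta / 2), which maps
    angles in (0, pi) to their halves in (0, pi/2), the domain of the positive part. It identifies
    the constant that the Jacobian of xi |-> xi+ will produce. *)
Lemma sphere_positive_part n (e : n.-tuple R) r : (2 <= n)%N -> enorm e = 1 ->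
  ((2 ^+ n.-1)%:E * \int[S n]_s ((dotp s e `^ (n%:R + r - 2))%:E *
    (\1_`]0%R, +oo[ (dotp s e))%:E) = half_angle_mean n r)%E.
Proof.
move=> n2 e1.
pose h (u : R) : \bar R := ((u `^ (n%:R + r - 2))%:E * (\1_`]0%R, +oo[ u)%:E)%E.
have mI : measurable (`]0%R, +oo[ : set R) by exact: measurable_itv.
have mind : measurable_fun setT (fun u : R => (\1_`]0%R, +oo[ u)%:E : \bar R).
  by apply/measurable_EFinP; exact: measurable_indic.
have mh : measurable_fun setT h.
  apply: emeasurable_funM => //.
  by apply/measurable_EFinP; exact: measurable_powR.
have h0 u : (0 <= h u)%E by rewrite mule_ge0// lee_fin ?powR_ge0// indicE.
rewrite (ge0_zonal n2 e1 (h := h))// /half_angle_mean muleCA; congr (_ * _)%E.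
pose g (u : R) : \bar R := (((2 ^+ n.-1) * ((u * hcos u) `^ (n%:R + r - 2)) * (hcos u ^+ n))%:E
  * (\1_`]0%R, +oo[ u)%:E)%E.
have mg : measurable_fun setT g.
  apply: emeasurable_funM => //; apply/measurable_EFinP.
  apply: measurable_funM; last by apply: measurable_funX; exact: measurable_hcos.
  apply: measurable_funM => //; apply: (measurableT_comp (measurable_powR _)).
  by apply: measurable_funM => //; exact: measurable_hcos.
have g0 u : (0 <= g u)%E.
  by rewrite mule_ge0// lee_fin ?indicE// !mulr_ge0// ?powR_ge0// exprn_ge0// ltW// hcos_gt0.
have E1 : ((2 ^+ n.-1)%:E * \int[leb]_t (h (t * hcos t)%R * (hcos t ^+ n)%:E) = \int[leb]_t g t)%E.
  rewrite -ge0_integralZl//; last 2 first.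
  - apply: emeasurable_funM; last first.
      by apply/measurable_EFinP; apply: measurable_funX; exact: measurable_hcos.
    by apply: (measurableT_comp mh); apply: measurable_funM => //; exact: measurable_hcos.
  - by move=> t _; rewrite mule_ge0// lee_fin exprn_ge0// ltW// hcos_gt0.
  - apply: eq_integral => t _; rewrite /g /h.
    have -> : \1_`]0%R, +oo[ (t * hcos t) = \1_`]0%R, +oo[ t :> R.
      by apply: eq_indic; rewrite /= !in_itv/= !andbT pmulr_lgt0 ?hcos_gt0.
    by rewrite -!EFinM; congr (_%:E); ring.
have two0 : 0 < 2 :> R by [].
rewrite E1 -(ge0_integral_dilation two0 mg g0).
pose k (u : R) : \bar R := (((2 ^+ n) * ((2 * u * hcos (2 * u)) `^ (n%:R + r - 2)) * (hcos (2 * u) ^+ n))%:E)%E.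
have mk : measurable_fun setT k.
  have m2 : measurable_fun setT (fun u : R => hcos (2 * u)).
    by apply: (measurableT_comp measurable_hcos); exact: measurable_funM.
  apply/measurable_EFinP; apply: measurable_funM; last exact: measurable_funX.
  apply: measurable_funM => //; apply: (measurableT_comp (measurable_powR _)).
  by apply: measurable_funM => //; exact: measurable_funM.
have k0 u : (0 <= k u)%E.
  by rewrite lee_fin !mulr_ge0// ?powR_ge0// exprn_ge0// ltW// hcos_gt0.
transitivity (\int[leb]_x (k x * (\1_`]0%R, +oo[ x)%:E))%E.
  apply: eq_integral => x _; rewrite /g /k.
  have -> : \1_`]0%R, +oo[ (2 * x) = \1_`]0%R, +oo[ x :> R.
    by apply: eq_indic; rewrite /= !in_itv/= !andbT pmulr_rgt0.
  rewrite -!EFinM; congr (_%:E); have -> : 2 ^+ n = 2 * 2 ^+ n.-1 :> R by rewrite -exprS prednK// ltnW.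
  by ring.
rewrite -(ge0_integral_halfway ltr01 mk k0); apply: eq_integral => t _.
rewrite /k -!EFinM; congr (_%:E).
have Y0 := hyp_gt0 t (@ltr01 R); have q0 := hypD_gt0 t (@ltr01 R).
rewrite one_hcos /halfway.
have Hq : hyp 1 (2 * ((hyp 1 t + t) / 2)) = Num.sqrt (2 * (hyp 1 t + t) * hyp 1 t).
  rewrite /hyp -/(hyp 1 t); congr Num.sqrt.
  by have := sqr_hyp 1 t; nra.
rewrite /hcos Hq.
rewrite (_ : 2 * ((hyp 1 t + t) / 2) = hyp 1 t + t); last by field.
rewrite -!powR_mulrn ?invr_ge0 ?sqrtr_ge0 ?ltW//.
rewrite -powR12_sqrt ?mulr_ge0 ?ltW//.
set Y := hyp 1 t in Y0 q0 *; set q := Y + t in q0 *.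
(* Writing each positive factor as an exponential turns the identity between real powers into a
   linear identity between exponents. *)
have [a qE] : exists a, q = expR a by exists (ln q); rewrite lnK.
have [b YE] : exists b, Y = expR b by exists (ln Y); rewrite lnK.
have [l lE] : exists l, 2 = expR l :> R by exists (ln 2); rewrite lnK.
rewrite qE YE lE -!(expRN, expRD, expRM).
by rewrite !(expRN l) -lE; congr expR; field.
Qed.

Lemma kappa_int (n : nat) r : (2 <= n)%N -> 0 < r ->
  (\int[leb]_(theta in `[0%R, pi]) (sin (theta / 2) `^ r * sin theta ^+ (n - 2))%:E =
   \int[leb]_t ((((1 + t * hcos t) / 2) `^ (r / 2))%:E * (hcos t ^+ n)%:E))%E.
Proof.
move=> n2 r0.
(* Positive parts make the integrand nonnegative on the whole line, as the substitution requires; on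
   [0, pi] they change nothing. *)
pose h0 (x : R) : R := Num.max 0 (sin (x / 2)) `^ r * Num.max 0 (sin x) ^+ (n - 2).
pose h (x : R) : \bar R := (h0 x)%:E.
have h0_ge0 x : 0 <= h0 x by rewrite mulr_ge0 ?powR_ge0// exprn_ge0// le_max lexx.
have msin2 : measurable_fun setT (fun x : R => sin (x / 2)).
  apply: (@measurableT_comp _ _ _ _ _ _ (@sin R)); last exact: measurable_funM.
  by apply: continuous_measurable_fun; exact: continuous_sin.
have mh : measurable_fun setT h.
  apply/measurable_EFinP; apply: measurable_funM.
    apply: (measurableT_comp (measurable_powR _)).
    exact: measurable_maxr.
  apply: measurable_funX; apply: measurable_maxr => //.
  by apply: continuous_measurable_fun; exact: continuous_sin.
transitivity (\int[leb]_(x in `]0%R, pi[) h x)%E.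
  transitivity (\int[leb]_(x in `[0%R, pi]) h x)%E; last first.
    by apply: integral_itv_bndoo; exact: measurable_funTS.
  apply: eq_integral => x; rewrite inE/= in_itv/= => /andP[x0 xpi].
  rewrite /h /h0 !max_r//.
    by apply: sin_ge0_pi; rewrite x0.
  by apply: sin_ge0_pi; rewrite divr_ge0//=; have := pi_gt0 R; lra.
have hE x : (0 <= h x)%E by rewrite lee_fin.
rewrite -(ge0_integral_atan mh hE); apply: eq_integral => t _.
rewrite /h /h0 -!EFinM; congr (_%:E).
have s1 : sin (atan t + pi / 2) = hcos t.
  by rewrite sinD cos_pihalf sin_pihalf mulr0 mulr1 add0r hcos_atan.
have cE : cos (atan t + pi / 2) = - (t * hcos t).
  by rewrite cosD cos_pihalf sin_pihalf mulr0 mulr1 sub0r sin_atan.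
have a1 := atan_gtNpi2 t; have a2 := atan_ltpi2 t.
have s20 : 0 <= sin ((atan t + pi / 2) / 2).
  by apply: sin_ge0_pi; have pi0 := pi_gt0 R; apply/andP; split; lra.
have s2 : sin ((atan t + pi / 2) / 2) ^+ 2 = (1 + t * hcos t) / 2.
  have := cosD ((atan t + pi / 2) / 2) ((atan t + pi / 2) / 2).
  rewrite -splitr cE -!expr2 => H; have := cos2Dsin2 ((atan t + pi / 2) / 2).
  by move=> H2; lra.
rewrite s1 !max_r ?(ltW (hcos_gt0 _))// -s2.
have -> : (sin ((atan t + pi / 2) / 2) ^+ 2) `^ (r / 2) = sin ((atan t + pi / 2) / 2) `^ r.
  by rewrite -powR_mulrn// -powRrM; congr (_ `^ _); field.
by rewrite -mulrA -exprD subnK.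
Qed.

Lemma half_angle_int_lty n r : (2 <= n)%N -> 0 < r ->
  (\int[leb]_t ((((1 + t * hcos t) / 2) `^ (r / 2))%:E * (hcos t ^+ n)%:E) < +oo)%E.
Proof.
move=> n2 r0.
apply: le_lt_trans (sphere_mass_lty (R := R) n2).
apply: ge0_le_integral => //.
- by move=> t _; rewrite mule_ge0// lee_fin ?powR_ge0// exprn_ge0// ltW// hcos_gt0.
- apply: emeasurable_funM; apply/measurable_EFinP.
    apply: (measurableT_comp (measurable_powR _)); apply: measurable_funM => //.
    apply: measurable_funD => //; apply: measurable_funM => //; exact: measurable_hcos.
  by apply: measurable_funX; exact: measurable_hcos.
- by apply/measurable_EFinP; apply: measurable_funX; exact: measurable_hcos.
- move=> t _; rewrite -EFinM lee_fin ler_piMl ?exprn_ge0 ?(ltW (hcos_gt0 _))//.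
  have u1 : (1 + t * hcos t) / 2 <= 1.
    rewrite ler_pdivrMr// mul1r -lerBrDl (_ : 2 - 1 = 1); last by lra.
    by rewrite -sin_atan sin_le1.
  rewrite -[leRHS](powRr0 ((1 + t * hcos t) / 2)).
  by apply: ger_powR; [rewrite one_hcos_gt0/=|rewrite divr_ge0// ltW].
Qed.

Lemma half_angle_mean_lty n r : (2 <= n)%N -> 0 < r -> (half_angle_mean n r < +oo)%E.
Proof.
move=> n2 r0; rewrite /half_angle_mean lte_mul_pinfty ?half_angle_int_lty//.
by rewrite lee_fin invr_ge0 ltW// sphere_mass_gt0.
Qed.

(** The Gamma function with values in the extended reals, so that identities can be proved before
    finiteness is known. *)
Definition gamma_int (a : R) : \bar R :=
  (\int[leb]_(t in `]0%R, +oo[) (t `^ (a - 1) * expR (- t))%:E)%E.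

Let gi (a : R) (t : R) : R := t `^ (a - 1) * expR (- t) * \1_`]0, +oo[ t.

Let mpos : measurable_fun setT (\1_`]0, +oo[ : R -> R).
Proof. by apply: measurable_indic; exact: measurable_itv. Qed.

Let mexpN : measurable_fun setT (fun t : R => expR (- t)).
Proof. by apply: measurableT_comp => //; exact: measurable_expR. Qed.

Let mgi a : measurable_fun setT (gi a).
Proof.
apply: measurable_funM; last exact: mpos.
by apply: measurable_funM => //; exact: measurable_powR.
Qed.

Let gi_ge0 a t : 0 <= gi a t.
Proof. by rewrite !mulr_ge0 ?powR_ge0 ?expR_ge0// indicE. Qed.

Let gamma_intE a : (gamma_int a = \int[leb]_t (gi a t)%:E)%E.
Proof.
by rewrite /gamma_int ge0_integral_indicr; apply: eq_integral => t _; rewrite -EFinM.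
Qed.

Let pos_indic (c t : R) : 0 < c -> \1_`]0, +oo[ (c * t) = \1_`]0, +oo[ t :> R.
Proof. by move=> c0; apply: eq_indic; rewrite /= !in_itv/= !andbT pmulr_rgt0. Qed.

Let gamma_dilation a c : 0 < c ->
  (\int[leb]_t (t `^ (a - 1) * expR (- (c * t)) * \1_`]0, +oo[ t)%:E =
   (c `^ (- a))%:E * gamma_int a)%E.
Proof.
move=> c0; rewrite gamma_intE.
rewrite -(@ge0_integral_dilation R c (fun t => (gi a t)%:E)) //; last 2 first.
- by apply/measurable_EFinP; exact: mgi.
- by move=> t; rewrite lee_fin; exact: gi_ge0.
rewrite -ge0_integralZl ?lee_fin ?powR_ge0//; last 2 first.
- apply/measurable_EFinP; apply: measurable_funM => //.
  by apply: (measurableT_comp (mgi a)); exact: measurable_funM.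
- by move=> t _; rewrite lee_fin mulr_ge0 ?gi_ge0// ltW.
apply: eq_integral => t _; rewrite -!EFinM; congr (_%:E); rewrite /gi pos_indic//.
have [t0|t0] := ltP 0 t; last first.
  have -> : \1_`]0, +oo[ t = 0 :> R by rewrite indicE memNset//= in_itv/= andbT; apply/negP; rewrite -leNgt.
  by rewrite !(mulr0, mul0r).
rewrite powRM ?ltW//.
have -> : c `^ (- a) * (c `^ (a - 1) * t `^ (a - 1) * expR (- (c * t)) * \1_`]0, +oo[ t * c) =
  (c `^ (- a) * c `^ (a - 1) * c) * (t `^ (a - 1) * expR (- (c * t)) * \1_`]0, +oo[ t) by ring.
have -> : c `^ (- a) * c `^ (a - 1) * c = 1.
  rewrite -[X in _ * X](powRr1 (ltW c0)) -!powRD ?(gt_eqF c0) ?implybT//.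
  by rewrite (_ : _ + 1 = 0) ?powRr0//; ring.
by rewrite mul1r.
Qed.

(** The beta integral: with the second variable written x y, integrating first in x leaves the
    integral of y^(a-1) (1+y)^(-2a), and y = (t + sqrt (1 + t^2))^2 turns it into 2^(2-n) times
    [sphere_mass]. *)
Lemma gamma_int_sqr (n : nat) a : (2 <= n)%N -> 2 * a = n%:R - 1 ->
  (gamma_int a * gamma_int a =
   gamma_int (2 * a) * ((2 `^ (2 - n%:R))%:E * sphere_mass n))%E.
Proof.
move=> n2 an.
pose K (z : R * measurableTypeR R) : \bar R :=
  ((z.1 `^ (2 * a - 1) * expR (- z.1) * \1_`]0, +oo[ z.1) *
   (z.2 `^ (a - 1) * expR (- (z.1 * z.2)) * \1_`]0, +oo[ z.2))%:E.
have K0 z : (0 <= K z)%E by rewrite lee_fin !mulr_ge0 ?powR_ge0 ?expR_ge0// indicE.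
have m1 : measurable_fun setT (fun z : R * measurableTypeR R => z.1) by exact: measurable_fst.
have m2 : measurable_fun setT (fun z : R * measurableTypeR R => z.2) by exact: measurable_snd.
have mK : measurable_fun setT K.
  apply/measurable_EFinP; apply: measurable_funM.
    exact: (measurableT_comp (mgi (2 * a)) m1).
  apply: measurable_funM; last exact: (measurableT_comp mpos m2).
  apply: measurable_funM; first exact: (measurableT_comp (measurable_powR _) m2).
  by apply: (measurableT_comp mexpN); exact: measurable_funM.
transitivity (\int[leb]_x \int[leb]_y K (x, y))%E.
  rewrite {1}gamma_intE -ge0_integralZr//; last 3 first.
  - by apply/measurable_EFinP; exact: mgi.
  - by move=> t _; rewrite lee_fin; exact: gi_ge0.
  - by apply: integral_ge0 => t _; rewrite lee_fin mulr_ge0 ?powR_ge0 ?expR_ge0.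
  apply: eq_integral => x _; rewrite /K/=.
  have [x0|x0] := ltP 0 x; last first.
    have x1 : \1_`]0, +oo[ x = 0 :> R.
      by rewrite indicE memNset//= in_itv/= andbT; apply/negP; rewrite -leNgt.
    rewrite /gi x1 !mulr0 mul0e; apply/esym; rewrite integral0_eq// => y _.
    by rewrite mul0r.
  under eq_integral do rewrite EFinM.
  rewrite ge0_integralZl//; last 3 first.
  - apply/measurable_EFinP; apply: measurable_funM; last exact: mpos.
    apply: measurable_funM; first exact: measurable_powR.
    by apply: (measurableT_comp mexpN); exact: measurable_funM.
  - by move=> t _; rewrite lee_fin !mulr_ge0 ?powR_ge0 ?expR_ge0// indicE.
  - by rewrite lee_fin !mulr_ge0 ?powR_ge0 ?expR_ge0// indicE.
  rewrite gamma_dilation// muleA; congr (_ * _)%E; rewrite -EFinM; congr (_%:E).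
  rewrite /gi.
  have -> : x `^ (2 * a - 1) * expR (- x) * \1_`]0, +oo[ x * x `^ (- a) =
    x `^ (2 * a - 1) * x `^ (- a) * expR (- x) * \1_`]0, +oo[ x by ring.
  by rewrite -powRD ?(gt_eqF x0) ?implybT//; congr (_ `^ _ * _ * _); ring.
rewrite (@fubini_tonelli _ _ (measurableTypeR R) (measurableTypeR R) _ leb leb K mK K0).
transitivity (\int[leb]_y (gamma_int (2 * a) * (y `^ (a - 1) * (1 + y) `^ (- (2 * a)) * \1_`]0, +oo[ y)%:E))%E.
  apply: eq_integral => y _; rewrite /K/=.
  have [y0|y0] := ltP 0 y; last first.
    have y1 : \1_`]0, +oo[ y = 0 :> R.
      by rewrite indicE memNset//= in_itv/= andbT; apply/negP; rewrite -leNgt.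
    rewrite y1 !mulr0 mule0 integral0_eq// => x _.
    by rewrite !mulr0.
  have y11 : \1_`]0, +oo[ y = 1 :> R by rewrite indicE mem_set//= in_itv/= andbT.
  rewrite y11 !mulr1.
  transitivity (\int[leb]_x ((y `^ (a - 1))%:E * (x `^ (2 * a - 1) * expR (- ((1 + y) * x)) * \1_`]0, +oo[ x)%:E))%E.
    apply: eq_integral => x _; rewrite -EFinM; congr (_%:E).
    rewrite mulr1 (_ : - ((1 + y) * x) = - x + - (x * y)); last by ring.
    by rewrite expRD; ring.
  rewrite ge0_integralZl ?lee_fin ?powR_ge0//; last 2 first.
  - apply/measurable_EFinP; apply: measurable_funM; last exact: mpos.
    apply: measurable_funM; first exact: measurable_powR.
    by apply: (measurableT_comp mexpN); exact: measurable_funM.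
  - by move=> t _; rewrite lee_fin !mulr_ge0 ?powR_ge0 ?expR_ge0// indicE.
  rewrite gamma_dilation ?addr_gt0// muleA -EFinM muleC//.
pose g (y : R) : \bar R := (y `^ (a - 1) * (1 + y) `^ (- (2 * a)) * \1_`]0, +oo[ y)%:E.
have mg : measurable_fun setT g.
  apply/measurable_EFinP; apply: measurable_funM; last exact: mpos.
  apply: measurable_funM; first exact: measurable_powR.
  by apply: (measurableT_comp (measurable_powR _)); exact: measurable_funD.
have g0 y : (0 <= g y)%E by rewrite lee_fin !mulr_ge0 ?powR_ge0// indicE.
rewrite ge0_integralZl//; last 2 first.
- by move=> y _; exact: g0.
- by apply: integral_ge0 => t _; rewrite lee_fin mulr_ge0 ?powR_ge0 ?expR_ge0.
congr (_ * _)%E.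
transitivity (\int[leb]_y g y)%E => //.
pose p (t : R) := hyp 1 t + t.
have p0 t : 0 < p t by exact: hypD_gt0.
have Y0 (t : R) : 0 < hyp 1 t by exact: hyp_gt0.
pose phi (t : R) := p t ^+ 2.
have dphi (t : R) : is_derive t 1 phi (2 * p t ^+ 2 / hyp 1 t).
  have d1 := is_derive_hyp t (@ltr01 R).
  have : is_derive t 1 ((hyp 1 + @id R)^+2)%R (2 * p t ^+ 2 / hyp 1 t).
    apply: is_derive_eq; rewrite /GRing.scale/= expr1 -[(_ + _)%R t]/(p t).
    by rewrite /p; field; rewrite gt_eqF.
  by [].
have rphi : range phi = `]0, +oo[%classic.
  apply/seteqP; split => [_ [t _ <-]|y]; first by rewrite /= in_itv/= andbT exprn_gt0.
  rewrite /= in_itv/= andbT => y0.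
  have : (range (halfway 1)) (Num.sqrt y / 2).
    by rewrite range_halfway//= in_itv/= andbT divr_gt0// sqrtr_gt0.
  move=> [t _ tE]; exists t => //; rewrite /phi.
  have -> : p t = Num.sqrt y by move: tE; rewrite /halfway /p; lra.
  by rewrite sqr_sqrtr// ltW.
have -> : (\int[leb]_y g y = \int[leb]_(y in range phi) g y)%E.
  rewrite rphi [RHS]ge0_integral_indicr; apply: eq_integral => y _.
  by rewrite /g -EFinM indicE; case: (_ \in _); rewrite !(mulr1, mulr0).
have cphi : continuous (fun t => 2 * p t ^+ 2 / hyp 1 t).
  have cp : continuous p by move=> t; apply: cvgD; [exact: continuous_hyp|exact: cvg_id].
  move=> t; apply: cvgM; last first.
    by apply: cvgV; [rewrite gt_eqF|exact: continuous_hyp].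
  by apply: cvgM; [exact: cvg_cst|apply: (@cvgM _ _ _ _ p p); exact: cp].
have pphi t : 0 < 2 * p t ^+ 2 / hyp 1 t by rewrite divr_gt0// mulr_gt0// exprn_gt0.
rewrite -(ge0_integral_substitution dphi cphi pphi mg g0).
rewrite /sphere_mass -ge0_integralZl ?lee_fin ?powR_ge0//; last 2 first.
- by apply/measurable_EFinP; apply: measurable_funX; exact: measurable_hcos.
- by move=> t _; rewrite lee_fin exprn_ge0// ltW// hcos_gt0.
apply: eq_integral => t _; rewrite /g -!EFinM; congr (_%:E).
have -> : \1_`]0, +oo[ (phi t) = 1 :> R.
  by rewrite indicE mem_set//= in_itv/= andbT exprn_gt0.
have -> : 1 + phi t = 2 * p t * hyp 1 t.
  by rewrite /phi /p; have := sqr_hyp 1 t; nra.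
rewrite /phi /hcos -!powR_mulrn ?invr_ge0 ?(ltW (Y0 t)) ?(ltW (p0 t))//.
have [u uE] : exists u, p t = expR u by exists (ln (p t)); rewrite lnK// posrE p0.
have [v vE] : exists v, hyp 1 t = expR v by exists (ln (hyp 1 t)); rewrite lnK// posrE Y0.
have [l lE] : exists l, 2 = expR l :> R by exists (ln 2); rewrite lnK// posrE.
have l2 (y : R) : 2 `^ y = expR (l * y) by rewrite {1}lE -expRM.
have m2E : 2 * expR u * expR v = expR (l + u + v) by rewrite !expRD -lE.
rewrite uE vE mulr1 an m2E l2 -!(expRN, expRM).
have -> : 2 * expR (u * 2) * expR (- v) = expR (l + u * 2 - v) by rewrite !expRD -lE.
rewrite -!expRD; congr expR; have aE : a = (n%:R - 1) / 2 by rewrite -an; field.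
by rewrite aE; field.
Qed.

Lemma gamma_int_lty (n : nat) : (gamma_int n.+1%:R < +oo)%E.
Proof.
have e2 : 0 < 2^-1 :> R by rewrite invr_gt0.
rewrite gamma_intE.
(* From t^n <= 2^n n! e^(t/2); the additional factor 2 offsets the 1/2 in the exponential density of
   rate 1/2. *)
pose M : R := 2 ^+ n.+1 * n`!%:R.
have M0 : 0 <= M by rewrite mulr_ge0// exprn_ge0.
have mpdf : measurable_fun setT (EFin \o exponential_pdf (2^-1 : R)).
  by apply/measurable_EFinP; exact: measurable_exponential_pdf.
apply: (@le_lt_trans _ _ (\int[leb]_t (M%:E * (exponential_pdf 2^-1 t)%:E))%E); last first.
  rewrite ge0_integralZl ?lee_fin//; last first.
    by move=> t _; rewrite lee_fin exponential_pdf_ge0.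
  by rewrite integral_exponential_pdf// mule1 ltry.
apply: ge0_le_integral => //.
- by move=> t _; rewrite lee_fin gi_ge0.
- by apply/measurable_EFinP; exact: mgi.
- exact: emeasurable_funM.
- move=> t _; rewrite -EFinM lee_fin /gi.
  have [t0|t0] := ltP 0 t; last first.
    rewrite (_ : \1_`]0, +oo[ t = 0) ?mulr0.
      by rewrite mulr_ge0// exponential_pdf_ge0.
    by rewrite indicE memNset//= in_itv/= andbT; apply/negP; rewrite -leNgt.
  rewrite (_ : \1_`]0, +oo[ t = 1) ?mulr1; last first.
    by rewrite indicE mem_set//= in_itv/= andbT.
  rewrite exponential_pdfE ?(ltW t0)// -natr1 addrK powR_mulrn ?(ltW t0)//.
  have -> : - t = - (2^-1) * t + - (t / 2) by field.
  rewrite expRD mulrA [t ^+ n * _]mulrC -mulrA /M.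
  have H : t ^+ n <= 2 ^+ n * n`!%:R * expR (t / 2).
    case: n {M M0} => [|n].
      by rewrite !expr0 fact0 !mul1r -expR0 ler_expR divr_ge0// ltW.
    have t20 : 0 <= t / 2 by rewrite divr_ge0// ltW.
    have := expR_ge1Dxn n t20.
    rewrite expr_div_n => H.
    have {H} : t ^+ n.+1 / 2 ^+ n.+1 / (n.+1)`!%:R <= expR (t / 2) by apply: le_trans H; rewrite lerDr.
    by rewrite !ler_pdivrMr ?exprn_gt0 ?ltr0n ?fact_gt0// => H; apply: le_trans H _; rewrite le_eqVlt; apply/orP; left; apply/eqP; ring.
  have -> : 2 ^+ n.+1 * n`!%:R * (2^-1 * expR (- 2^-1 * t)) =
    expR (- 2^-1 * t) * (2 ^+ n * n`!%:R) by rewrite exprS; field.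
  rewrite ler_pM2l ?expR_gt0//.
  by rewrite expRN ler_pdivrMr ?expR_gt0.
Qed.

Lemma gamma_int_gt0 (n : nat) : (0 < gamma_int n.+1%:R)%E.
Proof.
rewrite gamma_intE.
apply: (@lt_le_trans _ _ (\int[leb]_t ((expR (-2))%:E * (\1_`[1%R, 2%R] t)%:E))%E).
  rewrite ge0_integralZl ?lee_fin ?expR_ge0//; last first.
    by apply: measurable_EFin_indic; exact: measurable_itv.
  rewrite integral_indic// setIT; have := @lebesgue_measure_itv R `[1, 2]; rewrite /= lte_fin ltr1n => ->.
  by rewrite -EFinB -EFinM lte_fin mulr_gt0 ?expR_gt0// subr_gt0 ltr1n.
apply: ge0_le_integral => //.
- by apply: emeasurable_funM => //; apply: measurable_EFin_indic; exact: measurable_itv.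
- by apply/measurable_EFinP; exact: mgi.
move=> t _; rewrite -EFinM lee_fin [X in _ * X]indicE.
case: (boolP (t \in _)) => [|_]; last by rewrite mulr0 gi_ge0.
rewrite inE/= in_itv/= => /andP[t1 t2]; rewrite mulr1 /gi.
have t0 : 0 < t by apply: lt_le_trans t1.
rewrite (_ : \1_`]0, +oo[ t = 1) ?mulr1; last by rewrite indicE mem_set//= in_itv/= andbT.
have -> : n.+1%:R - 1 = n%:R :> R by rewrite -natr1 addrK.
rewrite powR_mulrn ?(ltW t0)//.
apply: (@le_trans _ _ (expR (- t))); first by rewrite ler_expR lerN2.
by rewrite ler_peMl ?expR_ge0// exprn_ege1.
Qed.

(** By [gamma_int_sqr] the prefactor in [kappa] is 2 divided by [sphere_mass], and by [kappa_int]
    its integral is the one in [half_angle_mean]. *)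
Lemma kappaE (n : nat) r : (2 <= n)%N -> 0 < r ->
  ((1 - kappa n r)%:E = 2%:E * half_angle_mean n r)%E.
Proof.
move=> n2 r0.
pose a : R := (n%:R - 1) / 2.
have a2 : 2 * a = n%:R - 1 by rewrite /a; field.
have := gamma_int_sqr n2 a2; rewrite a2.
have n1E : n%:R - 1 = n.-2.+1%:R :> R.
  by case: n n2 {a a2} => [|[|n]]// _; rewrite -[in LHS]natr1 addrK.
have Gpos b : (0 <= gamma_int b)%E.
  by apply: integral_ge0 => t _; rewrite lee_fin mulr_ge0 ?powR_ge0 ?expR_ge0.
have Gfin b : gamma_int b \is a fin_num -> gamma_int b = (Gamma b)%:E.
  by move=> bf; rewrite -[LHS]fineK.
have G2fin : gamma_int (n%:R - 1) = (Gamma (n%:R - 1))%:E.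
  by apply: Gfin; rewrite ge0_fin_numE// n1E gamma_int_lty.
have G2gt0 : 0 < Gamma (n%:R - 1) :> R.
  by rewrite -lte_fin -G2fin n1E gamma_int_gt0.
have mfin : sphere_mass n \is a @fin_num R.
  rewrite ge0_fin_numE ?sphere_mass_lty//; apply: integral_ge0 => t _.
  by rewrite lee_fin exprn_ge0// ltW// hcos_gt0.
have m0 := @sphere_mass_gt0 R n n2.
rewrite G2fin -(fineK mfin) -!EFinM.
(* An infinite value at the possibly half-integer [a] would make the square infinite, against the
   finite right side. *)
have [G1fin|] := boolP (gamma_int a \is a fin_num); last first.
  by rewrite ge0_fin_numE// -leNgt leye_eq => /eqP ->; rewrite mulyy.
rewrite (Gfin a)// -EFinM => -[H].
rewrite /half_angle_mean.
set I := (\int[leb]_t _)%E.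
have Ifin : I \is a fin_num.
  rewrite ge0_fin_numE ?half_angle_int_lty//; apply: integral_ge0 => t _.
  by rewrite mule_ge0// lee_fin ?powR_ge0// exprn_ge0// ltW// hcos_gt0.
rewrite -(fineK Ifin) -!EFinM; congr (_%:E).
have -> : kappa n r = 1 - Gamma (n%:R - 1) / (2 `^ (n%:R - 3) * Gamma a ^+ 2) * fine I.
  by rewrite /kappa -/a /Rintegral kappa_int.
rewrite opprB addrC subrK expr2 H.
have -> : 2 `^ (n%:R - 3) * (Gamma (n%:R - 1) * (2 `^ (2 - n%:R) * fine (sphere_mass n))) =
   (2 `^ (n%:R - 3) * 2 `^ (2 - n%:R)) * (Gamma (n%:R - 1) * fine (sphere_mass n)) :> R by ring.
rewrite -powRD ?pnatr_eq0 ?implybT// (_ : n%:R - 3 + (2 - n%:R) = -1); last by ring.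
by rewrite powR_inv1//; field; rewrite !gt_eqF.
Qed.
End zonal_constants.

(** * The change of variables xi |-> xi+ *)

Section collision_jacobian.
Context {R : realType}.
Notation leb := (@lebesgue_measure R).
Notation lam := (lebesgue_tuple R).
Notation S n := (@uniform_sphere R n).

Definition post_plus {n} (xi s : n.-tuple R) : n.-tuple R :=
  vscale 2^-1 (vadd xi (vscale (enorm xi) s)).

Lemma measurable_post_plus dT (T : measurableType dT) n (f g : T -> n.-tuple R) :
  measurable_fun setT f -> measurable_fun setT g ->
  measurable_fun setT (fun z => post_plus (f z) (g z)).
Proof.
move=> mf mg; apply: measurable_vscale => //; apply: measurable_vadd => //.
by apply: measurable_vscale => //; exact: measurable_enorm_comp.
Qed.

(** For unit [s] this is |xi+|^2 / |xi|^2, and 2^(n-1) times the Jacobian determinant of xi |->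
    xi+. *)
Definition jac {n} (xi s : n.-tuple R) : R := (enorm xi + dotp xi s) / (2 * enorm xi).

Lemma measurable_jac dT (T : measurableType dT) n (f g : T -> n.-tuple R) :
  measurable_fun setT f -> measurable_fun setT g ->
  measurable_fun setT (fun z => jac (f z) (g z)).
Proof.
move=> mf mg; rewrite /jac.
have me := measurable_enorm_comp mf.
apply: measurable_funM; first by apply: measurable_funD => //; exact: measurable_dotp.
rewrite (_ : (fun _ => _) = (fun z => (2 * enorm (f z)) `^ (-1))); last first.
  by apply/funext => z; rewrite powR_inv1// mulr_ge0// enorm_ge0.
by apply: (measurableT_comp (measurable_powR (-1))); exact: measurable_funM.
Qed.

(** On a line parallel to the axis, xi |-> xi+ acts on the first coordinate by [halfway], whose
    derivative is [jac], and halves the n others, hence 2^n. The image is the open half-space. *)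
Let jacobian_axis n (H : n.+1.-tuple R -> \bar R) : (0 < n)%N ->
  measurable_fun setT H -> (forall v, (0 <= H v)%E) ->
  (\int[lam n.+1]_xi (H (post_plus xi (axis1 n)) * (jac xi (axis1 n))%:E) =
   (2 ^+ n)%:E * \int[lam n.+1]_eta (H eta * (\1_`]0%R, +oo[ (dotp eta (axis1 n)))%:E))%E.
Proof.
move=> n0 mH H0.
have mpos : measurable_fun setT (\1_`]0, +oo[ : R -> R).
  by apply: measurable_indic; exact: measurable_itv.
pose F xi := (H (post_plus xi (axis1 n)) * (jac xi (axis1 n))%:E)%E.
have jac_cons (x : R) (y : n.-tuple R) :
    jac (cons_pair (x, y)) (axis1 n) = (hyp (enorm y) x + x) / (2 * hyp (enorm y) x).
  by rewrite /jac enorm_cons dotp_axis1.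
have jacE0 xi : 0 <= jac xi (axis1 n).
  rewrite (cons_pairE xi) jac_cons; set y := [tuple of behead xi]; set x := thead xi.
  rewrite divr_ge0 ?mulr_ge0 ?sqrtr_ge0// -lerBlDr sub0r.
  rewrite (le_trans (ler_norm _))// normrN /hyp -sqrtr_sqr ler_sqrt ?addr_ge0 ?sqr_ge0//.
  by rewrite lerDl sqr_ge0.
have mF : measurable_fun setT F.
  apply: emeasurable_funM; first by apply: (measurableT_comp mH); exact: measurable_post_plus.
  by apply/measurable_EFinP; exact: measurable_jac.
have F0 xi : (0 <= F xi)%E by rewrite mule_ge0// lee_fin.
pose G eta := (H eta * (\1_`]0%R, +oo[ (dotp eta (axis1 n)))%:E)%E.
have mG : measurable_fun setT G.
  apply: emeasurable_funM => //; apply/measurable_EFinP.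
  by apply: (measurableT_comp mpos); exact: measurable_dotp.
have G0 eta : (0 <= G eta)%E by rewrite mule_ge0// lee_fin indicE.
have mcons y : measurable_fun setT (fun x : R => cons_pair (x, y : n.-tuple R)).
  apply: (measurableT_comp (measurable_cons_pair (R := R) (n := n))).
  exact: measurable_pair2.
have mint (f : n.+1.-tuple R -> \bar R) : measurable_fun setT f -> (forall v, (0 <= f v)%E) ->
    measurable_fun setT (fun y : n.-tuple R => \int[leb]_x f (cons_pair (x, y)))%E.
  move=> mf f0; apply: (@measurable_fun_fubini_tonelli_G _ _ _ _ _ leb (f \o @cons_pair R n)) => //.
    by apply: measurableT_comp => //; exact: measurable_cons_pair.
  by move=> ?; exact: f0.
rewrite (ge0_integral_lebesgue_tupleS_swap mF F0) (ge0_integral_lebesgue_tupleS_swap mG G0).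
pose Gi (y : n.-tuple R) := (\int[leb]_x G (cons_pair (x, y)))%E.
have half0 : 0 < 2^-1 :> R by rewrite invr_gt0.
have Gi0 y : (0 <= Gi y)%E by exact: integral_ge0.
rewrite -[in RHS](ge0_integral_vscale half0 (mint _ mG G0) Gi0).
rewrite -ge0_integralZl ?lee_fin ?exprn_ge0//; last 2 first.
- apply: emeasurable_funM => //; apply: (measurableT_comp (mint _ mG G0)).
  exact: measurable_vscale.
- by move=> y _; rewrite mule_ge0 ?Gi0// lee_fin exprn_ge0// ltW.
have mGs : measurable_fun setT (fun y : n.-tuple R => ((2 ^+ n)%:E * (Gi (vscale 2^-1 y) * (2^-1 ^+ n)%:E)))%E.
  apply: emeasurable_funM => //; apply: emeasurable_funM => //.
  by apply: (measurableT_comp (mint _ mG G0)); exact: measurable_vscale.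
apply: ge0_ae_eq_integral => //.
- exact: (mint _ mF F0).
- by move=> y _; exact: integral_ge0.
- by move=> y _; rewrite !mule_ge0 ?Gi0// lee_fin exprn_ge0// ltW.
apply: filterS (ae_enorm_gt0 n0) => y y0 _.
rewrite muleCA -EFinM -exprMn mulfV// expr1n mule1.
have mHy : measurable_fun setT (fun u : R => H (cons_pair (u, vscale 2^-1 y))).
  exact: (measurableT_comp mH (mcons _)).
transitivity (\int[leb]_x (H (cons_pair (halfway (enorm y) x, vscale 2^-1 y)) *
   ((hyp (enorm y) x + x) / (2 * hyp (enorm y) x))%:E))%E.
  apply: eq_integral => x _; rewrite /F jac_cons; congr (H _ * _)%E.
  rewrite /post_plus enorm_cons /axis1 vscale_cons vadd_cons vscale_cons.
  congr cons_pair; congr (_, _); first by rewrite /halfway mulr1 addrC mulrC.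
  by apply: eq_from_tnth => i; rewrite !vtnthE mulr0 addr0.
rewrite (ge0_integral_halfway y0 mHy)//.
by apply: eq_integral => x _; rewrite /G dotp_axis1.
Qed.

Lemma ge0_integral_post_plus n (s : n.-tuple R) (H : n.-tuple R -> \bar R) :
  (2 <= n)%N -> enorm s = 1 ->
  measurable_fun setT H -> (forall v, (0 <= H v)%E) ->
  (\int[lam n]_xi (H (post_plus xi s) * (jac xi s)%:E) =
   (2 ^+ n.-1)%:E * \int[lam n]_eta (H eta * (\1_`]0%R, +oo[ (dotp eta s))%:E))%E.
Proof.
case: n s H => [//|n] s H n2 s1 mH H0; have n0 : (0 < n)%N by [].
have mpos : measurable_fun setT (\1_`]0, +oo[ : R -> R).
  by apply: measurable_indic; exact: measurable_itv.
have as1 : enorm (axis1 n) = enorm s by rewrite enorm_axis1 s1.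
have iU := householder_isometry (vsub (axis1 n) s).
set U := householder _ in iU.
have Ua : U (axis1 n) = s by rewrite /U householder_swap.
have jacE xi : jac (U xi) s = jac xi (axis1 n).
  by rewrite /jac isom_enorm// -Ua isom_dotp.
have ppE xi : post_plus (U xi) s = U (post_plus xi (axis1 n)).
  by rewrite /post_plus (isomZ iU) (isomD iU) (isomZ iU) (isom_enorm _ iU) Ua.
have jac0 xi : 0 <= jac xi s.
  have [w <-] := isom_surj iU xi; rewrite jacE (cons_pairE w) /jac enorm_cons dotp_axis1.
  set y := [tuple of behead w]; set x := thead w.
  rewrite divr_ge0 ?mulr_ge0 ?sqrtr_ge0// -lerBlDr sub0r.
  rewrite (le_trans (ler_norm _))// normrN /hyp -sqrtr_sqr ler_sqrt ?addr_ge0 ?sqr_ge0//.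
  by rewrite lerDl sqr_ge0.
rewrite -(ge0_integral_isometry iU); last 2 first.
- apply: emeasurable_funM; first by apply: (measurableT_comp mH); exact: measurable_post_plus.
  by apply/measurable_EFinP; exact: measurable_jac.
- by move=> xi; rewrite mule_ge0// lee_fin.
transitivity (\int[lam n.+1]_xi ((H \o U) (post_plus xi (axis1 n)) * (jac xi (axis1 n))%:E))%E.
  by apply: eq_integral => xi _; rewrite jacE ppE.
have mHU : measurable_fun setT (H \o U) by exact: (measurableT_comp mH (isom_measurable iU)).
rewrite (jacobian_axis n0 mHU)//; last by move=> v; exact: H0.
congr (_ * _)%E.
rewrite -[RHS](ge0_integral_isometry iU); last 2 first.
- apply: emeasurable_funM => //; apply/measurable_EFinP.
  by apply: (measurableT_comp mpos); exact: measurable_dotp.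
- by move=> xi; rewrite mule_ge0// lee_fin indicE.
by apply: eq_integral => xi _; rewrite /= -Ua isom_dotp.
Qed.


Section half_angle_weight.
Variables (n : nat) (r : R).
Hypotheses (n2 : (2 <= n)%N) (r0 : 0 < r).
Notation E := (n.-tuple R).
Let p : R := n%:R + 2 * r.
Notation A := (half_angle_mean n r).

Let p_gt0 : 0 < p.
Proof. by rewrite /p addr_gt0 ?mulr_gt0// ltr0n ltnW. Qed.

Let n0 : (0 < n)%N. Proof. exact: ltnW. Qed.

(** The Sobolev weight |xi|^(-2s), since 2s = n + 2r. At the origin the convention for powers of 0
    gives 0. *)
Definition wt (xi : E) : R := enorm xi `^ (- p).

Lemma wt_ge0 xi : 0 <= wt xi. Proof. exact: powR_ge0. Qed.

Lemma measurable_wt : measurable_fun setT wt.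
Proof. exact: (measurableT_comp (measurable_powR _) measurable_enorm). Qed.

Lemma wt_eq0 xi : enorm xi = 0 -> wt xi = 0.
Proof. by rewrite /wt => ->; rewrite powR0// oppr_eq0 gt_eqF. Qed.

Let cc (xi s : E) : R := enorm (post_plus xi s) / enorm xi.

Let cc_ge0 xi s : 0 <= cc xi s.
Proof. by rewrite divr_ge0 ?enorm_ge0. Qed.

Let measurable_cc dT (T : measurableType dT) (f g : T -> E) :
  measurable_fun setT f -> measurable_fun setT g ->
  measurable_fun setT (fun z => cc (f z) (g z)).
Proof.
move=> mf mg; rewrite /cc; apply: measurable_funM.
  by apply: measurable_enorm_comp; exact: measurable_post_plus.
rewrite (_ : (fun _ => _) = (fun z => (enorm (f z)) `^ (-1))); last first.
  by apply/funext => z; rewrite powR_inv1// enorm_ge0.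
by apply: (measurableT_comp (measurable_powR (-1))); exact: measurable_enorm_comp.
Qed.

Let enorm_post_plus (xi s : E) : enorm s = 1 -> 0 < enorm xi ->
  enorm (post_plus xi s) ^+ 2 = enorm xi ^+ 2 * jac xi s.
Proof.
move=> s1 x0; rewrite sqr_enorm /post_plus !dotpE (dotpC s xi) -!sqr_enorm s1 /jac.
by field; rewrite gt_eqF.
Qed.

Let dotp_post_plus (xi s : E) : enorm s = 1 -> 0 < enorm xi ->
  dotp (post_plus xi s) s = enorm xi * jac xi s.
Proof.
move=> s1 x0; rewrite /post_plus !dotpE -!sqr_enorm s1 /jac.
by field; rewrite gt_eqF.
Qed.

Let sqr_cc (xi s : E) : enorm s = 1 -> 0 < enorm xi -> cc xi s ^+ 2 = jac xi s.
Proof.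
move=> s1 x0; rewrite /cc exprMn enorm_post_plus// exprVn mulrAC divff ?mul1r//.
by rewrite gt_eqF// exprn_gt0.
Qed.

Let m1 : measurable_fun setT (fun z : E * E => z.1). Proof. exact: measurable_fst. Qed.
Let m2 : measurable_fun setT (fun z : E * E => z.2). Proof. exact: measurable_snd. Qed.

Let mpow (dT : measure_display) (T : measurableType dT) (f : T -> R) a :
  measurable_fun setT f -> measurable_fun setT (fun x => f x `^ a).
Proof. by move=> mf; exact: (measurableT_comp (measurable_powR a) mf). Qed.

Let integral_cc (xi : E) : 0 < enorm xi ->
  (\int[S n]_s (cc xi s `^ r)%:E = A)%E.
Proof.
move=> x0.
have d1 : enorm (direction xi) = 1 by rewrite enorm_direction// gt_eqF.
rewrite -(sphere_half_angle _ n2 d1).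
apply: ge0_ae_eq_integral => //.
- by apply/measurable_EFinP; apply: mpow; exact: measurable_cc.
- apply/measurable_EFinP; apply: mpow; apply: measurable_funM => //.
  by apply: measurable_funD => //; exact: measurable_dotp.
- by move=> s _; rewrite lee_fin powR_ge0.
- by move=> s _; rewrite lee_fin powR_ge0.
apply: filterS (ae_sphere n0) => s s1 _; congr (_%:E).
have -> : (1 + dotp s (direction xi)) / 2 = cc xi s ^+ 2.
  by rewrite sqr_cc// /jac direction_vscale dotpZr dotpC; field; rewrite gt_eqF.
by rewrite -powR_mulrn// -powRrM; congr (_ `^ _); field.
Qed.

(** Put eta = xi+ and c = |xi+|/|xi|, which is also the cosine of the angle between eta and s. Then
    |xi| = |eta|/c and dxi = 2^(n-1) c^(-2) deta, so the power of c becomes n + 2r - r - 2 = n + r -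
    2, whose mean is given by [sphere_positive_part]. *)
Let integral_pull (F : E -> \bar R) : measurable_fun setT F -> (forall v, (0 <= F v)%E) ->
  (\int[lam n]_xi \int[S n]_s (F (post_plus xi s) * (cc xi s `^ (- r) * wt xi)%:E) =
   A * \int[lam n]_eta (F eta * (wt eta)%:E))%E.
Proof.
move=> mF F0.
pose K (z : E * E) := (F (post_plus z.1 z.2) * (cc z.1 z.2 `^ (- r) * wt z.1)%:E)%E.
have mK : measurable_fun setT K.
  apply: emeasurable_funM; first by apply: (measurableT_comp mF); exact: measurable_post_plus.
  apply/measurable_EFinP; apply: measurable_funM; first by apply: mpow; exact: measurable_cc.
  exact: (measurableT_comp measurable_wt m1).
have K0 z : (0 <= K z)%E by rewrite mule_ge0// lee_fin mulr_ge0 ?powR_ge0.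
rewrite (fubini_tonelli K mK K0).
pose h (u : R) : R := u `^ (n%:R + r - 2) * \1_`]0, +oo[ u.
have mpos : measurable_fun setT (\1_`]0, +oo[ : R -> R).
  by apply: measurable_indic; exact: measurable_itv.
have mh : measurable_fun setT h by apply: measurable_funM => //; exact: measurable_powR.
pose G (z : E * E) : \bar R := ((2 ^+ n.-1)%:E *
  (F z.1 * (wt z.1)%:E * (h (dotp z.1 z.2 / enorm z.1))%:E))%E.
have mG : measurable_fun setT G.
  apply: emeasurable_funM => //; apply: emeasurable_funM.
    apply: emeasurable_funM; first exact: (measurableT_comp mF m1).
    by apply/measurable_EFinP; exact: (measurableT_comp measurable_wt m1).
  apply/measurable_EFinP; apply: (measurableT_comp mh).
  apply: measurable_funM; first exact: measurable_dotp.
  rewrite (_ : (fun _ => _) = (fun z : E * E => (enorm z.1) `^ (-1))); last first.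
    by apply/funext => z; rewrite powR_inv1// enorm_ge0.
  by apply: mpow; exact: measurable_enorm_comp.
have h0 u : 0 <= h u by rewrite mulr_ge0 ?powR_ge0// indicE.
have G0 z : (0 <= G z)%E by rewrite !mule_ge0// lee_fin ?exprn_ge0 ?powR_ge0.
transitivity (\int[S n]_s \int[lam n]_eta G (eta, s))%E.
  apply: ge0_ae_eq_integral => //.
  - exact: (measurable_fun_fubini_tonelli_G (m1 := lam n) K).
  - exact: (measurable_fun_fubini_tonelli_G (m1 := lam n) G).
  - by move=> s _; apply: integral_ge0 => ? _; exact: K0.
  - by move=> s _; apply: integral_ge0 => ? _; exact: G0.
  apply: filterS (ae_sphere n0) => s s1 _.
  pose H (eta : E) : \bar R := (F eta * (wt eta * (dotp eta s / enorm eta) `^ (n%:R + r - 2))%:E)%E.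
  have mH : measurable_fun setT H.
    apply: emeasurable_funM => //; apply/measurable_EFinP; apply: measurable_funM.
      exact: measurable_wt.
    apply: mpow; apply: measurable_funM; first exact: measurable_dotp.
    rewrite (_ : (fun _ => _) = (fun z : E => (enorm z) `^ (-1))); last first.
      by apply/funext => z; rewrite powR_inv1// enorm_ge0.
    by apply: mpow; exact: measurable_enorm_comp.
  have H0 eta : (0 <= H eta)%E by rewrite mule_ge0// lee_fin mulr_ge0 ?powR_ge0.
  transitivity (\int[lam n]_xi (H (post_plus xi s) * (jac xi s)%:E))%E.
    apply: eq_integral => xi _; rewrite /K /H/= -muleA -EFinM; congr (_ * _%:E)%E.
    have [x0|x0] := eqVneq (enorm xi) 0.
      by rewrite wt_eq0// /jac x0 !mulr0 invr0 !mulr0.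
    have {}x0 : 0 < enorm xi by rewrite lt_neqAle eq_sym x0 enorm_ge0.
    rewrite dotp_post_plus// -sqr_cc//.
    have [c0|c0] := eqVneq (cc xi s) 0.
      by rewrite c0 expr0n/= powR0 ?oppr_eq0 ?gt_eqF// !(mulr0, mul0r).
    have {}c0 : 0 < cc xi s by rewrite lt_neqAle eq_sym c0 cc_ge0.
    have eE : enorm (post_plus xi s) = cc xi s * enorm xi by rewrite /cc mulfVK// gt_eqF.
    rewrite /wt eE (_ : enorm xi * cc xi s ^+ 2 / _ = cc xi s); last first.
      by field; rewrite !gt_eqF.
    rewrite powRM ?ltW// -[cc xi s ^+ 2]powR_mulrn ?ltW//.
    have cD a b : cc xi s `^ a * cc xi s `^ b = cc xi s `^ (a + b).
      by rewrite powRD// (gt_eqF c0) implybT.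
    have -> : cc xi s `^ (- r) = cc xi s `^ (- p) * cc xi s `^ (n%:R + r - 2) * cc xi s `^ 2%:R.
      by rewrite !cD; congr (_ `^ _); rewrite /p; ring.
    by ring.
  rewrite (ge0_integral_post_plus n2 s1 mH H0) -ge0_integralZl//; last 2 first.
  - apply: emeasurable_funM => //; apply/measurable_EFinP.
    by apply: (measurableT_comp mpos); exact: measurable_dotp.
  - by move=> eta _; rewrite mule_ge0// lee_fin indicE.
  apply: eq_integral => eta _; rewrite /G /H/= /h; congr (_ * _)%E.
  rewrite -!muleA; congr (_ * _)%E; rewrite -!EFinM; congr (_%:E).
  have [x0|x0] := eqVneq (enorm eta) 0; first by rewrite wt_eq0// !mul0r.
  rewrite -!mulrA; congr (_ * (_ * _)); apply: eq_indic.
  rewrite /= !in_itv/= !andbT pmulr_lgt0// invr_gt0 lt_neqAle eq_sym x0.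
  exact: enorm_ge0.
rewrite -(fubini_tonelli G mG G0) muleC -ge0_integralZr ?half_angle_mean_ge0//; last 2 first.
- by apply: emeasurable_funM => //; apply/measurable_EFinP; exact: measurable_wt.
- by move=> eta _; rewrite mule_ge0// lee_fin powR_ge0.
apply: eq_integral => eta _; rewrite /G/=.
have [x0|x0] := eqVneq (enorm eta) 0.
  rewrite wt_eq0// mule0 mul0e integral0_eq// => s _.
  by rewrite mul0e mule0.
have {}x0 : 0 < enorm eta by rewrite lt_neqAle eq_sym x0 enorm_ge0.
under eq_integral do rewrite muleCA.
have mhd : measurable_fun setT (fun s : E => h (dotp eta s / enorm eta)).
  apply: (measurableT_comp mh); apply: measurable_funM => //; exact: measurable_dotp.
have a0 : (0 <= F eta * (wt eta)%:E)%E by rewrite mule_ge0// lee_fin powR_ge0.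
rewrite ge0_integralZl//; last 2 first.
- by apply: emeasurable_funM => //; exact/measurable_EFinP.
- by move=> s _; rewrite mule_ge0// lee_fin// exprn_ge0.
congr (_ * _)%E.
rewrite ge0_integralZl ?lee_fin ?exprn_ge0//; last 2 first.
- exact/measurable_EFinP.
- by move=> s _; rewrite lee_fin.
have d1 : enorm (direction eta) = 1 by rewrite enorm_direction// gt_eqF.
rewrite -(sphere_positive_part r n2 d1); congr (_ * _)%E.
apply: eq_integral => s _; rewrite direction_vscale dotpZr dotpC mulrC /h -EFinM//.
Qed.

(** With c = |xi+|/|xi|, f(xi) f(xi+) <= (c^r f(xi)^2 + c^(-r) f(xi+)^2) / 2. The exponent r is the
    one for which both halves have the same constant, by [integral_cc] and [integral_pull]. *)
Lemma post_plus_form (f : E -> R) : measurable_fun setT f -> (forall v, 0 <= f v) ->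
  f origin = 0 ->
  (\int[lam n]_xi \int[S n]_s (f xi * f (post_plus xi s) * wt xi)%:E <=
   A * \int[lam n]_xi (f xi ^+ 2 * wt xi)%:E)%E.
Proof.
move=> mf f0 fo.
pose K1 (z : E * E) : \bar R := (2^-1 * (f z.1 ^+ 2 * wt z.1) * cc z.1 z.2 `^ r)%:E.
pose K2 (z : E * E) : \bar R := ((f (post_plus z.1 z.2) ^+ 2)%:E * (cc z.1 z.2 `^ (- r) * wt z.1)%:E)%E.
have mw1 := measurableT_comp measurable_wt m1.
have mf1 := measurableT_comp mf m1.
have mfp : measurable_fun setT (fun z : E * E => f (post_plus z.1 z.2)).
  by apply: (measurableT_comp mf); exact: measurable_post_plus.
have mcc := measurable_cc m1 m2.
have mK1 : measurable_fun setT K1.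
  apply/measurable_EFinP; apply: measurable_funM; last exact: mpow.
  by apply: measurable_funM => //; apply: measurable_funM => //; exact: measurable_funX.
have mK2 : measurable_fun setT K2.
  apply: emeasurable_funM; apply/measurable_EFinP; first exact: measurable_funX.
  by apply: measurable_funM => //; exact: mpow.
have K10 z : (0 <= K1 z)%E by rewrite lee_fin !mulr_ge0 ?powR_ge0 ?sqr_ge0.
have K20 z : (0 <= K2 z)%E by rewrite mule_ge0// lee_fin ?sqr_ge0// mulr_ge0 ?powR_ge0.
apply: (@le_trans _ _ (\int[lam n]_xi \int[S n]_s (K1 (xi, s) + 2^-1%:E * K2 (xi, s)))%E).
  have mL : measurable_fun setT (fun z : E * E => (f z.1 * f (post_plus z.1 z.2) * wt z.1)%:E : \bar R).
    by apply/measurable_EFinP; apply: measurable_funM => //; exact: measurable_funM.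
  have mR : measurable_fun setT (fun z => K1 z + 2^-1%:E * K2 z)%E.
    by apply: emeasurable_funD => //; exact: emeasurable_funM.
  have L0 z : (0 <= (f z.1 * f (post_plus z.1 z.2) * wt z.1)%:E)%E.
    by rewrite lee_fin !mulr_ge0 ?powR_ge0.
  have R0 z : (0 <= K1 z + 2^-1%:E * K2 z)%E by rewrite adde_ge0// mule_ge0// lee_fin.
  apply: ge0_le_integral => //.
  - by move=> xi _; apply: integral_ge0 => s _; exact: (L0 (xi, s)).
  - exact: (measurable_fun_fubini_tonelli_F (m2 := S n) _ mL L0).
  - exact: (measurable_fun_fubini_tonelli_F (m2 := S n) _ mR R0).
  move=> xi _; apply: ge0_le_integral => //.
  - by move=> s _; exact: (L0 (xi, s)).
  - exact: (measurableT_comp mL (measurable_pair1 _)).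
  - exact: (measurableT_comp mR (measurable_pair1 _)).
  move=> s _; rewrite /K1 /K2/= -!EFinM -EFinD lee_fin.
  have [x0|x0] := eqVneq (enorm xi) 0.
    by rewrite wt_eq0// !(mulr0, mul0r) addr0.
  have {}x0 : 0 < enorm xi by rewrite lt_neqAle eq_sym x0 enorm_ge0.
  (* Then xi+ = 0 and the left side vanishes by [fo]; otherwise one may divide by c^r. *)
  have [c0|c0] := eqVneq (cc xi s) 0.
    have -> : post_plus xi s = origin.
      by apply: enorm_eq0; move/eqP: c0; rewrite /cc mulf_eq0 invr_eq0 (gt_eqF x0) orbF => /eqP.
    by rewrite fo !(mulr0, mul0r) addr_ge0// !mulr_ge0 ?powR_ge0 ?sqr_ge0 ?exprn_ge0.
  have {}c0 : 0 < cc xi s by rewrite lt_neqAle eq_sym c0 cc_ge0.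
  rewrite powRN; set c := cc xi s `^ r.
  have cp : 0 < c by rewrite powR_gt0.
  set a := f xi; set b := f _; have w0 := wt_ge0 xi.
  rewrite (_ : _ + _ = (2^-1 * (a ^+ 2 * c + b ^+ 2 / c)) * wt xi); last by field; rewrite gt_eqF.
  apply: ler_wpM2r => //; rewrite -(ler_pM2r cp).
  rewrite (_ : 2^-1 * _ * c = 2^-1 * ((a * c) ^+ 2 + b ^+ 2)); last by field; rewrite gt_eqF.
  by have := sqr_ge0 (a * c - b); nra.
have mw : measurable_fun setT wt := measurable_wt.
have K1i xi : (\int[S n]_s K1 (xi, s) = (2^-1 * (f xi ^+ 2 * wt xi))%:E * A)%E.
  have [x0|x0] := eqVneq (enorm xi) 0.
    by rewrite wt_eq0// !mulr0 mul0e integral0_eq// => s _; rewrite /K1/= wt_eq0// !(mulr0, mul0r).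
  have {}x0 : 0 < enorm xi by rewrite lt_neqAle eq_sym x0 enorm_ge0.
  rewrite -(integral_cc x0) -ge0_integralZl//.
  - by apply/measurable_EFinP; apply: mpow; exact: measurable_cc.
  - by move=> s _; rewrite lee_fin powR_ge0.
  - by rewrite lee_fin !mulr_ge0 ?sqr_ge0 ?powR_ge0.
rewrite (_ : \int[lam n]_xi _ = \int[lam n]_xi ((2^-1 * (f xi ^+ 2 * wt xi))%:E * A) +
  2^-1%:E * \int[lam n]_xi \int[S n]_s K2 (xi, s))%E; last first.
  have mK2i := measurable_fun_fubini_tonelli_F (m2 := S n) K2 mK2 K20.
  have K2i0 xi : (0 <= \int[S n]_s K2 (xi, s))%E.
    by apply: integral_ge0 => s _; exact: K20.
  rewrite -ge0_integralZl ?lee_fin//.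
  rewrite -ge0_integralD//; last 4 first.
  - by move=> xi _; rewrite mule_ge0 ?half_angle_mean_ge0// lee_fin !mulr_ge0 ?sqr_ge0 ?powR_ge0.
  - apply: emeasurable_funM => //; apply/measurable_EFinP; apply: measurable_funM => //.
    by apply: measurable_funM => //; exact: measurable_funX.
  - by move=> xi _; rewrite mule_ge0 ?K2i0// lee_fin.
  - exact: emeasurable_funM.
  apply: eq_integral => xi _; rewrite ge0_integralD//.
  - rewrite K1i ge0_integralZl ?lee_fin//.
    exact: (measurableT_comp mK2 (measurable_pair1 _)).
  - exact: (measurableT_comp mK1 (measurable_pair1 _)).
  - by move=> s _; rewrite mule_ge0// lee_fin.
  - by apply: emeasurable_funM => //; exact: (measurableT_comp mK2 (measurable_pair1 _)).
have mf2 : measurable_fun setT (fun v => (f v ^+ 2)%:E : \bar R).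
  by apply/measurable_EFinP; exact: measurable_funX.
rewrite (integral_pull mf2); last by move=> v; rewrite lee_fin sqr_ge0.
have mfw : measurable_fun setT (fun xi => (f xi ^+ 2 * wt xi)%:E : \bar R).
  by apply/measurable_EFinP; apply: measurable_funM => //; exact: measurable_funX.
rewrite ge0_integralZr ?half_angle_mean_ge0//; last 2 first.
- by apply/measurable_EFinP; apply: measurable_funM => //; exact/measurable_EFinP.
- by move=> xi _; rewrite lee_fin !mulr_ge0 ?sqr_ge0 ?powR_ge0.
under eq_integral do rewrite EFinM.
rewrite ge0_integralZl ?lee_fin//; last by move=> xi _; rewrite lee_fin !mulr_ge0 ?sqr_ge0 ?powR_ge0.
set I := (\int[lam n]_xi _)%E.
rewrite -(muleA _ I A) (muleC I A) -ge0_muleDl ?lee_fin//.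
by rewrite -EFinD (_ : 2^-1 + 2^-1 = 1) ?mul1e//; field.
Qed.
End half_angle_weight.
End collision_jacobian.

(** * Integrability of the Sobolev weight *)

Section weight_integrals.
Context {R : realType} (n : nat) (r : R).
Hypotheses (n2 : (2 <= n)%N) (r01 : 0 < r < 1).
Notation E := (n.-tuple R).
Notation lam := (lebesgue_tuple R n).
Notation w := (@wt R n r).

Let n0 : (0 < n)%N. Proof. exact: ltnW. Qed.
Let r0 : 0 < r. Proof. by case/andP: r01. Qed.
Let r1 : r < 1. Proof. by case/andP: r01. Qed.

(** A geometric series in disguise: by homogeneity the integrals over the increasing sets satisfy
    I_(k+1) <= I_1 + q I_k, hence stay below I_1 / (1 - q). It replaces polar coordinates. *)
Lemma homogeneous_integral_lty (g : E -> R) (c q : R) (A : nat -> set E) :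
  measurable_fun setT g -> (forall xi, 0 <= g xi) -> 0 < c -> 0 <= q < 1 ->
  (forall xi, g xi = q * c ^+ n * g (vscale c xi)) ->
  (forall k, measurable (A k)) -> nondecreasing_seq A -> A 0 = set0 ->
  (forall k xi, A k.+1 xi -> A 1 xi \/ A k (vscale c xi)) ->
  (\int[lam]_xi (g xi * \1_(A 1%N) xi)%:E < +oo)%E ->
  (\int[lam]_(xi in \bigcup_k A k) (g xi)%:E < +oo)%E.
Proof.
move=> mg g0 c0 /andP[q0 q1] gE mA ndA A0 AS A1.
have mEg : measurable_fun setT (EFin \o g) by exact/measurable_EFinP.
have mI k : measurable_fun setT (fun xi => (g xi * \1_(A k) xi)%:E : \bar R).
  by apply/measurable_EFinP; apply: measurable_funM => //; exact: measurable_indic.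
have I0 k xi : (0 <= (g xi * \1_(A k) xi)%:E :> \bar R)%E.
  by rewrite lee_fin mulr_ge0// indicE.
set s := fine (\int[lam]_xi (g xi * \1_(A 1%N) xi)%:E).
have s0 : 0 <= s by apply: fine_ge0; apply: integral_ge0.
have sE : (\int[lam]_xi (g xi * \1_(A 1%N) xi)%:E = s%:E)%E.
  by rewrite /s fineK// ge0_fin_numE//; exact: integral_ge0.
have q10 : 0 < 1 - q by rewrite subr_gt0.
have bnd k : (\int[lam]_xi (g xi * \1_(A k) xi)%:E <= (s / (1 - q))%:E)%E.
  elim: k => [|k IH].
    rewrite integral0_eq; first by rewrite lee_fin divr_ge0// ltW.
    by move=> xi _; rewrite A0 indic0 mulr0.
  apply: (@le_trans _ _ (\int[lam]_xi ((g xi * \1_(A 1%N) xi)%:E +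
      q%:E * ((g (vscale c xi) * \1_(A k) (vscale c xi))%:E * (c ^+ n)%:E)))%E).
    apply: ge0_le_integral => //.
    - apply: emeasurable_funD => //; apply: emeasurable_funM => //.
      apply: emeasurable_funM => //; apply: (measurableT_comp (mI k)).
      exact: measurable_vscale.
    - move=> xi _; rewrite -!EFinM -EFinD lee_fin !indicE.
      have Pz (b : bool) : 0 <= g xi * b%:R by rewrite mulr_ge0.
      have Qz (b : bool) : 0 <= q * (g (vscale c xi) * b%:R * c ^+ n).
        by rewrite !mulr_ge0// exprn_ge0// ltW.
      have [xA|xA] := boolP (xi \in A k.+1); last by rewrite mulr0 addr_ge0.
      move: xA; rewrite inE => /AS[h|h]; rewrite (mem_set h).
        by rewrite lerDl.
      have -> : q * (g (vscale c xi) * true%:R * c ^+ n) = g xi.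
        by rewrite [RHS]gE mulr1; ring.
      by rewrite mulr1 lerDr.
  rewrite ge0_integralD//; last 2 first.
  - by move=> xi _; rewrite -!EFinM lee_fin !mulr_ge0 ?exprn_ge0 ?(ltW c0)// indicE.
  - apply: emeasurable_funM => //; apply: emeasurable_funM => //.
    by apply: (measurableT_comp (mI k)); exact: measurable_vscale.
  rewrite ge0_integralZl ?lee_fin//; last 2 first.
  - apply: emeasurable_funM => //.
    by apply: (measurableT_comp (mI k)); exact: measurable_vscale.
  - by move=> xi _; rewrite -!EFinM lee_fin !mulr_ge0 ?exprn_ge0 ?(ltW c0)// indicE.
  rewrite (ge0_integral_vscale c0 (mI k) (I0 k)) sE.
  apply: (@le_trans _ _ (s%:E + q%:E * (s / (1 - q))%:E)%E).
    by rewrite leeD2l// lee_wpmul2l// lee_fin.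
  rewrite -EFinM -EFinD lee_fin le_eqVlt; apply/orP; left; apply/eqP; field.
  by rewrite gt_eqF.
apply: (@le_lt_trans _ _ (s / (1 - q))%:E); last by rewrite ltry.
rewrite ge0_integral_indicr.
have cvgI xi : ((g xi)%:E * (\1_(\bigcup_k A k) xi)%:E =
    limn (fun k => (g xi * \1_(A k) xi)%:E))%E.
  apply/esym/cvg_lim => //; rewrite -EFinM; apply: cvg_near_cst.
  have [[k _ Akx]|nA] := pselect ((\bigcup_k A k) xi).
    near=> m; congr (_ * _)%:E; apply: eq_indic; split => // _; first by exists k.
    have km : (k <= m)%N by near: m; exact: nbhs_infty_ge.
    by move/subsetPset : (ndA _ _ km); exact.
  near=> m; congr (_ * _)%:E; apply: eq_indic; split => // h; first by exists m.
under eq_integral do rewrite cvgI.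
rewrite monotone_convergence//; last first.
  move=> xi _ a b ab; rewrite lee_fin ler_wpM2l// !indicE ler_nat.
  case: (boolP (xi \in A a)) => // /set_mem h; rewrite mem_set//.
  by move/subsetPset : (ndA _ _ ab); exact.
apply: lime_le; last by apply: nearW => k; exact: bnd.
apply: ereal_nondecreasing_is_cvgn => a b ab; apply: ge0_le_integral => //.
move=> xi _; rewrite lee_fin ler_wpM2l// !indicE ler_nat.
case: (boolP (xi \in A a)) => // /set_mem h; rewrite mem_set//.
by move/subsetPset : (ndA _ _ ab); exact.
Unshelve. all: by end_near. Qed.

Let menorm := @measurable_enorm R n.

Let mpre (B : set R) : measurable B -> measurable [set xi : E | B (enorm xi)].
Proof.
move=> mB; rewrite (_ : [set _ | _] = (@enorm R n) @^-1` B); last by apply/seteqP; split.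
by rewrite -[X in measurable X]setTI; exact: menorm.
Qed.

Let wZ c xi : 0 < c -> w (vscale c xi) = c `^ (- (n%:R + 2 * r)) * w xi.
Proof.
by move=> c0; rewrite /wt enormZ (ger0_norm (ltW c0)) powRM ?enorm_ge0// ltW.
Qed.

Let exp_gt (x : R) : exists k, x < 2 ^+ k.
Proof. by exists (Num.Def.archi_bound x); exact: upper_nthrootP. Qed.

Let mw := @measurable_wt R n r.

Let pow2_gt1 (a : R) : 0 < a -> 1 < 2 `^ a.
Proof.
move=> a0; suff: 1 `^ a < 2 `^ a by rewrite powR1.
by apply: gt0_ltr_powR; rewrite ?nnegrE ?ltr1n.
Qed.

Let half0 : 0 < 2^-1 :> R. Proof. by rewrite invr_gt0. Qed.

Let inner_lty : (\int[lam]_(xi in [set xi : E | (0 < enorm xi <= 1)%R])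
  (enorm xi ^+ 2 * w xi)%:E < +oo)%E.
Proof.
pose g (xi : E) := enorm xi ^+ 2 * w xi.
have mg : measurable_fun setT g by apply: measurable_funM => //; exact: measurable_funX.
have g0 xi : 0 <= g xi by rewrite mulr_ge0 ?sqr_ge0// powR_ge0.
pose A k := [set xi : E | (2^-1 ^+ k < enorm xi <= 1)%R].
have mA k : measurable (A k).
  rewrite (_ : A k = [set xi : E | `]2^-1 ^+ k, 1]%classic (enorm xi)]); last first.
    by apply/seteqP; split => xi; rewrite /A /= in_itv.
  by apply: mpre; exact: measurable_itv.
have -> : [set xi : E | (0 < enorm xi <= 1)%R] = \bigcup_k A k.
  apply/seteqP; split => [xi /= /andP[x0 x1]|xi [k _] /= /andP[h ->]]; last first.
    by rewrite (lt_trans _ h).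
  have [k hk] := exp_gt (enorm xi)^-1; exists k => //=.
  by rewrite /A/= x1 andbT exprVn invf_plt ?posrE// exprn_gt0.
have A1E xi : A 1%N xi -> (2^-1 < enorm xi <= 1)%R by rewrite /A/= expr1.
(* The integrand has degree 2 - n - 2r; the ratio between dyadic shells is below 1 because r < 1. *)
apply: (@homogeneous_integral_lty g 2 (2 `^ (2 * r - 2)) A) => //.
- rewrite powR_ge0/= -[2 * r - 2]opprK powRN invf_lt1 ?powR_gt0//.
  by apply: pow2_gt1; rewrite opprB subr_gt0 -[ltRHS]mulr1 ltr_pM2l.
- move=> xi; rewrite /g wZ// enormZ ger0_norm// exprMn.
  rewrite -!(@powR_mulrn R 2)//.
  have -> : 2 `^ (2 * r - 2) * 2 `^ n%:R * (2 `^ 2%:R * enorm xi ^+ 2 * (2 `^ (- (n%:R + 2 * r)) * w xi)) =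
    (2 `^ (2 * r - 2) * 2 `^ n%:R * 2 `^ 2%:R * 2 `^ (- (n%:R + 2 * r))) * (enorm xi ^+ 2 * w xi) by ring.
  have c20 : (2 == 0 :> R) = false by rewrite pnatr_eq0.
  have expo : 2 * r - 2 + n%:R + 2%:R + - (n%:R + 2 * r) = 0 :> R by ring.
  rewrite -!powRD ?c20 ?implybT// expo ?powRr0 ?mul1r//.
- move=> a b ab; apply/subsetPset => xi; rewrite /A/= => /andP[h ->]; rewrite andbT.
  apply: le_lt_trans h; rewrite !exprVn lef_pV2 ?posrE ?exprn_gt0//.
  by rewrite ler_weXn2l// ler1n.
- apply/seteqP; split => // xi; rewrite /A/= expr0 => /andP[h1 h2].
  by have := lt_le_trans h1 h2; rewrite ltxx.
- move=> k xi; rewrite /A/= expr1 enormZ ger0_norm// => /andP[h1 h2].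
  have [h|h] := ltP 2^-1 (enorm xi); first by left; rewrite h2.
  right; rewrite -ler_pdivlMl// mulr1 h andbT.
  by rewrite -ltr_pdivrMl// -exprS.
- have hle : (\int[lam]_xi (g xi * \1_(A 1%N) xi)%:E <=
      \int[lam]_xi ((2^-1 `^ (- (n%:R + 2 * r)))%:E * (\1_unit_ball xi)%:E))%E.
    apply: ge0_le_integral => //.
    + by move=> xi _; rewrite lee_fin mulr_ge0// indicE.
    + by apply/measurable_EFinP; apply: measurable_funM => //; exact: measurable_indic.
    + by apply: emeasurable_funM => //; apply: measurable_EFin_indic; exact: measurable_unit_ball.
    move=> xi _; rewrite -EFinM lee_fin !indicE.
    case: (boolP (xi \in A 1%N)) => [/set_mem/A1E/andP[h1 h2]|_]; last first.
      by rewrite mulr0 mulr_ge0// powR_ge0.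
    rewrite mem_set// !mulr1 /g -[leRHS]mul1r ler_pM ?sqr_ge0 ?powR_ge0//.
      by rewrite expr_le1 ?enorm_ge0.
    rewrite /wt !powRN lef_pV2 ?posrE ?powR_gt0 ?(lt_trans half0 h1) ?half0//.
    apply: ge0_ler_powR; rewrite ?nnegrE ?enorm_ge0 ?(ltW half0) ?(ltW h1)//.
    by rewrite addr_ge0 ?mulr_ge0// ltW.
  apply: le_lt_trans hle _.
  rewrite ge0_integralZl ?lee_fin ?powR_ge0//; last first.
    by apply: measurable_EFin_indic; exact: measurable_unit_ball.
  rewrite integral_indic ?setIT//; last exact: measurable_unit_ball.
  by rewrite lte_mul_pinfty ?lee_fin ?powR_ge0//; exact: lebesgue_unit_ball_lty.
Qed.

Let outer_lty : (\int[lam]_(xi in [set xi : E | (1 < enorm xi)%R]) (w xi)%:E < +oo)%E.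
Proof.
have w0 xi : 0 <= w xi by exact: powR_ge0.
pose A k := [set xi : E | (1 < enorm xi <= 2 ^+ k)%R].
have mA k : measurable (A k).
  rewrite (_ : A k = [set xi : E | `]1, 2 ^+ k]%classic (enorm xi)]); last first.
    by apply/seteqP; split => xi; rewrite /A /= in_itv.
  by apply: mpre; exact: measurable_itv.
have -> : [set xi : E | (1 < enorm xi)%R] = \bigcup_k A k.
  apply/seteqP; split => [xi /= x1|xi [k _] /= /andP[h _]//].
  have [k hk] := exp_gt (enorm xi); exists k => //=.
  by rewrite /A/= x1 ltW.
(* Here the ratio is below 1 because r > 0. *)
apply: (@homogeneous_integral_lty w 2^-1 (2 `^ (- (2 * r))) A) => //.
- rewrite powR_ge0/= powRN invf_lt1 ?powR_gt0//.
  by apply: pow2_gt1; rewrite mulr_gt0.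
- move=> xi; rewrite wZ//.
  have -> : 2^-1 = 2 `^ (-1) :> R by rewrite powR_inv1.
  rewrite -powR_mulrn ?powR_ge0// -!powRrM mulrA.
  have c20 : (2 == 0 :> R) = false by rewrite pnatr_eq0.
  have expo : - (2 * r) + -1 * n%:R + -1 * - (n%:R + 2 * r) = 0 :> R by ring.
  rewrite -!powRD ?c20 ?implybT// expo ?powRr0 ?mul1r//.
- move=> a b ab; apply/subsetPset => xi; rewrite /A/= => /andP[-> h]/=.
  by apply: le_trans h _; rewrite ler_weXn2l// ler1n.
- apply/seteqP; split => // xi; rewrite /A/= expr0 => /andP[h1 h2].
  by have := lt_le_trans h1 h2; rewrite ltxx.
- move=> k xi; rewrite /A/= expr1 enormZ ger0_norm// => /andP[h1 h2].
  have [h|h] := leP (enorm xi) 2; first by left; rewrite h1.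
  right; rewrite ltr_pdivlMl ?mulr1 ?h//=.
  by rewrite ler_pdivrMl// -exprS.
- have hle : (\int[lam]_xi (w xi * \1_(A 1%N) xi)%:E <=
      \int[lam]_xi (\1_(cube 2 : set E) xi)%:E)%E.
    apply: ge0_le_integral => //.
    + by move=> xi _; rewrite lee_fin mulr_ge0// indicE.
    + by apply/measurable_EFinP; apply: measurable_funM => //; exact: measurable_indic.
    + by apply: measurable_EFin_indic; exact: measurable_cube.
    move=> xi _; rewrite lee_fin !indicE.
    case: (boolP (xi \in A 1%N)) => [/set_mem|_]; last by rewrite mulr0.
    rewrite /A/= expr1 => /andP[h1 h2].
    rewrite mem_set ?mulr1; last by move=> i; exact: le_trans (tnth_le_enorm _ _) _.
    rewrite /wt powRN invf_le1 ?powR_gt0 ?(lt_trans ltr01)//.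
    suff : 1 `^ (n%:R + 2 * r) <= enorm xi `^ (n%:R + 2 * r) by rewrite powR1.
    apply: ge0_ler_powR; rewrite ?nnegrE ?enorm_ge0 ?(ltW h1)//.
    by rewrite addr_ge0 ?mulr_ge0// ltW.
  apply: le_lt_trans hle _.
  rewrite integral_indic ?setIT//; last exact: measurable_cube.
  suff : (lam (cube 2) < +oo)%E by [].
  by rewrite lebesgue_cube// ltry.
Qed.

(** Up to a constant, this bounds the difference of the Fourier transforms of two probability
    measures with a first moment. *)
Definition cutnorm (xi : E) : R := Num.min 1 (enorm xi).

Lemma cutnorm_ge0 xi : 0 <= cutnorm xi.
Proof. by rewrite le_min ler01 enorm_ge0. Qed.

Lemma measurable_cutnorm : measurable_fun setT cutnorm.
Proof. by apply: measurable_minr => //; exact: measurable_enorm. Qed.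

Lemma cutnorm_integral_lty : (\int[lam]_xi (cutnorm xi ^+ 2 * w xi)%:E < +oo)%E.
Proof.
have mI : measurable [set xi : E | (0 < enorm xi <= 1)%R].
  rewrite (_ : [set _ | _] = [set xi : E | `]0, 1]%classic (enorm xi)]); last first.
    by apply/seteqP; split => xi; rewrite /= in_itv.
  by apply: mpre; exact: measurable_itv.
have mO : measurable [set xi : E | (1 < enorm xi)%R].
  rewrite (_ : [set _ | _] = [set xi : E | `]1, +oo[%classic (enorm xi)]); last first.
    by apply/seteqP; split => xi; rewrite /= in_itv/= andbT.
  by apply: mpre; exact: measurable_itv.
have w0 xi : 0 <= w xi by exact: powR_ge0.
have mg : measurable_fun setT (fun xi : E => enorm xi ^+ 2 * w xi).
  by apply: measurable_funM => //; exact: measurable_funX.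
have := inner_lty; rewrite ge0_integral_indicr => hi.
have := outer_lty; rewrite ge0_integral_indicr => ho.
apply: le_lt_trans (lte_add_pinfty hi ho).
rewrite -ge0_integralD//; last 4 first.
- by move=> xi _; rewrite mule_ge0 ?EFin_indic_ge0// lee_fin mulr_ge0 ?sqr_ge0.
- by apply: emeasurable_funM; [exact/measurable_EFinP|exact: measurable_EFin_indic].
- by move=> xi _; rewrite mule_ge0 ?EFin_indic_ge0// lee_fin.
- by apply: emeasurable_funM; [exact/measurable_EFinP|exact: measurable_EFin_indic].
apply: ge0_le_integral => //.
- by move=> xi _; rewrite lee_fin !mulr_ge0 ?sqr_ge0// cutnorm_ge0.
- apply/measurable_EFinP; apply: measurable_funM => //; apply: measurable_funX.
  exact: measurable_cutnorm.
- apply: emeasurable_funD; (apply: emeasurable_funM; [exact/measurable_EFinP|exact: measurable_EFin_indic]).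
move=> xi _; rewrite -!EFinM -EFinD lee_fin !indicE.
have [x0|x0] := eqVneq (enorm xi) 0.
  rewrite wt_eq0// ?mulr0 ?mul0r ?addr0//.
have {}x0 : 0 < enorm xi by rewrite lt_neqAle eq_sym x0 enorm_ge0.
have [h|h] := leP (enorm xi) 1.
  have -> : xi \in [set xi : E | (0 < enorm xi <= 1)%R] by rewrite inE/= x0 h.
  rewrite mulr1 /cutnorm min_r// lerDl mulr_ge0//.
have -> : xi \in [set xi : E | (1 < enorm xi)%R] by rewrite inE.
rewrite mulr1 /cutnorm min_l ?(ltW h)// expr1n mul1r.
by rewrite lerDr mulr_ge0 ?ler0n// mulr_ge0 ?sqr_ge0.
Qed.

(** A reflection carries the direction of z to e, and the dilation by |z| leaves the exponent 2r out
    of the weight of degree - n - 2r. *)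
Lemma cosine_energy (z e : E) : enorm e = 1 ->
  (\int[lam]_xi ((1 - cos (dotp xi z)) * w xi)%:E =
   (enorm z `^ (2 * r))%:E * \int[lam]_xi ((1 - cos (dotp xi e)) * w xi)%:E)%E.
Proof.
move=> e1.
have w0 xi : 0 <= w xi by exact: powR_ge0.
have mcos (u : E) : measurable_fun setT (fun xi => ((1 - cos (dotp xi u)) * w xi)%:E : \bar R).
  apply/measurable_EFinP; apply: measurable_funM => //; apply: measurable_funB => //.
  apply: (@measurableT_comp _ _ _ _ _ _ (@cos R)); last exact: measurable_dotp.
  by apply: continuous_measurable_fun; exact: continuous_cos.
have cosge0 (u xi : E) : (0 <= ((1 - cos (dotp xi u)) * w xi)%:E :> \bar R)%E.
  by rewrite lee_fin mulr_ge0// subr_ge0 cos_le1.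
have [z0|z0] := eqVneq (enorm z) 0.
  rewrite z0 powR0; last by rewrite mulf_neq0 ?pnatr_eq0// gt_eqF.
  rewrite mul0e integral0_eq// => xi _.
  by rewrite (enorm_eq0 z0) dotp_origin cos0 subrr mul0r.
have {}z0 : 0 < enorm z by rewrite lt_neqAle eq_sym z0 enorm_ge0.
have dz : enorm (direction z) = enorm e by rewrite enorm_direction ?gt_eqF.
have iU := householder_isometry (vsub (direction z) e).
rewrite -[in RHS](ge0_integral_isometry iU (mcos e) (cosge0 e)).
under [in RHS]eq_integral => xi _.
  rewrite -{2}(householder_swap dz) (isom_dotp iU) /wt (isom_enorm _ iU) -/(w xi).
  over.
have := ge0_integral_vscale z0 (mcos (direction z)) (cosge0 (direction z)).
move=> <-; rewrite -ge0_integralZl ?lee_fin ?powR_ge0//; last 2 first.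
- apply: emeasurable_funM => //; apply: (measurableT_comp (mcos (direction z))).
  exact: measurable_vscale.
- by move=> xi _; rewrite mule_ge0 ?cosge0// lee_fin exprn_ge0// ltW.
apply: eq_integral => xi _; rewrite -!EFinM; congr (_%:E).
have -> : dotp (vscale (enorm z) xi) (direction z) = dotp xi z.
  by rewrite dotpZl direction_vscale dotpZr mulrA divff ?mul1r// gt_eqF.
rewrite wZ//.
rewrite -powR_mulrn ?ltW//.
have -> : enorm z `^ (2 * r) * ((1 - cos (dotp xi z)) * (enorm z `^ (- (n%:R + 2 * r)) * w xi) * enorm z `^ n%:R)
  = (enorm z `^ (2 * r) * enorm z `^ (- (n%:R + 2 * r)) * enorm z `^ n%:R) * ((1 - cos (dotp xi z)) * w xi) by ring.
have expo : 2 * r + - (n%:R + 2 * r) + n%:R = 0 :> R by ring.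
rewrite -!powRD ?(gt_eqF z0) ?implybT// expo ?powRr0 ?mul1r//.
Qed.

End weight_integrals.

(** * Bounded measurable functions *)

Section bounded_functions.
Context {R : realType} {d : measure_display} {T : measurableType d}.
Implicit Types f g : T -> R.

(** The test functions of [has_generator]; they are integrable for every probability measure. *)
Definition bmf f := measurable_fun setT f /\ exists M, forall x, `|f x| <= M.

Lemma bmf_cst c : bmf (fun=> c).
Proof. by split => //; exists `|c|. Qed.

Lemma bmfD f g : bmf f -> bmf g -> bmf (fun x => f x + g x).
Proof.
move=> [mf [M fM]] [mg [L gL]]; split; first exact: measurable_funD.
by exists (M + L) => x; apply: le_trans (ler_normD _ _) _; rewrite lerD.
Qed.

Lemma bmfM f g : bmf f -> bmf g -> bmf (fun x => f x * g x).
Proof.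
move=> [mf [M fM]] [mg [L gL]]; split; first exact: measurable_funM.
by exists (M * L) => x; rewrite normrM ler_pM.
Qed.

Lemma bmfZ c f : bmf f -> bmf (fun x => c * f x).
Proof. by apply: bmfM; exact: bmf_cst. Qed.

Lemma bmfB f g : bmf f -> bmf g -> bmf (fun x => f x - g x).
Proof.
move=> bf bg; have := bmfD bf (bmfZ (-1) bg); congr bmf.
by apply/funext => x; rewrite mulN1r.
Qed.

Lemma bmf_indic (A : set T) : measurable A -> bmf \1_A.
Proof.
by move=> mA; split; [exact: measurable_indic|exists 1 => x; rewrite indicE ger0_norm// lern1 leq_b1].
Qed.

Lemma bmf_integrable (m : {finite_measure set T -> \bar R}) f : bmf f ->
  m.-integrable setT (EFin \o f).
Proof.
move=> [mf [M fM]].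
apply: (@le_integrable _ _ _ m _ measurableT _ (EFin \o cst M)).
- exact/measurable_EFinP.
- by move=> x _ /=; rewrite lee_fin; apply: le_trans (fM x) _; exact: ler_norm.
- by apply: finite_measure_integrable_cst.
Qed.

Lemma Rintegral_prob_cst (m : probability T R) c : \int[m]_x c = c.
Proof.
rewrite Rintegral_cst//; have /(congr1 fine)/= e := probability_setT m.
by rewrite [X in _ * X]e mulr1.
Qed.

Lemma norm_Rintegral_le (m : probability T R) f g : m.-integrable setT (EFin \o f) ->
  m.-integrable setT (EFin \o g) ->
  (forall x, `|f x| <= g x) -> `|\int[m]_x f x| <= \int[m]_x g x.
Proof.
move=> If Ig fg; apply: le_trans (le_normr_Rintegral measurableT If) _.
by apply: le_Rintegral => //; exact: integrable_norm.
Qed.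

Lemma bmf_Rintegral_le (m : probability T R) f M : bmf f ->
  (forall x, `|f x| <= M) -> `|\int[m]_x f x| <= M.
Proof.
move=> bf fM; rewrite -[leRHS](Rintegral_prob_cst m).
by apply: norm_Rintegral_le => //; apply: bmf_integrable => //; exact: bmf_cst.
Qed.

Lemma Rintegral_indic (m : {finite_measure set T -> \bar R}) (A : set T) :
  measurable A -> \int[m]_x \1_A x = fine (m A).
Proof. by move=> mA; rewrite /Rintegral integral_indic// setIT. Qed.

End bounded_functions.

Section parametric.
Context {R : realType} {d1 d2 : measure_display}
  {T1 : measurableType d1} {T2 : measurableType d2}.

Lemma measurable_Rintegral (m : {sigma_finite_measure set T2 -> \bar R}) (f : T1 * T2 -> R) :
  measurable_fun setT f -> measurable_fun setT (fun x => \int[m]_y f (x, y)).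
Proof.
move=> mf; have mEf : measurable_fun setT (EFin \o f) by exact/measurable_EFinP.
apply: (@measurableT_comp _ _ _ _ _ _ (@fine R)).
  exact: fine_measurable.
rewrite (_ : (fun x => _) = (fun x =>
  \int[m]_y (EFin \o f)^\+ (x, y) - \int[m]_y (EFin \o f)^\- (x, y))%E); last first.
  by apply/funext => x; rewrite [LHS]integralE; congr (_ - _)%E; apply: eq_integral => y _;
  rewrite ?funeposE ?funenegE.
apply: emeasurable_funB; apply: measurable_fun_fubini_tonelli_F => //.
- exact: measurable_funepos.
- exact: measurable_funeneg.
Qed.

(** A product bound valid everywhere makes every section integrable, so that [fine] is harmless at
    each point and not only almost everywhere. *)
Lemma Rintegral_fubini (m1 : {sigma_finite_measure set T1 -> \bar R})
  (m2 : {sigma_finite_measure set T2 -> \bar R})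
  (f : T1 * T2 -> R) (g : T1 -> R) (h : T2 -> R) :
  measurable_fun setT f ->
  m1.-integrable setT (EFin \o g) -> m2.-integrable setT (EFin \o h) ->
  (forall x y, `|f (x, y)| <= g x * h y) ->
  \int[m1]_x \int[m2]_y f (x, y) = \int[m2]_y \int[m1]_x f (x, y).
Proof.
move=> mf Ig Ih fgh.
have mEf : measurable_fun setT (EFin \o f) by exact/measurable_EFinP.
have I2 x : m2.-integrable setT (EFin \o (fun y => f (x, y))).
  apply: (@le_integrable _ _ _ m2 _ measurableT _ (EFin \o (fun y => g x * h y))) => //.
  - by apply/measurable_EFinP; apply: (measurableT_comp mf); exact: pair1_measurable.
  - by move=> y _ /=; rewrite lee_fin; apply: le_trans (fgh x y) _; exact: ler_norm.
  - by have := integrableZl measurableT (g x) Ih; congr integrable.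
have I1 y : m1.-integrable setT (EFin \o (fun x => f (x, y))).
  apply: (@le_integrable _ _ _ m1 _ measurableT _ (EFin \o (fun x => g x * h y))) => //.
  - by apply/measurable_EFinP; apply: (measurableT_comp mf); exact: pair2_measurable.
  - by move=> x _ /=; rewrite lee_fin; apply: le_trans (fgh x y) _; exact: ler_norm.
  - have := integrableZl measurableT (h y) Ig; congr integrable.
    by apply/funext => x /=; rewrite -EFinM mulrC.
have If : (m1 \x m2)%E.-integrable setT (EFin \o f).
  apply/integrable12ltyP => //.
  have /integrableP[mg gty] := Ig; have /integrableP[mh hty] := Ih.
  apply: (@le_lt_trans _ _ (\int[m1]_x (`|(g x)%:E| * \int[m2]_y `|(h y)%:E|))%E).
    apply: ge0_le_integral => //.
    - by move=> x _; exact: integral_ge0.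
    - apply: (@measurable_fun_fubini_tonelli_F _ _ _ _ _ m2 (fun z => `|(EFin \o f) z|%E)) => //.
      exact: measurableT_comp.
    - by apply: emeasurable_funM => //; exact: measurableT_comp.
    move=> x _; rewrite -ge0_integralZl//; last exact: measurableT_comp.
    apply: ge0_le_integral => //.
    - by apply: measurableT_comp => //; apply: (measurableT_comp mEf); exact: pair1_measurable.
    - by apply: emeasurable_funM => //; exact: measurableT_comp.
    move=> y _ /=; rewrite -EFinM lee_fin -normrM; apply: le_trans (fgh x y) _.
    exact: ler_norm.
  rewrite ge0_integralZr//; last 2 first.
    exact: measurableT_comp.
    exact: integral_ge0.
  apply: lte_mul_pinfty => //; first exact: integral_ge0.
  by rewrite ge0_fin_numE//; exact: integral_ge0.
rewrite /Rintegral.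
under eq_integral => x _ do rewrite fineK ?(integrable_fin_num measurableT (I2 x))//.
under [in RHS]eq_integral => y _ do rewrite fineK ?(integrable_fin_num measurableT (I1 y))//.
by rewrite (Fubini If).
Qed.

End parametric.

(** * The Hilbert space *)

Section weighted_space.
Context {R : realType} (n : nat) (r : R).
Hypotheses (n2 : (2 <= n)%N) (r01 : 0 < r < 1).
Notation E := (n.-tuple R).
Notation lam := (lebesgue_tuple R n).
Notation cut := (@cutnorm R n).
Implicit Types f g h : bool -> E -> R.

(** The squared normalization of the Fourier transform is moved into the weight, so that transforms
    can be left unnormalized. *)
Definition fw (xi : E) : R := ((2 * pi) `^ (- (n%:R / 2))) ^+ 2 * @wt R n r xi.

Lemma fw_ge0 xi : 0 <= fw xi.
Proof. by rewrite mulr_ge0 ?sqr_ge0 ?powR_ge0. Qed.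

Lemma measurable_fw : measurable_fun setT fw.
Proof. by apply: measurable_funM => //; exact: measurable_wt. Qed.

Lemma cut_fw_integrable :
  lam.-integrable setT (EFin \o (fun xi => cut xi ^+ 2 * fw xi)).
Proof.
have mc : measurable_fun setT (fun xi : E => cut xi ^+ 2 * @wt R n r xi).
  apply: measurable_funM; last exact: measurable_wt.
  by apply: measurable_funX; exact: measurable_cutnorm.
have I : lam.-integrable setT (EFin \o (fun xi => cut xi ^+ 2 * @wt R n r xi)).
  apply/integrableP; split; first exact/measurable_EFinP.
  apply: le_lt_trans (cutnorm_integral_lty n2 r01).
  rewrite le_eqVlt; apply/orP; left; apply/eqP; apply: eq_integral => xi _ /=.
  by rewrite ger0_norm// mulr_ge0 ?sqr_ge0 ?powR_ge0.
have := integrableZl measurableT (((2 * pi) `^ (- (n%:R / 2))) ^+ 2) I.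
by congr integrable; apply/funext => xi /=; rewrite -EFinM mulrCA.
Qed.

(** A pair of real functions indexed by [bool] stands for a complex one. The domination is stronger
    than membership in the weighted L^2 space, and is stable under the averages and linear
    combinations used below. *)
Definition hdom f := (forall b, measurable_fun setT (f b)) /\
  exists2 M : R, 0 <= M & forall b xi, `|f b xi| <= M * cut xi.

Definition pairing f g (xi : E) : R := f true xi * g true xi + f false xi * g false xi.

Definition ip f g : R := \int[lam]_xi (pairing f g xi * fw xi).

Definition hnorm f : R := Num.sqrt (ip f f).

(** The norm of the element whose two components both equal min(1, |xi|). *)
Definition cut_const : R := Num.sqrt (2 * \int[lam]_xi (cut xi ^+ 2 * fw xi)).

Lemma pairing_le f g M L : (forall b xi, `|f b xi| <= M * cut xi) ->
  (forall b xi, `|g b xi| <= L * cut xi) ->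
  forall xi, `|pairing f g xi * fw xi| <= M * L * (2 * (cut xi ^+ 2 * fw xi)).
Proof.
move=> fM gL xi; rewrite normrM (ger0_norm (fw_ge0 xi)).
have h b : `|f b xi * g b xi| <= M * L * cut xi ^+ 2.
  have -> : M * L * cut xi ^+ 2 = (M * cut xi) * (L * cut xi) by ring.
  by rewrite normrM ler_pM.
have -> : M * L * (2 * (cut xi ^+ 2 * fw xi)) =
  (M * L * cut xi ^+ 2 + M * L * cut xi ^+ 2) * fw xi by ring.
rewrite ler_wpM2r ?fw_ge0//; apply: le_trans (ler_normD _ _) _.
exact: lerD.
Qed.

Lemma measurable_pairing f g : (forall b, measurable_fun setT (f b)) ->
  (forall b, measurable_fun setT (g b)) ->
  measurable_fun setT (fun xi => pairing f g xi * fw xi).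
Proof.
move=> mf mg; apply: measurable_funM; last exact: measurable_fw.
by apply: measurable_funD; exact: measurable_funM.
Qed.

Lemma ip_integrable f g : hdom f -> hdom g ->
  lam.-integrable setT (EFin \o (fun xi => pairing f g xi * fw xi)).
Proof.
move=> [mf [M M0 fM]] [mg [L L0 gL]].
apply: (@le_integrable _ _ _ lam _ measurableT _
  (EFin \o (fun xi => M * L * (2 * (cut xi ^+ 2 * fw xi))))).
- by apply/measurable_EFinP; exact: measurable_pairing.
- move=> xi _ /=; rewrite lee_fin; apply: le_trans (pairing_le fM gL xi) _.
  exact: ler_norm.
- have := integrableZl measurableT (M * L * 2) cut_fw_integrable.
  by congr integrable; apply/funext => xi /=; rewrite -EFinM; congr EFin; ring.
Qed.

Lemma hdom_lin f g a : hdom f -> hdom g -> hdom (fun b xi => f b xi + a * g b xi).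
Proof.
move=> [mf [M M0 fM]] [mg [L L0 gL]]; split.
  by move=> b; apply: measurable_funD => //; exact: measurable_funM.
exists (M + `|a| * L); first by rewrite addr_ge0// mulr_ge0.
move=> b xi; apply: le_trans (ler_normD _ _) _.
by rewrite mulrDl lerD// normrM -mulrA ler_wpM2l.
Qed.

Lemma hdom0 : hdom (fun _ _ => 0).
Proof. by split => //; exists 0 => // b xi; rewrite normr0 mul0r. Qed.

Lemma hdom_sum (I : Type) (s : seq I) (F : I -> bool -> E -> R) :
  (forall i, hdom (F i)) -> hdom (fun b xi => \sum_(i <- s) F i b xi).
Proof.
move=> dF; elim: s => [|i s IH].
  have := hdom0; congr hdom; apply/funext => b; apply/funext => xi; by rewrite big_nil.
have := hdom_lin 1 (dF i) IH; congr hdom; apply/funext => b; apply/funext => xi.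
by rewrite big_cons mul1r.
Qed.

Lemma ipC f g : ip f g = ip g f.
Proof.
apply: eq_Rintegral => xi _; rewrite /pairing; congr (_ * _).
by rewrite mulrC; congr (_ + _); rewrite mulrC.
Qed.

Lemma ip_linr f g h a : hdom f -> hdom g -> hdom h ->
  ip f (fun b xi => g b xi + a * h b xi) = ip f g + a * ip f h.
Proof.
move=> df dg dh; rewrite /ip -RintegralZl//; last exact: ip_integrable.
rewrite -RintegralD//; last 2 first.
- exact: ip_integrable.
- have := integrableZl measurableT a (ip_integrable df dh).
  by congr integrable.
by apply: eq_Rintegral => xi _; rewrite /pairing; ring.
Qed.

Lemma ip0r f : ip f (fun _ _ => 0) = 0.
Proof.
rewrite /ip; under eq_Rintegral do rewrite /pairing !mulr0 addr0 mul0r.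
by rewrite /Rintegral integral0.
Qed.

Lemma ip_sumr (I : Type) (s : seq I) f (F : I -> bool -> E -> R) : hdom f ->
  (forall i, hdom (F i)) ->
  ip f (fun b xi => \sum_(i <- s) F i b xi) = \sum_(i <- s) ip f (F i).
Proof.
move=> df dF; elim: s => [|i s IH].
  rewrite big_nil -[RHS](ip0r f); congr ip; apply/funext => b; apply/funext => xi.
  by rewrite big_nil.
rewrite big_cons -IH -[X in _ = _ + X]mul1r -ip_linr//; last exact: hdom_sum.
by congr ip; apply/funext => b; apply/funext => xi; rewrite big_cons mul1r.
Qed.

Lemma ipZr f g a : hdom f -> hdom g -> ip f (fun b xi => a * g b xi) = a * ip f g.
Proof.
move=> df dg; have := ip_linr a df hdom0 dg; rewrite ip0r add0r => <-.
by congr ip; apply/funext => b; apply/funext => xi; rewrite add0r.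
Qed.

Lemma ip_ge0 f : 0 <= ip f f.
Proof.
apply: Rintegral_ge0 => xi _; rewrite mulr_ge0 ?fw_ge0// /pairing -!expr2.
by rewrite addr_ge0 ?sqr_ge0.
Qed.

Lemma ip_sqr_lin f g a : hdom f -> hdom g ->
  let h := fun b xi => f b xi + a * g b xi in
  ip h h = ip f f + 2 * a * ip f g + a ^+ 2 * ip g g.
Proof.
move=> df dg h; have dh : hdom h by exact: hdom_lin.
rewrite {2}/h ip_linr// (ipC h f) (ipC h g) /h !ip_linr// (ipC g f); ring.
Qed.

Lemma hnorm_ge0 f : 0 <= hnorm f. Proof. exact: sqrtr_ge0. Qed.

Lemma sqr_hnorm f : hnorm f ^+ 2 = ip f f.
Proof. by rewrite sqr_sqrtr ?ip_ge0. Qed.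

Lemma ip_le f g : hdom f -> hdom g -> `|ip f g| <= hnorm f * hnorm g.
Proof.
move=> df dg; rewrite /hnorm -sqrtrM ?ip_ge0// -sqrtr_sqr ler_wsqrtr//.
have q a : 0 <= ip f f + 2 * a * ip f g + a ^+ 2 * ip g g.
  by rewrite -ip_sqr_lin// ip_ge0.
have := ip_ge0 g; rewrite le_eqVlt => /orP[/eqP g0|g0].
  rewrite -g0 mulr0; have [->|fg0] := eqVneq (ip f g) 0; first by rewrite expr0n.
  (* If g is degenerate, the nonnegative quadratic is affine in a; at this value it would be -1. *)
  have := q (- (ip f f + 1) / (2 * ip f g)); rewrite -g0 mulr0 addr0.
  have -> : 2 * (- (ip f f + 1) / (2 * ip f g)) * ip f g = - (ip f f + 1).
    by field; rewrite ?fg0 ?pnatr_eq0.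
  by rewrite opprD addrA subrr add0r lerNr oppr0 ler10.
have := q (- ip f g / ip g g).
have -> : ip f f + 2 * (- ip f g / ip g g) * ip f g + (- ip f g / ip g g) ^+ 2 * ip g g
  = (ip f f * ip g g - ip f g ^+ 2) / ip g g by field; rewrite gt_eqF.
by rewrite pmulr_lge0 ?invr_gt0// subr_ge0.
Qed.

Lemma hnorm_lin_le f g a : hdom f -> hdom g ->
  hnorm (fun b xi => f b xi + a * g b xi) <= hnorm f + `|a| * hnorm g.
Proof.
move=> df dg; rewrite -[leRHS]ger0_norm ?addr_ge0 ?mulr_ge0 ?hnorm_ge0//.
rewrite -sqrtr_sqr ler_wsqrtr// ip_sqr_lin// sqrrD exprMn !sqr_hnorm real_normK ?num_real//.
rewrite lerD2r lerD2l.
apply: le_trans (ler_norm _) _; rewrite !normrM ger0_norm// -mulr_natl.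
have := ip_le df dg; have := normr_ge0 a; nra.
Qed.

Lemma hnorm_cut f M : 0 <= M -> (forall b, measurable_fun setT (f b)) ->
  (forall b xi, `|f b xi| <= M * cut xi) -> hnorm f <= M * cut_const.
Proof.
move=> M0 mf fM; have df : hdom f by split => //; exists M.
rewrite -[X in X * _](ger0_norm M0) -sqrtr_sqr /cut_const -sqrtrM ?sqr_ge0//.
rewrite ler_wsqrtr// -!RintegralZl//; last 2 first.
- by have := integrableZl measurableT 2 cut_fw_integrable; congr integrable.
- exact: cut_fw_integrable.
apply: le_Rintegral => //; first exact: ip_integrable.
- have := integrableZl measurableT (M ^+ 2 * 2) cut_fw_integrable.
  by congr integrable; apply/funext => xi /=; rewrite -EFinM; congr EFin; ring.
- by move=> xi _; apply: le_trans (ler_norm _) _; exact: pairing_le.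
Qed.

Section average.
Context {dT : measure_display} {T : measurableType dT} (m : probability T R).
Variables (Z : T -> bool -> E -> R) (gT : T -> R).
Hypothesis mZ : forall b, measurable_fun setT (fun p : T * E => Z p.1 b p.2).
Hypothesis IgT : m.-integrable setT (EFin \o gT).
Hypothesis ZgT : forall t b xi, `|Z t b xi| <= gT t * cut xi.

Let mZ1 b xi : measurable_fun setT (fun t => Z t b xi).
Proof. have h := measurableT_comp (mZ b) (pair2_measurable xi); exact: h. Qed.

Let mZ2 t b : measurable_fun setT (fun xi => Z t b xi).
Proof. have h := measurableT_comp (mZ b) (pair1_measurable t); exact: h. Qed.

Let IZ b xi : m.-integrable setT (EFin \o (fun t => Z t b xi)).
Proof.
apply: (@le_integrable _ _ _ m _ measurableT _ (EFin \o (fun t => gT t * cut xi))) => //.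
- exact/measurable_EFinP.
- by move=> t _ /=; rewrite lee_fin; apply: le_trans (ZgT _ _ _) _; exact: ler_norm.
- have := integrableZr measurableT (cut xi) IgT; congr integrable.
Qed.

Lemma hdom_average : hdom (fun b xi => \int[m]_t Z t b xi).
Proof.
split.
  move=> b; apply: (@measurable_Rintegral _ _ _ _ _ m (fun p => Z p.2 b p.1)).
  have h := measurableT_comp (mZ b) (@measurable_swap _ _ E T); exact: h.
exists `|\int[m]_t gT t|; first exact: normr_ge0.
move=> b xi; apply: (@le_trans _ _ (\int[m]_t gT t * cut xi)).
  rewrite -RintegralZr//; apply: norm_Rintegral_le => //.
  by have := integrableZr measurableT (cut xi) IgT; congr integrable.
by rewrite ler_wpM2r ?cutnorm_ge0// ler_norm.
Qed.

(** Stands in for a Bochner integral with values in the Hilbert space; the bound by gT t * cut xi is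
    the one that Fubini's theorem asks for. *)
Lemma ip_average f : hdom f ->
  ip f (fun b xi => \int[m]_t Z t b xi) = \int[m]_t ip f (Z t).
Proof.
move=> [mf [M M0 fM]].
rewrite /ip [RHS](@Rintegral_fubini _ _ _ _ _ m lam
  (fun p => pairing f (Z p.1) p.2 * fw p.2) gT
  (fun xi => M * (2 * (cut xi ^+ 2 * fw xi))))//; last 3 first.
- apply: measurable_funM; last by apply: measurableT_comp => //; exact: measurable_fw.
  by apply: measurable_funD; apply: measurable_funM => //; exact: measurableT_comp.
- have := integrableZl measurableT (M * 2) cut_fw_integrable.
  by congr integrable; apply/funext => xi /=; rewrite -EFinM; congr EFin; ring.
- move=> t xi /=; have := @pairing_le f (Z t) M (gT t) fM (ZgT t) xi.
  by rewrite [gT t * _]mulrA (mulrC (gT t)).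
apply: eq_Rintegral => xi _ /=; rewrite RintegralZr//; last first.
  have := integrableD measurableT (integrableZl measurableT (f true xi) (IZ true xi))
    (integrableZl measurableT (f false xi) (IZ false xi)).
  by congr integrable; apply/funext => t /=; rewrite -!EFinM -EFinD.
rewrite /pairing RintegralD//; last 2 first.
- by have := integrableZl measurableT (f true xi) (IZ true xi); congr integrable.
- by have := integrableZl measurableT (f false xi) (IZ false xi); congr integrable.
by rewrite !RintegralZl.
Qed.

End average.

End weighted_space.

(** * Fourier transforms of probability measures *)

Section trigonometry.
Context {R : realType}.
Implicit Types x y : R.

Definition trig (b : bool) y : R := if b then cos y else sin y.

Lemma trig_le1 b y : `|trig b y| <= 1.
Proof. by case: b; [exact: cos_max|exact: sin_max]. Qed.

Let is_derive_trig b y : is_derive y 1 (trig b) (if b then - sin y else cos y).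
Proof. by case: b; [exact: is_derive_cos|exact: is_derive_sin]. Qed.

Lemma continuous_trig b : continuous (trig b).
Proof. by case: b => y; [exact: continuous_cos|exact: continuous_sin]. Qed.

Lemma measurable_trig b : measurable_fun setT (trig b).
Proof. by apply: continuous_measurable_fun; exact: continuous_trig. Qed.

Lemma trig_lip b x y : `|trig b x - trig b y| <= `|x - y|.
Proof.
wlog xy : x y / y <= x => [h|].
  by have [/h//|/ltW/h] := leP y x; rewrite distrC (distrC y).
have [||c _ ->] := @MVT_segment _ (trig b) (fun z => if b then - sin z else cos z) y x xy.
- by move=> z _; exact: is_derive_trig.
- by apply: continuous_subspaceT; exact: continuous_trig.
rewrite normrM ler_piMl//.
by case: b; [rewrite normrN; exact: sin_max|exact: cos_max].
Qed.

Lemma trigD b x y : trig b (x + y) =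
  if b then cos x * cos y - sin x * sin y else sin x * cos y + cos x * sin y.
Proof. by case: b; [exact: cosD|exact: sinD]. Qed.

End trigonometry.

Section planar.
Context {R : realType}.
Implicit Types p q x e m : bool -> R.

Definition md p : R := Num.sqrt (p true ^+ 2 + p false ^+ 2).

(* A function [p] on [bool] stands for the complex number [p true + i p false]. *)
Definition cmul p q (b : bool) : R :=
  if b then p true * q true - p false * q false else p false * q true + p true * q false.

Lemma md_ge0 p : 0 <= md p. Proof. exact: sqrtr_ge0. Qed.

Lemma sqr_md p : md p ^+ 2 = p true ^+ 2 + p false ^+ 2.
Proof. by rewrite sqr_sqrtr// addr_ge0 ?sqr_ge0. Qed.

Lemma dot_md x p : x true * p true + x false * p false <= md x * md p.
Proof.
apply: le_trans (ler_norm _) _; rewrite -[leRHS]ger0_norm ?mulr_ge0 ?md_ge0//.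
rewrite -ler_sqr ?nnegrE// real_normK ?num_real// ger0_norm ?mulr_ge0 ?md_ge0// exprMn !sqr_md -subr_ge0.
have -> : (x true ^+ 2 + x false ^+ 2) * (p true ^+ 2 + p false ^+ 2) -
  (x true * p true + x false * p false) ^+ 2 = (x true * p false - x false * p true) ^+ 2 by ring.
exact: sqr_ge0.
Qed.

Lemma md_cmul p q : md (cmul p q) = md p * md q.
Proof.
rewrite /md -sqrtrM ?addr_ge0 ?sqr_ge0//; congr Num.sqrt; rewrite /cmul; ring.
Qed.

Lemma md_le p (M : R) : (forall b, `|p b| <= M) -> md p <= 2 * M.
Proof.
move=> pM; have M0 : 0 <= M by exact: le_trans (pM true).
rewrite -[leRHS]ger0_norm ?mulr_ge0// -sqrtr_sqr ler_wsqrtr//.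
have h b : p b ^+ 2 <= M ^+ 2 by rewrite -real_normK ?num_real// ler_sqr ?nnegrE.
by have := h true; have := h false; have := sqr_ge0 M; lra.
Qed.

(** From e1 e2 - m1 m2 = (e1 - m1) e2 + m1 (e2 - m2): each difference meets a factor of modulus at
    most 1. *)
Lemma dot_cmulB x e1 e2 m1 m2 : md e2 <= 1 -> md m1 <= 1 ->
  x true * (cmul e1 e2 true - cmul m1 m2 true) +
  x false * (cmul e1 e2 false - cmul m1 m2 false) <=
  md x * (md (fun b => e1 b - m1 b) + md (fun b => e2 b - m2 b)).
Proof.
move=> h2 h1; set p := fun b => e1 b - m1 b; set q := fun b => e2 b - m2 b.
have -> : x true * (cmul e1 e2 true - cmul m1 m2 true) +
  x false * (cmul e1 e2 false - cmul m1 m2 false) =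
  (x true * cmul p e2 true + x false * cmul p e2 false) +
  (x true * cmul m1 q true + x false * cmul m1 q false) by rewrite /cmul /p /q; ring.
rewrite [leRHS]mulrDr; apply: lerD; apply: le_trans (dot_md _ _) _;
  rewrite ler_wpM2l ?md_ge0// md_cmul.
- by rewrite ler_piMr ?md_ge0.
- by rewrite ler_piMl ?md_ge0.
Qed.

End planar.

Section transform.
Context {R : realType} (n : nat).
Notation E := (n.-tuple R).
Notation cut := (@cutnorm R n).
Implicit Types mu nu : probability E R.

(** Cosine part for [true], sine part for [false]: the complex conjugate of the transform, without
    its normalization. The modulus is unaffected by the conjugation. *)
Definition TF (mu : {measure set E -> \bar R}) (b : bool) (xi : E) : R :=
  \int[mu]_x trig b (dotp xi x).

Lemma measurable_trig_dotp b : measurable_fun setT (fun p : E * E => trig b (dotp p.1 p.2)).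
Proof. by apply: measurableT_comp; [exact: measurable_trig|exact: measurable_dotp]. Qed.

Lemma bmf_trig b (xi : E) : bmf (fun x : E => trig b (dotp xi x)).
Proof.
split; last by exists 1 => x; exact: trig_le1.
by apply: measurableT_comp; [exact: measurable_trig|exact: measurable_dotp].
Qed.

Lemma measurable_TF mu b : measurable_fun setT (TF mu b).
Proof. exact: (@measurable_Rintegral _ _ _ _ _ mu _ (measurable_trig_dotp b)). Qed.

Lemma TF_le1 mu b xi : `|TF mu b xi| <= 1.
Proof. by apply: bmf_Rintegral_le; [exact: bmf_trig|move=> x; exact: trig_le1]. Qed.

(* Jensen: rho^2 = int (C cos + S sin) dmu <= rho for rho = |C + i S|. *)
Lemma md_TF_le1 mu xi : md (TF mu ^~ xi) <= 1.
Proof.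
set p := TF mu ^~ xi.
have B b := bmf_integrable mu (bmf_trig b xi).
have : md p ^+ 2 <= md p.
  rewrite sqr_md !expr2 /p /TF -!RintegralZl// -RintegralD//; last 2 first.
  - by apply: bmf_integrable; apply: bmfZ; exact: bmf_trig.
  - by apply: bmf_integrable; apply: bmfZ; exact: bmf_trig.
  apply: le_trans (ler_norm _) _; apply: bmf_Rintegral_le.
    by apply: bmfD; apply: bmfZ; exact: bmf_trig.
  move=> x; have mt : md (trig^~ (dotp xi x)) = 1.
    by rewrite /md /= cos2Dsin2 sqrtr1.
  have := dot_md p (trig^~ (dotp xi x)); rewrite mt mulr1 => h1.
  have := dot_md (fun b => - p b) (trig^~ (dotp xi x)); rewrite mt mulr1 => h2.
  have e : md (fun b => - p b) = md p by rewrite /md !sqrrN.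
  have g : `|p true * trig true (dotp xi x) + p false * trig false (dotp xi x)| <= md p.
    by rewrite ler_norml; move: h1 h2; rewrite e; lra.
  exact: g.
by have := md_ge0 p; nra.
Qed.

Definition mom1 mu := mu.-integrable setT (EFin \o @enorm R n).

Lemma TF_sub0 mu b xi : mom1 mu ->
  `|TF mu b xi - trig b 0| <= enorm xi * \int[mu]_x enorm x.
Proof.
move=> m1; rewrite -[X in _ - X](Rintegral_prob_cst mu) /TF -RintegralB//; last 2 first.
- exact: bmf_integrable (bmf_trig b xi).
- exact: bmf_integrable (bmf_cst _).
rewrite -RintegralZl//; apply: norm_Rintegral_le.
- by apply: bmf_integrable; apply: bmfB; [exact: bmf_trig|exact: bmf_cst].
- by have := integrableZl measurableT (enorm xi) m1; congr integrable.
- move=> x; apply: le_trans (trig_lip _ _ _) _; rewrite subr0.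
  exact: dotp_le.
Qed.

Lemma le_cut (z M : R) xi : 0 <= M -> z <= M -> z <= enorm xi * M -> z <= M * cut xi.
Proof.
move=> M0 z1 z2; rewrite /cutnorm; case: (leP 1 (enorm xi)) => h.
  by rewrite mulr1.
by rewrite mulrC.
Qed.

(** Both transforms take the same value at 0 and are Lipschitz there by the first moments, which
    serves small xi; for large xi each is bounded by 1. *)
Lemma TF_sub_cut mu nu b xi : mom1 mu -> mom1 nu ->
  `|TF mu b xi - TF nu b xi| <=
  (2 + \int[mu]_x enorm x + \int[nu]_x enorm x) * cut xi.
Proof.
move=> m1 m2; have e0 m : 0 <= \int[m]_x @enorm R n x.
  by apply: Rintegral_ge0 => x _; exact: enorm_ge0.
apply: le_cut; first by rewrite !addr_ge0.
- apply: le_trans (ler_normB _ _) _.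
  by have := TF_le1 mu b xi; have := TF_le1 nu b xi; have := e0 mu; have := e0 nu; lra.
- have -> : TF mu b xi - TF nu b xi = (TF mu b xi - trig b 0) - (TF nu b xi - trig b 0) by ring.
  apply: le_trans (ler_normB _ _) _.
  have := TF_sub0 b xi m1; have := TF_sub0 b xi m2.
  by have := enorm_ge0 xi; rewrite !mulrDr; lra.
Qed.

Definition TFB (mu nu : {measure set E -> \bar R}) (b : bool) xi : R := TF mu b xi - TF nu b xi.

Lemma hdom_TFB mu nu : mom1 mu -> mom1 nu -> hdom (TFB mu nu).
Proof.
move=> m1 m2; split.
  by move=> b; apply: measurable_funB; exact: measurable_TF.
exists (2 + \int[mu]_x enorm x + \int[nu]_x enorm x).
  by rewrite !addr_ge0// Rintegral_ge0// => x _; exact: enorm_ge0.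
by move=> b xi; exact: TF_sub_cut.
Qed.

(** [hdom] makes the integral finite, so that the extended norm of the statement and the real one of
    the proof coincide. *)
Lemma hsobolevE (r : R) (mu nu : {measure set E -> \bar R}) :
  (2 <= n)%N -> 0 < r < 1 -> hdom (TFB mu nu) ->
  hsobolev (n%:R / 2 + r) mu nu = (hnorm r (TFB mu nu))%:E.
Proof.
move=> n2 r01 dB.
have I := ip_integrable n2 r01 dB dB.
rewrite /hsobolev (_ : (\int[_]_xi _)%E = (ip r (TFB mu nu) (TFB mu nu))%:E).
  by rewrite poweR12_sqrt// lee_fin ip_ge0.
rewrite /ip /Rintegral fineK; last exact: (integrable_fin_num measurableT I).
apply: eq_integral => xi _; congr EFin.
have -> : - (2 * (n%:R / 2 + r)) = - (n%:R + 2 * r) :> R by field.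
rewrite /fw /wt mulrA; congr (_ * _).
rewrite /fourier /pairing /TFB /TF /=.
set c := (2 * pi) `^ _; set a1 := \int[mu]_x cos _; set a2 := \int[mu]_x sin _.
set b1 := \int[nu]_x cos _; set b2 := \int[nu]_x sin _.
rewrite /ComplexField.Normc.normc /= sqr_sqrtr; last by rewrite addr_ge0 ?sqr_ge0.
ring.
Qed.

End transform.

(** * The collision operator *)

Section collisions.
Context {R : realType} (n : nat).
Hypothesis n2 : (2 <= n)%N.
Notation E := (n.-tuple R).
Notation S := (@uniform_sphere R n).
Implicit Types (mu nu : probability E R) (f : E -> R).

Let n0 : (0 < n)%N. Proof. exact: ltnW. Qed.

Lemma kac_post1E (v w s : E) : (kac_post v w s).1 =
  vadd (vscale 2^-1 (vadd v w)) (vscale (enorm (vsub v w) / 2) s).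
Proof. by apply: eq_from_tnth => i; rewrite /kac_post/= !vtnthE !tnth_mktuple; ring. Qed.

Lemma kac_post2E (v w s : E) : (kac_post v w s).2 =
  vadd (vscale 2^-1 (vadd v w)) (vscale (- (enorm (vsub v w) / 2)) s).
Proof. by apply: eq_from_tnth => i; rewrite /kac_post/= !vtnthE !tnth_mktuple; ring. Qed.

Lemma kac_post2N (v w s : E) : (kac_post v w s).2 = (kac_post v w (vscale (-1) s)).1.
Proof.
by rewrite kac_post1E kac_post2E; apply: eq_from_tnth => i; rewrite !vtnthE; ring.
Qed.

Section measurability.
Context {dT : measure_display} {T : measurableType dT} (a b c : T -> E).
Hypotheses (ma : measurable_fun setT a) (mb : measurable_fun setT b)
  (mc : measurable_fun setT c).

Lemma measurable_kac_post1 : measurable_fun setT (fun t => (kac_post (a t) (b t) (c t)).1).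
Proof.
under eq_fun do rewrite kac_post1E.
apply: measurable_vadd; apply: measurable_vscale => //; first exact: measurable_vadd.
by apply: measurable_funM => //; apply: measurable_enorm_comp; exact: measurable_vsub.
Qed.

Lemma measurable_kac_post2 : measurable_fun setT (fun t => (kac_post (a t) (b t) (c t)).2).
Proof.
under eq_fun do rewrite kac_post2E.
apply: measurable_vadd; apply: measurable_vscale => //; first exact: measurable_vadd.
apply: measurableT_comp => //.
by apply: measurable_funM => //; apply: measurable_enorm_comp; exact: measurable_vsub.
Qed.

End measurability.

Definition collision_sum f v w s : R := f (kac_post v w s).1 + f (kac_post v w s).2.

Definition coll f v w : R := \int[S]_s collision_sum f v w s - f v - f w.

(** The signed measure Q(mu, mu) tested against f. *)
Definition QF mu f : R := 2^-1 * \int[mu]_v \int[mu]_w coll f v w.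

Lemma measurable_collision_sum f : measurable_fun setT f ->
  measurable_fun setT (fun p : E * E * E => collision_sum f p.1.1 p.1.2 p.2).
Proof.
move=> mf.
have m11 : measurable_fun setT (fun p : E * E * E => p.1.1).
  by apply: measurableT_comp; exact: measurable_fst.
have m12 : measurable_fun setT (fun p : E * E * E => p.1.2).
  by apply: (measurableT_comp (@measurable_snd _ _ E E)); exact: measurable_fst.
apply: measurable_funD; apply: measurableT_comp => //.
- by apply: measurable_kac_post1.
- by apply: measurable_kac_post2.
Qed.

Lemma bmf_collision_sum f v w : bmf f -> bmf (collision_sum f v w).
Proof.
move=> [mf [M fM]]; split.
  by apply: measurable_funD; apply: measurableT_comp => //;
    [exact: measurable_kac_post1|exact: measurable_kac_post2].
by exists (M + M) => s; apply: le_trans (ler_normD _ _) _; rewrite lerD.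
Qed.

Lemma coll_le f v w M : bmf f -> (forall x, `|f x| <= M) -> `|coll f v w| <= 4 * M.
Proof.
move=> bf fM; have := fM v; have := fM w.
have : `|\int[S]_s collision_sum f v w s| <= 2 * M.
  apply: bmf_Rintegral_le; first exact: bmf_collision_sum.
  by move=> s; rewrite /collision_sum; apply: le_trans (ler_normD _ _) _;
    have := fM (kac_post v w s).1; have := fM (kac_post v w s).2; lra.
rewrite /coll; set J := \int[S]_s _ => h1 h2 h3.
apply: le_trans (ler_normB _ _) _; apply: le_trans (lerD (ler_normB _ _) (lexx _)) _; lra.
Qed.

Lemma measurable_coll f : measurable_fun setT f ->
  measurable_fun setT (fun p : E * E => coll f p.1 p.2).
Proof.
move=> mf; apply: measurable_funB.
  apply: measurable_funB; last exact: measurableT_comp.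
  exact: (@measurable_Rintegral _ _ _ _ _ S _ (measurable_collision_sum mf)).
exact: measurableT_comp.
Qed.

Lemma bmf_coll f : bmf f -> bmf (fun p : E * E => coll f p.1 p.2).
Proof.
move=> bf; split; first by apply: measurable_coll; case: bf.
by case: (bf) => _ [M fM]; exists (4 * M) => p; exact: coll_le.
Qed.

(** Carries the identities proved for nonnegative functions over to bounded ones, which become
    nonnegative after adding a constant. *)
Lemma eq_Rintegral_shift (dT : measure_display) (T : measurableType dT)
  (m : probability T R) (g1 g2 : T -> R) M : bmf g1 -> bmf g2 ->
  (\int[m]_x (g1 x + M)%:E = \int[m]_x (g2 x + M)%:E)%E ->
  \int[m]_x g1 x = \int[m]_x g2 x.
Proof.
move=> b1 b2 e.
have h g : bmf g -> \int[m]_x g x = \int[m]_x (g x + M) - M.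
  move=> bg; rewrite RintegralD//; last 2 first.
  - exact: bmf_integrable.
  - exact: bmf_integrable (bmf_cst _).
  by rewrite Rintegral_prob_cst addrK.
by rewrite (h g1 b1) (h g2 b2) /Rintegral e.
Qed.

Lemma sphere_neg (h : E -> R) : bmf h -> \int[S]_s h (vscale (-1) s) = \int[S]_s h s.
Proof.
move=> [mh [M hM]].
have mn : measurable_fun setT (fun s : E => vscale (-1) s) by exact: measurable_vscale.
apply: (@eq_Rintegral_shift _ _ _ _ _ M).
- by split; [exact: measurableT_comp|exists M => s; exact: hM].
- by split => //; exists M.
apply: (integral_sphere_isometry (neg_isometry) (h := fun s => (h s + M)%:E)).
- by apply/measurable_EFinP; exact: measurable_funD.
- by move=> s; rewrite lee_fin; have := hM s; rewrite ler_norml => /andP[]; lra.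
Qed.

Lemma sphere_zonal (e1 e2 : E) (h : R -> R) : enorm e1 = enorm e2 ->
  measurable_fun setT h -> (forall y, `|h y| <= 1) ->
  \int[S]_s h (dotp s e1) = \int[S]_s h (dotp s e2).
Proof.
move=> ee mh h1.
have bh e : bmf (fun s : E => h (dotp s e)).
  by split; [apply: measurableT_comp => //; exact: measurable_dotp|exists 1].
apply: (@eq_Rintegral_shift _ _ _ _ _ 1) => //.
apply: (ge0_sphere_zonal (h := fun y => (h y + 1)%:E)) => //.
- by apply/measurable_EFinP; exact: measurable_funD.
- by move=> y; rewrite lee_fin; have := h1 y; rewrite ler_norml => /andP[]; lra.
Qed.

Definition post_minus (xi s : E) := post_plus xi (vscale (-1) s).

(** The phase of v' contains |v - w| <s, xi> / 2. In law it equals |xi| <s, v - w> / 2, the product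
    of s with another vector of the same norm, and the phase then splits into <xi+, v> + <xi-, w>.
    The factor 2 counts v' and w', exchanged by s -> -s. *)
Lemma coll_trig b xi v w :
  coll (fun x => trig b (dotp xi x)) v w =
  2 * \int[S]_s trig b (dotp (post_plus xi s) v + dotp (post_minus xi s) w)
  - trig b (dotp xi v) - trig b (dotp xi w).
Proof.
rewrite /coll; congr (_ - _ - _).
set f := fun x => trig b (dotp xi x).
have bf : bmf f by exact: bmf_trig.
have b1 : bmf (fun s => f (kac_post v w s).1).
  case: bf => mf [M fM]; split; last by exists M.
  by apply: measurableT_comp => //; exact: measurable_kac_post1.
have b2 : bmf (fun s => f (kac_post v w s).2).
  case: bf => mf [M fM]; split; last by exists M.
  by apply: measurableT_comp => //; exact: measurable_kac_post2.
rewrite /collision_sum RintegralD//; try exact: bmf_integrable.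
have -> : \int[S]_s f (kac_post v w s).2 = \int[S]_s f (kac_post v w s).1.
  rewrite -(sphere_neg b1); apply: eq_Rintegral => s _.
  by rewrite kac_post2N.
rewrite -mulr2n -[LHS]mulr_natl; congr (_ * _).
set c := 2^-1 * dotp xi (vadd v w).
have ez : enorm (vscale (enorm (vsub v w) / 2) xi) = enorm (vscale (enorm xi / 2) (vsub v w)).
  rewrite !enormZ !ger0_norm ?divr_ge0 ?enorm_ge0//; ring.
have := @sphere_zonal _ _ (fun y => trig b (c + y)) ez _ _.
rewrite (_ : \int[S]_s trig b (c + dotp s (vscale (enorm (vsub v w) / 2) xi)) =
  \int[S]_s f (kac_post v w s).1); last first.
  apply: eq_Rintegral => s _; rewrite /f kac_post1E !dotpE (dotpC s xi) /c !dotpE.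
  by congr trig; ring.
move=> ->.
- apply: eq_Rintegral => s _; congr trig.
  rewrite /c /post_minus /post_plus !dotpE; ring.
- by apply: measurableT_comp; [exact: measurable_trig|exact: measurable_funD].
- by move=> y; exact: trig_le1.
Qed.

Let mpp : measurable_fun setT (fun p : E * E => post_plus p.1 p.2).
Proof. exact: measurable_post_plus. Qed.

Let mpm : measurable_fun setT (fun p : E * E => post_minus p.1 p.2).
Proof. by apply: measurable_post_plus => //; exact: measurable_vscale. Qed.

Lemma Rintegral_fubini_bounded (d1 d2 : measure_display) (T1 : measurableType d1)
  (T2 : measurableType d2) (m1 : probability T1 R) (m2 : probability T2 R)
  (f : T1 * T2 -> R) : bmf f ->
  \int[m1]_x \int[m2]_y f (x, y) = \int[m2]_y \int[m1]_x f (x, y).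
Proof.
move=> [mf [M fM]]; apply: (@Rintegral_fubini _ _ _ _ _ m1 m2 f (cst M) (cst 1)) => //.
- exact: bmf_integrable (bmf_cst _).
- exact: bmf_integrable (bmf_cst _).
- by move=> x y /=; rewrite mulr1.
Qed.

Lemma bmf_Rintegral (d1 d2 : measure_display) (T1 : measurableType d1)
  (T2 : measurableType d2) (m2 : probability T2 R) (f : T1 * T2 -> R) : bmf f ->
  bmf (fun x => \int[m2]_y f (x, y)).
Proof.
move=> [mf [M fM]]; split; first exact: measurable_Rintegral.
exists M => x; apply: bmf_Rintegral_le => //; split; last by exists M.
by have h := measurableT_comp mf (pair1_measurable x); exact: h.
Qed.

Lemma bmf_comp (d1 d2 : measure_display) (T1 : measurableType d1)
  (T2 : measurableType d2) (f : T1 -> R) (g : T2 -> T1) : bmf f ->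
  measurable_fun setT g -> bmf (fun x => f (g x)).
Proof.
by move=> [mf [M fM]] mg; split; [exact: measurableT_comp|exists M].
Qed.

(* Bobylev's identity *)
Lemma QF_trig mu b xi : QF mu (fun x => trig b (dotp xi x)) =
  \int[S]_s cmul (TF mu ^~ (post_plus xi s)) (TF mu ^~ (post_minus xi s)) b - TF mu b xi.
Proof.
pose g (q : E * E * E) : R :=
  trig b (dotp (post_plus xi q.2) q.1.1 + dotp (post_minus xi q.2) q.1.2).
have mq (h : E * E -> E) : measurable_fun setT h ->
    measurable_fun setT (fun q : E * E * E => h (xi, q.2)).
  move=> mh; apply: (measurableT_comp mh); apply/measurable_fun_pair => //.
have bg : bmf g.
  split; last by exists 1 => q; exact: trig_le1.
  apply: measurableT_comp; first exact: measurable_trig.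
  apply: measurable_funD; apply: measurable_dotp.
  - exact: (mq _ mpp).
  - by apply: (measurableT_comp (@measurable_fst _ _ E E)); exact: measurable_fst.
  - exact: (mq _ mpm).
  - by apply: (measurableT_comp (@measurable_snd _ _ E E)); exact: measurable_fst.
pose f x := trig b (dotp xi x).
have bf : bmf f by exact: bmf_trig.
pose G (v w : E) := \int[S]_s g (v, w, s).
have bG : bmf (fun p : E * E => G p.1 p.2).
  have := bmf_Rintegral S bg; congr bmf; by apply/funext => -[].
have bGv v : bmf (G v) by have := bmf_comp bG (pair1_measurable v).
have bGG : bmf (fun v => \int[mu]_w G v w) by have := bmf_Rintegral mu bG.
have e1 v : \int[mu]_w coll f v w = 2 * \int[mu]_w G v w - f v - TF mu b xi.
  rewrite -RintegralZl//; last exact: bmf_integrable.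
  under eq_Rintegral => w _ do rewrite coll_trig.
  rewrite RintegralB//; last 2 first.
  - apply: bmf_integrable; apply: bmfB; [exact: (bmfZ 2 (bGv v))|exact: bmf_cst].
  - exact: bmf_integrable.
  rewrite RintegralB//; last 2 first.
  - by apply: bmf_integrable; exact: (bmfZ 2 (bGv v)).
  - exact: bmf_integrable (bmf_cst _).
  by rewrite Rintegral_prob_cst.
have -> : QF mu f = \int[mu]_v \int[mu]_w G v w - TF mu b xi.
  rewrite /QF; under eq_Rintegral => v _ do rewrite e1.
  rewrite RintegralB//; last 2 first.
  - by apply: bmf_integrable; apply: bmfB => //; exact: (bmfZ 2 bGG).
  - exact: bmf_integrable (bmf_cst _).
  rewrite RintegralB//; last 2 first.
  - by apply: bmf_integrable; exact: (bmfZ 2 bGG).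
  - exact: bmf_integrable.
  rewrite Rintegral_prob_cst RintegralZl//; last exact: bmf_integrable.
  by rewrite -[\int[mu]_x f x]/(TF mu b xi); field.
congr (_ - _).
have e2 v : \int[mu]_w G v w = \int[S]_s \int[mu]_w g (v, w, s).
  rewrite /G (@Rintegral_fubini_bounded _ _ _ _ mu S (fun p => g (v, p.1, p.2)))//.
  by apply: (bmf_comp bg); apply/measurable_fun_pair => //; apply/measurable_fun_pair.
under eq_Rintegral => v _ do rewrite e2.
have b3 : bmf (fun p : E * E => \int[mu]_w g (p.1, w, p.2)).
  apply: (@bmf_Rintegral _ _ _ _ mu (fun q : E * E * E => g (q.1.1, q.2, q.1.2))).
  apply: (bmf_comp bg); apply/measurable_fun_pair.
    apply/measurable_fun_pair => //=.
    by apply: (measurableT_comp (@measurable_fst _ _ E E)); exact: measurable_fst.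
  by apply: (measurableT_comp (@measurable_snd _ _ E E)); exact: measurable_fst.
rewrite (@Rintegral_fubini_bounded _ _ _ _ mu S (fun p => \int[mu]_w g (p.1, w, p.2)) b3).
apply: eq_Rintegral => s _ /=.
set x1 := post_plus xi s; set x2 := post_minus xi s.
have I (c : bool) x := bmf_integrable mu (bmf_trig c x).
have IZ c k x := bmf_integrable mu (bmfZ k (bmf_trig c x)).
have EC c1 c2 v : \int[mu]_w (trig c1 (dotp x1 v) * trig c2 (dotp x2 w)) =
    trig c1 (dotp x1 v) * TF mu c2 x2 by rewrite RintegralZl//; exact: I.
have ECv c1 k : \int[mu]_v (trig c1 (dotp x1 v) * k) = TF mu c1 x1 * k.
  by rewrite RintegralZr//; exact: I.
have IV c1 k : mu.-integrable setT (EFin \o (fun v => trig c1 (dotp x1 v) * k)).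
  by apply: bmf_integrable; apply: bmfM; [exact: bmf_trig|exact: bmf_cst].
rewrite /g /= -/x1 -/x2 /cmul; case: (b).
- rewrite (@eq_Rintegral _ _ _ _ _ (fun v => trig true (dotp x1 v) * TF mu true x2 -
    trig false (dotp x1 v) * TF mu false x2)); last first.
    move=> v _; rewrite -!EC -RintegralB//.
    by apply: eq_Rintegral => w _; rewrite trigD.
  by rewrite RintegralB// !ECv.
- rewrite (@eq_Rintegral _ _ _ _ _ (fun v => trig false (dotp x1 v) * TF mu true x2 +
    trig true (dotp x1 v) * TF mu false x2)); last first.
    move=> v _; rewrite -!EC -RintegralD//.
    by apply: eq_Rintegral => w _; rewrite trigD.
  by rewrite RintegralD// !ECv.
Qed.

End collisions.

Section bounded_integrals.
Context {R : realType} {d : measure_display} {T : measurableType d}.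
Implicit Types (f g : T -> R) (m : probability T R).

Lemma bmf_RintegralD m f g : bmf f -> bmf g ->
  \int[m]_x (f x + g x) = \int[m]_x f x + \int[m]_x g x.
Proof. by move=> bf bg; rewrite RintegralD//; exact: bmf_integrable. Qed.

Lemma bmf_RintegralB m f g : bmf f -> bmf g ->
  \int[m]_x (f x - g x) = \int[m]_x f x - \int[m]_x g x.
Proof. by move=> bf bg; rewrite RintegralB//; exact: bmf_integrable. Qed.

Lemma bmf_RintegralZ m k f : bmf f -> \int[m]_x (k * f x) = k * \int[m]_x f x.
Proof. by move=> bf; rewrite RintegralZl//; exact: bmf_integrable. Qed.

Lemma bmf_le_Rintegral m f g : bmf f -> bmf g -> (forall x, f x <= g x) ->
  \int[m]_x f x <= \int[m]_x g x.
Proof. by move=> bf bg fg; apply: le_Rintegral => //; exact: bmf_integrable. Qed.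

End bounded_integrals.

Section collision_bounds.
Context {R : realType} (n : nat) (r : R).
Hypotheses (n2 : (2 <= n)%N) (r01 : 0 < r < 1).
Notation E := (n.-tuple R).
Notation S := (@uniform_sphere R n).
Notation cut := (@cutnorm R n).
Implicit Types mu nu : probability E R.

Let n0 : (0 < n)%N. Proof. exact: ltnW. Qed.

Let r0 : 0 < r. Proof. by case/andP: r01. Qed.

Let me1 : (\int[S]_s (enorm s)%:E = 1)%E.
Proof.
rewrite -(@probability_setT _ _ _ S) -[RHS]mul1e -integral_cst//.
apply: ae_eq_integral => //.
- by apply/measurable_EFinP; exact: measurable_enorm.
- by apply: filterS (ae_sphere n0) => s -> _.
Qed.

Lemma mom1_sphere : mom1 S.
Proof.
apply/integrableP; split; first by apply/measurable_EFinP; exact: measurable_enorm.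
rewrite (_ : (\int[S]_s `|_|)%E = 1%E) ?ltry// -me1.
by apply: eq_integral => s _ /=; rewrite ger0_norm// enorm_ge0.
Qed.

Lemma mean_enorm_sphere : \int[S]_s enorm s = 1.
Proof. by rewrite /Rintegral me1. Qed.

Lemma enorm_kac_post1_sub (v w s : E) :
  enorm (vsub (kac_post v w s).1 v) <= enorm (vsub v w) / 2 * (1 + enorm s).
Proof.
have -> : vsub (kac_post v w s).1 v =
  vadd (vscale (- 2^-1) (vsub v w)) (vscale (enorm (vsub v w) / 2) s).
  by rewrite kac_post1E; apply: eq_from_tnth => i; rewrite !vtnthE; field.
apply: le_trans (enorm_triangle _ _) _.
rewrite !enormZ normrN !ger0_norm ?divr_ge0 ?enorm_ge0 ?invr_ge0//; lra.
Qed.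

Lemma enorm_kac_post2_sub (v w s : E) :
  enorm (vsub (kac_post v w s).2 w) <= enorm (vsub v w) / 2 * (1 + enorm s).
Proof.
have -> : vsub (kac_post v w s).2 w =
  vadd (vscale (2^-1) (vsub v w)) (vscale (- (enorm (vsub v w) / 2)) s).
  by rewrite kac_post2E; apply: eq_from_tnth => i; rewrite !vtnthE; field.
apply: le_trans (enorm_triangle _ _) _.
rewrite !enormZ normrN !ger0_norm ?divr_ge0 ?enorm_ge0 ?invr_ge0//; lra.
Qed.

(** N times the change of the empirical transform in one collision ([empTF_post]). *)
Definition jump (v w s : E) (b : bool) (xi : E) : R :=
  collision_sum (fun x => trig b (dotp xi x)) v w s - trig b (dotp xi v) - trig b (dotp xi w).

Lemma jump_le_enorm v w s b xi :
  `|jump v w s b xi| <= enorm xi * (enorm (vsub v w) * (1 + enorm s)).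
Proof.
have -> : jump v w s b xi =
  (trig b (dotp xi (kac_post v w s).1) - trig b (dotp xi v)) +
  (trig b (dotp xi (kac_post v w s).2) - trig b (dotp xi w)).
  by rewrite /jump /collision_sum; ring.
have h (x y : E) : `|trig b (dotp xi x) - trig b (dotp xi y)| <= enorm xi * enorm (vsub x y).
  apply: le_trans (trig_lip _ _ _) _.
  by rewrite (_ : _ - _ = dotp xi (vsub x y)) ?dotp_le// !dotpE.
apply: le_trans (ler_normD _ _) _.
apply: le_trans (lerD (h _ _) (h _ _)) _; rewrite -mulrDr ler_wpM2l ?enorm_ge0//.
apply: le_trans (lerD (enorm_kac_post1_sub _ _ _) (enorm_kac_post2_sub _ _ _)) _; lra.
Qed.

(** The bound has to hold for every [s], unit or not, hence the factor 1 + |s|, integrable by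
    [mom1_sphere]. *)
Definition jump_bound (v w s : E) : R := 4 + enorm (vsub v w) * (1 + enorm s).

Lemma jump_bound_ge0 v w s : 0 <= jump_bound v w s.
Proof. by rewrite addr_ge0// mulr_ge0 ?enorm_ge0// addr_ge0 ?enorm_ge0. Qed.

Lemma jump_le v w s b xi : `|jump v w s b xi| <= jump_bound v w s * cut xi.
Proof.
apply: le_cut; first exact: jump_bound_ge0.
- rewrite /jump_bound; apply: (@le_trans _ _ 4); last first.
    by rewrite lerDl mulr_ge0 ?enorm_ge0// addr_ge0 ?enorm_ge0.
  rewrite /jump /collision_sum.
  apply: le_trans (ler_normB _ _) _; apply: le_trans (lerD (ler_normB _ _) (lexx _)) _.
  apply: le_trans (lerD (lerD (ler_normD _ _) (lexx _)) (lexx _)) _.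
  have t := @trig_le1 R b; have := t (dotp xi v); have := t (dotp xi w).
  have := t (dotp xi (kac_post v w s).1); have := t (dotp xi (kac_post v w s).2); lra.
- apply: le_trans (jump_le_enorm _ _ _ _ _) _.
  by rewrite ler_wpM2l ?enorm_ge0// /jump_bound lerDr.
Qed.

Lemma jump_bound_integrable v w : S.-integrable setT (EFin \o jump_bound v w).
Proof.
have := integrableD measurableT (bmf_integrable S (bmf_cst (4 + enorm (vsub v w))))
  (integrableZl measurableT (enorm (vsub v w)) mom1_sphere).
by congr integrable; apply/funext => s /=; rewrite -EFinM -EFinD /jump_bound; congr EFin; ring.
Qed.

Lemma measurable_jump v w b : measurable_fun setT (fun p : E * E => jump v w p.1 b p.2).
Proof.
have m k : measurable_fun setT k -> measurable_fun setT (fun p : E * E => trig b (dotp p.2 (k p))).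
  move=> mk; apply: measurableT_comp; first exact: measurable_trig.
  by apply: measurable_dotp.
apply: measurable_funB; last exact: m.
apply: measurable_funB; last exact: m.
by apply: measurable_funD; apply: m; [apply: measurable_kac_post1|apply: measurable_kac_post2].
Qed.

Lemma coll_jump v w b xi : coll (fun x => trig b (dotp xi x)) v w = \int[S]_s jump v w s b xi.
Proof.
rewrite /jump RintegralB//; last 2 first.
- apply: bmf_integrable; apply: bmfB; last exact: bmf_cst.
  by apply: bmf_collision_sum; exact: bmf_trig.
- exact: bmf_integrable (bmf_cst _).
rewrite RintegralB//; last 2 first.
- by apply: bmf_integrable; apply: bmf_collision_sum; exact: bmf_trig.
- exact: bmf_integrable (bmf_cst _).
by rewrite !Rintegral_prob_cst.
Qed.

Lemma coll_trig_le (v w : E) b (xi : E) :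
  `|coll (fun x => trig b (dotp xi x)) v w| <= enorm xi * (2 * (enorm v + enorm w)).
Proof.
rewrite coll_jump; set D := enorm (vsub v w).
apply: (@le_trans _ _ (\int[S]_s (enorm xi * D * (1 + enorm s)))).
  apply: norm_Rintegral_le.
  - apply: bmf_integrable; apply: bmfB; last exact: bmf_cst.
    apply: bmfB; last exact: bmf_cst.
    by apply: bmf_collision_sum; exact: bmf_trig.
  - have := integrableD measurableT (bmf_integrable S (bmf_cst (enorm xi * D)))
      (integrableZl measurableT (enorm xi * D) mom1_sphere).
    by congr integrable; apply/funext => s /=; rewrite -EFinM -EFinD mulrDr mulr1.
  - by move=> s; apply: le_trans (jump_le_enorm _ _ _ _ _) _; rewrite mulrA.
rewrite RintegralZl//; last first.
  have := integrableD measurableT (bmf_integrable S (bmf_cst 1)) mom1_sphere.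
  by congr integrable.
rewrite RintegralD//; last 2 first.
- exact: bmf_integrable (bmf_cst _).
- exact: mom1_sphere.
rewrite Rintegral_prob_cst mean_enorm_sphere -mulrA ler_wpM2l ?enorm_ge0//.
rewrite mulrC ler_pM2l//; exact: enormB.
Qed.

Definition QT mu (b : bool) (xi : E) : R := QF mu (fun x => trig b (dotp xi x)).

Lemma measurable_QT mu b : measurable_fun setT (QT mu b).
Proof.
rewrite (_ : QT mu b = fun xi => \int[S]_s cmul (TF mu ^~ (post_plus xi s))
  (TF mu ^~ (post_minus xi s)) b - TF mu b xi); last by apply/funext => xi; exact: QF_trig.
apply: measurable_funB; last exact: measurable_TF.
apply: (@measurable_Rintegral _ _ _ _ _ S (fun p : E * E =>
  cmul (TF mu ^~ (post_plus p.1 p.2)) (TF mu ^~ (post_minus p.1 p.2)) b)).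
have mp c : measurable_fun setT (fun p : E * E => TF mu c (post_plus p.1 p.2)).
  apply: (measurableT_comp (measurable_TF mu c)); exact: measurable_post_plus.
have mm c : measurable_fun setT (fun p : E * E => TF mu c (post_minus p.1 p.2)).
  apply: (measurableT_comp (measurable_TF mu c)).
  by apply: measurable_post_plus => //; exact: measurable_vscale.
by case: b; [apply: measurable_funB|apply: measurable_funD]; apply: measurable_funM.
Qed.

Lemma QT_le mu b xi : mom1 mu -> `|QT mu b xi| <= (2 + 2 * \int[mu]_x enorm x) * cut xi.
Proof.
move=> m1; have e0 : 0 <= \int[mu]_x enorm x.
  by apply: Rintegral_ge0 => x _; exact: enorm_ge0.
have bc := bmf_coll (bmf_trig b xi).
have bi := bmf_Rintegral mu bc.
have bcv v : bmf (coll (fun x => trig b (dotp xi x)) v).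
  by have := bmf_comp bc (pair1_measurable v).
have I (v : E) : mu.-integrable setT (EFin \o (fun w => enorm xi * (2 * (enorm v + enorm w)))).
  have := integrableD measurableT (bmf_integrable mu (bmf_cst (enorm xi * (2 * enorm v))))
      (integrableZl measurableT (enorm xi * 2) m1).
  by congr integrable; apply/funext => w /=; rewrite -EFinM -EFinD; congr EFin; ring.
have I' : mu.-integrable setT (EFin \o (fun v => enorm v + \int[mu]_x enorm x)).
  have := integrableD measurableT m1 (bmf_integrable mu (bmf_cst (\int[mu]_x enorm x))).
  by congr integrable.
have Iv (v : E) : mu.-integrable setT (EFin \o (fun w => enorm v + enorm w)).
  have := integrableD measurableT (bmf_integrable mu (bmf_cst (enorm v))) m1.
  by congr integrable.
rewrite /QT /QF normrM ger0_norm ?invr_ge0//.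
apply: le_cut; first by rewrite addr_ge0// mulr_ge0.
- have h : `|\int[mu]_v \int[mu]_w coll (fun x => trig b (dotp xi x)) v w| <= 4 * 1.
    apply: bmf_Rintegral_le => // v; apply: bmf_Rintegral_le => // w.
    by apply: coll_le; [exact: bmf_trig|move=> y; exact: trig_le1].
  by lra.
- have h : `|\int[mu]_v \int[mu]_w coll (fun x => trig b (dotp xi x)) v w| <=
      \int[mu]_v (enorm xi * 2 * (enorm v + \int[mu]_w enorm w)).
    apply: norm_Rintegral_le; first exact: bmf_integrable.
      by have := integrableZl measurableT (enorm xi * 2) I'; congr integrable.
    move=> v; have -> : enorm xi * 2 * (enorm v + \int[mu]_w enorm w) =
        \int[mu]_w (enorm xi * (2 * (enorm v + enorm w))).
      under [RHS]eq_Rintegral => w _ do rewrite mulrA.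
      rewrite RintegralZl// RintegralD//; last exact: bmf_integrable (bmf_cst _).
      by rewrite Rintegral_prob_cst.
    apply: norm_Rintegral_le => //; first exact: bmf_integrable.
    by move=> w; exact: coll_trig_le.
  apply: le_trans (ler_wpM2l _ h) _; first by rewrite invr_ge0.
  rewrite RintegralZl// RintegralD//; last exact: bmf_integrable (bmf_cst _).
  rewrite Rintegral_prob_cst; have := enorm_ge0 xi; nra.
Qed.

Lemma hdom_QT mu : mom1 mu -> hdom (QT mu).
Proof.
move=> m1; split; first by move=> b; exact: measurable_QT.
exists (2 + 2 * \int[mu]_x enorm x) => [|b xi]; last exact: QT_le.
by rewrite addr_ge0// mulr_ge0// Rintegral_ge0// => x _; exact: enorm_ge0.
Qed.

Lemma cutnorm_origin : cut origin = 0.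
Proof. by rewrite /cutnorm enorm_origin min_r. Qed.

Definition smean (g : E -> R) : R := \int[S]_s g s.

Lemma smeanD g h : bmf g -> bmf h -> smean (fun s => g s + h s) = smean g + smean h.
Proof. exact: bmf_RintegralD. Qed.

Lemma smeanB g h : bmf g -> bmf h -> smean (fun s => g s - h s) = smean g - smean h.
Proof. exact: bmf_RintegralB. Qed.

Lemma smeanZ k g : bmf g -> smean (fun s => k * g s) = k * smean g.
Proof. exact: bmf_RintegralZ. Qed.

Lemma smean_le g h : bmf g -> bmf h -> (forall s, g s <= h s) -> smean g <= smean h.
Proof. exact: bmf_le_Rintegral. Qed.

Lemma smean_neg g : bmf g -> smean (fun s => g (vscale (-1) s)) = smean g.
Proof. exact: sphere_neg. Qed.

Lemma smean_double k g h : bmf g -> bmf h -> smean h = smean g ->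
  smean (fun s => k * (g s + h s)) <= 2 * (k * smean g).
Proof.
move=> bg bh e; rewrite (smeanZ k (bmfD bg bh)) (smeanD bg bh) e; lra.
Qed.

Section pointwise.
Variables (mu nu : probability E R) (M : R).
Hypothesis XM : forall b xi, `|TFB mu nu b xi| <= M.

Definition TFmod (xi : E) : R := md (TFB mu nu ^~ xi).

Lemma measurable_TFmod : measurable_fun setT TFmod.
Proof.
apply: (@measurableT_comp _ _ _ _ _ _ (@Num.sqrt R)).
  by apply: continuous_measurable_fun => x; exact: sqrt_continuous.
by apply: measurable_funD; apply: measurable_funX; apply: measurable_funB; exact: measurable_TF.
Qed.

Lemma bmf_TFmod : bmf TFmod.
Proof.
split; first exact: measurable_TFmod.
by exists (2 * M) => xi; rewrite ger0_norm ?md_ge0//; apply: md_le => b; exact: XM.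
Qed.

Lemma bmf_post_plus (g : E -> R) xi : bmf g -> bmf (fun s => g (post_plus xi s)).
Proof. by move=> bg; apply: (bmf_comp bg); exact: measurable_post_plus. Qed.

Lemma bmf_post_minus (g : E -> R) xi : bmf g -> bmf (fun s => g (post_minus xi s)).
Proof.
move=> bg; apply: (bmf_comp bg).
by apply: measurable_post_plus => //; exact: measurable_vscale.
Qed.

Let W (m : probability E R) xi b s :=
  cmul (TF m ^~ (post_plus xi s)) (TF m ^~ (post_minus xi s)) b.

Let bW m xi b : bmf (W m xi b).
Proof.
have bTF c : bmf (TF m c).
  by split; [exact: measurable_TF|exists 1 => x; exact: TF_le1].
rewrite /W /cmul; case: b; [apply: bmfB|apply: bmfD]; apply: bmfM;
  by [exact: bmf_post_plus|exact: bmf_post_minus].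
Qed.

Let QTB b xi : QT mu b xi - QT nu b xi =
  smean (fun s => W mu xi b s - W nu xi b s) - TFB mu nu b xi.
Proof.
have e m : QT m b xi = smean (W m xi b) - TF m b xi by exact: QF_trig.
by rewrite !e smeanB// /TFB; ring.
Qed.

(* By Bobylev's identity, the pairing is bounded by [|X| (|X+| + |X-|) - |X|^2]. *)
Lemma pairing_QT_le xi : pairing (TFB mu nu) (fun b xi => QT mu b xi - QT nu b xi) xi <=
  2 * (TFmod xi * smean (fun s => TFmod (post_plus xi s))) - TFmod xi ^+ 2.
Proof.
have bp := bmf_post_plus xi bmf_TFmod; have bm := bmf_post_minus xi bmf_TFmod.
have bB b := bmfB (bW mu xi b) (bW nu xi b).
have GE : smean (fun s => TFmod (post_minus xi s)) = smean (fun s => TFmod (post_plus xi s)).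
  exact: (smean_neg bp).
rewrite /pairing !QTB.
set X := TFB mu nu.
set I1 := smean (fun s => _ - _); set I2 := smean (fun s => _ - _).
have -> : X true xi * (I1 - X true xi) + X false xi * (I2 - X false xi) =
  (X true xi * I1 + X false xi * I2) - TFmod xi ^+ 2.
  by rewrite /TFmod sqr_md -/X; ring.
rewrite lerD2r /I1 /I2 -(smeanZ (X true xi) (bB true)) -(smeanZ (X false xi) (bB false)).
rewrite -(smeanD (bmfZ _ (bB true)) (bmfZ _ (bB false))).
apply: (@le_trans _ _
    (smean (fun s => TFmod xi * (TFmod (post_plus xi s) + TFmod (post_minus xi s))))).
  apply: smean_le.
  - by apply: bmfD; apply: bmfZ; [exact: (bB true)|exact: (bB false)].
  - by apply: bmfZ; exact: bmfD.
  - by move=> s; apply: dot_cmulB; exact: md_TF_le1.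
exact: (smean_double _ bp bm GE).
Qed.

End pointwise.

(** Integrate [pairing_QT_le]: with A = [half_angle_mean] the cross term is at most 2 A |X|^2 by
    [post_plus_form], and 2 A - 1 = - kappa by [kappaE]. *)
Lemma collision_contraction mu nu : mom1 mu -> mom1 nu ->
  ip r (TFB mu nu) (fun b xi => QT mu b xi - QT nu b xi) <=
  - kappa n r * ip r (TFB mu nu) (TFB mu nu).
Proof.
move=> m1 m2; set X := TFB mu nu.
have dX : hdom X by exact: hdom_TFB.
have dQ : hdom (fun b xi => QT mu b xi - QT nu b xi).
  have := hdom_lin (-1) (hdom_QT m1) (hdom_QT m2); congr hdom.
  by apply/funext => b; apply/funext => xi; rewrite mulN1r.
have cut1 xi : cut xi <= 1 by rewrite /cutnorm ge_min lexx.
have [M M0 [XM fM]] : exists2 M : R, 0 <= M & (forall b xi, `|X b xi| <= M) /\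
    forall xi, TFmod mu nu xi <= 2 * (M * cut xi).
  case: dX => _ [M M0 h]; exists M => //; split => [b xi|xi].
    by apply: le_trans (h _ _) _; rewrite -[leRHS]mulr1 ler_wpM2l.
  by apply: md_le => b; exact: h.
have point xi := pairing_QT_le XM xi.
have bf := bmf_TFmod XM.
have bp xi := bmf_post_plus xi bf.
have fX xi : TFmod mu nu xi ^+ 2 = pairing X X xi.
  by rewrite /TFmod sqr_md /pairing !expr2.
have f0 xi : 0 <= TFmod mu nu xi by exact: md_ge0.
have mf : measurable_fun setT (TFmod mu nu) by case: bf.
move: (TFmod mu nu) fM point bf bp fX f0 mf => f fM point bf bp fX f0 mf.
have fo : f origin = 0.
  by apply/eqP; rewrite eq_le f0 andbT; apply: le_trans (fM _) _; rewrite cutnorm_origin !mulr0.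
pose G xi := smean (fun s => f (post_plus xi s)).
have mG : measurable_fun setT G.
  apply: (@measurable_Rintegral _ _ _ _ _ S (fun p : E * E => f (post_plus p.1 p.2))).
  by apply: (measurableT_comp mf); exact: measurable_post_plus.
have G0 xi : 0 <= G xi by apply: Rintegral_ge0.
have GE xi k : f xi * G xi * k = smean (fun s => f xi * f (post_plus xi s) * k).
  have -> : f xi * G xi * k = (f xi * k) * G xi by ring.
  rewrite -(smeanZ _ (bp xi)); congr smean; apply/funext => s; ring.
have GEe xi k : ((f xi * G xi * k)%:E = \int[S]_s (f xi * f (post_plus xi s) * k)%:E)%E.
  rewrite GE /smean /Rintegral fineK//; apply: (integrable_fin_num measurableT).
  by apply: bmf_integrable; apply: bmfM; [apply: bmfZ|exact: bmf_cst].
have {}point xi : pairing X (fun b xi => QT mu b xi - QT nu b xi) xi <=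
    2 * (f xi * G xi) - f xi ^+ 2 by exact: point.
clearbody G.
pose c := (2 * pi) `^ (- (n%:R / 2)) ^+ 2 : R.
have c0 : 0 <= c by exact: sqr_ge0.
have XX : ip r X X = \int[lebesgue_tuple R n]_xi (f xi ^+ 2 * fw r xi).
  by apply: eq_Rintegral => xi _; rewrite fX.
have IX : (lebesgue_tuple R n).-integrable setT (EFin \o (fun xi => f xi ^+ 2 * fw r xi)).
  have := ip_integrable n2 r01 dX dX; congr integrable; apply/funext => xi /=.
  by rewrite fX.
have mFG : measurable_fun setT (fun xi => f xi * G xi * fw r xi).
  by apply: measurable_funM; [exact: measurable_funM|exact: measurable_fw].
have FG0 xi : 0 <= f xi * G xi * fw r xi by apply: mulr_ge0; [exact: mulr_ge0|exact: fw_ge0].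
have Alty := half_angle_mean_lty n2 r0.
have A0 := @half_angle_mean_ge0 R n r.
have Afin : half_angle_mean n r \is a fin_num by rewrite ge0_fin_numE.
have form : (\int[lebesgue_tuple R n]_xi (f xi * G xi * fw r xi)%:E <=
    (fine (half_angle_mean n r) * ip r X X)%:E)%E.
  have := post_plus_form n2 r0 mf f0 fo.
  rewrite (_ : (\int[_]_xi \int[_]_s _)%E =
    \int[lebesgue_tuple R n]_xi (f xi * G xi * @wt R n r xi)%:E)%E; last first.
    by apply: eq_integral => xi _; rewrite GEe.
  move=> h.
  have e1 (g : E -> R) : measurable_fun setT g -> (forall xi, 0 <= g xi) ->
     (\int[lebesgue_tuple R n]_xi (g xi * fw r xi)%:E =
      c%:E * \int[lebesgue_tuple R n]_xi (g xi * @wt R n r xi)%:E)%E.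
    move=> mg g0; rewrite -ge0_integralZl//.
    - by apply: eq_integral => xi _; rewrite -EFinM /fw -/c; congr EFin; ring.
    - by apply/measurable_EFinP; apply: measurable_funM => //; exact: measurable_wt.
    - by move=> xi _; rewrite lee_fin mulr_ge0// powR_ge0.
  rewrite XX EFinM /Rintegral fineK// fineK; last exact: (integrable_fin_num measurableT IX).
  rewrite e1//; last 2 first.
  - exact: measurable_funM.
  - by move=> xi; rewrite mulr_ge0.
  rewrite e1//; last 2 first.
  - exact: measurable_funX.
  - by move=> xi; exact: sqr_ge0.
  by rewrite muleCA; apply: lee_wpmul2l.
have IFG : (lebesgue_tuple R n).-integrable setT (EFin \o (fun xi => f xi * G xi * fw r xi)).
  apply/integrableP; split; first exact/measurable_EFinP.
  apply: le_lt_trans (ltry (fine (half_angle_mean n r) * ip r X X)).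
  apply: le_trans form; rewrite le_eqVlt; apply/orP; left; apply/eqP.
  by apply: eq_integral => xi _ /=; rewrite ger0_norm.
have FGle : \int[lebesgue_tuple R n]_xi (f xi * G xi * fw r xi) <=
    fine (half_angle_mean n r) * ip r X X.
  rewrite -lee_fin /Rintegral fineK//; exact: (integrable_fin_num measurableT IFG).
have kE : 1 - kappa n r = 2 * fine (half_angle_mean n r).
  apply: EFin_inj; rewrite (kappaE n2)//.
  by rewrite EFinM fineK.
apply: (@le_trans _ _ (\int[lebesgue_tuple R n]_xi
    (2 * (f xi * G xi * fw r xi) - f xi ^+ 2 * fw r xi))).
  apply: le_Rintegral => //.
  - exact: ip_integrable.
  - have := integrableB measurableT (integrableZl measurableT 2 IFG) IX.
    by congr integrable.
  - move=> xi _; rewrite (_ : _ - _ = (2 * (f xi * G xi) - f xi ^+ 2) * fw r xi); last by ring.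
    by rewrite ler_wpM2r ?fw_ge0.
rewrite RintegralB//; last first.
  by have := integrableZl measurableT 2 IFG; congr integrable.
rewrite RintegralZl// -XX.
have -> : - kappa n r = 2 * fine (half_angle_mean n r) - 1 by rewrite -kE; ring.
by move: FGle; rewrite mulrBl mul1r; lra.
Qed.

End collision_bounds.

(** * The size of a collision jump *)

Section power_means.
Context {R : realType}.

(** The tangent at m to the concave power, multiplied by m^(1-p) so that m = 0 is allowed: Young's
    inequality with exponents 1/p and 1/(1-p). *)
Lemma powR_tangent (p y m : R) : 0 < p < 1 -> 0 <= y -> 0 <= m ->
  y `^ p * m `^ (1 - p) <= p * y + (1 - p) * m.
Proof.
move=> /andP[p0 p1] y0 m0.
have q0 : 0 < 1 - p by rewrite subr_gt0.
have := @conjugate_powR R (y `^ p) (m `^ (1 - p)) p^-1 (1 - p)^-1 (powR_ge0 _ _) (powR_ge0 _ _).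
rewrite !invr_gt0 !invrK addrCA subrr addr0 => /(_ p0 q0 erefl).
rewrite -!powRrM !divff ?gt_eqF// !powRr1//.
by rewrite (mulrC y) (mulrC m).
Qed.

Lemma powR_mean_le (I : finType) (y : I -> R) (p : R) : 0 < p < 1 -> (0 < #|I|)%N ->
  (forall i, 0 <= y i) ->
  \sum_i y i `^ p <= #|I|%:R * ((\sum_i y i) / #|I|%:R) `^ p.
Proof.
move=> p01 I0 y0; set m := (\sum_i y i) / _.
have p0 : p != 0 by case/andP: p01 => /gt_eqF ->.
have N0 : 0 < #|I|%:R :> R by rewrite ltr0n.
have S0 : 0 <= \sum_i y i by exact: sumr_ge0.
have mE : \sum_i y i = #|I|%:R * m by rewrite /m mulrC divfK// gt_eqF.
have : 0 <= m by rewrite divr_ge0// ltW.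
rewrite le_eqVlt => /orP[/eqP m0|m0].
  move: mE; rewrite -m0 mulr0 => /eqP; rewrite psumr_eq0// => /allP h.
  rewrite powR0// mulr0 big1// => i _.
  by have /eqP -> := h i (mem_index_enum i); rewrite powR0.
have pm0 : 0 < m `^ (1 - p) by rewrite powR_gt0.
rewrite -(ler_pM2r pm0) -mulrA -powRD; last by rewrite (gt_eqF m0) implybT.
rewrite addrCA subrr addr0 powRr1 ?(ltW m0)// mulr_suml.
apply: (@le_trans _ _ (\sum_i (p * y i + (1 - p) * m))).
  by apply: ler_sum => i _; apply: powR_tangent => //; exact: ltW.
rewrite big_split/= -mulr_sumr mE sumr_const -mulr_natl le_eqVlt; apply/orP; left; apply/eqP.
by rewrite cardE -cardE; ring.
Qed.

End power_means.

Section cosine_kernel.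
Context {R : realType} (n : nat) (r : R).
Hypotheses (n2 : (2 <= n)%N) (r01 : 0 < r < 1).
Notation E := (n.-tuple R).
Notation lam := (lebesgue_tuple R n).
Notation cut := (@cutnorm R n).

(** Half the squared Sobolev norm of delta_z - delta_0, hence C_r^2 / 2 at a unit vector and
    proportional to |z|^(2r). *)
Definition coskernel (z : E) : R := \int[lam]_xi ((1 - cos (dotp xi z)) * fw r xi).

Let measurable_cos_dotp (z : E) : measurable_fun setT (fun xi : E => 1 - cos (dotp xi z)).
Proof.
apply: measurable_funB => //; apply: (measurableT_comp (@measurable_trig R true)).
exact: measurable_dotp.
Qed.

Lemma coskernel_integrable z :
  lam.-integrable setT (EFin \o (fun xi => (1 - cos (dotp xi z)) * fw r xi)).
Proof.
have I := integrableZl measurableT (2 + enorm z ^+ 2) (cut_fw_integrable n2 r01).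
apply: (le_integrable measurableT _ _ I).
- apply/measurable_EFinP; apply: measurable_funM; last exact: measurable_fw.
  exact: measurable_cos_dotp.
move=> xi _ /=; rewrite lee_fin [leRHS]ger0_norm; last first.
  apply: mulr_ge0; first by rewrite addr_ge0// sqr_ge0.
  by apply: mulr_ge0; [exact: sqr_ge0|exact: fw_ge0].
rewrite normrM (ger0_norm (fw_ge0 _ _)) [leRHS]mulrA ler_wpM2r ?fw_ge0//.
rewrite ger0_norm ?subr_ge0 ?cos_le1//.
have c1 := @cos_geN1 R (dotp xi z).
have e0 := sqr_ge0 (enorm z).
have c2 : 1 - cos (dotp xi z) <= enorm xi ^+ 2 * enorm z ^+ 2.
  have -> : cos (dotp xi z) = 1 - 2 * sin (dotp xi z / 2) ^+ 2.
    have {1}-> : dotp xi z = dotp xi z / 2 + dotp xi z / 2 by field.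
    by rewrite cosD -!expr2 cos2sin2; ring.
  have h : `|sin (dotp xi z / 2)| <= `|dotp xi z| / 2.
    have := @trig_lip R false (dotp xi z / 2) 0; rewrite /trig sin0 !subr0 normrM.
    by rewrite (@ger0_norm _ 2^-1) ?invr_ge0.
  have h2 := dotp_le xi z.
  have h3 : `|sin (dotp xi z / 2)| <= enorm xi * enorm z / 2.
    by apply: le_trans h _; rewrite ler_pM2r.
  rewrite -exprMn; have : sin (dotp xi z / 2) ^+ 2 <= (enorm xi * enorm z / 2) ^+ 2.
    rewrite -real_normK ?num_real// ler_sqr ?nnegrE//.
    by rewrite divr_ge0 ?mulr_ge0 ?enorm_ge0.
  have := sqr_ge0 (enorm xi * enorm z); rewrite exprMn => + h4.
  move: h4; rewrite exprMn exprVn; lra.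
rewrite /cutnorm; case: (leP 1 (enorm xi)) => h; first by rewrite expr1n; lra.
rewrite mulrC; apply: le_trans c2 _; rewrite ler_wpM2l ?sqr_ge0//; lra.
Qed.

Lemma coskernel_scale z e : enorm e = 1 -> coskernel z = enorm z `^ (2 * r) * coskernel e.
Proof.
move=> e1; rewrite /coskernel.
have r0 : 0 < r by case/andP: r01.
have c0 : 0 <= (2 * pi) `^ (- (n%:R / 2)) ^+ 2 :> R by exact: sqr_ge0.
have h u : (\int[lam]_xi ((1 - cos (dotp xi u)) * fw r xi)%:E =
    ((2 * pi) `^ (- (n%:R / 2)) ^+ 2)%:E *
    \int[lam]_xi ((1 - cos (dotp xi u)) * @wt R n r xi)%:E)%E.
  rewrite -ge0_integralZl ?lee_fin//.
  - by apply: eq_integral => xi _; rewrite -EFinM /fw; congr EFin; ring.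
  - apply/measurable_EFinP; apply: measurable_funM; last exact: measurable_wt.
    exact: measurable_cos_dotp.
  - by move=> xi _; rewrite lee_fin mulr_ge0 ?powR_ge0// subr_ge0 cos_le1.
apply: EFin_inj; rewrite EFinM /Rintegral.
rewrite fineK; last exact: (integrable_fin_num measurableT (coskernel_integrable z)).
rewrite fineK; last exact: (integrable_fin_num measurableT (coskernel_integrable e)).
by rewrite !h (cosine_energy r01 z e1) muleCA.
Qed.

Let cosB_dotp (xi x y : E) : cos (dotp xi (vsub x y)) =
  cos (dotp xi x) * cos (dotp xi y) + sin (dotp xi x) * sin (dotp xi y).
Proof. by rewrite !dotpE cosB. Qed.

Lemma ip_point_masses (a b : E) :
  ip r (fun c xi => trig c (dotp xi a) - trig c (dotp xi b))
       (fun c xi => trig c (dotp xi a) - trig c (dotp xi b)) = 2 * coskernel (vsub a b).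
Proof.
rewrite /coskernel -RintegralZl//; last exact: coskernel_integrable.
apply: eq_Rintegral => xi _; rewrite [RHS]mulrA; congr (_ * _).
rewrite /pairing /trig cosB_dotp.
have := cos2Dsin2 (dotp xi a); have := cos2Dsin2 (dotp xi b); rewrite !expr2 => h1 h2.
by lra.
Qed.

Lemma coskernel_sum (l : seq (R * E)) : \sum_(p <- l) p.1 * coskernel p.2 =
  \int[lam]_xi ((\sum_(p <- l) p.1 * (1 - cos (dotp xi p.2))) * fw r xi).
Proof.
suff: lam.-integrable setT (EFin \o (fun xi =>
    (\sum_(p <- l) p.1 * (1 - cos (dotp xi p.2))) * fw r xi)) /\
  \sum_(p <- l) p.1 * coskernel p.2 =
  \int[lam]_xi ((\sum_(p <- l) p.1 * (1 - cos (dotp xi p.2))) * fw r xi) by case.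
elim: l => [|p l [I IH]].
  under eq_fun do rewrite big_nil mul0r.
  rewrite big_nil; split; first exact: integrable0.
  by rewrite /Rintegral integral0.
have Ip := integrableZl measurableT p.1 (coskernel_integrable p.2).
have e xi : (\sum_(q <- p :: l) q.1 * (1 - cos (dotp xi q.2))) * fw r xi =
    p.1 * ((1 - cos (dotp xi p.2)) * fw r xi) +
    (\sum_(q <- l) q.1 * (1 - cos (dotp xi q.2))) * fw r xi.
  by rewrite big_cons mulrDl -[X in X + _]mulrA.
split.
  have := integrableD measurableT Ip I; congr integrable; apply/funext => xi.
  by rewrite /= e.
under eq_Rintegral do rewrite e.
rewrite RintegralD//; first by rewrite big_cons IH RintegralZl//; exact: coskernel_integrable.
Qed.

(** For charges c_i of zero sum at points x_i, the squared norm is minus the double sum of c_i c_j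
    coskernel (x_i - x_j), because cos may be replaced by cos - 1. Here the charges are +1 at v', w'
    and -1 at v, w. *)
Lemma ip_jump (v w s : E) : ip r (jump v w s) (jump v w s) =
  2 * (coskernel (vsub (kac_post v w s).1 v) + coskernel (vsub (kac_post v w s).1 w)
     + coskernel (vsub (kac_post v w s).2 v) + coskernel (vsub (kac_post v w s).2 w)
     - coskernel (vsub (kac_post v w s).1 (kac_post v w s).2) - coskernel (vsub v w)).
Proof.
set p := (kac_post v w s).1; set q := (kac_post v w s).2.
transitivity (\sum_(t <- [:: (2, vsub p v); (2, vsub p w); (2, vsub q v); (2, vsub q w);
    (-2, vsub p q); (-2, vsub v w)]) t.1 * coskernel t.2).
  rewrite coskernel_sum; apply: eq_Rintegral => xi _; congr (_ * _).
  rewrite !big_cons big_nil /= !cosB_dotp /pairing /jump /collision_sum -/p -/q /trig.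
  have := cos2Dsin2 (dotp xi p); have := cos2Dsin2 (dotp xi q).
  have := cos2Dsin2 (dotp xi v); have := cos2Dsin2 (dotp xi w).
  rewrite !expr2; lra.
rewrite !big_cons big_nil /=; clearbody p q.
move: (coskernel (vsub p v)) (coskernel (vsub p w)) (coskernel (vsub q v))
  (coskernel (vsub q w)) (coskernel (vsub p q)) (coskernel (vsub v w)) => *; ring.
Qed.

Lemma enorm_vsubC (x y : E) : enorm (vsub x y) = enorm (vsub y x).
Proof. by apply: eq_enorm; rewrite !dotpE (dotpC y x); ring. Qed.

(* The post-collisional velocities lie on the sphere with diameter [v, w]. *)
Lemma ip_jump_le (v w s e : E) : enorm s = 1 -> enorm e = 1 ->
  ip r (jump v w s) (jump v w s) <=
  4 * (2 `^ (1 - r) - 1) * coskernel e * enorm (vsub v w) `^ (2 * r).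
Proof.
move=> s1 e1; rewrite ip_jump; set p := (kac_post v w s).1; set q := (kac_post v w s).2.
set D := enorm (vsub v w).
have D0 : 0 <= D by exact: enorm_ge0.
have K0 : 0 <= coskernel e.
  apply: Rintegral_ge0 => xi _; apply: mulr_ge0; last exact: fw_ge0.
  by rewrite subr_ge0 cos_le1.
have pE : p = vadd (vscale 2^-1 (vadd v w)) (vscale (D / 2) s) by exact: kac_post1E.
have qE : q = vadd (vscale 2^-1 (vadd v w)) (vscale (- (D / 2)) s) by exact: kac_post2E.
clearbody p q.
have ss : dotp s s = 1 by rewrite -sqr_enorm s1 expr1n.
have pq : enorm (vsub p q) = D.
  have -> : vsub p q = vscale D s.
    by rewrite pE qE; apply: eq_from_tnth => i; rewrite !vtnthE; field.
  by rewrite enormZ s1 mulr1 ger0_norm.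
have qw : enorm (vsub q w) = enorm (vsub p v).
  rewrite enorm_vsubC; congr enorm.
  by rewrite pE qE; apply: eq_from_tnth => i; rewrite !vtnthE; field.
have qv : enorm (vsub q v) = enorm (vsub p w).
  rewrite enorm_vsubC; congr enorm.
  by rewrite pE qE; apply: eq_from_tnth => i; rewrite !vtnthE; field.
set a := enorm (vsub p v) ^+ 2; set b := enorm (vsub p w) ^+ 2.
(* Pythagoras: [p] sees the diameter [v, w] under a right angle. *)
have ab : a + b = D ^+ 2.
  have hD : D ^+ 2 = dotp (vsub v w) (vsub v w) by rewrite sqr_enorm.
  rewrite /a /b !sqr_enorm pE !dotpE ss (dotpC s v) (dotpC s w) (dotpC w v).
  by move: hD; rewrite !dotpE (dotpC w v); lra.
have sqp (x : R) : 0 <= x -> x `^ (2 * r) = (x ^+ 2) `^ r.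
  by move=> x0; rewrite powRrM powR_mulrn.
(* Concavity of the power r gives 2^(1-r); the two subtracted kernels, both at distance D, give the
   -1. *)
have mean : a `^ r + b `^ r <= 2 `^ (1 - r) * (D ^+ 2) `^ r.
  have := @powR_mean_le R bool (fun c => if c then a else b) r r01.
  rewrite card_bool !big_bool /= => /(_ isT) h; apply: le_trans (h _) _.
    by case; exact: sqr_ge0.
  rewrite ab powRM ?sqr_ge0 ?invr_ge0// (mulrC (_ `^ r)) mulrA ler_wpM2r ?powR_ge0//.
  rewrite -powR_inv1// -powRrM mulN1r -[X in X * _](powRr1 (ler0n R 2)) -powRD//.
  by rewrite pnatr_eq0 implybT.
have kE z : coskernel z = (enorm z ^+ 2) `^ r * coskernel e.
  by rewrite (coskernel_scale z e1) sqp ?enorm_ge0.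
move: (coskernel e) K0 kE => k K0 kE.
rewrite !kE pq qw qv -/D -/a -/b (sqp D D0).
have P0 : 0 <= (D ^+ 2) `^ r by exact: powR_ge0.
move: mean P0.
move: (a `^ r) (b `^ r) ((D ^+ 2) `^ r) (2 `^ (1 - r)) => pa pb pd p2 mean P0.
by have := ler_wpM2l K0 mean; lra.
Qed.

End cosine_kernel.

(** * Hyperbolic functions *)

Section hyperbolic.
Context {R : realType}.
Implicit Types x y z a b m : R.

Definition ch x : R := (expR x + expR (- x)) / 2.
Definition sh x : R := (expR x - expR (- x)) / 2.

Lemma ch0 : ch 0 = 1. Proof. by rewrite /ch oppr0 expR0; field. Qed.
Lemma sh0 : sh 0 = 0. Proof. by rewrite /sh oppr0 expR0 subrr mul0r. Qed.

Lemma expRM_inv x : expR x * expR (- x) = 1.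
Proof. by rewrite -expRD subrr expR0. Qed.

Lemma ch_ge1 x : 1 <= ch x.
Proof.
have e0 := expR_gt0 x; have e1 := expR_gt0 (- x); have e := expRM_inv x.
rewrite /ch; have := sqr_ge0 (expR x - expR (- x)); nra.
Qed.

Lemma ch_homo x y : 0 <= x -> x <= y -> ch x <= ch y.
Proof.
move=> x0 xy; rewrite /ch ler_pM2r ?invr_gt0//.
have h1 : expR x <= expR y by rewrite ler_expR.
have h2 : 1 <= expR x by rewrite -expR0 ler_expR.
have ex := expRM_inv x; have ey := expRM_inv y.
have ey0 := expR_gt0 (- y); have ex0 := expR_gt0 (- x).
have -> : expR (- x) = expR (- x) * (expR y * expR (- y)) by rewrite ey mulr1.
have h3 : expR (- y) <= 1 by rewrite -expR0 ler_expR oppr_le0 (le_trans x0).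
have h4 : expR (- x) <= 1 by rewrite -expR0 ler_expR oppr_le0.
have e3 : expR (- y) = expR (- x) * expR x * expR (- y) by rewrite (mulrC (expR (- x))) ex mul1r.
have : (expR y - expR x) * (1 - expR (- x) * expR (- y)) >= 0.
  by apply: mulr_ge0; [rewrite subr_ge0|rewrite subr_ge0 mulr_ile1// ltW].
rewrite mulrBl !mulrBr !mulr1 => h5.
have e4 : expR y * (expR (- x) * expR (- y)) = expR (- x) * (expR y * expR (- y)) by ring.
have e5 : expR x * (expR (- x) * expR (- y)) = expR (- y) by rewrite mulrA ex mul1r.
rewrite e4 e5 in h5; lra.
Qed.

Lemma sh_ge0 x : 0 <= x -> 0 <= sh x.
Proof. by move=> x0; rewrite /sh divr_ge0// subr_ge0 ler_expR; lra. Qed.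

Lemma sh_le_ch x : sh x <= ch x.
Proof. by rewrite /sh /ch ler_pM2r ?invr_gt0//; have := expR_gt0 (- x); lra. Qed.

Lemma ch_ge_exp x : expR x / 2 <= ch x.
Proof. by rewrite /ch ler_pM2r ?invr_gt0// lerDl ltW// expR_gt0. Qed.

Lemma chD x y : ch (x + y) = ch x * ch y + sh x * sh y.
Proof. by rewrite /ch /sh opprD !expRD; field. Qed.

Lemma chN x : ch (- x) = ch x.
Proof. by rewrite /ch opprK addrC. Qed.

Lemma chB x y : ch (x - y) = ch x * ch y - sh x * sh y.
Proof. by rewrite /ch /sh opprD opprK !expRD; field. Qed.

Lemma ch_norm x : ch `|x| = ch x.
Proof. by case: (leP 0 x) => x0; [rewrite ger0_norm|rewrite ltr0_norm ?chN]. Qed.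

Lemma chD_le x y : 0 <= y -> ch (x + y) <= ch x * expR y.
Proof.
move=> y0; rewrite /ch mulrAC ler_pM2r ?invr_gt0// opprD !expRD mulrDl lerD2l.
by rewrite ler_pM2l ?expR_gt0// ler_expR; lra.
Qed.

Lemma ch_add_sh x : ch x + sh x = expR x.
Proof. by rewrite /ch /sh; field. Qed.

Let is_derive_expRN x : is_derive x 1 (fun y : R => expR (- y)) (- expR (- x)).
Proof.
have h : is_derive x 1 (fun y : R => - y) (-1) by exact: is_deriveN.
have := @is_derive1_comp _ expR (fun y : R => - y) x _ _ (is_derive_expR (- x)) h.
by rewrite mulrN1.
Qed.

Lemma is_derive_ch x : is_derive x 1 ch (sh x).
Proof.
have h := is_deriveD (is_derive_expR x) (is_derive_expRN x).
have := is_deriveZ (2^-1 : R) h; rewrite (_ : _ \*: _ = ch); last first.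
  by apply/funext => y; rewrite /ch mulrC.
by rewrite (_ : _ *: _ = sh x)// /sh mulrC.
Qed.

Lemma is_derive_sh x : is_derive x 1 sh (ch x).
Proof.
have h := is_deriveB (is_derive_expR x) (is_derive_expRN x).
have := is_deriveZ (2^-1 : R) h; rewrite (_ : _ \*: _ = sh); last first.
  by apply/funext => y; rewrite /sh mulrC.
by rewrite (_ : _ *: _ = ch x)// /ch opprK mulrC.
Qed.

Let mvt (f df : R -> R) x y : x < y -> (forall z : R, is_derive z 1 f (df z)) ->
  exists2 c, x < c < y & f y - f x = df c * (y - x).
Proof.
move=> xy hf.
have cf : {within `[x, y], continuous f}.
  apply: continuous_subspaceT => z; apply: differentiable_continuous.
  by apply/derivable1_diffP; have [] := hf z.
have [c] := @MVT _ f df x y xy (fun z _ => hf z) cf.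
by rewrite in_itv/= => cxy e; exists c.
Qed.

Lemma sh_ge x : 0 <= x -> x <= sh x.
Proof.
rewrite le_eqVlt => /orP[/eqP <-|x0]; first by rewrite sh0.
have [c /andP[c0 _]] := mvt x0 is_derive_sh.
rewrite sh0 !subr0 => ->; rewrite ler_peMl ?(ltW x0)//; exact: ch_ge1.
Qed.

(* sh is convex on the half-line and vanishes at 0 *)
Lemma sh_star x z : 0 <= x -> x <= z -> z * sh x <= x * sh z.
Proof.
rewrite le_eqVlt => /orP[/eqP <-|x0]; first by rewrite sh0 mulr0 mul0r.
rewrite le_eqVlt => /orP[/eqP <-//|xz].
have [c1 /andP[c10 c1x]] := mvt x0 is_derive_sh; rewrite sh0 !subr0 => e1.
have [c2 /andP[c2x _]] := mvt xz is_derive_sh => e2.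
have h : ch c1 <= ch c2 by apply: ch_homo; [exact: ltW|lra].
have -> : sh z = sh x + ch c2 * (z - x) by rewrite -e2; ring.
have : 0 <= (z - x) * x * (ch c2 - ch c1).
  by rewrite mulr_ge0 ?subr_ge0// mulr_ge0 ?subr_ge0// ltW.
rewrite e1; lra.
Qed.

(* Convexity of y |-> ch (sqrt y). *)
Lemma ch_tangent x z : 0 <= x -> 0 < z ->
  sh z / (2 * z) * (x ^+ 2 - z ^+ 2) <= ch x - ch z.
Proof.
move=> x0 z0; set k := sh z / (2 * z).
have kE : 2 * k * z = sh z by rewrite /k; field; rewrite gt_eqF.
(* Its derivative sh y - 2 k y has the sign of y - z by [sh_star], so G is minimal at z. *)
pose G y := ch y - k * (y * y).
have dG (y : R) : is_derive y 1 G (sh y - k * (y + y)).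
  have hid : is_derive y 1 (fun t : R => t) 1 by exact: is_derive_id.
  have hsq := is_deriveM hid hid.
  have := is_deriveB (is_derive_ch y) (is_deriveZ k hsq).
  by rewrite (_ : _ - _ = G)// (_ : _ - _ = sh y - k * (y + y))// /GRing.scale/= !mulr1.
suff : G z <= G x by rewrite /G !expr2 mulrBr; lra.
case: (ltgtP x z) => [xz|zx|->//].
- have [c /andP[cx cz]] := mvt xz dG => e.
  have h : z * sh c <= c * sh z by apply: sh_star; [exact: le_trans (ltW cx)|exact: ltW].
  have : sh c - k * (c + c) <= 0 by rewrite -kE in h; nra.
  nra.
- have [c /andP[cz cx]] := mvt zx dG => e.
  have h : c * sh z <= z * sh c by apply: sh_star; exact: ltW.
  have : 0 <= sh c - k * (c + c) by rewrite -kE in h; nra.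
  nra.
Qed.

(** The lower counterpart of Pinelis' inequality, with no error term: it absorbs the deterministic
    displacement of a time step. At a = 0 the quotient is 0 by convention, and m = 0. *)
Lemma ch_sqrt_ge a m q : 0 <= a -> 0 <= q -> `|m| <= a * q ->
  ch a + sh a / a * m <= ch (Num.sqrt (a ^+ 2 + 2 * m + q ^+ 2)).
Proof.
move=> a0 q0 mq; set y := _ + _ + _.
have y0 : 0 <= y.
  by move: mq; rewrite ler_norml => /andP[h1 h2]; rewrite /y; have := sqr_ge0 (a - q); nra.
move: a0; rewrite le_eqVlt => /orP[/eqP a0|a0].
  rewrite -a0 mul0r normr_le0 in mq; rewrite (eqP mq) mulr0 addr0 -a0 ch0.
  exact: ch_ge1.
have := @ch_tangent (Num.sqrt y) a (sqrtr_ge0 _) a0; rewrite sqr_sqrtr//.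
have -> : sh a / (2 * a) * (y - a ^+ 2) = sh a / a * m + sh a / a * (q ^+ 2 / 2).
  by rewrite /y; field; rewrite gt_eqF.
have : 0 <= sh a / a * (q ^+ 2 / 2).
  apply: mulr_ge0; last by rewrite divr_ge0// sqr_ge0.
  by apply: divr_ge0; [apply: sh_ge0|]; exact: ltW.
lra.
Qed.

(** The argument of the root is the mean of (a+b)^2 and (a-b)^2 with weights (1+c)/2 and (1-c)/2;
    the tangent of y -> ch (sqrt y) at this mean is averaged with the same weights. *)
Lemma ch_sqrt_convex a b c : 0 <= a -> 0 <= b -> -1 <= c <= 1 ->
  ch (Num.sqrt (a ^+ 2 + 2 * (a * b * c) + b ^+ 2)) <= ch a * ch b + c * (sh a * sh b).
Proof.
move=> a0 b0 /andP[c1 c2].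
have p0 : 0 <= (1 + c) / 2 by lra.
have q0 : 0 <= (1 - c) / 2 by lra.
have -> : ch a * ch b + c * (sh a * sh b) =
    (1 + c) / 2 * ch (a + b) + (1 - c) / 2 * ch `|a - b|.
  by rewrite ch_norm chD chB; field.
set y := _ + _ + _.
have yE : y = (1 + c) / 2 * (a + b) ^+ 2 + (1 - c) / 2 * `|a - b| ^+ 2.
  by rewrite real_normK ?num_real// /y; field.
have y0 : 0 <= y by rewrite yE addr_ge0// mulr_ge0// sqr_ge0.
have := sqrtr_ge0 y; rewrite le_eqVlt => /orP[/eqP <-|z0].
  have := ch_ge1 (a + b); have := ch_ge1 `|a - b|; rewrite ch0; nra.
have t1 := @ch_tangent (a + b) _ (addr_ge0 a0 b0) z0.
have t2 := @ch_tangent `|a - b| _ (normr_ge0 _) z0.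
rewrite sqr_sqrtr// in t1 t2.
set k := sh _ / _ in t1 t2.
have e : (1 + c) / 2 * (k * ((a + b) ^+ 2 - y)) + (1 - c) / 2 * (k * (`|a - b| ^+ 2 - y)) = 0.
  have -> : (1 + c) / 2 * (k * ((a + b) ^+ 2 - y)) + (1 - c) / 2 * (k * (`|a - b| ^+ 2 - y)) =
    k * ((1 + c) / 2 * (a + b) ^+ 2 + (1 - c) / 2 * `|a - b| ^+ 2 - y) by field.
  by rewrite -yE subrr mulr0.
have s1 := ler_wpM2l p0 t1; have s2 := ler_wpM2l q0 t2.
rewrite !mulrBr in s1 s2 e; lra.
Qed.

(* Pinelis' inequality *)
Lemma ch_sqrt_le a b m : 0 <= a -> 0 <= b -> `|m| <= a * b ->
  ch (Num.sqrt (a ^+ 2 + 2 * m + b ^+ 2)) <=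
  ch a + sh a / a * m + ch a * (expR b - 1 - b).
Proof.
move=> a0 b0 mab.
have hb := sh_ge b0.
have [ab0|ab0] := eqVneq (a * b) 0.
  rewrite ab0 normr_le0 in mab; rewrite (eqP mab) !mulr0 !addr0.
  move/eqP: ab0; rewrite mulf_eq0 => /orP[]/eqP e0.
    rewrite e0 expr0n add0r sqrtr_sqr ger0_norm// ch0 -ch_add_sh; lra.
  by rewrite e0 expr0n addr0 sqrtr_sqr ger0_norm// expR0 subrr subr0 mulr0 addr0.
have an0 : a != 0 by apply: contraNneq ab0 => ->; rewrite mul0r.
have bn0 : b != 0 by apply: contraNneq ab0 => ->; rewrite mulr0.
have ab : 0 < a * b by rewrite lt_neqAle eq_sym ab0 mulr_ge0.
pose c := m / (a * b).
have mE : m = a * b * c by rewrite /c mulrC divfK.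
have c1 : -1 <= c <= 1.
  by rewrite -ler_norml /c normrM normfV (ger0_norm (ltW ab)) ler_pdivrMr// mul1r.
rewrite mE; apply: le_trans (ch_sqrt_convex a0 b0 c1) _.
have -> : sh a / a * (a * b * c) = sh a * b * c by field.
have ca := sh_le_ch a; have sa := sh_ge0 a0; case/andP: c1 => c1 c2.
(* This product is exactly the difference of the two sides, as e^b = ch b + sh b. *)
have : 0 <= (sh b - b) * (ch a - c * sh a) by apply: mulr_ge0; nra.
rewrite -(ch_add_sh b); nra.
Qed.

Lemma expR_sub_le x : 0 <= x -> expR x - 1 - x <= x ^+ 2 / 2 * expR x.
Proof.
rewrite le_eqVlt => /orP[/eqP <-|x0]; first by rewrite expR0 expr2; lra.
(* F x - F 0 is twice the difference of the two sides; F increases because (1 - c) e^c <= 1. *)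
pose F y := (y * y) * expR y + (-2) * (expR y - y).
have dF (y : R) : is_derive y 1 F ((y + y) * expR y + (y * y) * expR y + (-2) * (expR y - 1)).
  have hid : is_derive y 1 (fun t : R => t) 1 by exact: is_derive_id.
  have h1 := is_deriveM (is_deriveM hid hid) (is_derive_expR y).
  have h2 := is_deriveZ (-2 : R) (is_deriveB (is_derive_expR y) hid).
  apply: (@is_derive_eq _ _ _ _ _ _ _ _ (is_deriveD h1 h2)).
  have -> : (id * id : R -> R) y = y * y by [].
  by rewrite /GRing.scale/= !mulr1; ring.
have [c /andP[c0 _] e] := mvt x0 dF.
have := expR_gt0 c; have := expR_ge1Dx (- c); have := expRM_inv c => h1 h2 h3.
have h4 : 0 <= (c + c) * expR c + (c * c) * expR c + (-2) * (expR c - 1).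
  have : 0 <= c * c * expR c by rewrite !mulr_ge0 ?ltW.
  have : (1 + - c) * expR c <= expR (- c) * expR c by rewrite ler_pM2r.
  rewrite (mulrC (expR (- c))) h1; lra.
have : F 0 <= F x by rewrite -subr_ge0 e subr0 mulr_ge0// ltW.
rewrite /F expR0 expr2; lra.
Qed.

Lemma expR_sub_le_sqr x : 0 <= x <= 2^-1 -> expR x - 1 - x <= x ^+ 2.
Proof.
move=> /andP[x0 x1]; apply: le_trans (expR_sub_le x0) _.
have h : expR x <= 2.
  have := expR_ge1Dx (- x); have := expRM_inv x; have := expR_gt0 x; nra.
by have := sqr_ge0 x; nra.
Qed.

End hyperbolic.

(** * The particle system *)

Section empirical_measure.
Context {R : realType} (n : nat) (N : nat).
Hypothesis N0 : (0 < N)%N.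
Notation E := (n.-tuple R).
Implicit Types V : N.-tuple E.

Lemma Rintegral_empirical V (f : E -> R) : measurable_fun setT f ->
  \int[empirical V]_x f x = N%:R^-1 * \sum_(i < N) f (tnth V i).
Proof.
move=> mf.
have ge0 (g : E -> \bar R) : measurable_fun setT g -> (forall x, (0 <= g x)%E) ->
    (\int[empirical V]_x g x = N%:R^-1%:E * \sum_(i < N) g (tnth V i))%E.
  move=> mg g0; rewrite /empirical ge0_integral_mscale//; congr (_ * _)%E.
  rewrite ge0_integral_measure_sum//; apply: eq_bigr => i _.
  by rewrite integral_dirac// diracT mul1e (tnth_nth origin).
have mEf : measurable_fun setT (EFin \o f) by exact/measurable_EFinP.
rewrite /Rintegral integralE !ge0//; last 2 first.
- exact: measurable_funeneg.
- exact: measurable_funepos.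
have fp i : ((EFin \o f)^\+ (tnth V i) = (Num.max (f (tnth V i)) 0)%:E)%E.
  by rewrite funeposE/= EFin_max.
have fn i : ((EFin \o f)^\- (tnth V i) = (Num.max (- f (tnth V i)) 0)%:E)%E.
  by rewrite funenegE/= EFin_max.
under eq_bigr do rewrite fp.
under [X in (_ - _ * X)%E]eq_bigr do rewrite fn.
rewrite !sumEFin -!EFinM -EFinB/= -mulrBr -sumrB; congr (_ * _).
apply: eq_bigr => i _; move: (f _) => y.
by have [h1|h1] := leP y 0; have [h2|h2] := leP (- y) 0; lra.
Qed.

Let empirical_setT V : empirical V setT = 1%E.
Proof.
have -> : (empirical V setT = N%:R^-1%:E * \sum_(i < N) \d_(nth origin V i) setT)%E by [].
rewrite (eq_bigr (fun=> 1%E)); last by move=> i _; rewrite diracT.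
by rewrite sumEFin sumr_const card_ord -EFinM mulVf// pnatr_eq0 -lt0n.
Qed.

(** The same measure ([empPE]), packaged as a probability so that the results on probability
    measures apply to it. *)
Definition empP V : probability E R := mnormalize (empirical V) (\d_(origin : E)).

Lemma empPE V A : empP V A = empirical V A.
Proof. by rewrite /empP /= /mnormalize/= empirical_setT/= onee_eq0/= invr1 mule1. Qed.

Lemma integral_empP V (f : E -> \bar R) :
  (\int[empP V]_x f x = \int[empirical V]_x f x)%E.
Proof. by apply: eq_measure_integral => A _ _; exact: empPE. Qed.

Lemma Rintegral_empP V (f : E -> R) : measurable_fun setT f ->
  \int[empP V]_x f x = N%:R^-1 * \sum_(i < N) f (tnth V i).
Proof. by move=> mf; rewrite -Rintegral_empirical// /Rintegral integral_empP. Qed.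

Lemma mom1_empP V : mom1 (empP V).
Proof.
have mE := @measurable_enorm R n.
apply/integrableP; split; first exact/measurable_EFinP.
rewrite (_ : (fun x => _) = (fun x => (enorm x)%:E)); last first.
  by apply/funext => x /=; rewrite ger0_norm ?enorm_ge0.
rewrite integral_empP /empirical ge0_integral_mscale//; last 2 first.
- exact/measurable_EFinP.
- by move=> x _; rewrite lee_fin enorm_ge0.
rewrite ge0_integral_measure_sum//; last 2 first.
- by move=> x _; rewrite lee_fin enorm_ge0.
- exact/measurable_EFinP.
rewrite (eq_bigr (fun i : 'I_N => (enorm (nth origin V i))%:E)); last first.
  by move=> i _; rewrite integral_dirac ?diracT ?mul1e//; exact/measurable_EFinP.
by rewrite sumEFin -EFinM ltry.
Qed.

Definition empTF V (b : bool) (xi : E) : R := N%:R^-1 * \sum_(i < N) trig b (dotp xi (tnth V i)).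

Lemma TF_empirical V b xi : TF (empirical V) b xi = empTF V b xi.
Proof. by rewrite /TF Rintegral_empirical//; case: (bmf_trig b xi). Qed.

Lemma TF_empP V b xi : TF (empP V) b xi = empTF V b xi.
Proof. by rewrite /TF Rintegral_empP//; case: (bmf_trig b xi). Qed.

(** The right side is the generator of the particles applied to [empTF]: same prefactor, and each
    collision changes [empTF] by N^-1 times a [jump]. So the empirical measure drifts along the
    Boltzmann vector field. *)
Lemma QT_empP V b xi : QT (empP V) b xi = (2 * N%:R)^-1 * \sum_(i < N) \sum_(j < N)
  (N%:R^-1 * coll (fun x => trig b (dotp xi x)) (tnth V i) (tnth V j)).
Proof.
have bc := bmf_coll (bmf_trig b xi).
have [mi _] := bmf_Rintegral (empP V) bc.
have mv v : measurable_fun setT (coll (fun x => trig b (dotp xi x)) v).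
  by have [] := bmf_comp bc (pair1_measurable v).
rewrite /QT /QF Rintegral_empP// invfM -mulrA; congr (_ * _); congr (_ * _).
apply: eq_bigr => i _; rewrite Rintegral_empP// mulr_sumr.
by apply: eq_bigr => j _.
Qed.

End empirical_measure.

Section particles.
Context {R : realType} (n : nat) (N : nat).
Hypothesis n2 : (2 <= n)%N.
Hypothesis N0 : (0 < N)%N.
Notation E := (n.-tuple R).
Notation S := (@uniform_sphere R n).
Notation St := (N.-tuple E).
Implicit Types V : St.

Definition post V (i j : 'I_N) (s : E) : St :=
  replace2 V i j (kac_post (tnth V i) (tnth V j) s).1 (kac_post (tnth V i) (tnth V j) s).2.

Lemma kac_post_diag (v s : E) : kac_post v v s = (v, v).
Proof.
have e0 : enorm (vsub v v) = 0.
  have -> : vsub v v = origin.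
    by apply: eq_from_tnth => i; rewrite !tnth_mktuple subrr.
  exact: enorm_origin.
by rewrite /kac_post e0 mul0r; congr (_, _); apply: eq_from_tnth => i;
  rewrite tnth_mktuple mul0r ?addr0 ?subr0; field.
Qed.

Lemma post_diag V i s : post V i i s = V.
Proof.
rewrite /post kac_post_diag; apply: eq_from_tnth => l; rewrite tnth_mktuple.
by case: eqP => [->|].
Qed.

Lemma sum_post V i j s (f : E -> R) : \sum_(l < N) f (tnth (post V i j s) l) =
  \sum_(l < N) f (tnth V l) + (collision_sum f (tnth V i) (tnth V j) s
    - f (tnth V i) - f (tnth V j)).
Proof.
have [<-|ij] := eqVneq i j.
  by rewrite post_diag /collision_sum kac_post_diag/= addrAC addrK subrr addr0.
rewrite (bigD1 i)//= (bigD1 j)/=; last by rewrite eq_sym.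
rewrite [in RHS](bigD1 i)//= [in RHS](bigD1 j)/=; last by rewrite eq_sym.
rewrite /post !tnth_mktuple eqxx eq_sym (negbTE ij) eqxx /collision_sum.
rewrite (eq_bigr (fun l => f (tnth V l))); first by ring.
by move=> l /andP[li lj]; rewrite tnth_mktuple (negbTE li) (negbTE lj).
Qed.

Lemma empTF_post V i j s b xi : empTF (post V i j s) b xi =
  empTF V b xi + N%:R^-1 * jump (tnth V i) (tnth V j) s b xi.
Proof. by rewrite /empTF (sum_post V i j s (fun v => trig b (dotp xi v))) mulrDr. Qed.

Definition energy V : R := \sum_(l < N) enorm (tnth V l) ^+ 2.

Lemma energy_post V i j s : enorm s = 1 -> energy (post V i j s) = energy V.
Proof.
move=> s1; rewrite /energy (sum_post V i j s (fun v => enorm v ^+ 2)) -[RHS]addr0; congr (_ + _).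
rewrite /collision_sum kac_post1E kac_post2E.
set v := tnth V i; set w := tnth V j; set D := enorm (vsub v w).
have hD : D ^+ 2 = dotp (vsub v w) (vsub v w) by rewrite sqr_enorm.
have ss : dotp s s = 1 by rewrite -sqr_enorm s1 expr1n.
rewrite !sqr_enorm !dotpE ss (dotpC s v) (dotpC s w) (dotpC w v).
by move: hD; rewrite !dotpE (dotpC w v); lra.
Qed.

Lemma measurable_energy : measurable_fun setT energy.
Proof.
apply: measurable_sum => l; apply: measurable_funX; apply: measurable_enorm_comp.
exact: measurable_tnth.
Qed.

Lemma measurable_post i j : measurable_fun setT (fun p : St * E => post p.1 i j p.2).
Proof.
have mt l : measurable_fun setT (fun p : St * E => tnth p.1 l).
  by apply: (measurableT_comp (measurable_tnth l)).
apply/measurable_fun_tnthP => l; rewrite /comp.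
under eq_fun do rewrite tnth_mktuple.
case: (l == i); first by apply: measurable_kac_post1.
by case: (l == j); [apply: measurable_kac_post2|exact: mt].
Qed.

Lemma bmf_post (f : St -> R) V i j : bmf f -> bmf (fun s => f (post V i j s)).
Proof.
move=> bf; apply: (bmf_comp bf).
have h := measurableT_comp (measurable_post i j) (pair1_measurable V); exact: h.
Qed.

Lemma kac_generatorE (f : St -> R) V : bmf f -> kac_generator f V =
  (2 * N%:R)^-1 * \sum_(i < N) \sum_(j < N) (\int[S]_s f (post V i j s) - f V).
Proof.
move=> bf; rewrite /kac_generator; congr (_ * _).
apply: eq_bigr => i _; apply: eq_bigr => j _.
rewrite -[in RHS](Rintegral_prob_cst S (f V)) -(bmf_RintegralB S (bmf_post V i j bf) (bmf_cst _)).
have [mf [M fM]] := bf.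
have mrep : measurable_fun setT (fun z : E * E => f (replace2 V i j z.1 z.2) - f V).
  apply: measurable_funB => //; apply: measurableT_comp => //.
  apply/measurable_fun_tnthP => l; rewrite /comp.
  under eq_fun do rewrite tnth_mktuple.
  by case: (l == i); [exact: measurable_fst|case: (l == j); [exact: measurable_snd|exact: measurable_cst]].
rewrite /Rintegral /kac_law integral_distribution//.
- exact/measurable_EFinP.
- exact: (bmf_integrable S (bmfB (bmf_post V i j bf) (bmf_cst (f V)))).
Qed.

Lemma kac_generator_le (f : St -> R) V M : bmf f -> (forall W, `|f W| <= M) ->
  `|kac_generator f V| <= N%:R * M.
Proof.
move=> bf fM; rewrite kac_generatorE// normrM ger0_norm ?invr_ge0 ?mulr_ge0//.
have NR : 0 < N%:R :> R by rewrite ltr0n.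
have h i j : `|\int[S]_s f (post V i j s) - f V| <= 2 * M.
  apply: le_trans (ler_normB _ _) _; have := fM V.
  have : `|\int[S]_s f (post V i j s)| <= M by apply: bmf_Rintegral_le => //; exact: bmf_post.
  lra.
rewrite ler_pdivrMl ?mulr_gt0//.
apply: le_trans (ler_norm_sum _ _ _) _.
apply: (@le_trans _ _ (\sum_(i < N) (N%:R * (2 * M)))).
  apply: ler_sum => i _; apply: le_trans (ler_norm_sum _ _ _) _.
  apply: (@le_trans _ _ (\sum_(j < N) (2 * M))); first by apply: ler_sum.
  by rewrite sumr_const card_ord -[leLHS]mulr_natl.
by rewrite sumr_const card_ord -[leLHS]mulr_natl; lra.
Qed.

Lemma bmf_kac_generator (f : St -> R) : bmf f -> bmf (kac_generator f).
Proof.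
move=> bf; have [mf [M fM]] := bf; split; last first.
  by exists (N%:R * M) => V; exact: kac_generator_le.
rewrite (_ : kac_generator f = fun V => (2 * N%:R)^-1 *
    \sum_(i < N) \sum_(j < N) (\int[S]_s f (post V i j s) - f V)); last first.
  by apply/funext => V; rewrite kac_generatorE.
apply: measurable_funM => //; apply: measurable_sum => i; apply: measurable_sum => j.
apply: measurable_funB => //.
apply: (@measurable_Rintegral _ _ _ _ _ S (fun p : St * E => f (post p.1 i j p.2))).
exact: (measurableT_comp mf (measurable_post i j)).
Qed.

End particles.

Section almost_everywhere.
Context {R : realType} {d : measure_display} {T : measurableType d}.

Lemma ae_le_Rintegral (m : {measure set T -> \bar R}) (f g : T -> R) :
  m.-integrable setT (EFin \o f) -> m.-integrable setT (EFin \o g) ->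
  {ae m, forall x, f x <= g x} -> \int[m]_x f x <= \int[m]_x g x.
Proof.
move=> If Ig fg; rewrite -subr_ge0 -RintegralB//.
have IB := integrableB measurableT Ig If.
have mB : measurable_fun setT (fun x => (g x - f x)%:E) by have /integrableP[] := IB.
rewrite /Rintegral.
have -> : (\int[m]_x (g x - f x)%:E = \int[m]_x `|(g x - f x)%:E|)%E.
  apply: ae_eq_integral => //; first exact: measurableT_comp.
  by apply: filterS fg => x h _ /=; rewrite ger0_norm// subr_ge0.
by apply: fine_ge0; apply: integral_ge0.
Qed.

End almost_everywhere.

Section section_integrable.
Context {R : realType} (n : nat) (r : R).
Hypotheses (n2 : (2 <= n)%N) (r01 : 0 < r < 1).
Notation E := (n.-tuple R).
Context {dT : measure_display} {T : measurableType dT} (m : probability T R).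
Variables (Z : T -> bool -> E -> R) (gT : T -> R).
Hypothesis mZ : forall b, measurable_fun setT (fun p : T * E => Z p.1 b p.2).
Hypothesis IgT : m.-integrable setT (EFin \o gT).
Hypothesis gT0 : forall t, 0 <= gT t.
Hypothesis ZgT : forall t b xi, `|Z t b xi| <= gT t * cutnorm xi.

Lemma measurable_section t b : measurable_fun setT (Z t b).
Proof. have h := measurableT_comp (mZ b) (pair1_measurable t); exact: h. Qed.

Lemma measurable_ip_section f : (forall b, measurable_fun setT (f b)) ->
  measurable_fun setT (fun t => ip r f (Z t)).
Proof.
move=> mf; apply: (@measurable_Rintegral _ _ _ _ _ (lebesgue_tuple R n)
  (fun p : T * E => pairing f (Z p.1) p.2 * fw r p.2)).
apply: measurable_funM; last by apply: measurableT_comp => //; exact: measurable_fw.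
by apply: measurable_funD; apply: measurable_funM => //; exact: measurableT_comp.
Qed.

Lemma ip_section_integrable f : hdom f ->
  m.-integrable setT (EFin \o (fun t => ip r f (Z t))).
Proof.
move=> df.
have I := integrableZl measurableT (hnorm r f * @cut_const R n r) IgT.
apply: (le_integrable measurableT _ _ I).
- by apply/measurable_EFinP; apply: measurable_ip_section; case: df.
- move=> t _ /=; rewrite lee_fin [leRHS]ger0_norm; last first.
    by rewrite !mulr_ge0// ?hnorm_ge0// sqrtr_ge0.
  have dZ : hdom (Z t).
    by split; [exact: measurable_section|exists (gT t)].
  apply: le_trans (ip_le n2 r01 df dZ) _; rewrite -mulrA ler_wpM2l ?hnorm_ge0//.
  rewrite mulrC; apply: hnorm_cut => //; exact: measurable_section.
Qed.

End section_integrable.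

Section generator_estimate.
Context {R : realType} (n N : nat) (r k1 : R).
Hypotheses (n2 : (2 <= n)%N) (r01 : 0 < r < 1) (N0 : (0 < N)%N) (k10 : 0 < k1).
Notation E := (n.-tuple R).
Notation S := (@uniform_sphere R n).
Notation St := (N.-tuple E).
Notation cut := (@cutnorm R n).
Variables (e : E).
Hypothesis e1 : enorm e = 1.
Implicit Types (V : St) (m : probability E R).

Let NR : 0 < N%:R :> R. Proof. by rewrite ltr0n. Qed.

Definition deviation m V (b : bool) (xi : E) : R := empTF V b xi - TF m b xi.

Lemma deviationE m V : deviation m V = TFB (empP V) m.
Proof. by apply/funext => b; apply/funext => xi; rewrite /TFB TF_empP. Qed.

Lemma deviation_empirical m V : deviation m V = TFB (empirical V) m.
Proof. by apply/funext => b; apply/funext => xi; rewrite /TFB TF_empirical. Qed.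

Lemma hdom_deviation m V : mom1 m -> hdom (deviation m V).
Proof. by move=> m1; rewrite deviationE; apply: hdom_TFB => //; exact: mom1_empP. Qed.

Lemma measurable_deviation m b : measurable_fun setT (fun p : St * E => deviation m p.1 b p.2).
Proof.
apply: measurable_funB; last by apply: (measurableT_comp (measurable_TF m b)).
apply: measurable_funM => //; apply: measurable_sum => i.
apply: measurableT_comp; first exact: measurable_trig.
apply: measurable_dotp => //.
exact: (measurableT_comp (measurable_tnth i) (@measurable_fst _ _ St E)).
Qed.

Definition dist m V : R := hnorm r (deviation m V).

Lemma measurable_dist m : measurable_fun setT (dist m).
Proof.
apply: (@measurableT_comp _ _ _ _ _ _ (@Num.sqrt R)).
  by apply: continuous_measurable_fun => x; exact: sqrt_continuous.
apply: (@measurable_Rintegral _ _ _ _ _ (lebesgue_tuple R n)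
  (fun p : St * E => pairing (deviation m p.1) (deviation m p.1) p.2 * fw r p.2)).
apply: measurable_funM; last by apply: measurableT_comp => //; exact: measurable_fw.
by apply: measurable_funD; apply: measurable_funM; exact: measurable_deviation.
Qed.

Definition low_energy : set St := [set V | energy V <= 2 * N%:R * k1].

Lemma measurable_low_energy : measurable low_energy.
Proof.
rewrite (_ : low_energy = @energy R n N @^-1` `]-oo, (2 * N%:R * k1)]); last first.
  by apply/seteqP; split => V; rewrite /low_energy /= in_itv.
by rewrite -[X in measurable X]setTI; apply: measurable_energy => //; exact: measurable_itv.
Qed.

(** The constant of [TF_sub_cut], with the mean of |v_i| bounded by 1 + 2 k1 on [low_energy], since
    |v| <= 1 + |v|^2. *)
Definition dist_bound m : R := (3 + 2 * k1 + \int[m]_x enorm x) * @cut_const R n r.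

Lemma dist_le m V : mom1 m -> low_energy V -> dist m V <= dist_bound m.
Proof.
move=> m1 VG; apply: (hnorm_cut n2 r01).
- by rewrite !addr_ge0 ?mulr_ge0 ?(ltW k10)// Rintegral_ge0// => x _; exact: enorm_ge0.
- by have [] := hdom_deviation V m1.
move=> b xi; rewrite deviationE.
apply: le_trans (TF_sub_cut _ _ (mom1_empP N0 V) m1) _.
rewrite ler_wpM2r ?cutnorm_ge0// lerD2r.
rewrite Rintegral_empP//; last exact: measurable_enorm.
suff : N%:R^-1 * \sum_(i < N) enorm (tnth V i) <= 1 + 2 * k1 by lra.
rewrite ler_pdivrMl//.
apply: (@le_trans _ _ (\sum_(i < N) (1 + enorm (tnth V i) ^+ 2))).
  by apply: ler_sum => i _; have := sqr_ge0 (enorm (tnth V i) - 2^-1); nra.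
rewrite big_split/= sumr_const card_ord; move: VG; rewrite /low_energy/= /energy.
lra.
Qed.

(** Without the indicator the function would be unbounded in V, outside the scope of
    [has_generator]. *)
Definition Phi m (c : R) V : R := ch (c * dist m V) * \1_low_energy V.

Lemma Phi_low m c V : low_energy V -> Phi m c V = ch (c * dist m V).
Proof. by move=> VG; rewrite /Phi indicE mem_set// mulr1. Qed.

Lemma Phi_ge0 m c V : 0 <= Phi m c V.
Proof. by rewrite mulr_ge0 ?indicE// (le_trans ler01)// ch_ge1. Qed.

Lemma dist_ge0 m V : 0 <= dist m V. Proof. exact: hnorm_ge0. Qed.

Lemma Phi_le m c V : mom1 m -> 0 <= c -> Phi m c V <= ch (c * dist_bound m).
Proof.
move=> m1 c0; rewrite /Phi indicE; case: (boolP (V \in low_energy)) => [/set_mem h|_].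
  rewrite mulr1; apply: ch_homo; first by rewrite mulr_ge0// dist_ge0.
  by rewrite ler_wpM2l// dist_le.
by rewrite mulr0 (le_trans ler01)// ch_ge1.
Qed.

Lemma measurable_ch : measurable_fun setT (@ch R).
Proof.
apply: continuous_measurable_fun => x; apply: differentiable_continuous.
by apply/derivable1_diffP; have [] := @is_derive_ch R x.
Qed.

Lemma bmf_Phi m c : mom1 m -> 0 <= c -> bmf (Phi m c).
Proof.
move=> m1 c0; split.
  apply: measurable_funM; last exact: measurable_indic measurable_low_energy.
  apply: (measurableT_comp measurable_ch); apply: measurable_funM => //.
  exact: measurable_dist.
by exists (ch (c * dist_bound m)) => V; rewrite ger0_norm ?Phi_ge0// Phi_le.
Qed.

Definition jump_const : R := 4 * (2 `^ (1 - r) - 1) * @coskernel R n r e.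

Lemma coskernel_ge0 z : 0 <= @coskernel R n r z.
Proof.
apply: Rintegral_ge0 => xi _; apply: mulr_ge0; last exact: fw_ge0.
by rewrite subr_ge0 cos_le1.
Qed.

Lemma jump_const_ge0 : 0 <= jump_const.
Proof.
apply: mulr_ge0; last exact: coskernel_ge0; apply: mulr_ge0 => //.
have : 2 `^ 0 <= 2 `^ (1 - r) :> R.
  by apply: ler_powR; rewrite ?ler1n// subr_ge0 ltW//; case/andP: r01.
by rewrite powRr0 subr_ge0.
Qed.

Lemma sqr_hnorm_jump (v w s : E) : enorm s = 1 ->
  hnorm r (jump v w s) ^+ 2 <= jump_const * (enorm (vsub v w) ^+ 2) `^ r.
Proof.
move=> s1; rewrite sqr_hnorm; apply: le_trans (ip_jump_le n2 r01 v w s1 e1) _.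
by rewrite powRrM powR_mulrn// enorm_ge0.
Qed.

(** The two sides differ by twice the square of the sum of the velocities. *)
Lemma sum_sqr_dist V : \sum_(i < N) \sum_(j < N) enorm (vsub (tnth V i) (tnth V j)) ^+ 2 <=
  2 * N%:R * energy V.
Proof.
have e2 i j : enorm (vsub (tnth V i) (tnth V j)) ^+ 2 =
    enorm (tnth V i) ^+ 2 + enorm (tnth V j) ^+ 2 - 2 * dotp (tnth V i) (tnth V j).
  by rewrite !sqr_enorm !dotpE (dotpC (tnth V j)); ring.
under eq_bigr => i _ do under eq_bigr => j _ do rewrite e2.
have -> : \sum_(i < N) \sum_(j < N) (enorm (tnth V i) ^+ 2 + enorm (tnth V j) ^+ 2
    - 2 * dotp (tnth V i) (tnth V j)) =
  2 * N%:R * energy V - 2 * \sum_(i < N) \sum_(j < N) dotp (tnth V i) (tnth V j).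
  under eq_bigr => i _ do rewrite sumrB big_split/= sumr_const card_ord -mulr_sumr.
  rewrite sumrB big_split/= -mulr_sumr sumr_const card_ord sumrMnl -/(energy V).
  by rewrite -[energy V *+ N]mulr_natr; ring.
rewrite lerBlDr lerDl mulr_ge0//.
rewrite (_ : \sum_(i < N) _ = \sum_(k < n) (\sum_(i < N) tnth (tnth V i) k) ^+ 2).
  by apply: sumr_ge0 => k _; exact: sqr_ge0.
rewrite /dotp; under eq_bigr do rewrite exchange_big.
rewrite exchange_big/=; apply: eq_bigr => k _.
by rewrite expr2 mulr_suml; apply: eq_bigr => i _; rewrite mulr_sumr.
Qed.

Lemma sum_powR_dist V : low_energy V ->
  \sum_(i < N) \sum_(j < N) (enorm (vsub (tnth V i) (tnth V j)) ^+ 2) `^ r <=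
  N%:R ^+ 2 * (4 * k1) `^ r.
Proof.
move=> VG; rewrite pair_big/=.
have c : #|{: 'I_N * 'I_N}| = (N * N)%N by rewrite card_prod card_ord.
have := @powR_mean_le R ('I_N * 'I_N)%type
  (fun p => enorm (vsub (tnth V p.1) (tnth V p.2)) ^+ 2) r r01.
rewrite c muln_gt0 N0 => /(_ isT (fun p => sqr_ge0 _)) h; apply: le_trans h _.
rewrite natrM -expr2 ler_wpM2l ?sqr_ge0//.
apply: ge0_ler_powR; rewrite ?nnegrE ?(ltW k10)//.
- by case/andP: r01 => /ltW.
- by rewrite divr_ge0 ?sqr_ge0// sumr_ge0// => p _; exact: sqr_ge0.
- by rewrite mulr_ge0// ltW.
rewrite ler_pdivrMr ?exprn_gt0// -(pair_big xpredT xpredT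
  (fun i j => enorm (vsub (tnth V i) (tnth V j)) ^+ 2))/=.
apply: le_trans (sum_sqr_dist V) _; move: VG; rewrite /low_energy/= => h.
have : 2 * N%:R * energy V <= 2 * N%:R * (2 * N%:R * k1) by rewrite ler_wpM2l// mulr_ge0.
lra.
Qed.

Lemma pair_dist_le V i j : low_energy V ->
  enorm (vsub (tnth V i) (tnth V j)) ^+ 2 <= 4 * N%:R * k1.
Proof.
move=> VG; set v := tnth V i; set w := tnth V j.
have [vw|vw] := eqVneq i j.
  rewrite /v /w vw (_ : vsub _ _ = origin); last first.
    by apply: eq_from_tnth => l; rewrite !tnth_mktuple subrr.
  by rewrite enorm_origin expr0n !mulr_ge0// ltW.
have h : enorm (vsub v w) ^+ 2 <= 2 * (enorm v ^+ 2 + enorm w ^+ 2).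
  have := dotp_ge0 (vadd v w); rewrite !sqr_enorm !dotpE (dotpC w v); lra.
have : enorm v ^+ 2 + enorm w ^+ 2 <= energy V.
  rewrite /energy (bigD1 i)//= (bigD1 j)/=; last by rewrite eq_sym.
  by rewrite addrA lerDl sumr_ge0// => l _; exact: sqr_ge0.
move: VG; rewrite /low_energy/=; lra.
Qed.

(** On [low_energy] no squared relative velocity exceeds 4 N k1, so this keeps every jump of c X
    below 1/2 in norm. Then e^q - 1 - q <= q^2; the constant [omega] of the theorem leaves room for
    q^2 in place of the sharper q^2 / 2. *)
Definition small_jumps (c : R) : Prop :=
  c ^+ 2 * (N%:R^-1 ^+ 2 * (jump_const * (4 * N%:R * k1) `^ r)) <= 4^-1.

Section one_pair.
Variables (m : probability E R) (V : St) (c : R) (i j : 'I_N).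
Hypotheses (m1 : mom1 m) (VG : low_energy V) (c0 : 0 <= c) (sc : small_jumps c).

Let v := tnth V i.
Let w := tnth V j.
Let a := c * dist m V.
Let D := enorm (vsub v w) ^+ 2.
Let J s := jump v w s.
Let qv := c ^+ 2 * (N%:R^-1 ^+ 2 * (jump_const * D `^ r)).

Let r0 : 0 < r. Proof. by case/andP: r01. Qed.

Lemma hdom_jump s : hdom (J s).
Proof.
split; last first.
  by exists (jump_bound v w s); [exact: jump_bound_ge0|exact: jump_le].
move=> b; have h := measurableT_comp (measurable_jump v w b) (pair1_measurable s); exact: h.
Qed.

Lemma Phi_post_le s : enorm s = 1 -> Phi m c (post V i j s) <=
  ch a + sh a / a * (c ^+ 2 * (N%:R^-1 * ip r (deviation m V) (J s))) + ch a * qv.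
Proof.
move=> s1.
have dX := hdom_deviation V m1; have dJ := hdom_jump s.
rewrite Phi_low; last by rewrite /low_energy/= energy_post.
set x := ip r (deviation m V) (J s).
have e2 : dist m (post V i j s) ^+ 2 =
    dist m V ^+ 2 + 2 * N%:R^-1 * x + N%:R^-1 ^+ 2 * hnorm r (J s) ^+ 2.
  rewrite /dist !sqr_hnorm /x -(ip_sqr_lin n2 r01 _ dX dJ).
  rewrite (_ : deviation m (post V i j s) = fun b xi =>
    deviation m V b xi + N%:R^-1 * J s b xi); first by [].
  by apply/funext => b; apply/funext => xi; rewrite /deviation empTF_post /J; ring.
pose q := c * (N%:R^-1 * hnorm r (J s)).
have q0 : 0 <= q by rewrite !mulr_ge0 ?invr_ge0 ?hnorm_ge0// ltW.
have a0 : 0 <= a by rewrite mulr_ge0// dist_ge0.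
have e3 : c * dist m (post V i j s) =
    Num.sqrt (a ^+ 2 + 2 * (c ^+ 2 * (N%:R^-1 * x)) + q ^+ 2).
  have -> : a ^+ 2 + 2 * (c ^+ 2 * (N%:R^-1 * x)) + q ^+ 2 = (c * dist m (post V i j s)) ^+ 2.
    by rewrite [RHS]exprMn e2 /a /q; ring.
  by rewrite sqrtr_sqr ger0_norm// mulr_ge0// dist_ge0.
have mq : `|c ^+ 2 * (N%:R^-1 * x)| <= a * q.
  rewrite normrM (ger0_norm (sqr_ge0 c)) normrM (@ger0_norm _ N%:R^-1) ?invr_ge0 ?(ltW NR)//.
  have -> : a * q = c ^+ 2 * (N%:R^-1 * (dist m V * hnorm r (J s))) by rewrite /a /q; ring.
  rewrite ler_wpM2l ?sqr_ge0// ler_wpM2l ?invr_ge0 ?(ltW NR)//.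
  exact: ip_le.
rewrite e3; apply: le_trans (ch_sqrt_le a0 q0 mq) _; rewrite lerD2l.
have q2 : q ^+ 2 <= qv.
  have -> : q ^+ 2 = c ^+ 2 * (N%:R^-1 ^+ 2 * hnorm r (J s) ^+ 2) by rewrite /q; ring.
  by rewrite ler_wpM2l ?sqr_ge0// ler_wpM2l ?sqr_ge0//; exact: sqr_hnorm_jump.
have q2' : q ^+ 2 <= 4^-1.
  apply: le_trans q2 _; apply: le_trans sc.
  rewrite ler_wpM2l ?sqr_ge0// ler_wpM2l ?sqr_ge0// ler_wpM2l ?jump_const_ge0//.
  apply: ge0_ler_powR; rewrite ?nnegrE ?sqr_ge0 ?(ltW r0)//.
    by rewrite !mulr_ge0// ltW.
  exact: pair_dist_le.
have q1 : 0 <= q <= 2^-1 by rewrite q0 /=; nra.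
rewrite ler_wpM2l ?(le_trans ler01 (ch_ge1 _))//.
exact: le_trans (expR_sub_le_sqr q1) q2.
Qed.

Let mJ b : measurable_fun setT (fun p : E * E => J p.1 b p.2).
Proof. exact: measurable_jump. Qed.

Let IJ : S.-integrable setT (EFin \o (fun s => ip r (deviation m V) (J s))).
Proof.
apply: (ip_section_integrable n2 r01 mJ (jump_bound_integrable n2 v w)).
- by move=> s; exact: jump_bound_ge0.
- by move=> s b xi; exact: jump_le.
- exact: hdom_deviation.
Qed.

Lemma mean_Phi_post_le : \int[S]_s Phi m c (post V i j s) - Phi m c V <=
  sh a / a * c ^+ 2 * (N%:R^-1 * ip r (deviation m V)
     (fun b xi => coll (fun x => trig b (dotp xi x)) v w)) + ch a * qv.
Proof.
have dX := hdom_deviation V m1.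
have PV : Phi m c V = ch a by exact: Phi_low.
have IK := integrableZl measurableT (sh a / a * c ^+ 2 * N%:R^-1) IJ.
have IU : S.-integrable setT (EFin \o (fun s => (ch a + ch a * qv) +
    sh a / a * c ^+ 2 * N%:R^-1 * ip r (deviation m V) (J s))).
  have := integrableD measurableT (bmf_integrable S (bmf_cst (ch a + ch a * qv))) IK.
  by congr integrable.
have := ae_le_Rintegral (bmf_integrable S (bmf_post V i j (bmf_Phi m1 c0))) IU.
rewrite RintegralD//; last exact: bmf_integrable (bmf_cst _).
rewrite Rintegral_prob_cst RintegralZl//.
rewrite -(ip_average n2 r01 mJ (jump_bound_integrable n2 v w)) //; last first.
  by move=> s b xi; exact: jump_le.
rewrite (_ : (fun b xi => \int[S]_t J t b xi) =
  fun b xi => coll (fun x => trig b (dotp xi x)) v w); last first.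
  by apply/funext => b; apply/funext => xi; rewrite coll_jump.
rewrite PV => h.
have n0 : (0 < n)%N by exact: ltnW.
have {}h := h (filterS _ (ae_sphere n0)).
apply: (@le_trans _ _ (ch a + ch a * qv + sh a / a * c ^+ 2 * N%:R^-1 *
  ip r (deviation m V) (fun b xi => coll (fun x => trig b (dotp xi x)) v w) - ch a)).
  rewrite lerD2r; apply: h => s s1; apply: le_trans (Phi_post_le s1) _.
  by rewrite le_eqVlt; apply/orP; left; apply/eqP; ring.
by rewrite le_eqVlt; apply/orP; left; apply/eqP; ring.
Qed.

End one_pair.

Lemma hdom_coll v w : hdom (fun b (xi : E) => coll (fun x => trig b (dotp xi x)) v w).
Proof.
rewrite (_ : (fun b xi => _) = fun b xi => \int[S]_s jump v w s b xi); last first.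
  by apply/funext => b; apply/funext => xi; rewrite coll_jump.
apply: (hdom_average _ (jump_bound_integrable n2 v w)).
- by move=> b; exact: measurable_jump.
- by move=> s b xi; exact: jump_le.
Qed.

(** The linear terms of Pinelis' inequality add up to the inner product with Q by [QT_empP]; the
    quadratic ones are summed by [sum_powR_dist], N^2 pairs weighted by N^-2 / (2 N). *)
Lemma generator_Phi_le m V c : mom1 m -> low_energy V -> 0 <= c -> small_jumps c ->
  kac_generator (Phi m c) V <=
  sh (c * dist m V) / (c * dist m V) * c ^+ 2 * ip r (deviation m V) (QT (empP V)) +
  ch (c * dist m V) * (c ^+ 2 * (jump_const * (4 * k1) `^ r) / (2 * N%:R)).
Proof.
move=> m1 VG c0 sc; set a := c * dist m V.
have dX := hdom_deviation V m1.
rewrite kac_generatorE//; last exact: bmf_Phi.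
pose F i j := fun b (xi : E) => coll (fun x => trig b (dotp xi x)) (tnth V i) (tnth V j).
have dF i j : hdom (F i j) by exact: hdom_coll.
have dZ i j : hdom (fun b xi => N%:R^-1 * F i j b xi).
  have := hdom_lin N%:R^-1 (@hdom0 R n) (dF i j); congr hdom.
  by apply/funext => b; apply/funext => xi; rewrite add0r.
have -> : ip r (deviation m V) (QT (empP V)) =
    (2 * N%:R)^-1 * \sum_(i < N) \sum_(j < N) (N%:R^-1 * ip r (deviation m V) (F i j)).
  rewrite (_ : QT (empP V) = fun b xi => (2 * N%:R)^-1 *
    \sum_(i < N) \sum_(j < N) (N%:R^-1 * F i j b xi)); last first.
    by apply/funext => b; apply/funext => xi; rewrite QT_empP.
  rewrite (ipZr n2 r01)//; last by apply: hdom_sum => i; exact: hdom_sum.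
  congr (_ * _); rewrite (ip_sumr n2 r01)//; last by move=> i; exact: hdom_sum.
  apply: eq_bigr => i _; rewrite (ip_sumr n2 r01)//.
  by apply: eq_bigr => j _; rewrite (ipZr n2 r01).
set P := sh a / a * c ^+ 2.
pose q i j := c ^+ 2 * (N%:R^-1 ^+ 2 * (jump_const *
  (enorm (vsub (tnth V i) (tnth V j)) ^+ 2) `^ r)).
apply: (@le_trans _ _ ((2 * N%:R)^-1 * \sum_(i < N) \sum_(j < N)
   (P * (N%:R^-1 * ip r (deviation m V) (F i j)) + ch a * q i j))).
  rewrite ler_wpM2l ?invr_ge0 ?mulr_ge0 ?(ltW NR)//.
  by apply: ler_sum => i _; apply: ler_sum => j _; exact: mean_Phi_post_le.
rewrite (eq_bigr (fun i => \sum_(j < N) P * (N%:R^-1 * ip r (deviation m V) (F i j)) +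
  \sum_(j < N) ch a * q i j)); last by move=> i _; rewrite big_split.
rewrite big_split/=.
have pull (k : R) (G : 'I_N -> 'I_N -> R) :
    \sum_(i < N) \sum_(j < N) k * G i j = k * \sum_(i < N) \sum_(j < N) G i j.
  by rewrite mulr_sumr; apply: eq_bigr => i _; rewrite mulr_sumr.
rewrite !(pull P) (pull (ch a)) mulrDr lerD//; first by rewrite mulrCA.
have ca : 0 <= ch a by exact: le_trans ler01 (ch_ge1 _).
rewrite mulrCA ler_wpM2l// mulrC ler_pM2r ?invr_gt0 ?mulr_gt0//.
rewrite /q !pull ler_wpM2l ?sqr_ge0// mulrCA ler_wpM2l ?jump_const_ge0//.
rewrite exprVn ler_pdivrMl ?exprn_gt0//; exact: sum_powR_dist.
Qed.

End generator_estimate.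

(** * Markov semigroups *)

Section bounded_induction.
Context {R : realType} {d : measure_display} {T : measurableType d}.

(** As long as y <= K t, the sum is t times the integer part of y / t. *)
Let count_le (y t : R) (K : nat) : 0 <= y -> 0 < t ->
  forall s, s = \sum_(k < K) t * (k.+1%:R * t <= y)%R%:R ->
  [/\ s <= y, (y <= K%:R * t -> y - t <= s) & (K%:R * t <= y -> s = K%:R * t)].
Proof.
move=> y0 t0; elim: K => [|K IH] s ->.
  by rewrite big_ord0 mul0r; split => // h; lra.
rewrite big_ord_recr/=; case: (IH _ erefl); set u := \sum_(k < K) _ => h1 h2 h3.
have KS : K.+1%:R * t = K%:R * t + t by rewrite -natr1 mulrDl mul1r.
rewrite KS; case: (leP (K%:R * t + t) y) => h.
  have /h3 e : K%:R * t <= y by lra.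
  by rewrite e mulr1; split => // *; lra.
rewrite mulr0 addr0; split => [//|h4|h4]; last by lra.
by case: (leP (K%:R * t) y) => [/h3 ->|/ltW/h2//]; lra.
Qed.

(** The semigroup law and the Boltzmann equation are given on measurable sets; this carries their
    linear consequences to bounded functions. With [y] the integer part of y, the approximation is
    the staircase e [(f + M) / e] - M, a finite combination of indicators. *)
Lemma bmf_approx (Q : (T -> R) -> Prop) :
  (forall A, measurable A -> Q \1_A) ->
  (forall f g, bmf f -> bmf g -> Q f -> Q g -> Q (fun x => f x + g x)) ->
  (forall c f, bmf f -> Q f -> Q (fun x => c * f x)) ->
  forall f, bmf f -> forall e, 0 < e ->
  exists g, [/\ bmf g, Q g & forall x, `|f x - g x| <= e].
Proof.
move=> Q1 QD QZ f [mf [M fM]] e e0.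
pose A k := [set x | k.+1%:R * e <= f x + M].
have mA k : measurable (A k).
  rewrite (_ : A k = (fun x => f x + M) @^-1` `[(k.+1%:R * e), +oo[); last first.
    by apply/seteqP; split => x; rewrite /A /= in_itv/= andbT.
  rewrite -[X in measurable X]setTI; apply: measurable_funD => //; exact: measurable_itv.
have QS K : Q (fun x => \sum_(k < K) e * \1_(A k) x) /\ bmf (fun x => \sum_(k < K) e * \1_(A k) x).
  elim: K => [|K [IH bIH]].
    have b0 := bmf_indic (R := R) (@measurable0 _ T).
    have e0' : (fun x : T => \sum_(k < 0) e * \1_(A k) x) = fun x => 0 * \1_set0 x.
      by apply/funext => x; rewrite big_ord0 mul0r.
    by rewrite e0'; split; [apply: QZ => //; exact: Q1|exact: bmfZ].
  have bA := bmf_indic (R := R) (mA K).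
  have eS : (fun x : T => \sum_(k < K.+1) e * \1_(A k) x) =
      fun x => \sum_(k < K) e * \1_(A k) x + e * \1_(A K) x.
    by apply/funext => x; rewrite big_ord_recr.
  rewrite eS; split; last by apply: bmfD => //; exact: bmfZ.
  by apply: QD => //; [exact: bmfZ|apply: QZ => //; exact: Q1].
have [K hK] : exists K : nat, 2 * M <= K%:R * e.
  exists (Num.bound `|2 * M / e|); rewrite -ler_pdivrMr//.
  exact: le_trans (ler_norm _) (ltW (archi_boundP (normr_ge0 _))).
have [QK bK] := QS K.
have bT := bmf_indic (R := R) (@measurableT _ T).
exists (fun x => \sum_(k < K) e * \1_(A k) x + (- M) * \1_setT x); split.
- by apply: bmfD => //; exact: bmfZ.
- by apply: QD => //; [exact: bmfZ|apply: QZ => //; exact: Q1].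
move=> x; rewrite indicT mulr1.
have := fM x; rewrite ler_norml => /andP[f1 f2].
have y0 : 0 <= f x + M by lra.
have [|] := @count_le _ _ K y0 e0 (\sum_(k < K) e * \1_(A k) x).
  apply: eq_bigr => k _; rewrite indicE; congr (_ * (nat_of_bool _)%:R).
  by apply/idP/idP => [/set_mem//|h]; exact: mem_set.
move=> h1 h2 _; rewrite ler_norml; apply/andP; split; first by lra.
by have := h2 (le_trans _ hK); lra.
Qed.

End bounded_induction.

Section semigroup.
Context {R : realType} {d : measure_display} {X : measurableType d}.
Variables (p : R -> R.-pker X ~> X) (L : (X -> R) -> X -> R).
Hypotheses (hp : markov_semigroup p) (hL : has_generator p L).
Hypothesis bL : forall f, bmf f -> bmf (L f).

(* [p t x] normalized, which makes it a [probability] *)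
Definition trans t x : probability X R := mnormalize (p t x) (\d_x).

Lemma transE t x A : trans t x A = p t x A.
Proof. by rewrite /trans/= /mnormalize/= prob_kernel/= onee_eq0/= invr1 mule1. Qed.

Lemma integral_trans t x (f : X -> \bar R) :
  (\int[trans t x]_y f y = \int[p t x]_y f y)%E.
Proof. by apply: eq_measure_integral => A _ _; exact: transE. Qed.

Definition evolve t (f : X -> R) x : R := \int[trans t x]_y f y.

Lemma evolveE t f x : evolve t f x = \int[p t x]_y f y.
Proof. by rewrite /evolve /Rintegral integral_trans. Qed.

Lemma evolveD t f g x : bmf f -> bmf g ->
  evolve t (fun y => f y + g y) x = evolve t f x + evolve t g x.
Proof. exact: bmf_RintegralD. Qed.

Lemma evolveB t f g x : bmf f -> bmf g ->
  evolve t (fun y => f y - g y) x = evolve t f x - evolve t g x.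
Proof. exact: bmf_RintegralB. Qed.

Lemma evolveZ t c f x : bmf f -> evolve t (fun y => c * f y) x = c * evolve t f x.
Proof. exact: bmf_RintegralZ. Qed.

Lemma evolve_le t f g x : bmf f -> bmf g -> (forall y, f y <= g y) ->
  evolve t f x <= evolve t g x.
Proof. exact: bmf_le_Rintegral. Qed.

Lemma evolve_norm t f x M : bmf f -> (forall y, `|f y| <= M) -> `|evolve t f x| <= M.
Proof. exact: bmf_Rintegral_le. Qed.

Lemma evolve_indic t A x : measurable A -> evolve t \1_A x = fine (p t x A).
Proof. by move=> mA; rewrite /evolve Rintegral_indic//; congr fine; exact: transE. Qed.

Lemma bmf_evolve t f : bmf f -> bmf (evolve t f).
Proof.
move=> [mf [M fM]]; split; last by exists M => x; apply: evolve_norm => //; split => //; exists M.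
have mEf : measurable_fun setT (EFin \o f) by exact/measurable_EFinP.
apply: (@measurableT_comp _ _ _ _ _ _ (@fine R)); first exact: fine_measurable.
rewrite (_ : (fun x => _) = (fun x =>
  \int[p t x]_y (EFin \o f)^\+ y - \int[p t x]_y (EFin \o f)^\- y)%E); last first.
  by apply/funext => x; rewrite integral_trans [LHS]integralE.
have mk U : measurable U -> measurable_fun setT (p t ^~ U) by exact: measurable_kernel.
apply: emeasurable_funB; apply: (measurable_fun_integral_kernel mk) => //.
- exact: measurable_funepos.
- exact: measurable_funeneg.
Qed.

Lemma evolve0 f x : bmf f -> evolve 0 f x = f x.
Proof.
move=> [mf _]; rewrite evolveE /Rintegral.
rewrite (eq_measure_integral (\d_x)); last by move=> A mA _; case: hp => + _; exact.
by rewrite integral_dirac// ?diracT ?mul1e//; exact/measurable_EFinP.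
Qed.

(** Chapman-Kolmogorov on indicators extends by [bmf_approx], as both sides contract the uniform
    norm. *)
Lemma evolve_add s t f x : 0 <= s -> 0 <= t -> bmf f ->
  evolve (s + t) f x = evolve s (evolve t f) x.
Proof.
move=> s0 t0 bf; move: x.
have app := @bmf_approx _ _ _
  (fun f => forall x, evolve (s + t) f x = evolve s (evolve t f) x) _ _ _ f bf.
move=> x; apply/eqP; rewrite -subr_eq0 -normr_le0; apply/ler_addgt0Pl => e e0.
have e20 : 0 < e / 2 by rewrite divr_gt0.
have [||| g [bg hg fg]] := app _ _ _ _ e20; last first.
- have a1 : `|evolve (s + t) f x - evolve (s + t) g x| <= e / 2.
    by rewrite -evolveB//; apply: evolve_norm => //; exact: bmfB.
  have a2 : `|evolve s (evolve t f) x - evolve s (evolve t g) x| <= e / 2.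
    rewrite -evolveB; [|exact: bmf_evolve|exact: bmf_evolve].
    apply: evolve_norm; first by apply: bmfB; exact: bmf_evolve.
    by move=> y; rewrite -evolveB//; apply: evolve_norm => //; exact: bmfB.
  rewrite addr0 (_ : _ - _ = (evolve (s + t) f x - evolve (s + t) g x) -
    (evolve s (evolve t f) x - evolve s (evolve t g) x)); last by rewrite hg; ring.
  by apply: le_trans (ler_normB _ _) _; lra.
- move=> c f' bf' hf y; rewrite evolveZ// hf -evolveZ//; last exact: bmf_evolve.
  by congr evolve; apply/funext => z; rewrite evolveZ.
- move=> f' g bf' bg hf hg y; rewrite evolveD// hf hg -evolveD//; try exact: bmf_evolve.
  by congr evolve; apply/funext => z; rewrite evolveD.
- move=> A mA {}x; rewrite evolve_indic//; case: hp => _ /(_ s t s0 t0 x A mA) ->.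
  rewrite evolveE /Rintegral; congr fine; apply: eq_integral => y _.
  by rewrite evolve_indic// -transE fineK//; exact: fin_num_measure.
Qed.

Let small_step f e : bmf f -> 0 < e ->
  exists2 t, 0 < t & forall h, 0 < h < t -> forall x,
    `|evolve h f x - f x - h * L f x| <= h * e.
Proof.
move=> bf e0; have [mf bdf] := bf; have := hL mf bdf e0.
rewrite /at_right near_withinE => /nbhs_ballP[t /= t0 ht].
exists t => // h /andP[h0 hlt] x.
have hb : ball 0 t h by rewrite /ball/= sub0r normrN gtr0_norm.
have := ht h hb h0 x; rewrite -evolveE => hx.
have -> : evolve h f x - f x - h * L f x = h * ((evolve h f x - f x) / h - L f x).
  by field; rewrite gt_eqF.
by rewrite normrM gtr0_norm// ler_pM2l.
Qed.

Let subdivide (T t : R) : 0 < T -> 0 < t -> exists2 k : nat, (0 < k)%N & 0 < T / k%:R < t.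
Proof.
move=> T0 t0; exists (Num.bound `|T / t|).+1 => //.
rewrite divr_gt0//= ltr_pdivrMr// mulrC -ltr_pdivrMr//.
apply: le_lt_trans (ler_norm _) _; apply: lt_trans (archi_boundP (normr_ge0 _)) _.
by rewrite ltr_nat.
Qed.

(** The generator is a derivative at time 0 only. Its uniformity in x lets small steps be composed:
    each moves f by at most h (M + e/T), and the semigroup contracts the uniform norm. *)
Lemma evolve_lipschitz f M T : bmf f -> (forall x, `|L f x| <= M) -> 0 <= T ->
  forall x, `|evolve T f x - f x| <= T * M.
Proof.
move=> bf LM; rewrite le_eqVlt => /orP[/eqP <-|T0] x.
  by rewrite evolve0// subrr normr0 mul0r.
apply/ler_addgt0Pl => e e0.
have eT : 0 < e / T by rewrite divr_gt0.
have [t t0 ht] := small_step bf eT.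
have [k k0 /andP[h0 hlt]] := subdivide T0 t0; set h := T / k%:R in h0 hlt.
have step y : `|evolve h f y - f y| <= h * (M + e / T).
  have := ht h; rewrite h0 hlt => /(_ isT y) H.
  have -> : evolve h f y - f y = (evolve h f y - f y - h * L f y) + h * L f y by ring.
  apply: le_trans (ler_normD _ _) _; rewrite normrM (gtr0_norm h0).
  by have := ler_wpM2l (ltW h0) (LM y); lra.
have iter j : forall y, `|evolve (j%:R * h) f y - f y| <= j%:R * (h * (M + e / T)).
  elim: j => [|j IH] y; first by rewrite !mul0r evolve0// subrr normr0.
  have jh : 0 <= j%:R * h by rewrite mulr_ge0// ltW.
  have bh := bmf_evolve h bf.
  rewrite -natr1 !mulrDl !mul1r evolve_add ?(ltW h0)//.
  have -> : evolve (j%:R * h) (evolve h f) y - f y =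
    evolve (j%:R * h) (fun z => evolve h f z - f z) y + (evolve (j%:R * h) f y - f y).
    by rewrite evolveB//; ring.
  apply: le_trans (ler_normD _ _) _; rewrite addrC lerD//.
  by apply: evolve_norm => //; exact: bmfB.
have kh : k%:R * h = T by rewrite /h mulrC divfK// pnatr_eq0 -lt0n.
have := iter k x; rewrite kh mulrA kh mulrDr [T * (e / T)]mulrC divfK ?gt_eqF//.
by rewrite (addrC e).
Qed.

(** Step j contributes h times the evolved L f, which is within j h M <= T M of L f by
    [evolve_lipschitz]; the k steps together give T^2 M. *)
Lemma evolve_taylor f M T : bmf f -> (forall x, `|L (L f) x| <= M) -> 0 <= T ->
  forall x, `|evolve T f x - f x - T * L f x| <= T ^+ 2 * M.
Proof.
move=> bf LM; rewrite le_eqVlt => /orP[/eqP <-|T0] x.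
  by rewrite evolve0// subrr mul0r subrr normr0 expr0n mul0r.
have bLf := bL bf.
apply/ler_addgt0Pl => e e0.
have eT : 0 < e / T by rewrite divr_gt0.
have [t t0 ht] := small_step bf eT.
have [k k0 /andP[h0 hlt]] := subdivide T0 t0; set h := T / k%:R in h0 hlt.
have kh : k%:R * h = T by rewrite /h mulrC divfK// pnatr_eq0 -lt0n.
have M0 : 0 <= M by exact: le_trans (LM x).
have iter j : (j <= k)%N -> forall y,
    `|evolve (j%:R * h) f y - f y - (j%:R * h) * L f y| <= j%:R * (h * (e / T + T * M)).
  elim: j => [_|j IH jk] y; first by rewrite !mul0r evolve0// subrr subrr normr0.
  have jh : 0 <= j%:R * h by rewrite mulr_ge0// ltW.
  have jhT : j%:R * h <= T by rewrite -kh ler_pM2r// ler_nat ltnW.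
  have bh := bmf_evolve h bf.
  have brem : bmf (fun z => evolve h f z - f z - h * L f z).
    by apply: bmfB; [exact: bmfB|exact: bmfZ].
  rewrite -natr1 !mulrDl !mul1r evolve_add ?(ltW h0)//.
  have -> : evolve (j%:R * h) (evolve h f) y - f y - (j%:R * h * L f y + h * L f y) =
    evolve (j%:R * h) (fun z => evolve h f z - f z - h * L f z) y
    + h * (evolve (j%:R * h) (L f) y - L f y)
    + (evolve (j%:R * h) f y - f y - j%:R * h * L f y).
    rewrite evolveB//; [|exact: bmfB|exact: bmfZ].
    by rewrite evolveB// evolveZ//; ring.
  apply: le_trans (ler_normD _ _) _.
  rewrite [leRHS]addrC; apply: lerD; last exact: IH (ltnW jk) y.
  apply: le_trans (ler_normD _ _) _; rewrite [leRHS]mulrDr lerD//.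
    by apply: evolve_norm => // z; apply: ht; rewrite h0.
  rewrite normrM (gtr0_norm h0) ler_wpM2l ?(ltW h0)//.
  apply: le_trans (evolve_lipschitz bLf LM jh y) _.
  by rewrite ler_wpM2r.
have := iter k (leqnn k) x; rewrite kh => H; apply: le_trans H _.
rewrite mulrA kh mulrDr [T * (e / T)]mulrC divfK ?gt_eqF//.
by rewrite mulrA -expr2.
Qed.

End semigroup.

(** * The Boltzmann equation *)

Section mean_value.
Context {R : realType}.
Implicit Types (F G : R -> R) (s t u : R).

(** The derivative relative to the half-line of nonnegative times, one-sided at 0 like the
    hypothesis on [mu]. *)
Definition has_slope F c s := forall e, 0 < e -> exists2 k, 0 < k &
  forall h, 0 <= h -> `|h - s| < k -> `|F h - F s - (h - s) * c| <= e * `|h - s|.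

Lemma has_slope_local F c s : has_slope F c s -> exists2 k, 0 < k &
  forall h, 0 <= h -> `|h - s| < k -> `|F h - F s| <= (`|c| + 1) * `|h - s|.
Proof.
move=> /(_ 1 ltr01)[k k0 hk]; exists k => // h h0 hs.
have -> : F h - F s = (F h - F s - (h - s) * c) + (h - s) * c by ring.
apply: le_trans (ler_normD _ _) _; rewrite normrM.
by have := hk h h0 hs; lra.
Qed.

Lemma has_slopeD F1 F2 c1 c2 s : has_slope F1 c1 s -> has_slope F2 c2 s ->
  has_slope (fun h => F1 h + F2 h) (c1 + c2) s.
Proof.
move=> h1 h2 e e0; have e20 : 0 < e / 2 by rewrite divr_gt0.
have [k1 k10 {}h1] := h1 _ e20; have [k2 k20 {}h2] := h2 _ e20.
exists (Num.min k1 k2); first by rewrite lt_min k10.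
move=> h h0; rewrite lt_min => /andP[hs1 hs2].
have -> : F1 h + F2 h - (F1 s + F2 s) - (h - s) * (c1 + c2) =
  (F1 h - F1 s - (h - s) * c1) + (F2 h - F2 s - (h - s) * c2) by ring.
apply: le_trans (ler_normD _ _) _.
by have := h1 h h0 hs1; have := h2 h h0 hs2; lra.
Qed.

Lemma has_slopeZ a F c s : has_slope F c s -> has_slope (fun h => a * F h) (a * c) s.
Proof.
move=> hF e e0; have c0 : 0 < `|a| + 1 by rewrite ltr_pwDr.
have [k k0 hk] := hF _ (divr_gt0 e0 c0).
exists k => // h h0 hs.
have -> : a * F h - a * F s - (h - s) * (a * c) = a * (F h - F s - (h - s) * c) by ring.
rewrite normrM; apply: le_trans (ler_wpM2l (normr_ge0 a) (hk h h0 hs)) _.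
rewrite mulrA ler_wpM2r// mulrA ler_pdivrMr// mulrC ler_wpM2l ?(ltW e0)//.
by rewrite lerDl.
Qed.

(** The increments of F - F' must be small relative to |h - s|, which uniform closeness of F' to F
    would not give; [mean_lipschitz] will supply this. *)
Lemma has_slope_lim F c s : (forall e, 0 < e -> exists F' c', [/\ has_slope F' c' s,
    forall h, 0 <= h -> `|F h - F s - (F' h - F' s)| <= e * `|h - s| & `|c - c'| <= e]) ->
  has_slope F c s.
Proof.
move=> H e e0; have e30 : 0 < e / 3 by rewrite divr_gt0.
have [F' [c' [hF' FF' cc']]] := H _ e30.
have [k k0 hk] := hF' _ e30; exists k => // h h0 hs.
have -> : F h - F s - (h - s) * c = (F h - F s - (F' h - F' s)) +
  (F' h - F' s - (h - s) * c') - (h - s) * (c - c') by ring.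
apply: le_trans (ler_normB _ _) _; apply: le_trans (lerD (ler_normD _ _) (lexx _)) _.
rewrite normrM; have := hk h h0 hs; have := FF' h h0.
by have := ler_wpM2l (normr_ge0 (h - s)) cc'; lra.
Qed.

(** Freezing F at its value at 0 for negative times yields a function on the whole line, to which
    the mean value theorem applies. *)
Lemma is_derive_slope F c s : 0 < s -> has_slope F c s ->
  is_derive s 1 (fun h => F (Num.max h 0)) c.
Proof.
move=> s0 Fc; set F' := fun h => F (Num.max h 0).
have E : (fun h : R => h^-1 *: (F' (h *: 1 + s) - F' s)) @ 0^' --> c.
  apply/cvgrPdist_le => e e0.
  have [k k0 hk] := Fc e e0.
  rewrite near_withinE; apply/nbhs_ballP.
  exists (Num.min k s) => /=; first by rewrite lt_min k0 s0.
  move=> h; rewrite /ball/= sub0r normrN lt_min => /andP[hk1 hs] hn0.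
  have hs0 : 0 <= h + s by move: hs; rewrite ltr_norml => /andP[]; lra.
  rewrite /F' /GRing.scale/= mulr1 (max_l hs0) (max_l (ltW s0)).
  have := hk (h + s) hs0; rewrite addrK => /(_ hk1) H.
  have -> : c - h^-1 * (F (h + s) - F s) = - (h^-1 * (F (h + s) - F s - h * c)).
    by field.
  by rewrite normrN normrM normfV ler_pdivrMl ?normr_gt0// (mulrC `|h|).
apply: DeriveDef; first by apply/cvg_ex; exists c.
by apply/cvg_lim.
Qed.

Lemma mean_value_slope F G t u g0 K : 0 <= t -> t <= u ->
  (forall s, t <= s <= u -> has_slope F (G s) s) ->
  (forall s, t <= s <= u -> `|G s - g0| <= K) ->
  `|F u - F t - (u - t) * g0| <= K * (u - t).
Proof.
move=> t0; rewrite le_eqVlt => /orP[/eqP <-|tu] FG GK.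
  by rewrite !subrr mul0r subrr normr0 mulr0.
pose F' h := F (Num.max h 0).
have cF' : {within `[t, u], continuous F'}.
  apply: continuous_in_subspaceT => s; rewrite inE/= in_itv/= => /andP[ts su].
  have s0 : 0 <= s by exact: le_trans ts.
  apply/cvgrPdist_le => e e0.
  have tsu : t <= s <= u by rewrite ts su.
  have [k' k'0 hk'] := has_slope_local (FG s tsu).
  have c0 : 0 < `|G s| + 1 by rewrite ltr_pwDr.
  apply/nbhs_ballP; exists (Num.min k' (e / (`|G s| + 1))) => /=.
    by rewrite lt_min k'0 divr_gt0.
  move=> h; rewrite /ball/= lt_min => /andP[h1 h2].
  have d : `|Num.max h 0 - s| <= `|s - h|.
    by case: (leP h 0) => h0; rewrite distrC// ler_norml; move: (ler_norm (s - h)); lra.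
  have hm0 : 0 <= Num.max h 0 by rewrite le_max lexx orbT.
  rewrite /F' (max_l s0) distrC; apply: le_trans (hk' _ hm0 _) _.
    exact: le_lt_trans d h1.
  rewrite -ler_pdivlMl// mulrC; exact: le_trans d (ltW h2).
have [|c] := @MVT _ F' G t u tu _ cF'.
  move=> s; rewrite in_itv/= => /andP[ts su].
  apply: is_derive_slope; first exact: le_lt_trans ts.
  by apply: FG; rewrite !ltW.
rewrite in_itv/= => /andP[tc cu].
rewrite /F' (max_l t0) (max_l (le_trans t0 (ltW tu))) => ->.
rewrite mulrC -mulrBr normrM mulrC (@ger0_norm _ (u - t)) ?subr_ge0 ?(ltW tu)//.
by rewrite ler_wpM2r ?subr_ge0 ?(ltW tu)// GK// !ltW.
Qed.

End mean_value.

Section boltzmann.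
Context {R : realType} (n : nat).
Hypothesis n2 : (2 <= n)%N.
Notation E := (n.-tuple R).
Notation S := (@uniform_sphere R n).
Variables (mu0 : probability E R) (mu : R -> probability E R).
Hypothesis hmu : boltzmann_solution mu0 mu.
Implicit Types f g : E -> R.

Definition mean t f : R := \int[mu t]_x f x.

Lemma meanD t f g : bmf f -> bmf g -> mean t (fun x => f x + g x) = mean t f + mean t g.
Proof. exact: bmf_RintegralD. Qed.

Lemma meanB t f g : bmf f -> bmf g -> mean t (fun x => f x - g x) = mean t f - mean t g.
Proof. exact: bmf_RintegralB. Qed.

Lemma meanZ t c f : bmf f -> mean t (fun x => c * f x) = c * mean t f.
Proof. exact: bmf_RintegralZ. Qed.

Lemma mean_le t f M : bmf f -> (forall x, `|f x| <= M) -> `|mean t f| <= M.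
Proof. exact: bmf_Rintegral_le. Qed.

Lemma collD f g v w : bmf f -> bmf g -> coll (fun x => f x + g x) v w = coll f v w + coll g v w.
Proof.
move=> bf bg; rewrite /coll.
rewrite (_ : \int[S]_s collision_sum (fun x => f x + g x) v w s =
  \int[S]_s (collision_sum f v w s + collision_sum g v w s)); last first.
  by apply: eq_Rintegral => s _; rewrite /collision_sum; ring.
rewrite (bmf_RintegralD S (bmf_collision_sum v w bf) (bmf_collision_sum v w bg)); ring.
Qed.

Lemma collZ c f v w : bmf f -> coll (fun x => c * f x) v w = c * coll f v w.
Proof.
move=> bf; rewrite /coll.
rewrite (_ : \int[S]_s collision_sum (fun x => c * f x) v w s =
  \int[S]_s (c * collision_sum f v w s)); last first.
  by apply: eq_Rintegral => s _; rewrite /collision_sum; ring.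
rewrite (bmf_RintegralZ S c (bmf_collision_sum v w bf)); ring.
Qed.

Lemma bmf_coll1 f v : bmf f -> bmf (coll f v).
Proof. by move=> bf; have := bmf_comp (bmf_coll bf) (pair1_measurable v). Qed.

Lemma bmf_mean_coll t f : bmf f -> bmf (fun v => mean t (coll f v)).
Proof. by move=> bf; have := bmf_Rintegral (mu t) (bmf_coll bf). Qed.

Lemma QFE t f : QF (mu t) f = 2^-1 * mean t (fun v => mean t (coll f v)).
Proof. by []. Qed.

Lemma QFD t f g : bmf f -> bmf g ->
  QF (mu t) (fun x => f x + g x) = QF (mu t) f + QF (mu t) g.
Proof.
move=> bf bg; rewrite !QFE -mulrDr -meanD; [|exact: bmf_mean_coll|exact: bmf_mean_coll].
congr (_ * mean _ _); apply/funext => v; rewrite -meanD; [|exact: bmf_coll1|exact: bmf_coll1].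
by congr mean; apply/funext => w; exact: collD.
Qed.

Lemma QFZ t c f : bmf f -> QF (mu t) (fun x => c * f x) = c * QF (mu t) f.
Proof.
move=> bf; rewrite !QFE [RHS]mulrCA -(@meanZ t c); last exact: bmf_mean_coll.
congr (_ * mean _ _); apply/funext => v; rewrite -meanZ; last exact: bmf_coll1.
by congr mean; apply/funext => w; exact: collZ.
Qed.

Lemma QF_le t f M : bmf f -> (forall x, `|f x| <= M) -> `|QF (mu t) f| <= 2 * M.
Proof.
move=> bf fM; rewrite QFE normrM ger0_norm ?invr_ge0//.
have : `|mean t (fun v => mean t (coll f v))| <= 4 * M.
  apply: mean_le; first exact: bmf_mean_coll.
  move=> v; apply: mean_le; first exact: bmf_coll1.
  by move=> w; exact: coll_le.
lra.
Qed.

Let kac_Q_QF t A : measurable A -> kac_Q (mu t) (mu t) A = QF (mu t) \1_A.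
Proof.
move=> mA; rewrite /kac_Q /QF; congr (_ * _).
have bA := bmf_indic (R := R) mA.
apply: eq_Rintegral => v _; apply: eq_Rintegral => w _.
have bz : bmf (fun z : E * E => - \1_A v - \1_A w + \1_A z.1 + \1_A z.2 : R).
  by apply: bmfD; [apply: bmfD; [exact: bmf_cst|]|]; apply: (bmf_comp bA).
have bs : bmf (fun s => collision_sum \1_A v w s - \1_A v - \1_A w : R).
  apply: bmfB; last exact: bmf_cst; apply: bmfB; last exact: bmf_cst.
  exact: bmf_collision_sum.
have e s : - \1_A v - \1_A w + \1_A (kac_post v w s).1 + \1_A (kac_post v w s).2 =
    collision_sum \1_A v w s - \1_A v - \1_A w :> R by rewrite /collision_sum; ring.
transitivity (\int[S]_s (collision_sum \1_A v w s - \1_A v - \1_A w)).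
  rewrite /Rintegral /kac_law integral_distribution//.
  - by congr fine; apply: eq_integral => s _ /=; rewrite e.
  - by apply/measurable_EFinP; case: bz.
  - have := bmf_integrable S bs; congr integrable.
    by apply/funext => s /=; rewrite e.
have bc := bmf_collision_sum v w bA.
rewrite (bmf_RintegralB S (bmfB bc (bmf_cst _)) (bmf_cst _)).
by rewrite (bmf_RintegralB S bc (bmf_cst _)) !Rintegral_prob_cst.
Qed.

Lemma mean_indic t A : measurable A -> mean t \1_A = fine (mu t A).
Proof. exact: Rintegral_indic. Qed.

Let slope_indic t A : 0 <= t -> measurable A ->
  has_slope (mean ^~ \1_A) (QF (mu t) \1_A) t.
Proof.
move=> t0 mA e e0; case: hmu => _ /(_ A mA t t0).
rewrite kac_Q_QF// => /cvgrPdist_le /(_ e e0).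
rewrite near_withinE near_withinE => /nbhs_ballP[k /= k0 hk].
exists k => // h h0 hs.
rewrite !mean_indic//; have [->|ht] := eqVneq h t.
  by rewrite !subrr mul0r subrr normr0 mulr0.
have hb : ball t k h by rewrite /ball/= distrC.
have := hk h hb ht h0; set q := QF _ _ => H.
have ht0 : h - t != 0 by rewrite subr_eq0.
have -> : fine (mu h A) - fine (mu t A) - (h - t) * q =
  - ((q - (fine (mu h A) - fine (mu t A)) / (h - t)) * (h - t)) by field.
by rewrite normrN normrM ler_wpM2r.
Qed.

Lemma mean_cst t c : mean t (fun=> c) = c.
Proof. exact: Rintegral_prob_cst. Qed.

Lemma mean_le_Rintegral t f (g : E -> R) : bmf f ->
  (mu t).-integrable setT (EFin \o g) -> (forall x, `|f x| <= g x) ->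
  `|mean t f| <= \int[mu t]_x g x.
Proof. by move=> bf; apply: norm_Rintegral_le; exact: bmf_integrable. Qed.

Lemma collC f v w : coll f v w = coll f w v.
Proof.
have e : enorm (vsub w v) = enorm (vsub v w) by exact: enorm_vsubC.
have -> : coll f w v = \int[S]_s collision_sum f w v s - f w - f v by [].
have -> : collision_sum f w v = collision_sum f v w; last by rewrite addrAC.
apply/funext => s; rewrite /collision_sum; congr (f _ + f _).
- by rewrite !kac_post1E e; apply: eq_from_tnth => i; rewrite !vtnthE; ring.
- by rewrite !kac_post2E e; apply: eq_from_tnth => i; rewrite !vtnthE; ring.
Qed.

Lemma mean_coll_swap t u f : bmf f ->
  mean t (fun v => mean u (coll f v)) = mean u (fun w => mean t (coll f w)).
Proof.
move=> bf; transitivity (mean u (fun w => mean t (fun v => coll f v w))).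
  exact: (@Rintegral_fubini_bounded _ _ _ _ _ (mu t) (mu u) (fun p => coll f p.1 p.2) (bmf_coll bf)).
by congr mean; apply/funext => w; congr mean; apply/funext => v; exact: collC.
Qed.

Opaque mean QF coll.

Let slope_approx f e : bmf f -> 0 < e -> exists g, [/\ bmf g,
  (forall t, 0 <= t -> has_slope (mean ^~ g) (QF (mu t) g) t) & forall x, `|f x - g x| <= e].
Proof.
move=> bf e0; pose Q g := bmf g /\ forall t, 0 <= t -> has_slope (mean ^~ g) (QF (mu t) g) t.
have [||| g [bg [_ Qg] fg]] := @bmf_approx _ _ _ Q _ _ _ f bf e e0; last by exists g.
- by move=> A mA; split => [|t t0]; [exact: bmf_indic|exact: slope_indic].
- move=> f1 g bf1 bg [_ hf] [_ hg]; split; first exact: bmfD.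
  move=> t t0; rewrite QFD//; have := has_slopeD (hf t t0) (hg t t0); congr has_slope.
  by apply/funext => h; rewrite meanD.
- move=> c f1 bf1 [_ hf]; split; first exact: bmfZ.
  move=> t t0; rewrite QFZ//; have := has_slopeZ c (hf t t0); congr has_slope.
  by apply/funext => h; rewrite meanZ.
Qed.

Lemma mean_lipschitz f M t u : bmf f -> (forall x, `|f x| <= M) -> 0 <= t -> t <= u ->
  `|mean u f - mean t f| <= 2 * M * (u - t).
Proof.
move=> bf fM t0 tu; apply/ler_addgt0Pl => e e0.
pose e' := e / (2 + 2 * (u - t)).
have c0 : 0 < 2 + 2 * (u - t) by lra.
have e'0 : 0 < e' by rewrite divr_gt0.
have [g [bg hg fg]] := slope_approx bf e'0.
have gM x : `|g x| <= M + e'.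
  have -> : g x = f x - (f x - g x) by ring.
  by apply: le_trans (ler_normB _ _) _; rewrite lerD.
have a s : `|mean s f - mean s g| <= e'.
  by rewrite -meanB//; apply: mean_le => //; exact: bmfB.
have := @mean_value_slope _ (mean ^~ g) (fun s => QF (mu s) g) t u 0 (2 * (M + e')) t0 tu.
rewrite mulr0 subr0 => H.
have {}H : `|mean u g - mean t g| <= 2 * (M + e') * (u - t).
  apply: H => s /andP[ts _]; first by apply: hg; exact: le_trans ts.
  by rewrite subr0; exact: QF_le.
have -> : mean u f - mean t f = (mean u f - mean u g) + (mean u g - mean t g)
   - (mean t f - mean t g) by ring.
apply: le_trans (ler_normB _ _) _; apply: le_trans (lerD (ler_normD _ _) (lexx _)) _.
have eE : e = e' * (2 + 2 * (u - t)) by rewrite /e' divfK// gt_eqF.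
by have := a u; have := a t; rewrite eE; lra.
Qed.

(** If f - g is uniformly small, its mean is Lipschitz in time with a small constant
    ([mean_lipschitz]), as [has_slope_lim] requires. *)
Lemma slope_mean f t : bmf f -> 0 <= t -> has_slope (mean ^~ f) (QF (mu t) f) t.
Proof.
move=> bf t0; apply: has_slope_lim => e e0.
have e20 : 0 < e / 2 by rewrite divr_gt0.
have [g [bg hg fg]] := slope_approx bf e20.
have bfg := bmfB bf bg.
exists (mean ^~ g), (QF (mu t) g); split; first exact: hg.
- move=> h h0; have -> : mean h f - mean t f - (mean h g - mean t g) =
    mean h (fun x => f x - g x) - mean t (fun x => f x - g x).
    by rewrite !meanB//; move: (mean h f) (mean t f) (mean h g) (mean t g) => *; ring.
  rewrite -[e in X in _ <= X](@divfK _ 2)// (mulrC (e / 2)).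
  have [th|ht] := leP t h.
    by rewrite (@ger0_norm _ (h - t)) ?subr_ge0//; exact: mean_lipschitz.
  rewrite distrC (distrC h) (@ger0_norm _ (t - h)) ?subr_ge0 ?(ltW ht)//.
  by apply: mean_lipschitz => //; exact: ltW.
- have -> : QF (mu t) f = QF (mu t) (fun x => f x - g x) + QF (mu t) g.
    by rewrite -(QFD t bfg bg); congr QF; apply/funext => x; rewrite subrK.
  rewrite addrK.
  by apply: le_trans (QF_le t bfg fg) _; rewrite mulrC divfK.
Qed.

(** Used twice: with weight 1 for bounded functions, and with weight 1 + |x|, once the first moment
    is known to stay finite, to gain a factor |xi| at small frequencies. *)
Section weighted.
Variables (rho : E -> R) (A B T : R).
Hypotheses (A0 : 0 <= A) (B0 : 0 <= B) (rho1 : forall x, 1 <= rho x).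
Hypothesis collA : forall f K, bmf f -> (forall x, `|f x| <= K * rho x) ->
  forall v w, `|coll f v w| <= K * A * (rho v + rho w).
Hypothesis Irho : forall t, 0 <= t <= T -> (mu t).-integrable setT (EFin \o rho).
Hypothesis rhoB : forall t, 0 <= t <= T -> \int[mu t]_x rho x <= B.

Let mean_coll_le f K t v : bmf f -> (forall x, `|f x| <= K * rho x) -> 0 <= K ->
  0 <= t <= T -> `|mean t (coll f v)| <= K * A * (rho v + B).
Proof.
move=> bf fK K0 tT; apply: (@le_trans _ _ (\int[mu t]_w (K * A * (rho v + rho w)))).
  apply: mean_le_Rintegral.
  - exact: bmf_coll1.
  - have := integrableZl measurableT (K * A)
      (integrableD measurableT (bmf_integrable (mu t) (bmf_cst (rho v))) (Irho tT)).
    by congr integrable.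
  - by move=> w; exact: collA.
have I : (mu t).-integrable setT (EFin \o (fun w => rho v + rho w)).
  have := integrableD measurableT (bmf_integrable (mu t) (bmf_cst (rho v))) (Irho tT).
  by congr integrable.
rewrite RintegralZl// RintegralD//; last 2 first.
- exact: bmf_integrable (bmf_cst _).
- exact: Irho.
by rewrite Rintegral_prob_cst ler_wpM2l ?mulr_ge0// lerD2l rhoB.
Qed.

Lemma QF_weighted_le f K t : bmf f -> (forall x, `|f x| <= K * rho x) -> 0 <= K ->
  0 <= t <= T -> `|QF (mu t) f| <= K * A * B.
Proof.
move=> bf fK K0 tT; rewrite QFE normrM ger0_norm ?invr_ge0//.
have : `|mean t (fun v => mean t (coll f v))| <= \int[mu t]_v (K * A * (rho v + B)).
  have I : (mu t).-integrable setT (EFin \o (fun v => rho v + B)).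
    have := integrableD measurableT (Irho tT) (bmf_integrable (mu t) (bmf_cst B)).
    by congr integrable.
  apply: mean_le_Rintegral.
  - exact: bmf_mean_coll.
  - by have := integrableZl measurableT (K * A) I; congr integrable.
  - by move=> v; exact: mean_coll_le.
have I : (mu t).-integrable setT (EFin \o (fun v => rho v + B)).
  have := integrableD measurableT (Irho tT) (bmf_integrable (mu t) (bmf_cst B)).
  by congr integrable.
rewrite RintegralZl// RintegralD//; last 2 first.
- exact: Irho.
- exact: bmf_integrable (bmf_cst _).
rewrite Rintegral_prob_cst => h.
have KA : 0 <= K * A by exact: mulr_ge0.
by have := ler_wpM2l KA (rhoB tT); lra.
Qed.

Lemma mean_weighted_lipschitz f K t u : bmf f -> (forall x, `|f x| <= K * rho x) -> 0 <= K ->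
  0 <= t -> t <= u -> u <= T -> `|mean u f - mean t f| <= K * A * B * (u - t).
Proof.
move=> bf fK K0 t0 tu uT.
have := @mean_value_slope _ (mean ^~ f) (fun s => QF (mu s) f) t u 0 (K * A * B) t0 tu.
rewrite mulr0 subr0; apply => s /andP[ts su].
  by apply: slope_mean => //; exact: le_trans ts.
by rewrite subr0; apply: QF_weighted_le => //; rewrite (le_trans t0 ts) (le_trans su uT).
Qed.

Let const : R := A * (A * (1 + B) * B).

(** Q is bilinear: one argument is moved at a time, the symmetry [mean_coll_swap] reducing both
    moves to [mean_weighted_lipschitz] with constant K A (1 + B); the factor 1/2 in Q offsets their
    number. *)
Lemma QF_weighted_lipschitz f K t u : bmf f -> (forall x, `|f x| <= K * rho x) -> 0 <= K ->
  0 <= t -> t <= u -> u <= T -> `|QF (mu u) f - QF (mu t) f| <= K * const * (u - t).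
Proof.
move=> bf fK K0 t0 tu uT; rewrite !QFE -mulrBr normrM ger0_norm ?invr_ge0//.
have tT : 0 <= t <= T by rewrite t0 (le_trans tu uT).
have uT' : 0 <= u <= T by rewrite (le_trans t0 tu) uT.
have K'0 : 0 <= K * A * (1 + B) by rewrite !mulr_ge0// addr_ge0.
have bw s v : 0 <= s <= T -> `|mean s (coll f v)| <= K * A * (1 + B) * rho v.
  move=> sT; apply: le_trans (mean_coll_le v bf fK K0 sT) _.
  rewrite -[leRHS]mulrA ler_wpM2l ?mulr_ge0// mulrDl mul1r lerD2l.
  by have := ler_wpM2l B0 (rho1 v); rewrite mulr1.
pose g2 w := mean t (coll f w).
have bg2 : bmf g2 by exact: bmf_mean_coll.
have -> : mean u (fun v => mean u (coll f v)) - mean t (fun v => mean t (coll f v)) =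
  (mean u (fun v => mean u (coll f v)) - mean t (fun v => mean u (coll f v))) +
  (mean u g2 - mean t g2) by rewrite (mean_coll_swap t u bf) /g2; ring.
have h1 := mean_weighted_lipschitz (bmf_mean_coll u bf) (bw u ^~ uT') K'0 t0 tu uT.
have h2 := mean_weighted_lipschitz bg2 (bw t ^~ tT) K'0 t0 tu uT.
have := ler_normD (mean u (fun v => mean u (coll f v)) - mean t (fun v => mean u (coll f v)))
  (mean u g2 - mean t g2).
rewrite /const; lra.
Qed.

Lemma mean_taylor f K t s u : bmf f -> (forall x, `|f x| <= K * rho x) -> 0 <= K ->
  0 <= t -> t <= s -> s <= u -> u <= T ->
  `|mean u f - mean t f - (u - t) * QF (mu s) f| <= K * const * (u - t) ^+ 2.
Proof.
move=> bf fK K0 t0 ts su uT; have tu := le_trans ts su.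
have -> : K * const * (u - t) ^+ 2 = K * const * (u - t) * (u - t) by ring.
have := @mean_value_slope _ (mean ^~ f) (fun s => QF (mu s) f) t u (QF (mu s) f)
  (K * const * (u - t)) t0 tu.
have C0 : 0 <= K * const by rewrite /const !mulr_ge0// addr_ge0.
apply => x /andP[tx xu].
  by apply: slope_mean => //; exact: le_trans tx.
have s0 := le_trans t0 ts; have x0 := le_trans t0 tx.
have [sx|xs] := leP s x.
  apply: le_trans (QF_weighted_lipschitz bf fK K0 s0 sx (le_trans xu uT)) _.
  by apply: ler_wpM2l => //; exact: lerB.
rewrite distrC.
apply: le_trans (QF_weighted_lipschitz bf fK K0 x0 (ltW xs) (le_trans su uT)) _.
by apply: ler_wpM2l => //; exact: lerB.
Qed.

End weighted.

Transparent mean QF coll.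

End boltzmann.

(** * First moment and Taylor expansion of the Boltzmann solution *)

Section boltzmann_moments.
Context {R : realType} (n : nat).
Hypothesis n2 : (2 <= n)%N.
Notation E := (n.-tuple R).
Notation S := (@uniform_sphere R n).
Notation cut := (@cutnorm R n).
Variables (mu0 : probability E R) (mu : R -> probability E R).
Hypothesis hmu : boltzmann_solution mu0 mu.
Hypothesis m01 : mom1 mu0.
Implicit Types f g : E -> R.
Notation mean := (mean mu).

Let n0 : (0 < n)%N. Proof. exact: ltnW. Qed.

Lemma enorm_kac_post1_le (v w s : E) : enorm s = 1 ->
  enorm (kac_post v w s).1 <= enorm v + enorm w.
Proof.
move=> s1; rewrite kac_post1E; apply: le_trans (enorm_triangle _ _) _.
rewrite !enormZ s1 mulr1 !ger0_norm ?divr_ge0 ?enorm_ge0 ?invr_ge0//.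
by have := enorm_triangle v w; have := enormB v w; lra.
Qed.

Lemma enorm_kac_post2_le (v w s : E) : enorm s = 1 ->
  enorm (kac_post v w s).2 <= enorm v + enorm w.
Proof.
move=> s1; rewrite kac_post2E; apply: le_trans (enorm_triangle _ _) _.
rewrite !enormZ s1 mulr1 normrN !ger0_norm ?divr_ge0 ?enorm_ge0 ?invr_ge0//.
by have := enorm_triangle v w; have := enormB v w; lra.
Qed.

Lemma mean_taylor1 f K t s u : bmf f -> (forall x, `|f x| <= K) ->
  0 <= t -> t <= s -> s <= u ->
  `|mean u f - mean t f - (u - t) * QF (mu s) f| <= 8 * K * (u - t) ^+ 2.
Proof.
move=> bf fK t0 ts su; have K0 : 0 <= K by exact: le_trans (fK origin).
have := @mean_taylor _ _ _ _ hmu (cst 1) 2 1 u _ _ _ _ _ _ f K t s u bf _ K0 t0 ts su (lexx u).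
rewrite (_ : K * (2 * (2 * (1 + 1) * 1)) = 8 * K); last by ring.
apply => //.
- move=> f' K' bf' fK' v w; rewrite (_ : K' * 2 * _ = 4 * K'); last by rewrite /=; ring.
  by apply: coll_le => // x; rewrite -[leRHS]mulr1.
- by move=> x _; exact: bmf_integrable (bmf_cst _).
- by move=> x _; rewrite Rintegral_prob_cst.
- by move=> x; rewrite mulr1.
Qed.

(** A bounded test function, to which the equation applies before any moment of mu_t is known to be
    finite. *)
Definition truncated_norm (M : R) (x : E) : R := Num.min (enorm x) M.

Let bmf_truncated M : 0 <= M -> bmf (truncated_norm M).
Proof.
move=> M0; split; first by apply: measurable_minr => //; exact: measurable_enorm.
exists M => x; rewrite ger0_norm; first by rewrite ge_min lexx orbT.
by rewrite le_min enorm_ge0.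
Qed.

Let truncated_norm_le M x y z : 0 <= M -> enorm x <= enorm y + enorm z ->
  truncated_norm M x <= truncated_norm M y + truncated_norm M z.
Proof.
move=> M0 xyz; rewrite /truncated_norm.
have := enorm_ge0 y; have := enorm_ge0 z; have := enorm_ge0 x; move: xyz.
move: (enorm x) (enorm y) (enorm z) => a b c *.
by case: (leP a M) => ?; case: (leP b M) => ?; case: (leP c M) => ?; lra.
Qed.

(** Both post-collisional norms are at most |v| + |w|, a bound that survives truncation; so a
    collision at most doubles the sum of the two truncated norms. The constant 1 does not depend on
    M. *)
Let QF_truncated M t : 0 <= M -> QF (mu t) (truncated_norm M) <= mean t (truncated_norm M).
Proof.
move=> M0; set psi := truncated_norm M.
have bpsi : bmf psi by exact: bmf_truncated.
have cle v w : coll psi v w <= psi v + psi w.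
  rewrite /coll.
  have : \int[S]_s collision_sum psi v w s <= \int[S]_s (2 * (psi v + psi w)).
    apply: ae_le_Rintegral.
    - by apply: bmf_integrable; exact: bmf_collision_sum.
    - exact: bmf_integrable (bmf_cst _).
    apply: filterS (ae_sphere n0) => s s1; rewrite /collision_sum.
    have := truncated_norm_le M0 (enorm_kac_post1_le v w s1).
    by have := truncated_norm_le M0 (enorm_kac_post2_le v w s1); rewrite -/psi; lra.
  by rewrite Rintegral_prob_cst; move: (\int[S]_s _) => I; lra.
have m_le f g : bmf f -> bmf g -> (forall x, f x <= g x) -> mean t f <= mean t g.
  exact: bmf_le_Rintegral.
have bpc c : bmf (fun w => c + psi w) by apply: bmfD => //; exact: bmf_cst.
have step v : mean t (coll psi v) <= mean t psi + psi v.
  apply: le_trans (m_le _ _ (bmf_coll1 v bpsi) (bpc (psi v)) (cle v)) _.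
  by rewrite (meanD mu t (bmf_cst _) bpsi) mean_cst addrC.
rewrite QFE; have := m_le _ _ (bmf_mean_coll mu t bpsi) (bpc (mean t psi)) step.
rewrite (meanD mu t (bmf_cst _) bpsi) mean_cst.
by move: (mean t _) (mean t psi) => I J; lra.
Qed.

Lemma mean0 f : mean 0 f = \int[mu0]_x f x.
Proof.
rewrite /mean /Rintegral; congr fine; apply: eq_measure_integral => A mA _.
by case: hmu => + _; exact.
Qed.

Let Itr M : 0 <= M -> mu0.-integrable setT (EFin \o truncated_norm M).
Proof. by move=> M0; apply: bmf_integrable; exact: bmf_truncated. Qed.

(** Gronwall's inequality by Euler steps. The error 8 M h^2 of a step depends on M, but its total
    vanishes as the number of steps grows, and the bound left over is free of M. *)
Let mean_truncated_le M T : 0 <= M -> 0 <= T ->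
  mean T (truncated_norm M) <= expR T * \int[mu0]_x enorm x.
Proof.
move=> M0 T0; set psi := truncated_norm M.
have bpsi : bmf psi by exact: bmf_truncated.
have psiM x : `|psi x| <= M.
  rewrite ger0_norm; first by rewrite ge_min lexx orbT.
  by rewrite le_min enorm_ge0.
pose m := \int[mu0]_x @enorm R n x.
have F0 : mean 0 psi <= m.
  rewrite mean0; apply: le_Rintegral => //; first exact: Itr.
  by move=> x _; rewrite ge_min lexx.
have m0 : 0 <= m by apply: Rintegral_ge0 => x _; exact: enorm_ge0.
have step t h : 0 <= t -> 0 <= h -> mean (t + h) psi <= (1 + h) * mean t psi + 8 * M * h ^+ 2.
  move=> t0 h0; have th : t <= t + h by rewrite lerDl.
  have := mean_taylor1 bpsi psiM t0 (lexx t) th; rewrite (addrC t) addrK ler_norml => /andP[_].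
  have := ler_wpM2l h0 (QF_truncated t M0); rewrite -/psi.
  by move: (mean _ psi) (mean t psi) (QF _ _) => a b c; lra.
have iter h k : 0 <= h -> mean (k%:R * h) psi <=
    expR (k%:R * h) * (m + k%:R * (8 * M * h ^+ 2)).
  move=> h0; elim: k => [|k IH].
    by rewrite !mul0r expR0 addr0 mul1r.
  have kh : 0 <= k%:R * h by rewrite mulr_ge0.
  rewrite -natr1 mulrDl mul1r; apply: le_trans (step _ _ kh h0) _.
  have h1 : 1 + h <= expR h by exact: expR_ge1Dx.
  set D := 8 * M * h ^+ 2.
  have D0 : 0 <= D by rewrite !mulr_ge0// sqr_ge0.
  have b1 := expR_gt0 (k%:R * h).
  have q0 : 0 <= expR (k%:R * h) * (m + k%:R * D).
    by rewrite mulr_ge0 ?(ltW b1)// addr_ge0// mulr_ge0.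
  apply: (@le_trans _ _ (expR h * (expR (k%:R * h) * (m + k%:R * D)) + D)).
    rewrite lerD2r; apply: (@le_trans _ _ ((1 + h) * (expR (k%:R * h) * (m + k%:R * D)))).
      by rewrite ler_wpM2l// addr_ge0.
    by rewrite ler_wpM2r.
  have e1 : 1 <= expR (k%:R * h + h) by apply: le_trans (expR_ge1Dx _); rewrite lerDl addr_ge0.
  have -> : expR (k%:R * h + h) * (m + (k%:R + 1) * D) =
      expR h * (expR (k%:R * h) * (m + k%:R * D)) + expR (k%:R * h + h) * D.
    by rewrite expRD; ring.
  by rewrite lerD2l ler_peMl.
apply/ler_addgt0Pl => e e0.
pose C := expR T * (8 * M * T ^+ 2).
have C0 : 0 <= C by rewrite !mulr_ge0 ?expR_ge0 ?sqr_ge0.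
pose k := (Num.bound (C / e)).+1.
have k0 : 0 < k%:R :> R by rewrite ltr0n.
have := iter (T / k%:R) k (divr_ge0 T0 (ltW k0)).
rewrite mulrC divfK ?gt_eqF// => /le_trans; apply.
have -> : expR T * (m + k%:R * (8 * M * (T / k%:R) ^+ 2)) = C / k%:R + expR T * m.
  by rewrite /C; field; rewrite gt_eqF.
rewrite lerD2r ler_pdivrMr// mulrC -ler_pdivrMr//.
apply: le_trans (ltW (archi_boundP (divr_ge0 C0 (ltW e0)))) _.
by rewrite ler_nat.
Qed.

Lemma integral_enorm_le T : 0 <= T ->
  (\int[mu T]_x (enorm x)%:E <= (expR T * \int[mu0]_x enorm x)%:E)%E.
Proof.
move=> T0.
pose g k (x : E) := (truncated_norm k%:R x)%:E.
have mg k : measurable_fun setT (g k).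
  by apply/measurable_EFinP; case: (bmf_truncated (ler0n R k)).
have g0 k x : (0 <= g k x)%E by rewrite lee_fin le_min enorm_ge0 ler0n.
have ndg x : nondecreasing_seq (g ^~ x).
  move=> a b ab; rewrite lee_fin /truncated_norm le_min !ge_min lexx/=.
  by apply/orP; right; rewrite ler_nat.
have limg x : ((enorm x)%:E = limn (g ^~ x))%E.
  apply/esym/cvg_lim => //; apply: cvg_near_cst; near=> k; rewrite /g /truncated_norm.
  rewrite min_l//; apply: ltW; apply: lt_le_trans (archi_boundP (enorm_ge0 x)) _.
  by rewrite ler_nat; near: k; exact: nbhs_infty_ge.
under eq_integral do rewrite limg.
rewrite monotone_convergence//.
apply: lime_le.
  apply: ereal_nondecreasing_is_cvgn => a b ab; apply: ge0_le_integral => //.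
  by move=> x _; exact: ndg.
apply: nearW => k; have := mean_truncated_le (ler0n R k) T0.
rewrite -lee_fin /mean /Rintegral fineK//.
apply: (integrable_fin_num measurableT); apply: bmf_integrable; exact: bmf_truncated.
Unshelve. all: by end_near. Qed.

Lemma mom1_mu T : 0 <= T -> mom1 (mu T).
Proof.
move=> T0; apply/integrableP; split; first by apply/measurable_EFinP; exact: measurable_enorm.
apply: le_lt_trans (ltry (expR T * \int[mu0]_x enorm x)).
apply: le_trans (integral_enorm_le T0); rewrite le_eqVlt; apply/orP; left; apply/eqP.
by apply: eq_integral => x _ /=; rewrite ger0_norm ?enorm_ge0.
Qed.

Lemma mean_enorm_le T : 0 <= T -> \int[mu T]_x enorm x <= expR T * \int[mu0]_x enorm x.
Proof.
move=> T0; rewrite -lee_fin; apply: le_trans (integral_enorm_le T0).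
by rewrite /Rintegral fineK//; exact: (integrable_fin_num measurableT (mom1_mu T0)).
Qed.

Definition growth_const (T : R) : R := 1 + expR T * \int[mu0]_x enorm x.

Let growth_const_ge0 T : 0 <= growth_const T.
Proof.
rewrite addr_ge0// mulr_ge0 ?expR_ge0//.
by apply: Rintegral_ge0 => x _; exact: enorm_ge0.
Qed.

Let coll_growth f K : bmf f -> (forall x, `|f x| <= K * (1 + enorm x)) ->
  forall v w, `|coll f v w| <= K * 3 * ((1 + enorm v) + (1 + enorm w)).
Proof.
move=> bf fK v w.
have K0 : 0 <= K.
  have := le_trans (normr_ge0 _) (fK origin).
  by rewrite enorm_origin addr0 mulr1.
have bc := bmf_collision_sum v w bf.
have : `|\int[S]_s collision_sum f v w s| <= K * (2 * (1 + (enorm v + enorm w))).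
  apply: le_trans (le_normr_Rintegral measurableT (bmf_integrable S bc)) _.
  rewrite -[leRHS](Rintegral_prob_cst S).
  apply: ae_le_Rintegral.
  - by have := integrable_norm (bmf_integrable S bc); congr integrable.
  - exact: bmf_integrable (bmf_cst _).
  apply: filterS (ae_sphere n0) => s s1; rewrite /collision_sum.
  apply: le_trans (ler_normD _ _) _.
  apply: le_trans (lerD (fK _) (fK _)) _; rewrite -mulrDr ler_wpM2l//.
  have := enorm_kac_post1_le v w s1; have := enorm_kac_post2_le v w s1; lra.
rewrite /coll; move: (\int[S]_s _) => I hI.
apply: le_trans (ler_normB _ _) _; apply: le_trans (lerD (ler_normB _ _) (lexx _)) _.
have := fK v; have := fK w; have := enorm_ge0 v; have := enorm_ge0 w; nra.
Qed.

(** The sum of the constants for the weights 1 and 1 + |x|, so that it dominates both. *)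
Definition taylor_const (T : R) : R :=
  8 + 3 * (3 * (1 + growth_const T) * growth_const T).

Lemma taylor_const_ge0 T : 0 <= taylor_const T.
Proof. by rewrite addr_ge0// !mulr_ge0// addr_ge0. Qed.

Let rho_integrable s : 0 <= s ->
  (mu s).-integrable setT (EFin \o (fun x => 1 + @enorm R n x)).
Proof.
move=> s0; have := integrableD measurableT (bmf_integrable (mu s) (bmf_cst 1)) (mom1_mu s0).
by congr integrable.
Qed.

Let rho_le s T : 0 <= s <= T -> \int[mu s]_x (1 + @enorm R n x) <= growth_const T.
Proof.
move=> /andP[s0 sT]; rewrite RintegralD; [|by []| |exact: mom1_mu].
- rewrite Rintegral_prob_cst lerD2l; apply: le_trans (mean_enorm_le s0) _.
  apply: ler_wpM2r; last by rewrite ler_expR.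
  by apply: Rintegral_ge0 => x _; exact: enorm_ge0.
- exact: bmf_integrable (bmf_cst _).
Qed.

Let mean_taylor_growth f K t u T : bmf f -> (forall x, `|f x| <= K * (1 + enorm x)) ->
  0 <= K -> 0 <= t -> t <= u -> u <= T ->
  `|mean u f - mean t f - (u - t) * QF (mu u) f| <= taylor_const T * (u - t) ^+ 2 * K.
Proof.
move=> bf fK K0 t0 tu uT; have gc0 := growth_const_ge0 T.
have A3 : 0 <= 3 :> R by [].
have rho1 (x : E) : 1 <= 1 + enorm x by rewrite lerDl enorm_ge0.
have Irho s : 0 <= s <= T -> (mu s).-integrable setT (EFin \o (fun x => 1 + @enorm R n x)).
  by move=> /andP[s0 _]; exact: rho_integrable.
apply: le_trans (mean_taylor hmu A3 gc0 rho1 coll_growth Irho (@rho_le ^~ T) bf fK K0 t0 tu (lexx u) uT) _.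
rewrite [leRHS]mulrC [leRHS]mulrA ler_wpM2r ?sqr_ge0// ler_wpM2l//.
by rewrite /taylor_const lerDr.
Qed.

(** For large xi the test function is bounded by 1. For small xi, subtracting its value at 0 leaves
    a function bounded by |xi| (1 + |x|); the left side does not change, as Q annihilates
    constants. *)
Lemma TF_taylor b xi t u T : 0 <= t -> t <= u -> u <= T ->
  `|TF (mu u) b xi - TF (mu t) b xi - (u - t) * QT (mu u) b xi| <=
  taylor_const T * (u - t) ^+ 2 * cut xi.
Proof.
move=> t0 tu uT; pose f x := trig b (dotp xi x).
have bf : bmf f by exact: bmf_trig.
have gc0 := growth_const_ge0 T.
apply: le_cut; first by rewrite mulr_ge0 ?sqr_ge0// taylor_const_ge0.
- have f1 x : `|f x| <= 1 by exact: trig_le1.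
  apply: le_trans (mean_taylor1 bf f1 t0 tu (lexx u)) _.
  by rewrite mulr1 ler_wpM2r ?sqr_ge0// /taylor_const lerDl !mulr_ge0// addr_ge0.
- pose g x := f x + - trig b 0.
  have bg : bmf g by apply: bmfD => //; exact: bmf_cst.
  have gg x : `|g x| <= enorm xi * (1 + enorm x).
    apply: le_trans (trig_lip _ _ _) _; rewrite subr0; apply: le_trans (dotp_le _ _) _.
    by rewrite ler_wpM2l ?enorm_ge0// lerDr.
  have QFg : QF (mu u) g = QF (mu u) f.
    rewrite (QFD mu u bf (bmf_cst _)) -[RHS]addr0; congr (_ + _).
    rewrite QFE (_ : (fun v => _) = fun=> 0); first by rewrite mean_cst mulr0.
    apply/funext => v; rewrite (_ : coll _ v = fun=> 0); first by rewrite mean_cst.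
    apply/funext => w; rewrite /coll /collision_sum Rintegral_prob_cst; ring.
  have meang s : mean s g = mean s f - trig b 0.
    by rewrite (meanD mu s bf (bmf_cst _)) mean_cst.
  have := mean_taylor_growth bg gg (enorm_ge0 _) t0 tu uT; rewrite QFg !meang => H.
  have -> : TF (mu u) b xi - TF (mu t) b xi - (u - t) * QT (mu u) b xi =
    mean u f - trig b 0 - (mean t f - trig b 0) - (u - t) * QF (mu u) f.
    have TFE s : TF (mu s) b xi = mean s f by [].
    rewrite !TFE /QT -/f.
    by move: (mean u f) (mean t f) (QF _ _) => *; ring.
  by rewrite (mulrC (enorm xi)).
Qed.

End boltzmann_moments.

(** * The supermartingale *)

Section energy_shell.
Context {R : realType} (n N : nat).
Hypotheses (n2 : (2 <= n)%N) (N0 : (0 < N)%N).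
Notation E := (n.-tuple R).
Notation S := (@uniform_sphere R n).
Notation St := (N.-tuple E).
Variable p : R -> R.-pker St ~> St.
Hypotheses (hp : markov_semigroup p) (hL : has_generator p (@kac_generator R n N)).

(** The generator kills this indicator, so [evolve_lipschitz] applies with constant 0. *)
Lemma evolve_invariant (A : set St) T V : measurable A ->
  (forall W i j s, enorm s = 1 -> A (post W i j s) <-> A W) -> 0 <= T ->
  evolve p T \1_A V = \1_A V.
Proof.
move=> mA hA T0; have bA := bmf_indic (R := R) mA.
have n0 : (0 < n)%N by exact: ltnW.
have post_eq W i j s : enorm s = 1 -> \1_A (post W i j s) = \1_A W :> R.
  by move=> s1; rewrite !indicE; congr (nat_of_bool _)%:R;
    apply/idP/idP => /set_mem h; apply/mem_set; apply/(hA W i j s s1).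
have L0 W : `|kac_generator \1_A W| <= (0 : R).
  rewrite normr_le0 kac_generatorE// big1 ?mulr0// => i _; rewrite big1// => j _.
  have bp := bmf_post W i j bA.
  apply/eqP; rewrite subr_eq0 eq_le.
  have I1 := bmf_integrable S bp; have I2 := bmf_integrable S (bmf_cst (\1_A W : R)).
  have -> : \1_A W = \int[S]_s (\1_A W : R) by rewrite Rintegral_prob_cst.
  by apply/andP; split; apply: ae_le_Rintegral => //; apply: filterS (ae_sphere n0) => s s1;
    rewrite post_eq.
have := evolve_lipschitz hp hL bA L0 T0 V.
by rewrite mulr0 normr_le0 subr_eq0 => /eqP.
Qed.

Lemma low_energy_post k1 (W : St) i j s : enorm s = 1 ->
  low_energy k1 (post W i j s) <-> low_energy k1 W.
Proof. by move=> s1; rewrite /low_energy/= energy_post. Qed.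

End energy_shell.

Section iteration.
Context {R : realType} {d : measure_display} {X : measurableType d}.
Variables (p : R -> R.-pker X ~> X) (hp : markov_semigroup p).
Variables (T C : R) (B : R -> R) (F : R -> X -> R).
Hypotheses (T0 : 0 <= T) (C0 : 0 <= C).
Hypothesis bF : forall t, 0 <= t -> bmf (F t).
Hypothesis F0 : forall t x, 0 <= F t x.
Hypothesis step : forall t h x, 0 <= t -> 0 <= h <= 1 -> t + h <= T ->
  evolve p h (F (t + h)) x <= expR (B (t + h) - B t + C * h ^+ 2) * F t x.

Let iter h j : 0 <= h <= 1 -> j%:R * h <= T -> forall x,
  evolve p (j%:R * h) (F (j%:R * h)) x <=
  expR (B (j%:R * h) - B 0 + j%:R * (C * h ^+ 2)) * F 0 x.
Proof.
move=> h01; have /andP[h0 _] := h01; elim: j => [_ x|j IH].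
  rewrite !mul0r (evolve0 hp); last exact: bF.
  by rewrite subrr addr0 expR0 mul1r.
have js : j.+1%:R * h = j%:R * h + h by rewrite -natr1 mulrDl mul1r.
rewrite js => jT x; set t := j%:R * h.
have t0 : 0 <= t by rewrite mulr_ge0.
have tT : t <= T by apply: le_trans jT; rewrite lerDl.
have th0 : 0 <= t + h by rewrite addr_ge0.
have b1 := bF th0; have b2 := bF t0.
rewrite (evolve_add hp)//.
apply: le_trans (@evolve_le _ _ _ p t _ _ x (bmf_evolve p h b1) (bmfZ _ b2) (fun y => step y t0 h01 jT)) _.
rewrite evolveZ//.
apply: le_trans (ler_wpM2l (expR_ge0 _) (IH tT x)) _.
rewrite [leLHS]mulrA -expRD ler_wpM2r// ler_expR -/t -natr1 le_eqVlt; apply/orP; left; apply/eqP.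
by ring.
Qed.

(** With M steps of length T/M the errors, kept in the exponent, add up to C T^2 / M. *)
Lemma evolve_iterate x : evolve p T (F T) x <= expR (B T - B 0) * F 0 x.
Proof.
set b := B T - B 0.
apply/ler_addgt0Pl => eps eps0.
pose P := F 0 x; have P0 : 0 <= P by exact: F0.
pose W := expR b * P; have W0 : 0 <= W by rewrite mulr_ge0 ?expR_ge0.
have le_step M : (0 < M)%N -> T <= M%:R ->
    evolve p T (F T) x <= expR (C * T ^+ 2 / M%:R) * W.
  move=> M0 TM; have MR : 0 < M%:R :> R by rewrite ltr0n.
  have h01 : 0 <= T / M%:R <= 1 by rewrite divr_ge0 ?(ltW MR)//= ler_pdivrMr// mul1r.
  have MT : M%:R * (T / M%:R) = T by rewrite mulrC divfK// gt_eqF.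
  have := @iter (T / M%:R) M h01; rewrite MT => /(_ (lexx _) x) /le_trans; apply.
  rewrite -/b -/P /W [leRHS]mulrA -expRD le_eqVlt; apply/orP; left; apply/eqP; congr (expR _ * _).
  by field; rewrite gt_eqF.
pose Y := C * T ^+ 2; have Y0 : 0 <= Y by rewrite mulr_ge0// sqr_ge0.
(* With y = Y/M, the three terms ensure in turn T/M <= 1, then 2 y <= 1 (whence e^y <= 1 + 2 y),
   then 2 y W <= eps. *)
pose M := (Num.bound (T + 2 * Y + 2 * Y * W / eps)).+1.
have MB : T + 2 * Y + 2 * Y * W / eps <= M%:R.
  apply: ltW; apply: lt_le_trans (archi_boundP _) _; last by rewrite ler_nat.
  by rewrite !addr_ge0 ?mulr_ge0 ?invr_ge0 ?(ltW eps0).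
have YW0 : 0 <= 2 * Y * W / eps by rewrite !mulr_ge0 ?invr_ge0 ?(ltW eps0).
have MR : 0 < M%:R :> R by rewrite ltr0n.
apply: le_trans (@le_step M isT _) _; first by move: MB; lra.
rewrite -/Y; set y := Y / M%:R.
have y0 : 0 <= y by rewrite divr_ge0// ltW.
have y1 : 2 * y <= 1.
  rewrite /y mulrA ler_pdivrMr// mul1r; move: MB T0 YW0.
  by move: (2 * Y * W / eps) (2 * Y) (M%:R) => *; lra.
have yW : 2 * y * W <= eps.
  have -> : 2 * y * W = (2 * Y * W) / M%:R by rewrite /y; ring.
  rewrite ler_pdivrMr// [leRHS]mulrC -ler_pdivrMr//; apply: le_trans MB.
  by rewrite lerDr addr_ge0// mulr_ge0.
have ey : expR y <= 1 + 2 * y.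
  have := expR_ge1Dx (- y); have := expRM_inv y; have := expR_gt0 y; nra.
by have := ler_wpM2r W0 ey; rewrite -/P -/W; lra.
Qed.

End iteration.

Section discount.
Context {R : realType}.

(** The integral of e^(-k s) for s in [0, t]. *)
Definition discount (k t : R) : R := if k == 0 then t else (1 - expR (- (k * t))) / k.

Lemma discount0 k : discount k 0 = 0.
Proof. by rewrite /discount mulr0 oppr0 expR0 subrr mul0r if_same. Qed.

(** The decreasing integrand is bounded below by its value at the right end, where each time step
    evaluates the rate. *)
Lemma discount_ge k t u : 0 <= k -> t <= u ->
  (u - t) * expR (- (k * u)) <= discount k u - discount k t.
Proof.
move=> k0 tu; rewrite /discount; case: eqP => [->|/eqP kn].
  by rewrite mul0r oppr0 expR0 mulr1.
have kp : 0 < k by rewrite lt_neqAle eq_sym kn.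
rewrite -mulrBl ler_pdivlMr//.
have -> : - (k * t) = - (k * u) + k * (u - t) by ring.
rewrite expRD; have := expR_ge1Dx (k * (u - t)); have := expR_gt0 (- (k * u)).
move: (expR _) (expR _) => x y; nra.
Qed.

(** In order: Taylor's formula for the semigroup, convexity at the displaced point, the contraction
    of Q, the bound on the generator. I and J are the inner products of X_u with Q of the empirical
    measure and with the vector W defined below. *)
Lemma step_combine (Ev ca cy sa rr h L I J M2 X Y : R) :
  Ev - ca - h * L <= h ^+ 2 * M2 -> ca + sa * (rr * (h * J)) <= cy ->
  h * (sa * rr * I) <= h * (sa * rr * J) ->
  h * L <= h * (sa * rr * I + ca * (rr * X / Y)) ->
  Ev <= cy + ca * (h * (rr * (X / Y))) + h ^+ 2 * M2.
Proof. lra. Qed.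

End discount.

Section one_step.
Context {R : realType} (n N : nat) (r k1 T lambda : R).
Hypotheses (n2 : (2 <= n)%N) (r01 : 0 < r < 1) (N0 : (0 < N)%N) (k10 : 0 < k1).
Hypotheses (T0 : 0 <= T) (l0 : 0 <= lambda).
Notation E := (n.-tuple R).
Notation St := (N.-tuple E).
Variable p : R -> R.-pker St ~> St.
Hypotheses (hp : markov_semigroup p) (hL : has_generator p (@kac_generator R n N)).
Variables (mu0 : probability E R) (mu : R -> probability E R).
Hypotheses (hmu : boltzmann_solution mu0 mu) (m01 : mom1 mu0).
Variables (e : E).
Hypotheses (e1 : enorm e = 1) (sc : @small_jumps R n N r k1 e lambda).

Let K := `|kappa n r|.
Let G := growth_const mu0 T.
Let cc := @cut_const R n r.
Let D := (3 + 2 * k1 + G) * cc.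
Let D' := (2 + 2 * G) * cc.
Let q0 := jump_const r e * (4 * k1) `^ r / (2 * N%:R).

(** Its decrease over a step cancels the factor e^(K h) of [hnorm_step]. As K = |kappa| >= 0, it
    never exceeds [lambda], whatever the sign of kappa. *)
Definition rate t := lambda * expR (- (K * t)).

Lemma rate_ge0 t : 0 <= rate t. Proof. by rewrite mulr_ge0// expR_ge0. Qed.

Let K0 : 0 <= K. Proof. exact: normr_ge0. Qed.

Let cc0 : 0 <= cc. Proof. exact: sqrtr_ge0. Qed.

Let rate_le t : 0 <= t -> rate t <= lambda.
Proof.
move=> t0; rewrite /rate ler_piMr// -expR0 ler_expR oppr_le0 mulr_ge0//.
Qed.

Let Im0 : 0 <= \int[mu0]_x @enorm R n x.
Proof. by apply: Rintegral_ge0 => x _; exact: enorm_ge0. Qed.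

Let mean_G t : 0 <= t <= T -> \int[mu t]_x enorm x <= G.
Proof.
move=> /andP[t0 tT]; apply: le_trans (mean_enorm_le n2 hmu m01 t0) _.
apply: (@le_trans _ _ (expR T * \int[mu0]_x @enorm R n x)); last by rewrite /G /growth_const lerDr.
by rewrite ler_wpM2r// ler_expR.
Qed.

Let G0 : 0 <= G. Proof. by rewrite /G /growth_const addr_ge0// mulr_ge0 ?expR_ge0. Qed.

Let D0 : 0 <= D.
Proof. by rewrite mulr_ge0// !addr_ge0// mulr_ge0// ltW. Qed.

Let D'0 : 0 <= D'. Proof. by rewrite mulr_ge0// addr_ge0// mulr_ge0. Qed.

Let dist_D t (V : St) : 0 <= t <= T -> low_energy k1 V -> dist r (mu t) V <= D.
Proof.
move=> tT VG; have /andP[t0 _] := tT.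
apply: le_trans (dist_le n2 r01 N0 k10 (mom1_mu n2 hmu m01 t0) VG) _.
by rewrite /dist_bound ler_wpM2r// lerD2l; exact: mean_G.
Qed.

Let bound_D t : 0 <= t <= T -> dist_bound r k1 (mu t) <= D.
Proof. by move=> tT; rewrite /dist_bound ler_wpM2r// lerD2l; exact: mean_G. Qed.

Let QT_bound u b xi : 0 <= u <= T -> `|QT (mu u) b xi| <= (2 + 2 * G) * cutnorm xi.
Proof.
move=> uT; have /andP[u0 _] := uT; apply: le_trans (QT_le n2 b xi (mom1_mu n2 hmu m01 u0)) _.
by rewrite ler_wpM2r ?cutnorm_ge0// lerD2l ler_wpM2l//; exact: mean_G.
Qed.

Let QT_D u : 0 <= u <= T -> hnorm r (QT (mu u)) <= D'.
Proof.
move=> uT; have /andP[u0 _] := uT; apply: (hnorm_cut n2 r01).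
- by rewrite addr_ge0// mulr_ge0.
- by have [] := hdom_QT n2 (mom1_mu n2 hmu m01 u0).
- by move=> b xi; exact: QT_bound.
Qed.

(** Chosen for two properties. By the contraction of Q, W bounds the drift of the particles in the
    direction X_u ([drift_le]). As the equation for mu gives X_t = X_u + h Q + O(h^2), with Q at
    time u, the vector X_u + h W is (1 + h K) X_t up to O(h^2) ([hnorm_step]). *)
Let W u (V : St) b xi := QT (mu u) b xi + K * deviation (mu u) V b xi.

Let hdom_W u V : 0 <= u -> hdom (W u V).
Proof.
move=> u0; have mu1 := mom1_mu n2 hmu m01 u0.
by apply: hdom_lin; [exact: hdom_QT|exact: hdom_deviation].
Qed.

Let hnorm_W u V : 0 <= u <= T -> low_energy k1 V -> hnorm r (W u V) <= D' + K * D.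
Proof.
move=> uT VG; have /andP[u0 _] := uT; have mu1 := mom1_mu n2 hmu m01 u0.
apply: le_trans (hnorm_lin_le n2 r01 _ (hdom_QT n2 mu1) (hdom_deviation N0 V mu1)) _.
rewrite ger0_norm//; apply: lerD; first exact: QT_D.
by rewrite ler_wpM2l//; exact: dist_D.
Qed.

Let drift_le u V : 0 <= u ->
  ip r (deviation (mu u) V) (QT (empP V)) <= ip r (deviation (mu u) V) (W u V).
Proof.
move=> u0; have mu1 := mom1_mu n2 hmu m01 u0; have ve1 := mom1_empP N0 V.
have dX := hdom_deviation N0 V mu1; have dQ := hdom_QT n2 mu1; have dQe := hdom_QT n2 ve1.
rewrite /W (ip_linr n2 r01)//.
have := collision_contraction n2 r01 ve1 mu1; rewrite -deviationE//.
rewrite (_ : (fun b xi => QT (empP V) b xi - QT (mu u) b xi) =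
  (fun b xi => QT (empP V) b xi + (-1) * QT (mu u) b xi)); last first.
  by apply/funext => b; apply/funext => xi; rewrite mulN1r.
rewrite (ip_linr n2 r01)//.
have kK : - kappa n r <= K by rewrite lerNl; exact: lerNnormlW.
have := ler_wpM2r (ip_ge0 r (deviation (mu u) V)) kK.
by move: (ip _ _ _) (ip _ _ _) (ip _ _ _) (kappa n r) K => *; lra.
Qed.

Let C2 := (K * (2 + 2 * G) + (1 + K) * taylor_const mu0 T) * cc.

Let tau0 : 0 <= taylor_const mu0 T. Proof. exact: taylor_const_ge0. Qed.

Let C20' : 0 <= K * (2 + 2 * G) + (1 + K) * taylor_const mu0 T.
Proof.
apply: addr_ge0; apply: mulr_ge0 => //; last exact: addr_ge0.
by apply: addr_ge0 => //; exact: mulr_ge0.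
Qed.

Let C20 : 0 <= C2. Proof. exact: mulr_ge0. Qed.

Let hnorm_step t h V : 0 <= t -> 0 <= h <= 1 -> t + h <= T -> low_energy k1 V ->
  hnorm r (fun b xi => deviation (mu (t + h)) V b xi + h * W (t + h) V b xi) <=
  C2 * h ^+ 2 + expR (K * h) * dist r (mu t) V.
Proof.
move=> t0 /andP[h0 h1] uT VG; set u := t + h.
have u0 : 0 <= u by rewrite addr_ge0.
have u0T : 0 <= u <= T by rewrite u0.
have tu : t <= u by rewrite lerDl.
have mu1 := mom1_mu n2 hmu m01 u0; have mt1 := mom1_mu n2 hmu m01 t0.
have dX := hdom_deviation N0 V mu1; have dXt := hdom_deviation N0 V mt1.
(* Z is - h^2 K Q - (1 + h K) times the remainder of [TF_taylor], with Q taken at time u. *)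
pose Z b xi := deviation (mu u) V b xi + h * W u V b xi - (1 + h * K) * deviation (mu t) V b xi.
have dZ : hdom Z.
  have := hdom_lin (- (1 + h * K)) (hdom_lin h dX (hdom_W V u0)) dXt; congr hdom.
  by apply/funext => b; apply/funext => xi; rewrite mulNr.
have -> : (fun b xi => deviation (mu u) V b xi + h * W u V b xi) =
    fun b xi => Z b xi + (1 + h * K) * deviation (mu t) V b xi.
  by apply/funext => b; apply/funext => xi; rewrite /Z subrK.
apply: le_trans (hnorm_lin_le n2 r01 _ dZ dXt) _.
have hK0 : 0 <= h * K by rewrite mulr_ge0.
apply: lerD.
  rewrite /C2 mulrAC; apply: (hnorm_cut n2 r01).
  - by apply: mulr_ge0 => //; exact: sqr_ge0.
  - by case: dZ.
  move=> b xi.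
  have := TF_taylor n2 hmu m01 b xi t0 tu uT; rewrite (_ : u - t = h); last first.
    by rewrite /u addrC addKr.
  have := QT_bound b xi u0T; have := cutnorm_ge0 xi.
  have -> : Z b xi = - (h ^+ 2 * K * QT (mu u) b xi +
    (1 + h * K) * (TF (mu u) b xi - TF (mu t) b xi - h * QT (mu u) b xi)).
    by rewrite /Z /W /deviation; move: (empTF _ _ _) (TF _ _ _) (TF _ _ _) (QT _ _ _) => *; ring.
  have tc := tau0.
  move: (TF (mu u) b xi) (TF (mu t) b xi) (QT _ _ _) (cutnorm xi) (taylor_const mu0 T) tc => x y Q c tau tau0' c0 hQ.
  set rho := x - y - h * Q => hrho.
  rewrite normrN; apply: le_trans (ler_normD _ _) _; rewrite !normrM.
  rewrite (ger0_norm h0) (ger0_norm K0) (@ger0_norm _ (1 + h * K)); last by rewrite addr_ge0.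
  rewrite [leRHS](_ : _ = h ^+ 2 * K * ((2 + 2 * G) * c) + (1 + K) * (tau * h ^+ 2 * c)); last by ring.
  apply: lerD; first by rewrite -expr2 ler_wpM2l// mulr_ge0// sqr_ge0.
  apply: ler_pM => //; first by rewrite addr_ge0.
  by rewrite lerD2l ler_piMl.
rewrite ler_wpM2r ?hnorm_ge0// ger0_norm; last by rewrite addr_ge0.
by rewrite mulrC; exact: expR_ge1Dx.
Qed.

(** [C1] bounds the norm of W times the rate, [M'] bounds the generator applied twice to [Phi] (each
    application costs a factor N), and [qm] the coefficient of the jumps. [C] collects the three
    errors of order h^2: the Taylor error of the equation, the exchange of cosh at a and y in the
    jump term, the remainder of the semigroup. *)
Let C1 := lambda * (D' + K * D).
Let M' : R := N%:R * (N%:R * ch (lambda * D)).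
Let qm := lambda ^+ 2 * q0.
Let C := lambda * C2 + qm * C1 * expR C1 + M'.

Let q00 : 0 <= q0.
Proof.
apply: divr_ge0; last exact: mulr_ge0.
by apply: mulr_ge0; [exact: jump_const_ge0|exact: powR_ge0].
Qed.

Let C10 : 0 <= C1.
Proof. by apply: mulr_ge0 => //; apply: addr_ge0 => //; exact: mulr_ge0. Qed.

Let C_ge0 : 0 <= C.
Proof.
apply: addr_ge0; last by rewrite /M' !mulr_ge0// (le_trans ler01)// ch_ge1.
apply: addr_ge0; first exact: mulr_ge0.
apply: mulr_ge0; last exact: expR_ge0.
by apply: mulr_ge0 => //; apply: mulr_ge0 => //; exact: sqr_ge0.
Qed.

(** Here a, y, z are the scaled norms of X_u, X_u + h W, X_t, and w is the evolved value of [Phi].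
    Everything is compared with ch z, and the errors are moved into the exponent. *)
Let scalar_step (h a y z w q : R) : 0 <= h <= 1 -> 0 <= z -> 0 <= y -> 0 <= a ->
  0 <= q -> q <= qm ->
  a <= y + C1 * h -> y <= z + lambda * C2 * h ^+ 2 ->
  w <= ch y + ch a * (h * q) + h ^+ 2 * M' ->
  w <= expR (h * q + C * h ^+ 2) * ch z.
Proof.
move=> /andP[h0 h1] z0 y0 a0 q0' qqm ay yz /le_trans; apply.
have lC2 : 0 <= lambda * C2 by exact: mulr_ge0.
have M'0 : 0 <= M' by rewrite /M' !mulr_ge0// (le_trans ler01)// ch_ge1.
have Ch0 : 0 <= C1 * h by rewrite mulr_ge0.
have cy : ch y <= ch z * expR (lambda * C2 * h ^+ 2).
  apply: le_trans (ch_homo y0 yz) (chD_le _ _); by rewrite mulr_ge0// sqr_ge0.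
have ca : ch a <= ch y * (1 + C1 * h * expR C1).
  apply: le_trans (ch_homo a0 ay) _; apply: le_trans (chD_le _ Ch0) _.
  rewrite ler_wpM2l ?(le_trans ler01 (ch_ge1 _))//.
  have eh : expR (C1 * h) <= expR C1 by rewrite ler_expR ler_piMr.
  have := expR_ge1Dx (- (C1 * h)); have := expRM_inv (C1 * h).
  have := expR_gt0 (C1 * h); nra.
have cz := ch_ge1 z; have cy0 := ch_ge1 y.
set P := expR (lambda * C2 * h ^+ 2) in cy.
have P1 : 1 <= P by rewrite -expR0 ler_expR mulr_ge0// sqr_ge0.
apply: (@le_trans _ _ (ch z * P * (1 + h * q + (qm * C1 * expR C1 + M') * h ^+ 2))).
  have hq : 0 <= h * q by rewrite mulr_ge0.
  have s1 : ch a * (h * q) <= ch y * (h * q + qm * C1 * expR C1 * h ^+ 2).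
    apply: le_trans (ler_wpM2r hq ca) _; rewrite -[leLHS]mulrA; apply: ler_wpM2l; first lra.
    rewrite mulrDl mul1r lerD2l.
    have -> : C1 * h * expR C1 * (h * q) = q * (C1 * expR C1 * h ^+ 2) by ring.
    have -> : qm * C1 * expR C1 * h ^+ 2 = qm * (C1 * expR C1 * h ^+ 2) by ring.
    apply: ler_wpM2r => //; apply: mulr_ge0; last exact: sqr_ge0.
    by apply: mulr_ge0; [exact: C10|exact: expR_ge0].
  have s2 : h ^+ 2 * M' <= ch y * (M' * h ^+ 2).
    by rewrite mulrC ler_peMl// mulr_ge0// sqr_ge0.
  apply: (@le_trans _ _ (ch y * (1 + h * q + (qm * C1 * expR C1 + M') * h ^+ 2))); first lra.
  have qm0 : 0 <= qm := le_trans q0' qqm.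
  have e0 : 0 <= qm * C1 * expR C1 + M' := addr_ge0 (mulr_ge0 (mulr_ge0 qm0 C10) (expR_ge0 _)) M'0.
  have e2 : 0 <= (qm * C1 * expR C1 + M') * h ^+ 2 := mulr_ge0 e0 (sqr_ge0 h).
  by apply: ler_wpM2r cy; lra.
rewrite [leRHS]mulrC -[leLHS]mulrA; apply: ler_wpM2l; first lra.
have -> : h * q + C * h ^+ 2 =
    h * q + (qm * C1 * expR C1 + M') * h ^+ 2 + lambda * C2 * h ^+ 2.
  by rewrite /C; move: qm C1 M' C2 => *; ring.
rewrite expRD mulrC; apply: ler_wpM2r; first exact: expR_ge0.
by apply: le_trans (expR_ge1Dx _); rewrite addrA.
Qed.

Let Phi_bound u (V : St) : 0 <= u <= T -> Phi r k1 (mu u) (rate u) V <= ch (lambda * D).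
Proof.
move=> uT; have /andP[u0 _] := uT; have mu1 := mom1_mu n2 hmu m01 u0.
apply: le_trans (Phi_le n2 r01 N0 k10 V mu1 (rate_ge0 u)) _.
have db0 : 0 <= dist_bound r k1 (mu u).
  rewrite mulr_ge0// !addr_ge0// ?mulr_ge0// ?(ltW k10)//.
  by apply: Rintegral_ge0 => x _; exact: enorm_ge0.
apply: ch_homo; first by rewrite mulr_ge0// rate_ge0.
by apply: ler_pM; rewrite ?rate_ge0 ?rate_le ?bound_D.
Qed.

Lemma evolve_Phi_step : exists2 C : R, 0 <= C & forall t h (V : St), 0 <= t ->
  0 <= h <= 1 -> t + h <= T ->
  evolve p h (Phi r k1 (mu (t + h)) (rate (t + h))) V <=
  expR (h * (rate (t + h) ^+ 2 * (jump_const r e * (4 * k1) `^ r / (2 * N%:R))) + C * h ^+ 2) *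
  Phi r k1 (mu t) (rate t) V.
Proof.
exists C => // t h V t0 h01 uT; have /andP[h0 h1] := h01.
set u := t + h; rewrite -/q0.
have u0 : 0 <= u by rewrite addr_ge0.
have u0T : 0 <= u <= T by rewrite u0.
have mu1 := mom1_mu n2 hmu m01 u0.
have bPhi := bmf_Phi n2 r01 N0 k10 mu1 (rate_ge0 u).
have mG := @measurable_low_energy R n N k1.
have [VG|VG] := pselect (low_energy k1 V); last first.
  rewrite [Phi _ _ (mu t) _ _]/Phi indicE memNset// mulr0 mulr0.
  have b1 := bmf_indic (R := R) mG.
  (* Outside the low-energy set both sides vanish: [Phi] is at most a constant times the indicator
     of this invariant set. *)
  apply: (@le_trans _ _ (evolve p h (fun W => ch (lambda * D) * \1_(low_energy k1) W) V)).
    apply: evolve_le => //; first exact: bmfZ.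
    move=> W'; have := Phi_bound W' u0T; rewrite /Phi indicE.
    by case: (W' \in _); rewrite ?mulr1 ?mulr0.
  rewrite evolveZ// (evolve_invariant n2 hp hL)//; last by move=> *; exact: low_energy_post.
  by rewrite indicE memNset// mulr0.
rewrite [Phi _ _ (mu t) _ _]Phi_low//.
have dX := hdom_deviation N0 V mu1.
have dW := hdom_W V u0.
have cu0 := rate_ge0 u; have cul := rate_le u0.
have d0 := dist_ge0 r (mu u) V.
set a := rate u * dist r (mu u) V.
pose y := rate u * hnorm r (fun b xi => deviation (mu u) V b xi + h * W u V b xi).
have y0 : 0 <= y := mulr_ge0 cu0 (hnorm_ge0 _ _).
have a0 : 0 <= a := mulr_ge0 cu0 d0.
have l2 : rate u ^+ 2 <= lambda ^+ 2 by rewrite ler_pXn2r.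
have z0 : 0 <= rate t * dist r (mu t) V := mulr_ge0 (rate_ge0 t) (dist_ge0 r (mu t) V).
have q1 : 0 <= rate u ^+ 2 * q0 := mulr_ge0 (sqr_ge0 _) q00.
have q2 : rate u ^+ 2 * q0 <= qm := ler_wpM2r q00 l2.
apply: (@scalar_step h a y (rate t * dist r (mu t) V) _ (rate u ^+ 2 * q0) h01 z0 y0 a0 q1 q2).
- have dWh := hdom_lin h dX dW.
  have := hnorm_lin_le n2 r01 (- h) dWh dW.
  rewrite (_ : (fun b xi => _ + - h * _) = deviation (mu u) V); last first.
    by apply/funext => b; apply/funext => xi; rewrite mulNr addrK.
  rewrite normrN ger0_norm// => H.
  have HW := hnorm_W u0T VG.
  have : a <= rate u * (hnorm r (fun b xi => deviation (mu u) V b xi + h * W u V b xi) + h * hnorm r (W u V)).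
    exact: (ler_wpM2l cu0).
  rewrite mulrDr -/y => /le_trans; apply; rewrite lerD2l.
  rewrite /C1 -mulrA (mulrC _ h); apply: (ler_pM cu0 _ cul).
  + exact: mulr_ge0 h0 (hnorm_ge0 _ _).
  + exact: ler_wpM2l h0 _ _ HW.
- have := ler_wpM2l cu0 (hnorm_step t0 h01 uT VG); rewrite -/u -/y => /le_trans; apply.
  rewrite mulrDr addrC; apply: lerD; last first.
    by rewrite mulrA; exact: ler_wpM2r (sqr_ge0 h) _ _ (ler_wpM2r C20 cul).
  rewrite mulrA; apply: ler_wpM2r (dist_ge0 r (mu t) V) _ _ _.
  (* The rate at time u times e^(K h) is the rate at time t. *)
  rewrite /rate -mulrA -expRD /u; apply: (ler_wpM2l l0).
  by rewrite mulrDr opprD -addrA addNr addr0.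
have sc' : small_jumps N r k1 e (rate u).
  apply: le_trans sc; apply: ler_wpM2r l2; apply: mulr_ge0; first exact: sqr_ge0.
  by apply: mulr_ge0; [exact: jump_const_ge0|exact: powR_ge0].
have gen := generator_Phi_le n2 r01 N0 k10 e1 mu1 VG cu0 sc'.
have LL (W' : St) : `|kac_generator (kac_generator (Phi r k1 (mu u) (rate u))) W'| <= M'.
  apply: kac_generator_le => //; first exact: bmf_kac_generator.
  move=> W''; apply: kac_generator_le => // W3.
  by rewrite ger0_norm ?Phi_ge0// Phi_bound.
have := evolve_taylor hp hL (@bmf_kac_generator R n N N0) bPhi LL h0 V.
rewrite [Phi _ _ (mu u) _ V]Phi_low// -/a ler_norml => /andP[_ tay].
have drift := drift_le V u0.
set I := ip r (deviation (mu u) V) (W u V) in drift.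
have mq : `|rate u ^+ 2 * (h * I)| <= a * (rate u * (h * hnorm r (W u V))).
  rewrite normrM (ger0_norm (sqr_ge0 _)) normrM (ger0_norm h0).
  have -> : a * (rate u * (h * hnorm r (W u V))) =
    rate u ^+ 2 * (h * (hnorm r (deviation (mu u) V) * hnorm r (W u V))).
    by rewrite /a /dist; ring.
  exact: ler_wpM2l (sqr_ge0 _) _ _ (ler_wpM2l h0 (ip_le n2 r01 dX dW)).
have q0' : 0 <= rate u * (h * hnorm r (W u V)) := mulr_ge0 cu0 (mulr_ge0 h0 (hnorm_ge0 _ _)).
have := ch_sqrt_ge a0 q0' mq.
have -> : Num.sqrt (a ^+ 2 + 2 * (rate u ^+ 2 * (h * I)) + (rate u * (h * hnorm r (W u V))) ^+ 2) = y.
  rewrite -[RHS]ger0_norm// -sqrtr_sqr; congr Num.sqrt.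
  rewrite /y [RHS]exprMn sqr_hnorm (ip_sqr_lin n2 r01 h dX dW) -/I -!sqr_hnorm.
  by rewrite /a /dist; ring.
move: gen; rewrite -/a => gen chy.
have sa0 : 0 <= sh a / a := divr_ge0 (sh_ge0 a0) a0.
have := ler_wpM2l h0 gen.
have : h * (sh a / a * rate u ^+ 2 * ip r (deviation (mu u) V) (QT (empP V))) <=
   h * (sh a / a * rate u ^+ 2 * I).
  exact: ler_wpM2l h0 _ _ (ler_wpM2l (mulr_ge0 sa0 (sqr_ge0 _)) drift).
exact: step_combine tay chy.
Qed.

End one_step.

Section supermartingale.
Context {R : realType} (n N : nat) (r k1 T lambda : R).
Hypotheses (n2 : (2 <= n)%N) (r01 : 0 < r < 1) (N0 : (0 < N)%N) (k10 : 0 < k1).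
Hypotheses (T0 : 0 <= T) (l0 : 0 <= lambda).
Notation E := (n.-tuple R).
Notation St := (N.-tuple E).
Variable p : R -> R.-pker St ~> St.
Hypotheses (hp : markov_semigroup p) (hL : has_generator p (@kac_generator R n N)).
Variables (mu0 : probability E R) (mu : R -> probability E R).
Hypotheses (hmu : boltzmann_solution mu0 mu) (m01 : mom1 mu0).
Variables (e : E).
Hypotheses (e1 : enorm e = 1) (sc : @small_jumps R n N r k1 e lambda).

Lemma evolve_Phi (V : St) :
  evolve p T (Phi r k1 (mu T) (rate n r lambda T)) V <=
  expR (lambda ^+ 2 * (jump_const r e * (4 * k1) `^ r / (2 * N%:R)) *
        discount (2 * `|kappa n r|) T) *
  Phi r k1 (mu 0) lambda V.
Proof.
have [C C0 step] := @evolve_Phi_step R n N r k1 T lambda n2 r01 N0 k10 l0 p hp hL mu0 mu hmu m01 e e1 sc.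
have q0 : 0 <= jump_const r e * (4 * k1) `^ r / (2 * N%:R).
  apply: divr_ge0; last exact: mulr_ge0.
  by apply: mulr_ge0; [exact: jump_const_ge0|exact: powR_ge0].
move: q0 step; set q := jump_const r e * _ / _; set K := `|kappa n r| => q0 step.
have K20 : 0 <= 2 * K by apply: mulr_ge0 => //; exact: normr_ge0.
(* The jump term at time t is q times the squared rate, lambda^2 e^(-2 K t); B is its integral. *)
pose B t := lambda ^+ 2 * q * discount (2 * K) t.
have rate0 : rate n r lambda 0 = lambda by rewrite /rate mulr0 oppr0 expR0 mulr1.
have := @evolve_iterate _ _ _ p hp T C B (fun t => Phi r k1 (mu t) (rate n r lambda t)) T0 C0.
rewrite /B discount0 mulr0 subr0 rate0; apply.
- move=> t t0; apply: (bmf_Phi n2 r01 N0 k10); first exact: (mom1_mu n2 hmu m01).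
  exact: (rate_ge0 _ _ l0).
- by move=> t W; exact: Phi_ge0.
move=> t h W t0 h01 thT; apply: le_trans (step t h W t0 h01 thT) _.
apply: ler_wpM2r; first exact: Phi_ge0.
rewrite ler_expR lerD2r -mulrBr.
have /andP[h0 _] := h01.
have th : t <= t + h by rewrite lerDl.
have := discount_ge K20 th; rewrite (addrC t h) addrK (addrC h t) => H.
have e2 : rate n r lambda (t + h) ^+ 2 = lambda ^+ 2 * expR (- (2 * K * (t + h))).
  rewrite /rate exprMn -expRM_natl -/K; congr (_ * expR _); ring.
rewrite e2; have := ler_wpM2l (mulr_ge0 (sqr_ge0 lambda) q0) H.
rewrite (_ : h * (lambda ^+ 2 * _ * q) = lambda ^+ 2 * q * (h * expR (- (2 * K * (t + h))))) //.
by move: (expR _) => y; ring.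
Qed.

End supermartingale.

(** * The initial law *)

Section iid_law.
Context {R : realType} {dE : measure_display} {E : measurableType dE}.
Variable m : probability E R.

Definition tuple_cons n (x : E * n.-tuple E) : n.+1.-tuple E := [tuple of x.1 :: x.2].

Lemma measurable_tuple_cons n : measurable_fun setT (@tuple_cons n).
Proof. exact: (@measurable_cons _ _ _ E fst n snd). Qed.

HB.instance Definition _ n :=
  isMeasurableFun.Build _ _ _ _ (@tuple_cons n) (@measurable_tuple_cons n).

(** Recursion on the number of coordinates lets a one-particle inequality be iterated
    ([iid_integral_iterate]). *)
Fixpoint iid_law n : probability (n.-tuple E) R :=
  match n with
  | 0 => \d_([tuple] : 0.-tuple E)
  | n.+1 => distribution (m \x iid_law n)%E (@tuple_cons n)
  end.

Definition rectangle n (B : 'I_n -> set E) : set (n.-tuple E) :=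
  [set x | forall i, B i (tnth x i)].

Lemma measurable_rectangle n (B : 'I_n -> set E) :
  (forall i, measurable (B i)) -> measurable (rectangle B).
Proof.
move=> mB; rewrite (_ : rectangle B = \bigcap_(i in [set: 'I_n]) (fun x => tnth x i) @^-1` B i).
  apply: fin_bigcap_measurable => // i _.
  by rewrite -[X in measurable X]setTI; exact: measurable_tnth.
by apply/seteqP; split => x h => [i _|i]; [exact: h|exact: h i I].
Qed.

Lemma iid_law_rectangle n (B : 'I_n -> set E) : (forall i, measurable (B i)) ->
  iid_law n (rectangle B) = (\prod_(i < n) m (B i))%E.
Proof.
elim: n B => [|n IH] B mB.
  rewrite big_ord0 /= diracE mem_set//; last by case.
rewrite big_ord_recl /= /distribution /pushforward/=.
rewrite (_ : _ @^-1` _ = B ord0 `*` rectangle (fun i => B (lift ord0 i))); last first.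
  apply/seteqP; split => -[x y] /=.
    by move=> h; split => [|i]; [have := h ord0|have := h (lift ord0 i); rewrite tnthS].
  move=> [h0 h] i; case: (unliftP ord0 i) => [j|] ->; last exact: h0.
  by rewrite tnthS; exact: h.
rewrite product_measure1E//; last exact: measurable_rectangle.
by congr (_ * _)%E; exact: (IH (fun i => B (lift ord0 i))).
Qed.

Lemma ge0_integral_iid_lawS n (f : n.+1.-tuple E -> \bar R) :
  measurable_fun setT f -> (forall x, (0 <= f x)%E) ->
  (\int[iid_law n.+1]_x f x = \int[iid_law n]_y \int[m]_x f (tuple_cons (x, y)))%E.
Proof.
move=> mf f0; rewrite /= ge0_integral_distribution// fubini_tonelli2//; last by move=> ?; exact: f0.
by apply: measurableT_comp => //; exact: measurable_tuple_cons.
Qed.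

Lemma measurable_tuple_consl n (y : n.-tuple E) :
  measurable_fun setT (fun x => tuple_cons (x, y)).
Proof. by apply: measurableT_comp; [exact: measurable_tuple_cons|exact: measurable_pair2]. Qed.

(** Rectangles are stable under intersection and generate the sigma-algebra, so the law is
    determined by them. *)
Lemma iid_distribution (dO : measure_display) (O : measurableType dO)
    (P : probability O R) n (V : O -> n.-tuple E) : measurable_fun setT V ->
  iid P m V -> forall A, measurable A -> P (V @^-1` A) = iid_law n A.
Proof.
move=> mV iV A mA.
pose Vm : {mfun O >-> n.-tuple E} := HB.pack V (isMeasurableFun.Build _ _ _ _ V mV).
pose G : set (set (n.-tuple E)) :=
  [set A | exists2 B : 'I_n -> set E, (forall i, measurable (B i)) & A = rectangle B].
have rI (B C : 'I_n -> set E) : rectangle B `&` rectangle C = rectangle (fun i => B i `&` C i).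
  apply/seteqP; split => x; first by move=> [h1 h2] i; split; [exact: h1|exact: h2].
  by move=> h; split => i; case: (h i).
have GT : G setT by exists (fun=> setT) => //; apply/seteqP; split.
apply: (measure_unique G (fun=> setT) _ _ _ _ (distribution P Vm) (iid_law n)) => //.
- apply/seteqP; split; last first.
    apply: smallest_sub; first exact: sigma_algebra_measurable.
    by move=> _ [B mB ->]; exact: measurable_rectangle.
  apply: smallest_sub; first exact: smallest_sigma_algebra.
  move=> X; rewrite -bigcup_seq => -[i _ [B mB <-]]; apply: sub_sigma_algebra.
  exists (fun j => if j == i then B else setT).
    by move=> j; case: ifP.
  apply/seteqP; split => x /=; first by move=> [_ Bx] j; case: eqP => // ->.
  by move=> /(_ i); rewrite eqxx.
- by move=> _ _ [B mB ->] [C mC ->]; exists (fun i => B i `&` C i); [move=> i; exact: measurableI|exact: rI].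
- by rewrite bigcup_const.
- by move=> _ [B mB ->]; exact: etrans (iV B mB) (esym (iid_law_rectangle mB)).
- by move=> _; rewrite -ge0_fin_numE//; exact: fin_num_measure.
Qed.

Lemma iid_integral (dO : measure_display) (O : measurableType dO)
    (P : probability O R) n (V : O -> n.-tuple E) (f : n.-tuple E -> \bar R) :
  measurable_fun setT V -> iid P m V -> measurable_fun setT f ->
  (forall x, (0 <= f x)%E) ->
  (\int[P]_w f (V w) = \int[iid_law n]_x f x)%E.
Proof.
move=> mV iV mf f0.
pose Vm : {mfun O >-> n.-tuple E} := HB.pack V (isMeasurableFun.Build _ _ _ _ V mV).
have := ge0_integral_distribution Vm mf f0 => <-.
by apply: eq_measure_integral => A mA _; exact: (iid_distribution mV iV).
Qed.

Lemma iid_integralD (dO : measure_display) (O : measurableType dO)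
    (P : probability O R) n (V : O -> n.-tuple E) (f g : n.-tuple E -> \bar R) :
  measurable_fun setT V -> iid P m V ->
  measurable_fun setT f -> (forall x, (0 <= f x)%E) ->
  measurable_fun setT g -> (forall x, (0 <= g x)%E) ->
  (\int[P]_w (f (V w) + g (V w)) = \int[iid_law n]_x f x + \int[iid_law n]_x g x)%E.
Proof.
move=> mV iV mf f0 mg g0.
rewrite ge0_integralD//; [|exact: (measurableT_comp mf)|exact: (measurableT_comp mg)].
by rewrite (iid_integral mV iV mf f0) (iid_integral mV iV mg g0).
Qed.

(** Integrating out one coordinate at a time gives an affine recursion; it is used with b = 0 for
    the hyperbolic cosine and with a = 1 for the variance. *)
Lemma iid_integral_iterate (F : forall n, n.-tuple E -> R) (a b : R) :
  (forall n, measurable_fun setT (F n)) -> (forall n x, 0 <= F n x) -> 0 <= a -> 0 <= b ->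
  (forall n (y : n.-tuple E), (\int[m]_x (F n.+1 (tuple_cons (x, y)))%:E <= (a * F n y + b)%:E)%E) ->
  forall n, (\int[iid_law n]_x (F n x)%:E <= (iter n (fun z => a * z + b) (F 0%N [tuple]))%:E)%E.
Proof.
move=> mF F0 a0 b0 step.
have mEF k : measurable_fun setT (fun x => (F k x)%:E) by apply/measurable_EFinP; exact: mF.
elim=> [|n IH].
  rewrite /= integral_dirac//; last exact: mEF.
  by rewrite diracT mul1e.
rewrite ge0_integral_iid_lawS//; last by move=> x; rewrite lee_fin.
apply: (@le_trans _ _ (\int[iid_law n]_y (a * F n y + b)%:E)%E).
  apply: ge0_le_integral => //.
  - by move=> y _; apply: integral_ge0 => x _; rewrite lee_fin.
  - apply: (@measurable_fun_fubini_tonelli_G _ _ _ _ _ m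
      (fun p : E * n.-tuple E => (F n.+1 (tuple_cons p))%:E)).
    + by apply: (measurableT_comp (mEF n.+1)); exact: measurable_tuple_cons.
    + by move=> p; rewrite lee_fin.
  - apply/measurable_EFinP; apply: measurable_funD => //; apply: measurable_funM => //; exact: mF.
rewrite /=; under eq_integral do rewrite EFinD EFinM.
have hp y : (0 <= a%:E * (F n y)%:E)%E by rewrite -EFinM lee_fin mulr_ge0.
have hm : measurable_fun setT (fun y => a%:E * (F n y)%:E)%E.
  by apply: emeasurable_funM => //; exact: mEF.
rewrite ge0_integralD//.
rewrite (ge0_integralZl _ measurableT (mEF n))//; last by move=> y _; rewrite lee_fin.
have e : iid_law n setT = 1%E := probability_setT _.
rewrite integral_cst// [X in (b%:E * X)%E]e mule1 EFinD leeD2r// EFinM.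
exact: lee_wpmul2l.
Qed.

End iid_law.

Section point_deviation.
Context {R : realType} (n : nat) (r : R).
Hypotheses (n2 : (2 <= n)%N) (r01 : 0 < r < 1).
Notation E := (n.-tuple R).
Notation cut := (@cutnorm R n).
Variables (m : probability E R) (e : E).
Hypotheses (m1 : mom1 m) (e1 : enorm e = 1).

(* The Fourier transform of [delta_v - m]. *)
Definition point_dev (v : E) b xi : R := trig b (dotp xi v) - TF m b xi.

Lemma mom1_dirac (v : E) : mom1 (\d_v : probability E R).
Proof.
apply/integrableP; split; first by apply/measurable_EFinP; exact: measurable_enorm.
rewrite integral_dirac//; first by rewrite diracT mul1e ltry.
by apply: measurableT_comp => //; apply/measurable_EFinP; exact: measurable_enorm.
Qed.

Lemma Rintegral_dirac (v : E) (f : E -> R) : measurable_fun setT f ->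
  \int[\d_v]_x f x = f v.
Proof.
by move=> mf; rewrite /Rintegral integral_dirac ?diracT ?mul1e//; exact/measurable_EFinP.
Qed.

Lemma point_devE v : point_dev v = TFB \d_v m.
Proof.
apply/funext => b; apply/funext => xi; rewrite /point_dev /TFB; congr (_ - _).
by rewrite /TF Rintegral_dirac//; case: (bmf_trig b xi).
Qed.

Lemma hdom_point_dev v : hdom (point_dev v).
Proof. by rewrite point_devE; exact: (hdom_TFB (mom1_dirac v) m1). Qed.

Let bound (v : E) : R := 2 + enorm v + \int[m]_x enorm x.

Let bound_ge0 v : 0 <= bound v.
Proof.
by rewrite !addr_ge0 ?enorm_ge0//; apply: Rintegral_ge0 => x _; exact: enorm_ge0.
Qed.

Let point_dev_le v b xi : `|point_dev v b xi| <= bound v * cut xi.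
Proof.
rewrite point_devE; have := TF_sub_cut b xi (mom1_dirac v) m1.
by rewrite (Rintegral_dirac _ (@measurable_enorm R n)).
Qed.

Lemma measurable_point_dev b : measurable_fun setT (fun p : E * E => point_dev p.1 b p.2).
Proof.
apply: measurable_funB; last by apply: (measurableT_comp (measurable_TF m b)).
by apply: measurableT_comp; [exact: measurable_trig|exact: measurable_dotp].
Qed.

Let bound_integrable : m.-integrable setT (EFin \o bound).
Proof.
have := integrableD measurableT (bmf_integrable m (bmf_cst (2 + \int[m]_x @enorm R n x))) m1.
by congr integrable; apply/funext => v /=; rewrite -EFinD /bound addrAC.
Qed.

Lemma mean_point_dev b xi : \int[m]_v point_dev v b xi = 0.
Proof.
rewrite (bmf_RintegralB m (bmf_trig b xi) (bmf_cst _)) Rintegral_prob_cst.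
exact: subrr.
Qed.

Lemma ip_point_dev_integrable f : hdom f ->
  m.-integrable setT (EFin \o (fun v => ip r f (point_dev v))).
Proof.
move=> hf; exact: (ip_section_integrable n2 r01 measurable_point_dev bound_integrable
  bound_ge0 point_dev_le hf).
Qed.

Lemma mean_ip_point_dev f : hdom f -> \int[m]_v ip r f (point_dev v) = 0.
Proof.
move=> hf; rewrite -(ip_average n2 r01 measurable_point_dev bound_integrable point_dev_le hf).
rewrite (_ : (fun _ _ => _) = fun _ _ => 0); first exact: ip0r.
by apply/funext => b; apply/funext => xi; rewrite mean_point_dev.
Qed.

Definition point_dist v : R := hnorm r (point_dev v).

Lemma point_dist_ge0 v : 0 <= point_dist v. Proof. exact: hnorm_ge0. Qed.

Lemma measurable_point_dist : measurable_fun setT point_dist.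
Proof.
apply: (@measurableT_comp _ _ _ _ _ _ (@Num.sqrt R)).
  by apply: continuous_measurable_fun => x; exact: sqrt_continuous.
apply: (@measurable_Rintegral _ _ _ _ _ (lebesgue_tuple R n)
  (fun p : E * E => pairing (point_dev p.1) (point_dev p.1) p.2 * fw r p.2)).
apply: measurable_funM; last by apply: measurableT_comp => //; exact: measurable_fw.
by apply: measurable_funD; apply: measurable_funM; exact: measurable_point_dev.
Qed.

(** Triangle inequality through delta_0, with |delta_v - delta_0| = C_r |v|^r: exponential moments
    of order r control those of this distance. *)
Lemma point_dist_le v :
  point_dist v <= point_dist origin + Num.sqrt (2 * @coskernel R n r e) * enorm v `^ r.
Proof.
pose f c xi : R := trig c (dotp xi v) - trig c (dotp xi origin).
have fE : f = TFB (\d_v : probability E R) (\d_(origin : E) : probability E R).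
  apply/funext => c; apply/funext => xi; rewrite /f /TFB /TF !Rintegral_dirac//;
    by case: (bmf_trig c xi).
have hf : hdom f by rewrite fE; apply: hdom_TFB; exact: mom1_dirac.
have := hnorm_lin_le n2 r01 1 (hdom_point_dev origin) hf.
rewrite normr1 mul1r (_ : (fun _ _ => _) = point_dev v); last first.
  by apply/funext => b; apply/funext => xi; rewrite mul1r /f /point_dev; ring.
move=> /le_trans; apply; rewrite lerD2l /hnorm /f (ip_point_masses n2 r01).
rewrite (coskernel_scale n2 r01 _ e1) (_ : vsub v origin = v); last first.
  by apply: eq_from_tnth => i; rewrite !tnth_mktuple subr0.
rewrite mulrCA mulrC sqrtrM; last by rewrite mulr_ge0// coskernel_ge0.
by rewrite (mulrC 2 r) powRrM powR_mulrn ?powR_ge0// sqrtr_sqr ger0_norm// powR_ge0.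
Qed.

End point_deviation.

Section initial_law.
Context {R : realType} (n : nat) (r : R).
Hypotheses (n2 : (2 <= n)%N) (r01 : 0 < r < 1).
Notation E := (n.-tuple R).
Variables (m : probability E R).
Hypotheses (m1 : mom1 m).
Variable c : R.
Hypothesis c0 : 0 <= c.
Notation Z := (point_dev m).
Notation z := (point_dist r m).
Hypothesis Iexp : m.-integrable setT (EFin \o (fun v => expR (c * z v) - 1 - c * z v)).

Let S k (x : k.-tuple E) b xi : R := \sum_(i < k) Z (tnth x i) b xi.

Let hdom_S k (x : k.-tuple E) : hdom (S x).
Proof. by apply: hdom_sum => i; exact: hdom_point_dev. Qed.

Let F k (x : k.-tuple E) : R := ch (c * hnorm r (S x)).

Let measurable_F k : measurable_fun setT (@F k).
Proof.
apply: (measurableT_comp (@measurable_ch R)); apply: measurable_funM => //.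
apply: (@measurableT_comp _ _ _ _ _ _ (@Num.sqrt R)).
  by apply: continuous_measurable_fun => x; exact: sqrt_continuous.
apply: (@measurable_Rintegral _ _ _ _ _ (lebesgue_tuple R n)
  (fun p : k.-tuple E * E => pairing (S p.1) (S p.1) p.2 * fw r p.2)).
have mS b : measurable_fun setT (fun p : k.-tuple E * E => S p.1 b p.2).
  apply: measurable_sum => i.
  have h := measurableT_comp (measurable_point_dev m b) (_ : measurable_fun setT
    (fun p : k.-tuple E * E => (tnth p.1 i, p.2))); apply: h.
  apply/measurable_fun_pair => //.
  exact: (measurableT_comp (measurable_tnth i) (@measurable_fst _ _ (k.-tuple E) E)).
apply: measurable_funM; last by apply: measurableT_comp => //; exact: measurable_fw.
by apply: measurable_funD; apply: measurable_funM; exact: mS.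
Qed.

(** The last factor of Pinelis' inequality averaged over one particle: each particle multiplies the
    expected hyperbolic cosine by at most 1 + excess. *)
Definition excess : R := \int[m]_v (expR (c * z v) - 1 - c * z v).

Lemma excess_ge0 : 0 <= excess.
Proof.
by apply: Rintegral_ge0 => v _; have := expR_ge1Dx (c * z v); lra.
Qed.

Let F_cons k (x : E) (y : k.-tuple E) : F (tuple_cons (x, y)) <=
  F y + sh (c * hnorm r (S y)) / (c * hnorm r (S y)) * c ^+ 2 * ip r (S y) (Z x)
  + F y * (expR (c * z x) - 1 - c * z x).
Proof.
set a := c * hnorm r (S y).
have a0 : 0 <= a by rewrite mulr_ge0// hnorm_ge0.
have b0 : 0 <= c * z x by rewrite mulr_ge0// point_dist_ge0.
have hS := hdom_S y; have hZ := hdom_point_dev m1 x.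
have mq : `|c ^+ 2 * ip r (S y) (Z x)| <= a * (c * z x).
  rewrite normrM (ger0_norm (sqr_ge0 c)) (_ : a * _ = c ^+ 2 * (hnorm r (S y) * z x)).
    by rewrite ler_wpM2l ?sqr_ge0//; exact: ip_le.
  by rewrite /a; ring.
have := ch_sqrt_le a0 b0 mq; rewrite /F -/a -[_ / a * c ^+ 2 * _]mulrA.
suff -> : Num.sqrt (a ^+ 2 + 2 * (c ^+ 2 * ip r (S y) (Z x)) + (c * z x) ^+ 2) =
  c * hnorm r (S (tuple_cons (x, y))) by [].
rewrite -[RHS]ger0_norm; last by rewrite mulr_ge0// hnorm_ge0.
rewrite -sqrtr_sqr; congr Num.sqrt; rewrite [RHS]exprMn sqr_hnorm.
have -> : S (tuple_cons (x, y)) = fun b xi => S y b xi + 1 * Z x b xi.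
  apply/funext => b; apply/funext => xi; rewrite /S big_ord_recl tnth0 mul1r addrC.
  by congr (_ + _); apply: eq_bigr => i _; rewrite tnthS.
rewrite (ip_sqr_lin n2 r01 1 hS hZ) /a /point_dist -!sqr_hnorm; ring.
Qed.

(** The linear term of [F_cons] averages to 0 because delta_v - m is centered. *)
Let F_step k (y : k.-tuple E) :
  (\int[m]_x (F (tuple_cons (x, y)))%:E <= ((1 + excess) * F y + 0)%:E)%E.
Proof.
set A := sh (c * hnorm r (S y)) / (c * hnorm r (S y)) * c ^+ 2.
have hS := hdom_S y.
have Ii := integrableZl measurableT A (ip_point_dev_integrable n2 r01 m1 hS).
have I1 := integrableD measurableT (bmf_integrable m (bmf_cst (F y))) Ii.
have I2 := integrableZl measurableT (F y) Iexp.
have I12 := integrableD measurableT I1 I2.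
pose G x := F y + A * ip r (S y) (Z x) + F y * (expR (c * z x) - 1 - c * z x).
have IG : m.-integrable setT (EFin \o G) by have := I12; congr integrable.
have EG : \int[m]_x G x = (1 + excess) * F y + 0.
  rewrite (RintegralD (f1 := fun x => F y + A * ip r (S y) (Z x))
    (f2 := fun x => F y * (expR (c * z x) - 1 - c * z x)))//.
  rewrite (RintegralD (f1 := fun=> F y) (f2 := fun x => A * ip r (S y) (Z x)))//; last first.
    exact: bmf_integrable (bmf_cst _).
  rewrite Rintegral_prob_cst RintegralZl//; last exact: ip_point_dev_integrable.
  rewrite mean_ip_point_dev// RintegralZl//; rewrite /excess; ring.
rewrite -EG /Rintegral fineK; last exact: (integrable_fin_num measurableT IG).
apply: ge0_le_integral => //.
- by move=> x _; rewrite lee_fin (le_trans ler01)// ch_ge1.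
- apply/measurable_EFinP.
  exact: (measurableT_comp (@measurable_F k.+1) (measurable_tuple_consl y)).
- by have /integrableP[] := IG.
- by move=> x _; rewrite lee_fin; exact: F_cons.
Qed.

Lemma iid_cosh_le N : (\int[iid_law m N]_x (ch (c * N%:R * dist r m x))%:E <=
  (expR (N%:R * excess))%:E)%E.
Proof.
have [->|N0] := posnP N.
  rewrite !mul0r expR0 mulr0.
  under eq_integral do rewrite mul0r ch0.
  rewrite integral_cst//.
  by have e : iid_law m 0 setT = 1%E := probability_setT _; rewrite [X in (_ * X)%E]e mule1.
have cS (x : N.-tuple E) : c * N%:R * dist r m x = c * hnorm r (S x).
  have NR : 0 < N%:R :> R by rewrite ltr0n.
  rewrite /dist.
  have -> : S x = fun b xi => N%:R * deviation m x b xi.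
    apply/funext => b; apply/funext => xi.
    rewrite /S /deviation /empTF /point_dev sumrB sumr_const card_ord mulrBr mulrA divff ?gt_eqF//.
    by rewrite mul1r -[TF m b xi *+ N]mulr_natl.
  have hX := hdom_deviation N0 x m1.
  have hNX : hdom (fun b xi => N%:R * deviation m x b xi).
    have := hdom_lin N%:R (@hdom0 R n) hX; congr hdom.
    by apply/funext => b; apply/funext => xi; rewrite add0r.
  rewrite /hnorm (ipZr n2 r01)// ipC (ipZr n2 r01)// mulrA -expr2 sqrtrM ?sqr_ge0//.
  by rewrite sqrtr_sqr ger0_norm ?(ltW NR)// mulrA.
under eq_integral do rewrite cS.
have := @iid_integral_iterate R _ E m F (1 + excess) 0 measurable_F _ _ (lexx 0) F_step N.
move=> h; apply: le_trans (h _ _) _.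
- by move=> k x; rewrite (le_trans ler01)// ch_ge1.
- by rewrite addr_ge0// excess_ge0.
rewrite lee_fin.
have -> : F ([tuple] : 0.-tuple E) = 1.
  rewrite /F (_ : S _ = fun _ _ => 0); last first.
    by apply/funext => b; apply/funext => xi; rewrite /S big_ord0.
  by rewrite /hnorm ip0r sqrtr0 mulr0 ch0.
have -> k : iter k (fun z : R => (1 + excess) * z + 0) 1 = (1 + excess) ^+ k.
  by elim: k => //= k ->; rewrite addr0 exprS.
rewrite expRM_natl ler_pXn2r ?nnegrE ?expR_ge0 ?addr_ge0 ?excess_ge0//.
exact: expR_ge1Dx.
Qed.

End initial_law.

Section energy_law.
Context {R : realType} {dE : measure_display} {E : measurableType dE}.
Variables (m : probability E R) (y : E -> R) (M : R).
Hypotheses (my : measurable_fun setT y).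
Hypothesis I1 : m.-integrable setT (EFin \o y).
Hypothesis I2 : m.-integrable setT (EFin \o (fun v => y v ^+ 2)).
Hypothesis yM : \int[m]_v y v = M.

Let S k (x : k.-tuple E) : R := \sum_(i < k) (y (tnth x i) - M).
Let var : R := \int[m]_v (y v ^+ 2) + M ^+ 2.

Let mS k : measurable_fun setT (@S k).
Proof.
apply: measurable_sum => i; apply: measurable_funB => //.
exact: (measurableT_comp my (measurable_tnth i)).
Qed.

(** A new coordinate adds its variance, bounded with + M^2 in place of - M^2: for Chebyshev's
    inequality only the order N matters. *)
Lemma iid_variance N : (\int[iid_law m N]_x ((\sum_(i < N) (y (tnth x i) - M)) ^+ 2)%:E <=
  (N%:R * (\int[m]_v (y v ^+ 2) + M ^+ 2))%:E)%E.
Proof.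
have v0 : 0 <= var.
  by rewrite addr_ge0 ?sqr_ge0//; apply: Rintegral_ge0 => v _; exact: sqr_ge0.
apply: (le_trans (@iid_integral_iterate R _ E m (fun k x => S x ^+ 2) 1 var _ _ ler01 v0 _ N)).
- by move=> k; apply: measurable_funX; exact: mS.
- by move=> k x; exact: sqr_ge0.
- move=> k x; rewrite mul1r.
  have Sc v : S (tuple_cons (v, x)) ^+ 2 = y v ^+ 2 + (2 * (S x - M)) * y v + (S x - M) ^+ 2.
    rewrite /S big_ord_recl tnth0.
    under eq_bigr do rewrite tnthS.
    by move: (\sum_(i < k) _) => s; ring.
  have J1 := integrableZl measurableT (2 * (S x - M)) I1.
  have J2 := integrableD measurableT I2 J1.
  have J3 := integrableD measurableT J2 (bmf_integrable m (bmf_cst ((S x - M) ^+ 2))).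
  pose G v := y v ^+ 2 + (2 * (S x - M)) * y v + (S x - M) ^+ 2.
  have IG : m.-integrable setT (EFin \o G) by have := J3; congr integrable.
  under eq_integral do rewrite Sc.
  have -> : (\int[m]_v (G v)%:E = (\int[m]_v G v)%:E)%E.
    by rewrite /Rintegral fineK//; exact: (integrable_fin_num measurableT IG).
  rewrite lee_fin (RintegralD (f1 := fun v => y v ^+ 2 + (2 * (S x - M)) * y v)
    (f2 := fun=> (S x - M) ^+ 2))//; last exact: bmf_integrable (bmf_cst _).
  rewrite (RintegralD (f1 := fun v => y v ^+ 2) (f2 := fun v => (2 * (S x - M)) * y v))//.
  rewrite Rintegral_prob_cst RintegralZl// yM /var.
  by have := sqr_ge0 M; move: (\int[m]_v _) (S x) => *; lra.
rewrite lee_fin /S big_ord0 expr0n /=.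
have -> k : iter k (fun z : R => 1 * z + var) 0 = k%:R * var.
  by elim: k => [|k IH] /=; rewrite ?mul0r// IH mul1r -natr1 mulrDl mul1r.
by [].
Qed.

End energy_law.

Section exponential_moments.
Context {R : realType} (n : nat).
Notation E := (n.-tuple R).
Variable m : probability E R.

(** The inequality y/k <= e^(y/k) raised to the power k. *)
Lemma exprn_le_expR (y : R) k : 0 <= y -> y ^+ k <= k%:R ^+ k * expR y.
Proof.
move=> y0; have [->|k0] := posnP k.
  by rewrite !expr0 mul1r -expR0 ler_expR.
have kR : 0 < k%:R :> R by rewrite ltr0n.
have e : expR y = expR (y / k%:R) ^+ k.
  by rewrite -expRM_natl mulrC divfK// gt_eqF.
rewrite e -exprMn ler_pXn2r ?nnegrE ?mulr_ge0 ?expR_ge0 ?(ltW kR)//.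
have := expR_ge1Dx (y / k%:R) => h.
rewrite mulrC -ler_pdivrMr//; apply: le_trans h; lra.
Qed.

Lemma expR_le1D (y : R) : expR y <= 1 + y * expR y.
Proof.
have := expR_ge1Dx (- y); have := expRM_inv y; have := expR_gt0 y.
move: (expR _) (expR _) => p q; nra.
Qed.

Let measurable_exp (b p : R) : measurable_fun setT (fun v : E => expR (b * enorm v `^ p)).
Proof.
apply: (measurableT_comp (@measurable_expR R)); apply: measurable_funM => //.
apply: (measurableT_comp (@measurable_powR R p)); exact: measurable_enorm.
Qed.

Lemma exp_dominated (b p C : R) (h : E -> R) :
  (\int[m]_v (expR (b * enorm v `^ p))%:E < +oo)%E ->
  measurable_fun setT h -> (forall v, `|h v| <= C * expR (b * enorm v `^ p)) ->
  m.-integrable setT (EFin \o h).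
Proof.
move=> bm mh hC.
have Ie : m.-integrable setT (EFin \o (fun v => expR (b * enorm v `^ p))).
  apply/integrableP; split; first exact/measurable_EFinP.
  by under eq_integral do rewrite /= ger0_norm ?expR_ge0//.
apply: (le_integrable measurableT _ _ (integrableZl measurableT C Ie)).
- exact/measurable_EFinP.
- by move=> v _ /=; rewrite lee_fin; apply: le_trans (hC v) (ler_norm _).
Qed.

(** Every power of |v| is a power of u = |v|^(1/2), which e^(b u) dominates. *)
Lemma enorm_integrable j : exp_moment m 2^-1 ->
  m.-integrable setT (EFin \o (fun v => enorm v ^+ j)).
Proof.
move=> [b b0 bm].
pose k := (2 * j)%N.
apply: (exp_dominated (C := b^-1 ^+ k * k%:R ^+ k) bm).
  by apply: measurable_funX; exact: measurable_enorm.
move=> v; set u := enorm v `^ 2^-1.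
have u0 : 0 <= u by exact: powR_ge0.
have ue : enorm v = u ^+ 2.
  by rewrite -powR_mulrn// /u -powRrM mulVf ?pnatr_eq0// powRr1 ?enorm_ge0.
rewrite ger0_norm ?exprn_ge0 ?enorm_ge0// ue -exprM -/k.
have := exprn_le_expR k (mulr_ge0 (ltW b0) u0); rewrite exprMn => h.
by rewrite exprVn -mulrA ler_pdivlMl ?exprn_gt0.
Qed.

Lemma exp_moment_mom1 : exp_moment m 2^-1 -> mom1 m.
Proof.
by move/(enorm_integrable 1); congr integrable; apply/funext => v /=; rewrite expr1.
Qed.

Variable r : R.
Hypotheses (n2 : (2 <= n)%N) (r01 : 0 < r < 1).
Variable e : E.
Hypothesis e1 : enorm e = 1.
Notation z := (point_dist r m).

(** From e^y - 1 - y <= (y^2 / 2) e^y and e^y <= 1 + y e^y: the leading term has the exact constant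
    1/2 of a Gaussian, and the remainder is of order c^3. *)
Lemma excess_le : mom1 m -> exp_moment m r ->
  m.-integrable setT (EFin \o (fun v => z v ^+ 2)) /\
  exists delta M3 : R, [/\ 0 < delta, 0 <= M3 & forall c, 0 <= c <= delta ->
    m.-integrable setT (EFin \o (fun v => expR (c * z v) - 1 - c * z v)) /\
    excess r m c <= c ^+ 2 / 2 * \int[m]_v (z v ^+ 2) + c ^+ 3 / 2 * M3].
Proof.
move=> m1 [b b0 bm].
set s := Num.sqrt (2 * @coskernel R n r e).
have s0 : 0 <= s by exact: sqrtr_ge0.
(* So that 2 delta s <= b, which makes e^(2 delta z) integrable: one factor e^(delta z) absorbs the
   powers of z, the other remains in the cubic term. *)
pose delta := b / (2 * (s + 1)).
have s1 : 0 < 2 * (s + 1) by rewrite mulr_gt0// ltr_wpDl.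
have d0 : 0 < delta by rewrite divr_gt0.
pose C := expR (2 * delta * z origin).
have mz := measurable_point_dist r m.
have z0 v := point_dist_ge0 r m v.
have ze v : expR (2 * delta * z v) <= C * expR (b * enorm v `^ r).
  rewrite /C -expRD ler_expR; have u0 : 0 <= enorm v `^ r by exact: powR_ge0.
  have d20 : 0 <= 2 * delta by rewrite mulr_ge0// ltW.
  apply: le_trans (ler_wpM2l d20 (point_dist_le n2 r01 m1 e1 v)) _.
  rewrite mulrDr lerD2l -/s mulrA ler_wpM2r//.
  have -> : 2 * delta * s = b * (s / (s + 1)).
    by rewrite /delta; field; rewrite gt_eqF ?ltr_wpDl//= gt_eqF.
  by rewrite ler_piMr ?(ltW b0)// ler_pdivrMr ?ltr_wpDl// mul1r lerDl.
have C0 : 0 <= C by exact: expR_ge0.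
have dz v : 0 <= delta * z v by rewrite mulr_ge0// ltW.
have I2 : m.-integrable setT (EFin \o (fun v => z v ^+ 2)).
  apply: (exp_dominated (C := delta^-1 ^+ 2 * 2%:R ^+ 2 * C) bm).
    exact: measurable_funX.
  move=> v; rewrite ger0_norm ?sqr_ge0//.
  have h : expR (delta * z v) <= C * expR (b * enorm v `^ r).
    by apply: le_trans (ze v); rewrite ler_expR -mulrA ler_peMl// ler1n.
  have := exprn_le_expR 2 (dz v); rewrite exprMn => h2.
  have -> : delta^-1 ^+ 2 * 2%:R ^+ 2 * C * expR (b * enorm v `^ r) =
      (delta ^+ 2)^-1 * (2%:R ^+ 2 * (C * expR (b * enorm v `^ r))) by rewrite exprVn !mulrA.
  rewrite ler_pdivlMl ?exprn_gt0//; apply: le_trans h2 _.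
  exact: (ler_wpM2l _ h).
have zz v : expR (delta * z v) * expR (delta * z v) <= C * expR (b * enorm v `^ r).
  by apply: le_trans (ze v); rewrite -expRD ler_expR -mulrA mulr_natl mulr2n.
have zzz v : z v ^+ 3 * expR (delta * z v) <= delta^-1 ^+ 3 * 3%:R ^+ 3 * C * expR (b * enorm v `^ r).
  have := exprn_le_expR 3 (dz v); rewrite exprMn => h3.
  have -> : delta^-1 ^+ 3 * 3%:R ^+ 3 * C * expR (b * enorm v `^ r) =
      (delta ^+ 3)^-1 * (3%:R ^+ 3 * (C * expR (b * enorm v `^ r))) by rewrite exprVn !mulrA.
  rewrite ler_pdivlMl ?exprn_gt0// [leLHS]mulrA.
  apply: (@le_trans _ _ (3%:R ^+ 3 * expR (delta * z v) * expR (delta * z v))).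
    by rewrite ler_wpM2r ?expR_ge0.
  rewrite -[leLHS]mulrA; apply: ler_wpM2l; first by rewrite exprn_ge0// ler0n.
  exact: zz.
have z30 v : 0 <= z v ^+ 3 * expR (delta * z v).
  by rewrite mulr_ge0 ?expR_ge0// exprn_ge0.
have I3 : m.-integrable setT (EFin \o (fun v => z v ^+ 3 * expR (delta * z v))).
  apply: (exp_dominated bm) => [|v].
    apply: measurable_funM; first exact: measurable_funX.
    by apply: (measurableT_comp (@measurable_expR R)); exact: measurable_funM.
  by rewrite ger0_norm//; exact: zzz.
split => //; exists delta, (\int[m]_v (z v ^+ 3 * expR (delta * z v))); split => //.
  by apply: Rintegral_ge0 => v _.
move=> c /andP[c0 cd].
have cz v : 0 <= c * z v by rewrite mulr_ge0.
have cle v : expR (c * z v) <= expR (delta * z v) by rewrite ler_expR ler_wpM2r.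
have ex0 v : 0 <= expR (c * z v) - 1 - c * z v by have := expR_ge1Dx (c * z v); lra.
have Iexp : m.-integrable setT (EFin \o (fun v => expR (c * z v) - 1 - c * z v)).
  apply: (exp_dominated (C := C) bm) => [|v].
    apply: measurable_funB; last exact: measurable_funM.
    apply: measurable_funB => //.
    by apply: (measurableT_comp (@measurable_expR R)); exact: measurable_funM.
  rewrite ger0_norm//; apply: le_trans (ze v).
  have : expR (delta * z v) <= expR (2 * delta * z v) by rewrite ler_expR -mulrA ler_peMl// ler1n.
  have := cle v; have := cz v; lra.
split => //.
have pw v : expR (c * z v) - 1 - c * z v <=
    c ^+ 2 / 2 * z v ^+ 2 + c ^+ 3 / 2 * (z v ^+ 3 * expR (delta * z v)).
  apply: le_trans (expR_sub_le (cz v)) _.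
  have h : expR (c * z v) <= 1 + c * z v * expR (delta * z v).
    by apply: le_trans (expR_le1D _) _; rewrite lerD2l; exact: ler_wpM2l (cz v) _ _ (cle v).
  have q0 : 0 <= (c * z v) ^+ 2 / 2 by rewrite divr_ge0// sqr_ge0.
  have := ler_wpM2l q0 h; rewrite mulrDr mulr1 => /le_trans; apply.
  rewrite le_eqVlt; apply/orP; left; apply/eqP; move: (expR _) => w; ring.
have J2 := integrableZl measurableT (c ^+ 2 / 2) I2.
have J3 := integrableZl measurableT (c ^+ 3 / 2) I3.
have IG : m.-integrable setT (EFin \o (fun v => c ^+ 2 / 2 * z v ^+ 2 +
    c ^+ 3 / 2 * (z v ^+ 3 * expR (delta * z v)))).
  by have := integrableD measurableT J2 J3; congr integrable.
have := le_Rintegral measurableT Iexp IG (fun v _ => pw v); rewrite /excess => /le_trans; apply.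
rewrite RintegralD// RintegralZl// RintegralZl//.
Qed.

Lemma sobolev_varianceE : mom1 m ->
  sobolev_variance (n%:R / 2 + r) m = \int[m]_v (z v ^+ 2).
Proof.
move=> m1; rewrite /sobolev_variance /Rintegral; congr fine; apply: eq_integral => v _.
have hd : hdom (TFB \d_v m) by rewrite -point_devE; exact: hdom_point_dev.
by rewrite (hsobolevE n2 r01 hd) -point_devE EFin_expe.
Qed.

End exponential_moments.

Section energy_concentration.
Context {R : realType} (n : nat).
Notation E := (n.-tuple R).
Variables (m : probability E R) (k1 : R).
Hypotheses (hexp : exp_moment m 2^-1) (hk : kinetic m < k1).

(** The mean of |v|^2 is 2 k < 2 k1, so high energy is a deviation of order N for a sum of variance
    O(N). *)
Lemma low_energy_law : exists2 C : R, 0 <= C & forall N, (0 < N)%N ->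
  (iid_law m N (~` low_energy k1) <= (C / N%:R)%:E)%E.
Proof.
pose y (v : E) := enorm v ^+ 2.
have I1 : m.-integrable setT (EFin \o y) by exact: enorm_integrable.
have I2 : m.-integrable setT (EFin \o (fun v => y v ^+ 2)).
  have := enorm_integrable 4 hexp; congr integrable; apply/funext => v /=.
  by rewrite /y -exprM.
have my : measurable_fun setT y by apply: measurable_funX; exact: measurable_enorm.
set M := \int[m]_v y v.
have gap : 0 < 2 * k1 - M.
  by move: hk; rewrite /kinetic -/M; lra.
pose W := \int[m]_v (y v ^+ 2) + M ^+ 2.
have W0 : 0 <= W by rewrite addr_ge0 ?sqr_ge0//; apply: Rintegral_ge0 => v _; exact: sqr_ge0.
exists (W / (2 * k1 - M) ^+ 2); first by rewrite divr_ge0// sqr_ge0.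
move=> N N0; have NR : 0 < N%:R :> R by rewrite ltr0n.
pose K := (N%:R * (2 * k1 - M)) ^+ 2.
have K0 : 0 < K by rewrite exprn_gt0// mulr_gt0.
have mB : measurable (~` low_energy k1 : set (N.-tuple E)).
  by apply: measurableC; exact: measurable_low_energy.
have := iid_variance my I1 I2 (erefl M) N; rewrite -/W => var.
have h : (K%:E * iid_law m N (~` low_energy k1) <= (N%:R * W)%:E)%E.
  apply: le_trans var.
  rewrite -[X in iid_law m N X]setIT -integral_indic// -ge0_integralZl//; last 2 first.
  - by apply/measurable_EFinP; exact: measurable_indic.
  - by rewrite lee_fin ltW.
  apply: ge0_le_integral => //.
  - by move=> x _; rewrite -EFinM lee_fin mulr_ge0// ltW.
  - apply: emeasurable_funM => //; apply/measurable_EFinP; exact: measurable_indic.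
  - apply/measurable_EFinP; apply: measurable_funX; apply: measurable_sum => i.
    by apply: measurable_funB => //; exact: (measurableT_comp my (measurable_tnth i)).
  move=> x _; rewrite -EFinM lee_fin indicE.
  case: (boolP (x \in _)) => [/set_mem xB|_]; last by rewrite mulr0 sqr_ge0.
  rewrite mulr1 /K sumrB sumr_const card_ord -[M *+ N]mulr_natl.
  have : 2 * N%:R * k1 < \sum_(i < N) y (tnth x i) by rewrite ltNge; exact/negP.
  move=> hx; rewrite ler_sqr ?nnegrE; last 2 first.
  - by rewrite mulr_ge0// ltW.
  - by move: hx gap; nra.
  lra.
rewrite -(@lee_pmul2l _ K%:E)//.
apply: le_trans h _; rewrite -EFinM lee_fin le_eqVlt; apply/orP; left; apply/eqP.
by rewrite /K; field; rewrite !gt_eqF.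
Qed.

End energy_concentration.

(** * The tail bound *)

Section tail_bound.
Context {R : realType} (n N : nat) (r k1 T lambda : R).
Hypotheses (n2 : (2 <= n)%N) (r01 : 0 < r < 1) (N0 : (0 < N)%N) (k10 : 0 < k1).
Hypotheses (T0 : 0 <= T) (l0 : 0 <= lambda).
Notation E := (n.-tuple R).
Notation St := (N.-tuple E).
Variables (mu0 : probability E R) (mu : R -> probability E R).
Hypotheses (hmu : boltzmann_solution mu0 mu) (m01 : mom1 mu0).
Variables (e : E).
Hypotheses (e1 : enorm e = 1) (sc : @small_jumps R n N r k1 e lambda).
Notation K := `|kappa n r|.
Notation q := (jump_const r e * (4 * k1) `^ r / (2 * N%:R)).

Lemma dist_mu0 (W : St) : dist r (mu 0) W = dist r mu0 W.
Proof.
rewrite /dist (_ : deviation (mu 0) W = deviation mu0 W)//.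
apply/funext => b; apply/funext => xi; rewrite /deviation; congr (_ - _).
exact: (mean0 hmu).
Qed.

Section transition.
Variable p : R -> R.-pker St ~> St.
Hypotheses (hp : markov_semigroup p) (hL : has_generator p (@kac_generator R n N)).

Lemma transition_tail (theta : R) (W : St) : 0 <= theta ->
  fine (p T W [set W | theta <= dist r (mu T) W]) <=
  \1_(~` low_energy k1) W +
  2 * expR (- (rate n r lambda T * theta) + lambda ^+ 2 * q * discount (2 * K) T) *
  ch (lambda * dist r mu0 W).
Proof.
move=> th0; set B := [set _ | _].
have mT := mom1_mu n2 hmu m01 T0.
have mB : measurable B.
  rewrite (_ : B = dist r (mu T) @^-1` `[theta, +oo[); last first.
    by apply/seteqP; split => V; rewrite /B /= in_itv/= andbT.
  by rewrite -[X in measurable X]setTI; apply: measurable_dist => //; exact: measurable_itv.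
have mG : measurable (~` low_energy k1 : set St).
  by apply: measurableC; exact: measurable_low_energy.
rewrite -(evolve_indic p) //.
set lT := rate n r lambda T.
have lT0 : 0 <= lT by exact: rate_ge0.
pose f (V : St) := Phi r k1 (mu T) lT V.
have bf : bmf f by exact: (bmf_Phi n2 r01 N0 k10 mT lT0).
pose c := 2 * expR (- (lT * theta)).
have c0 : 0 <= c by rewrite mulr_ge0// expR_ge0.
have bG := bmf_indic (R := R) mG.
(* Markov's inequality in pointwise form; ch y >= e^y / 2 is the source of the factor 2 in the
   theorem. *)
have pw V : \1_B V <= \1_(~` low_energy k1) V + c * f V.
  have f0 : 0 <= f V by exact: Phi_ge0.
  have [VG|VG] := pselect (low_energy k1 V); last first.
    rewrite [X in _ <= X + _]indicE mem_set// indicE.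
    have := mulr_ge0 c0 f0; case: (V \in B) => /=; lra.
  rewrite [X in _ <= X + _]indicE memNset ?add0r; last by move=> h; exact: h VG.
  rewrite indicE; case: (boolP (V \in B)) => [/set_mem VB|_]; last by rewrite mulr_ge0.
  rewrite /f Phi_low//.
  have h1 : ch (lT * theta) <= ch (lT * dist r (mu T) V).
    by apply: ch_homo; [rewrite mulr_ge0|rewrite ler_wpM2l].
  have h2 := ch_ge_exp (lT * theta).
  have := ler_wpM2l c0 (le_trans h2 h1); apply: le_trans.
  rewrite /c mulrAC -mulrA; have := expRM_inv (lT * theta).
  move: (expR _) (expR _) => u v uv.
  have -> : 2 * (v / 2 * u) = v * u by field.
  by rewrite uv.
have := @evolve_le _ _ _ p T _ _ W (bmf_indic mB) (bmfD bG (bmfZ c bf)) pw.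
rewrite evolveD//; last exact: bmfZ.
rewrite evolveZ// (evolve_invariant n2 hp hL W mG _ T0); last first.
  by move=> V i j s s1; split => h1 h2; apply: h1; exact/(low_energy_post k1 V i j s1).
move=> /le_trans; apply; rewrite lerD2l.
have := @evolve_Phi R n N r k1 T lambda n2 r01 N0 k10 T0 l0 p hp hL mu0 mu hmu m01 e e1 sc W.
rewrite -/lT -/f; set b := lambda ^+ 2 * q * _ => h.
apply: le_trans (ler_wpM2l c0 h) _.
rewrite /c expRD -!mulrA; apply: ler_wpM2l => //; apply: ler_wpM2l; first exact: expR_ge0.
apply: ler_wpM2l; first exact: expR_ge0.
rewrite /Phi dist_mu0 indicE; case: (W \in _); rewrite ?mulr1// mulr0.
by rewrite (le_trans ler01)// ch_ge1.
Qed.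

End transition.

(** The Markov property from time 0, with the whole space as event, averages [transition_tail] over
    the initial law. As X_0 is a mean of N terms, [iid_cosh_le] is applied with lambda / N. *)
Lemma kac_tail (dO : measure_display) (Omega : measurableType dO)
    (P : probability Omega R) (V : R -> Omega -> St) (theta : R) :
  markov_process (@kac_generator R n N) P V -> iid P mu0 (V 0) -> 0 <= theta ->
  mu0.-integrable setT (EFin \o (fun v =>
    expR (lambda / N%:R * point_dist r mu0 v) - 1 - lambda / N%:R * point_dist r mu0 v)) ->
  (P [set w | (theta <= dist r (mu T) (V T w))%R] <=
   iid_law mu0 N (~` low_energy k1) +
   (2 * expR (- (rate n r lambda T * theta) + lambda ^+ 2 * q * discount (2 * K) T
              + N%:R * excess r mu0 (lambda / N%:R)))%:E)%E.
Proof.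
move=> [mV [p [hp hL hPV]]] iV th0 Iexp.
have mT := mom1_mu n2 hmu m01 T0.
set B := [set W : St | theta <= dist r (mu T) W].
have mB : measurable B.
  rewrite (_ : B = dist r (mu T) @^-1` `[theta, +oo[); last first.
    by apply/seteqP; split => W; rewrite /B /= in_itv/= andbT.
  by rewrite -[X in measurable X]setTI; apply: measurable_dist => //; exact: measurable_itv.
have hist : history V 0 [set: Omega].
  rewrite /history; set G := (X in <<s X >>).
  by have [h0 hD _] := smallest_sigma_algebra setT G; have := hD _ h0; rewrite setD0.
have := hPV 0 T (lexx 0) T0 setT B hist mB.
rewrite add0r setTI (_ : V T @^-1` B = [set w | theta <= dist r (mu T) (V T w)])// => ->.
have mV0 := mV 0 (lexx 0).
have mG : measurable (~` low_energy k1 : set St).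
  by apply: measurableC; exact: measurable_low_energy.
set c := 2 * expR (- (rate n r lambda T * theta) + lambda ^+ 2 * q * discount (2 * K) T).
have c0 : 0 <= c by rewrite mulr_ge0// expR_ge0.
pose g (W : St) := (c%:E * (ch (lambda * dist r mu0 W))%:E)%E.
have mch : measurable_fun setT (fun W : St => (ch (lambda * dist r mu0 W))%:E).
  apply/measurable_EFinP; apply: (measurableT_comp (@measurable_ch R)).
  by apply: measurable_funM => //; exact: measurable_dist.
have ch0 (W : St) : (0 <= (ch (lambda * dist r mu0 W))%:E)%E.
  by rewrite lee_fin (le_trans ler01)// ch_ge1.
have mg : measurable_fun setT g by exact: emeasurable_funM.
have g0 W : (0 <= g W)%E by rewrite mule_ge0// lee_fin.
have mI : measurable_fun setT (fun W : St => (\1_(~` low_energy k1) W)%:E : \bar R).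
  by apply/measurable_EFinP; exact: measurable_indic.
have I0 (W : St) : (0 <= (\1_(~` low_energy k1) W)%:E :> \bar R)%E by rewrite lee_fin indicE.
apply: (@le_trans _ _ (\int[P]_w ((\1_(~` low_energy k1) (V 0%R w))%:E + g (V 0%R w))%E)%E).
  apply: ge0_le_integral => //.
  - apply: (@measurableT_comp _ _ _ _ _ _ (fun W => p T W B) _ (V 0)) => //.
    exact: measurable_kernel.
  - by apply: emeasurable_funD; [exact: (measurableT_comp mI mV0)|exact: (measurableT_comp mg mV0)].
  move=> w _; have := transition_tail hp hL (V 0 w) th0; rewrite -/B -/c.
  rewrite -lee_fin fineK; first by rewrite EFinD EFinM.
  by rewrite -(transE p); exact: fin_num_measure.
rewrite (iid_integralD mV0 iV mI I0 mg g0).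
rewrite integral_indic// setIT leeD2l//.
rewrite /g (ge0_integralZl _ measurableT mch (fun W _ => ch0 W)); last by rewrite lee_fin.
have NR : 0 < N%:R :> R by rewrite ltr0n.
have lN : lambda / N%:R * N%:R = lambda by rewrite divfK// gt_eqF.
have := iid_cosh_le n2 r01 m01 (divr_ge0 l0 (ltW NR)) Iexp N; rewrite lN => h.
apply: le_trans (lee_wpmul2l _ h) _; first by rewrite lee_fin.
by rewrite -EFinM lee_fin /c [X in _ <= 2 * X]expRD [leRHS]mulrA.
Qed.

End tail_bound.

(** * Constants and the limit of many particles *)

Lemma limn_esup_le_near (R : realType) (u : (\bar R)^nat) (b : R) :
  (forall eps : R, 0 < eps -> \forall N \near \oo, (u N <= (b + eps)%:E)%E) ->
  (limn_esup u <= b%:E)%E.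
Proof.
move=> h; apply/lee_addgt0Pr => eps eps0; rewrite -EFinD.
have [M _ hM] := h eps eps0.
apply: (@le_trans _ _ (ereal_sup (u @` [set k | (M <= k)%N]))).
  by apply: ereal_inf_lbound; exists [set k | (M <= k)%N] => //; exists M.
by apply: ge_ereal_sup => _ [k /= Mk <-]; exact: hM.
Qed.

Section rate_constants.
Context {R : realType}.

(** Both sides are the integral of e^(k t) over [0, T], the left one after reversing time. *)
Lemma discount_e1 (k T : R) : 0 <= k ->
  expR (k * T) * discount k T = T * e1 (k * T).
Proof.
rewrite le_eqVlt /discount /e1 => /orP[/eqP <-|k0].
  by rewrite !mul0r !eqxx expR0 mul1r mulr1.
have [->|Tn] := eqVneq T 0.
  by rewrite !mulr0 oppr0 expR0 subrr !mul0r if_same mulr0.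
rewrite (gt_eqF k0) mulf_eq0 (gt_eqF k0) (negbTE Tn)/=.
have := expRM_inv (k * T); move: (expR _) (expR _) => u v uv.
have e : v * (1 - u) = v - 1 by rewrite mulrBr mulr1 uv.
by rewrite [LHS]mulrA e; field; rewrite Tn gt_eqF.
Qed.

(** The factor 4 in [jump_const] times C^2 / 2 gives 2 C^2, and 4^r = 2^(2r). *)
Lemma omega_jump_const (n : nat) (r k1 : R) (e : n.-tuple R) (C : R) : 0 < k1 ->
  C ^+ 2 = 2 * coskernel r e ->
  omega r C k1 = jump_const r e * (4 * k1) `^ r.
Proof.
move=> k10 C2; rewrite /omega /jump_const C2 powRM ?(ltW k10)//.
have -> : 2 `^ (1 + 2 * r) = 2 * 4 `^ r :> R.
  rewrite powRD ?pnatr_eq0 ?implybT// powRr1// powRrM powR_mulrn//; congr (_ * _ `^ _).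
  by rewrite -natrX.
by move: (coskernel r e) (2 `^ (1 - r)) (4 `^ r) (k1 `^ r) => *; ring.
Qed.

(** For a parameter of order sqrt N the condition reads 4 Y <= N^(1-r), true for large N because r <
    1. *)
Lemma small_jumps_large (n N : nat) (r k1 x : R) (e : n.-tuple R) : 0 < r < 1 -> 0 < k1 ->
  (0 < N)%N ->
  (4 * (x ^+ 2 * (jump_const r e * (4 * k1) `^ r))) `^ (1 - r)^-1 <= N%:R ->
  small_jumps N r k1 e (Num.sqrt N%:R * x).
Proof.
move=> /andP[r0 r1] k10 N0; set Y := x ^+ 2 * _ => hN.
have NR : 0 < N%:R :> R by rewrite ltr0n.
have q0 : 0 < 1 - r by rewrite subr_gt0.
have Y0 : 0 <= Y.
  rewrite mulr_ge0 ?sqr_ge0// mulr_ge0 ?powR_ge0//; apply: jump_const_ge0.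
  by rewrite r0.
have Y4 : 4 * Y <= N%:R `^ (1 - r).
  have := ge0_ler_powR (ltW q0) _ _ hN; rewrite !nnegrE powR_ge0 ltW// => /(_ isT isT).
  by rewrite -powRrM mulVf ?gt_eqF// powRr1// mulr_ge0.
have NN : N%:R `^ r * N%:R `^ (1 - r) = N%:R.
  by rewrite -powRD ?(gt_eqF NR) ?implybT// addrCA subrr addr0 powRr1// ltW.
rewrite /small_jumps exprMn sqr_sqrtr ?(ltW NR)//.
have -> : 4 * N%:R * k1 = N%:R * (4 * k1) by ring.
rewrite powRM ?(ltW NR)//; last by rewrite mulr_ge0// ltW.
have Nr0 : 0 < N%:R `^ r by rewrite powR_gt0.
have -> : N%:R * x ^+ 2 * (N%:R^-1 ^+ 2 * (jump_const r e * (N%:R `^ r * (4 * k1) `^ r))) =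
    Y * N%:R `^ r / N%:R.
  by rewrite /Y; move: (jump_const _ _) (powR _ _) (powR _ _) => *; field; rewrite gt_eqF.
rewrite ler_pdivrMr// ler_pdivlMl// -[leRHS]NN [leLHS]mulrA [leRHS]mulrC.
by rewrite ler_pM2r.
Qed.

End rate_constants.

Lemma expR_perturb (R : realType) (y t eps : R) : 0 <= y -> 0 <= t <= 2^-1 -> 8 * t <= eps ->
  2 * expR (- y + t) <= 2 * expR (- y) + eps / 2.
Proof.
move=> y0 /andP[t0 t1] te; rewrite expRD.
have ey : expR (- y) <= 1 by rewrite -expR0 ler_expR oppr_le0.
have := expR_le1D t; have := expR_gt0 (- y); have := expR_gt0 t.
move: ey; move: (expR _) (expR _) => u v ey v0 u0 h.
have v1 : v <= 1 + 2 * t by nra.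
nra.
Qed.

Unset Implicit Arguments.
Set Strict Implicit.
Set Printing Implicit Defensive.

Theorem corollary6p3 (R : realType) (d : nat) (hd : (2 <= d)%N)
  (r : R) (hr : 0 < r < 1)
  (mu0 : probability (d.-tuple R) R)
  (hmom : forall r' : R, 0 < r' < 1 -> exp_moment mu0 r')
  (hmean : forall i : 'I_d, \int[mu0]_v tnth v i = 0)
  (k1 : R) (hk1 : kinetic mu0 < k1)
  (* C_r is the norm of delta_a - delta_b for any a, b at distance 1 *)
  (a b : d.-tuple R) (hab : enorm (vsub a b) = 1)
  (dO : nat -> measure_display) (Omega : forall N : nat, measurableType (dO N))
  (P : forall N : nat, probability (Omega N) R)
  (V : forall N : nat, R -> Omega N -> N.-tuple (d.-tuple R))
  (hV : forall N : nat, (2 <= N)%N ->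
     markov_process (@kac_generator R d N) (P N) (V N))
  (hV0 : forall N : nat, (2 <= N)%N -> iid (P N) mu0 (V N 0))
  (mu : R -> probability (d.-tuple R) R) (hmu : boltzmann_solution mu0 mu)
  (T : R) (hT : 0 < T) (x : R) (hx : 0 <= x) :
  let s := d%:R / 2 + r in
  let C := fine (hsobolev s \d_a \d_b) in
  let K := 2 * `|kappa d r| * T in
  (limn_esup (fun N : nat =>
     P N [set w | ((x / Num.sqrt N%:R)%:E <=
                   hsobolev s (empirical (V N T w)) (mu T))%E])
   <= (2 * expR (- x ^+ 2 /
         (2 * (expR K * sobolev_variance s mu0
               + e1 K * (omega r C k1 * T)))))%:E)%E.
Proof.
lazy zeta; set s := d%:R / 2 + r; set C := fine (hsobolev s \d_a \d_b).
set K := 2 * `|kappa d r| * T.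
have T0 : 0 <= T by exact: ltW.
have h12 : 0 < (2^-1 : R) < 1 by rewrite invr_gt0 ltr0n invf_lt1 ?ltr1n ?ltr0n.
have hexp2 := hmom _ h12.
have m01 : mom1 mu0 by exact: exp_moment_mom1.
have k10 : 0 < k1.
  apply: le_lt_trans hk1; rewrite mulr_ge0 ?invr_ge0//.
  by apply: Rintegral_ge0 => v _; exact: sqr_ge0.
have hC2 : C ^+ 2 = 2 * coskernel r (vsub a b).
  have h : hdom (TFB (\d_a : probability _ R) (\d_b : probability _ R)).
    by apply: hdom_TFB; exact: mom1_dirac.
  rewrite /C /s (hsobolevE hd hr h)/= sqr_hnorm -(ip_point_masses hd hr).
  by congr ip; apply/funext => c; apply/funext => xi; rewrite /TFB /TF !Rintegral_dirac//;
    case: (bmf_trig c xi).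
set S2 := sobolev_variance s mu0.
have S2E : S2 = \int[mu0]_v (point_dist r mu0 v ^+ 2) by exact: sobolev_varianceE.
have S20 : 0 <= S2 by rewrite S2E; apply: Rintegral_ge0 => v _; exact: sqr_ge0.
rewrite (omega_jump_const k10 hC2).
have Q0 : 0 <= jump_const r (vsub a b) * (4 * k1) `^ r.
  by apply: mulr_ge0; [exact: jump_const_ge0|exact: powR_ge0].
set Q := jump_const r (vsub a b) * (4 * k1) `^ r in Q0 *.
set kd := `|kappa d r| in K *.
have kd0 : 0 <= kd by exact: normr_ge0.
have k20 : 0 <= 2 * kd by rewrite mulr_ge0.
have disc0 : 0 <= discount (2 * kd) T.
  have := discount_ge k20 T0; rewrite discount0 !subr0; apply: le_trans.
  by rewrite mulr_ge0 ?expR_ge0.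
have disc1 := discount_e1 T k20; rewrite -/K in disc1.
(* The bracket of the theorem is e^K times the coefficient of x'^2 / 2 in the exponent to be
   optimized. *)
have -> : expR K * S2 + e1 K * (Q * T) = expR K * (S2 + Q * discount (2 * kd) T).
  rewrite mulrDr; congr (_ + _).
  by rewrite [RHS]mulrCA disc1; ring.
set dc := discount (2 * kd) T in disc0 *.
set A := expR K * _.
have A0 : 0 <= A by rewrite mulr_ge0 ?expR_ge0// addr_ge0// mulr_ge0.
have muT1 := mom1_mu hd hmu m01 T0.
have event N : (2 <= N)%N ->
    [set w | ((x / Num.sqrt N%:R)%:E <= hsobolev s (empirical (V N T w)) (mu T))%E] =
    [set w | x / Num.sqrt N%:R <= dist r (mu T) (V N T w)].
  move=> N2; have N0 : (0 < N)%N by exact: ltnW.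
  apply/seteqP; split => w /=; (have h := hdom_deviation N0 (V N T w) muT1);
    rewrite deviation_empirical in h;
    by rewrite (hsobolevE hd hr h) lee_fin /dist deviation_empirical.
(* If A = 0, division by zero makes the exponent 0 and the bound 2, above any probability. *)
have [Az|An] := eqVneq A 0.
  apply: limn_esup_le_near => eps eps0; near=> N.
  have N2 : (2 <= N)%N by near: N; exact: nbhs_infty_ge.
  have N0 : (0 < N)%N by exact: ltnW.
  rewrite Az mulr0 invr0 mulr0 expR0 mulr1 (event N N2).
  apply: le_trans (probability_le1 _ _) _; last by rewrite lee_fin; lra.
  have [mV _] := hV N N2.
  rewrite (_ : [set w | _] = V N T @^-1` (dist r (mu T) @^-1` `[x / Num.sqrt N%:R, +oo[)); last first.
    by apply/seteqP; split => w /=; rewrite in_itv/= andbT.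
  rewrite -[X in measurable X]setTI; apply: (mV T T0) => //.
  rewrite -[X in measurable X]setTI; apply: measurable_dist => //; exact: measurable_itv.
have Ap : 0 < A by rewrite lt_neqAle eq_sym An.
have [I2 [delta [M3 [d0 M30 hexc]]]] := excess_le hd hr hab m01 (hmom r hr).
have [C0 C00 hlow] := low_energy_law hexp2 hk1.
(* The optimal lambda divided by sqrt N: it minimizes - e^(-kd T) x x' + x'^2 (S2 + Q dc) / 2, where
   S2 + Q dc = A e^(-2 kd T). *)
pose x' := x / A * expR (kd * T).
have x'0 : 0 <= x' by rewrite mulr_ge0 ?expR_ge0// divr_ge0.
pose y := x ^+ 2 / (2 * A).
have y0 : 0 <= y by rewrite divr_ge0 ?sqr_ge0// mulr_ge0.
pose D := x' ^+ 3 / 2 * M3.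
have D0 : 0 <= D by rewrite mulr_ge0// divr_ge0// exprn_ge0.
have xx : x' ^+ 2 * (S2 + Q * dc) = x ^+ 2 / A.
  rewrite /x' exprMn -expRM_natl (_ : 2%:R * (kd * T) = K); last by rewrite /K mulrA.
  rewrite -mulrA -/A; field.
  exact: An.
(* The first condition on the size of N keeps lambda / N below [delta], the second makes the jumps
   small. *)
have bound N : (2 <= N)%N -> (x' / delta) ^+ 2 <= N%:R ->
    (4 * (x' ^+ 2 * Q)) `^ (1 - r)^-1 <= N%:R ->
    (P N [set w | (x / Num.sqrt N%:R <= dist r (mu T) (V N T w))%R] <=
     (C0 / N%:R + 2 * expR (- y + D / Num.sqrt N%:R))%:E)%E.
  move=> N2 hdelta hsmall; have N0 : (0 < N)%N by exact: ltnW.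
  set g := Num.sqrt N%:R.
  have g0 : 0 < g by rewrite sqrtr_gt0 ltr0n.
  have Ng : N%:R = g ^+ 2 by rewrite sqr_sqrtr.
  pose lambda := g * x'.
  have l0 : 0 <= lambda by rewrite mulr_ge0// ltW.
  have sc : small_jumps N r k1 (vsub a b) lambda by exact: small_jumps_large.
  have lN : lambda / N%:R = x' / g.
    by rewrite Ng /lambda; field; rewrite gt_eqF.
  have cd : 0 <= lambda / N%:R <= delta.
    rewrite lN divr_ge0 ?(ltW g0)//= ler_pdivrMr// mulrC -ler_pdivrMr//.
    rewrite -(@ler_pXn2r _ 2) ?nnegrE ?(ltW g0)// ?divr_ge0 ?(ltW d0)//.
    by rewrite -Ng.
  have [Iexp hle] := hexc _ cd.
  have th0 : 0 <= x / g by rewrite divr_ge0// ltW.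
  have := kac_tail hd hr N0 k10 T0 l0 hmu m01 hab sc (hV N N2) (hV0 N N2) th0 Iexp.
  move=> /le_trans; apply; rewrite EFinD; apply: leeD; first exact: hlow.
  rewrite lee_fin; apply: ler_wpM2l => //; rewrite ler_expR -/kd -/dc -/Q.
  have rT : rate d r lambda T * (x / g) = x ^+ 2 / A.
    rewrite /rate -/kd /lambda /x'; have := expRM_inv (kd * T).
    move: (expR _) (expR _) => u v uv.
    have -> : g * (x / A * v) * u * (x / g) = v * u * (x ^+ 2 / A).
      by field; rewrite An gt_eqF.
    by rewrite uv mul1r.
  rewrite rT.
  have N00 : 0 <= N%:R :> R by [].
  have := ler_wpM2l N00 hle; rewrite -S2E lN Ng => hle2.
  apply: le_trans (lerD (lexx _) hle2) _.
  rewrite le_eqVlt; apply/orP; left; apply/eqP.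
  have -> : g ^+ 2 * ((x' / g) ^+ 2 / 2 * S2 + (x' / g) ^+ 3 / 2 * M3) =
      x' ^+ 2 * S2 / 2 + D / g by rewrite /D; field; rewrite gt_eqF.
  have -> : lambda ^+ 2 * (Q / (2 * g ^+ 2)) * dc = x' ^+ 2 * (Q * dc) / 2.
    by rewrite /lambda; field; rewrite gt_eqF.
  have -> : - y = - (x ^+ 2 / A) + x' ^+ 2 * (S2 + Q * dc) / 2.
    by rewrite xx /y; field; exact: An.
  ring.
apply: limn_esup_le_near => eps eps0.
have e20 : 0 < eps / 2 by rewrite divr_gt0.
pose w := Num.min 2^-1 (eps / 8).
have w0 : 0 < w by rewrite lt_min invr_gt0 ltr0n/= divr_gt0.
(* X1 and X2 are the conditions of [bound]; X3 makes the high-energy term at most eps / 2, and X4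
   makes the cubic term D / sqrt N at most [w], as [expR_perturb] needs. *)
pose X1 := (x' / delta) ^+ 2.
pose X2 := (4 * (x' ^+ 2 * Q)) `^ (1 - r)^-1.
pose X3 := C0 / (eps / 2).
pose X4 := (D / w) ^+ 2.
have large X : \forall N \near \oo, X <= N%:R :> R by exact: nbhs_infty_ger.
near=> N.
have N2 : (2 <= N)%N by near: N; exact: nbhs_infty_ge.
have hX1 : X1 <= N%:R by near: N; exact: large.
have hX2 : X2 <= N%:R by near: N; exact: large.
have hX3 : X3 <= N%:R by near: N; exact: large.
have hX4 : X4 <= N%:R by near: N; exact: large.
have NR : 0 < N%:R :> R by rewrite ltr0n ltnW.
rewrite (event N N2); apply: le_trans (bound N N2 hX1 hX2) _.
rewrite lee_fin (_ : - x ^+ 2 / (2 * A) = - y); last by rewrite mulNr.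
have g0 : 0 < Num.sqrt N%:R :> R by rewrite sqrtr_gt0.
have hC : C0 / N%:R <= eps / 2.
  by rewrite ler_pdivrMr// mulrC -ler_pdivrMr.
have t1 : D / Num.sqrt N%:R <= w.
  rewrite ler_pdivrMr// mulrC -ler_pdivrMr//.
  rewrite -(@ler_pXn2r _ 2) ?nnegrE ?(ltW g0)// ?divr_ge0 ?(ltW w0)//.
  by rewrite sqr_sqrtr ?(ltW NR).
have t0 : 0 <= D / Num.sqrt N%:R by rewrite divr_ge0// ltW.
have w1 : w <= 2^-1 by rewrite ge_min lexx.
have w2 : w <= eps / 8 by rewrite ge_min lexx orbT.
have t01 : 0 <= D / Num.sqrt N%:R <= 2^-1 by rewrite t0 (le_trans t1).
have t8 : 8 * (D / Num.sqrt N%:R) <= eps.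
  by rewrite mulrC -ler_pdivlMr// (le_trans t1).
have := expR_perturb y0 t01 t8; lra.
Unshelve. all: by end_near. Qed.
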